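(* Let $\sigma\ge1$ and let $\rho,\eta>0$ satisfy $$\frac1{1+\rho^2}+\frac1{1+\eta^2}\le\frac1{1+\sigma^2}.\qquad( * )$$ For all $N\ge1$ the products $\star_N$ and $\star$ extend continuously from finite coefficient arrays and satisfy $$p_\sigma(A\star_NB)\le p_\rho(A)p_\eta(B),\qquad p_\sigma(A\star B)\le p_\rho(A)p_\eta(B).$$ Each $\mathfrak A_{2,N}$, with product $\star_N$ and involution $(A^* )_\alpha=A_\alpha^*$, is a complete Fréchet $*$-algebra, and $\Phi_N$ realizes ordinary multiplication: $\Phi_N(A\star_NB)=\Phi_N(A)\Phi_N(B)$. If $R_+>\rho$, $S_+>\eta$ and $q=\max(\rho/R_+,\eta/S_+)<1$, then $$p_\sigma(A\star_NB-A\star B)\le\frac{q^2}{N(1-q)^3}\,p_{R_+}(A)\,p_{S_+}(B).$$ Conversely, if $H\ne0$ and $E\ne0$, condition $( * )$ is necessary for the existence of a constant $C$ with $p_\sigma(A\star_NB)\le C\,p_\rho(A)p_\eta(B)$ for all $N\ge1$ and all finite coefficient arrays $A,B$, and under $( * )$ the optimal such uniform constant is one.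
   Context: $H$ is a real separable Hilbert space with orthonormal basis $(e_j)$ (finite or countable), $E$ a complex separable Hilbert space, $\mathcal S_2(E)$ the Hilbert--Schmidt operators. Coefficient arrays are $A=(A_\alpha)$, $A_\alpha\in\mathcal S_2(E)$, indexed by finitely supported multi-indices $\alpha$ over the basis index set; $$a_m(A)=\Big(\sum_{|\alpha|=m}\|A_\alpha\|_2^2\Big)^{1/2},\qquad p_\rho(A)=\sum_{m\ge0}\rho^ma_m(A),\qquad\mathfrak A_2=\{A:p_\rho(A)<\infty\ \forall\rho\ge1\}.$$ Finite coefficient arrays have finitely many nonzero $A_\alpha$, each with finitely many nonzero matrix entries in a fixed basis. Let $(\xi_{j,a})$ be independent symmetric $\pm1$ signs. For $0\le k\le N$, $Q^{(j)}_{k,N}=k!N^{-k/2}\sum_{I\subset\{1,\dots,N\},|I|=k}\prod_{a\in I}\xi_{j,a}$; $Q_{k,N}^{(j)}=0$ for $k>N$. $\Psi_{\alpha,N}=\prod_jQ^{(j)}_{\alpha_j,N}/\sqrt{\alpha_j!}$ and $\Phi_N(A)=\sum_\alpha A_\alpha\Psi_{\alpha,N}$ (convergent in $L^2(\mathcal S_2)$). $\mathcal I_N=\{\alpha:\max_j\alpha_j\le N\}$, $\Pi_N$ restricts coefficient arrays to $\mathcal I_N$, and $\mathfrak A_{2,N}=\Pi_N\mathfrak A_2$. Write $(t)_{\underline r}=t(t-1)\cdots(t-r+1)$, $(t)_{\underline0}=1$ (zero for integers $0\le t<r$). For multi-indices $r\le\alpha\wedge\beta$ (componentwise; factorials and binomials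 are products over components), put $\gamma=\alpha+\beta-2r$, $$c(\alpha,\beta,r)=r!\binom\alpha r\binom\beta r\sqrt{\frac{\gamma!}{\alpha!\beta!}},\qquad\vartheta_N(\alpha,\beta,r)=\prod_j\frac{(N-\gamma_j)_{\underline{r_j}}}{N^{r_j}},$$ with $\vartheta_N=0$ if any of $\alpha,\beta,\gamma$ is not in $\mathcal I_N$. On finite coefficient arrays $$(A\star_NB)_\gamma=\sum_{\alpha+\beta-2r=\gamma}c(\alpha,\beta,r)\vartheta_N(\alpha,\beta,r)A_\alpha B_\beta,\qquad(A\star B)_\gamma=\sum_{\alpha+\beta-2r=\gamma}c(\alpha,\beta,r)A_\alpha B_\beta.$$ *)

(* Defs.v *)
From HB Require Import structures.
From mathcomp Require Import all_boot all_order all_algebra finmap.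
From mathcomp Require Import sesquilinear.
From mathcomp Require Import all_classical all_reals all_analysis.
From mathcomp Require Import complex.

Set Implicit Arguments.
Unset Strict Implicit.
Unset Printing Implicit Defensive.

Import Order.TTheory GRing.Theory Num.Theory.
Import numFieldNormedType.Exports.

Local Open Scope classical_set_scope.
Local Open Scope fset_scope.
Local Open Scope complex_scope.
Local Open Scope ring_scope.

Section hilbert.
Context {R : realType}.

(* Inner products are the positive definite forms {dot V for theta} of
   sesquilinear.v, linear in the first argument (theta = idfun for a real
   space, conjC for a complex one); the norm is passed separately because it is
   R-valued in both cases. *)

Definition rnorm (H : lmodType R) (dot : H -> H -> R) (x : H) : R :=
  Num.sqrt (dot x x).

Definition cnorm (E : lmodType R[i]) (dot : E -> E -> R[i]) (x : E) : R :=
  Num.sqrt (complex.Re (dot x x)).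

Definition complete_norm (V : zmodType) (N : V -> R) : Prop :=
  forall u : nat -> V,
    (forall eps : R, 0 < eps -> \forall m & n \near \oo, N (u m - u n) < eps) ->
    exists l : V, N (u n - l) @[n --> \oo] --> (0 : R).

Definition orthonormal_basis (F : numFieldType) (V : lmodType F)
    (dot : V -> V -> F) (N : V -> R) (I : choiceType) (e : I -> V) : Prop :=
  (forall i k, dot (e i) (e k) = (i == k)%:R) /\
  (forall (x : V) (eps : R), 0 < eps ->
     exists (s : seq I) (c : I -> F), N (x - \sum_(i <- s) c i *: e i) < eps).

End hilbert.

Section hilbert_schmidt.
Context {R : realType} {E : lmodType R[i]} (dot : E -> E -> R[i])
  {K : countType} (e : K -> E).
Implicit Types T S : E -> E.

Definition bounded_operator T : Prop :=
  linear T /\ exists M : R, forall x, cnorm dot (T x) <= M * cnorm dot x.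

Definition hsnorm T : \bar R :=
  sqrte (\esum_(k in [set: K]) ((cnorm dot (T (e k))) ^+ 2)%:E).

(* Finiteness of the sum alone does not bound T, hence the first conjunct. *)
Definition hilbert_schmidt T : Prop :=
  bounded_operator T /\ (hsnorm T < +oo)%E.

Definition adjoint T : E -> E :=
  xget (fun=> 0) [set S : E -> E | forall x y, dot (T x) y = dot x (S y)].

Definition hs_open (U : set (E -> E)) : Prop :=
  forall T, U T -> hilbert_schmidt T ->
    exists2 eps : R, 0 < eps &
      forall S, hilbert_schmidt S -> (hsnorm (S - T)%R < eps%:E)%E -> U S.

End hilbert_schmidt.

Section multi_indices.
Context {J : countType}.

Definition mindex : choiceType := {fsfun J -> nat with 0%N}.
Implicit Types alpha beta r : mindex.

Definition mdegree alpha : nat := (\sum_(j <- finsupp alpha) alpha j)%N.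
Definition mfact alpha : nat := (\prod_(j <- finsupp alpha) (alpha j)`!)%N.
(* For r <= alpha the factors outside the support of alpha are 'C(0, 0) = 1. *)
Definition mbin alpha r : nat :=
  (\prod_(j <- finsupp alpha) 'C(alpha j, r j))%N.
Definition mle r alpha : Prop := forall j, (r j <= alpha j)%N.

(* alpha + beta - 2 r, used only for r <= alpha and r <= beta. *)
Definition mcontract alpha beta r : mindex :=
  [fsfun j in finsupp alpha `|` finsupp beta =>
     (alpha j + beta j - 2 * r j)%N | 0%N].

Definition in_range (N : nat) alpha : Prop := forall j, (alpha j <= N)%N.

End multi_indices.
Arguments mindex J : clear implicits.

Section product_coefficients.
Context (R : realType) {J : countType}.
Implicit Types alpha beta r : mindex J.

Definition coef_c alpha beta r : R :=
  (mfact r * mbin alpha r * mbin beta r)%:R *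
  Num.sqrt ((mfact (mcontract alpha beta r))%:R /
            ((mfact alpha)%:R * (mfact beta)%:R)).

(* In the first branch gamma_j <= N, so the truncated N - gamma_j is exact, and
   t ^_ m vanishes for t < m as the falling factorial (t)_m does. *)
Definition vartheta (N : nat) alpha beta r : R :=
  let gamma := mcontract alpha beta r in
  if `[< [/\ in_range N alpha, in_range N beta & in_range N gamma] >] then
    \prod_(j <- finsupp r) (((N - gamma j) ^_ (r j))%:R / N%:R ^+ r j)
  else 0.

End product_coefficients.

Section arrays.
Context {R : realType} {E : lmodType R[i]} (dot : E -> E -> R[i])
  {K : countType} (e : K -> E) {J : countType}.

Definition array := mindex J -> E -> E.
Implicit Types A B : array.

Definition hs_array A : Prop := forall alpha, hilbert_schmidt dot e (A alpha).

Definition level_norm (m : nat) A : \bar R :=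
  sqrte (\esum_(alpha in [set alpha : mindex J | mdegree alpha = m])
           (hsnorm dot e (A alpha) ^+ 2)%E).

Definition pnorm (rho : R) A : \bar R :=
  (\sum_(0 <= m <oo) (rho ^+ m)%:E * level_norm m A)%E.

Definition pspace (rho : R) : set array :=
  [set A | hs_array A /\ (pnorm rho A < +oo)%E].

Definition frakA2 : set array :=
  [set A | hs_array A /\
           forall rho : R, 1 <= rho -> (pnorm rho A < +oo)%E].

Definition cutoff (N : nat) A : array :=
  fun alpha => if `[< in_range N alpha >] then A alpha else 0.

Definition frakA2_seminorm (rho : {rho : R | 1 <= rho}) : array -> \bar R :=
  pnorm (val rho).

Definition frakA2N (N : nat) : set array := cutoff N @` frakA2.

Definition finite_array A : Prop :=
  [/\ hs_array A, finite_set [set alpha | A alpha <> 0] &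
      forall alpha,
        finite_set [set kl : K * K | dot (A alpha (e kl.2)) (e kl.1) <> 0]].

Definition array_adjoint A : array := fun alpha => adjoint dot (A alpha).

(* The triples (alpha, beta, r) are encoded as ((alpha, beta), r).  The sum
   \sum_(t \in D) F t runs over the t in D with F t <> 0, finitely many when A
   and B are finite arrays; on other arrays the value is irrelevant. *)
Definition weighted_product (w : mindex J -> mindex J -> mindex J -> R) A B :
    array := fun gamma =>
  \sum_(t \in [set t : mindex J * mindex J * mindex J |
                 [/\ mle t.2 t.1.1, mle t.2 t.1.2 &
                     mcontract t.1.1 t.1.2 t.2 = gamma]])
    (coef_c R t.1.1 t.1.2 t.2 * w t.1.1 t.1.2 t.2)%:C *:
      (A t.1.1 \o B t.1.2).

Definition fin_starN (N : nat) := weighted_product (vartheta R N).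
Definition fin_star := weighted_product (fun _ _ _ => 1).

(* M restricts to a continuous map of the product of the spaces {p_rho < oo}
   and {p_eta < oo} into {p_sigma < oo}, and agrees with prod on finite
   arrays. *)
Definition continuous_extension (prod : array -> array -> array)
    (sigma rho eta : R) (M : array -> array -> array) : Prop :=
  [/\ forall A B, finite_array A -> finite_array B -> M A B = prod A B,
      forall A B, pspace rho A -> pspace eta B -> pspace sigma (M A B) &
      forall A B, pspace rho A -> pspace eta B ->
      forall eps : R, 0 < eps -> exists2 delta : R, 0 < delta &
        forall A' B', pspace rho A' -> pspace eta B' ->
          (pnorm rho (A' - A)%R < delta%:E)%E ->
          (pnorm eta (B' - B)%R < delta%:E)%E ->
          (pnorm sigma (M A' B' - M A B)%R < eps%:E)%E].

Definition unique_continuous_extension (prod : array -> array -> array)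
    (sigma rho eta : R) (M : array -> array -> array) : Prop :=
  continuous_extension prod sigma rho eta M /\
  forall M', continuous_extension prod sigma rho eta M' ->
    forall A B, pspace rho A -> pspace eta B -> M' A B = M A B.

Definition admissible (sigma rho eta : R) : Prop :=
  (1 + rho ^+ 2)^-1 + (1 + eta ^+ 2)^-1 <= (1 + sigma ^+ 2)^-1.

Definition uniform_constant (sigma rho eta C : R) : Prop :=
  forall N : nat, (0 < N)%N -> forall A B, finite_array A -> finite_array B ->
    (pnorm sigma (fin_starN N A B) <= C%:E * (pnorm rho A * pnorm eta B))%E.

End arrays.
Arguments array {R} E J.

Section frechet.
(* A subspace D of V with the topology given by the seminorms p i. *)
Context {R : realType} {V : lmodType R[i]} {I : choiceType}
  (D : set V) (p : I -> V -> \bar R).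

Definition jointly_continuous (mul : V -> V -> V) : Prop :=
  forall x y, D x -> D y -> forall (i : I) (eps : R), 0 < eps ->
    exists (s : seq I) (delta : R), 0 < delta /\
      forall x' y', D x' -> D y' ->
        (forall k, k \in s ->
           (p k (x' - x)%R < delta%:E)%E /\ (p k (y' - y)%R < delta%:E)%E) ->
        (p i (mul x' y' - mul x y)%R < eps%:E)%E.

Definition continuous_self_map (f : V -> V) : Prop :=
  forall x, D x -> forall (i : I) (eps : R), 0 < eps ->
    exists (s : seq I) (delta : R), 0 < delta /\
      forall x', D x' -> (forall k, k \in s -> (p k (x' - x)%R < delta%:E)%E) ->
        (p i (f x' - f x)%R < eps%:E)%E.

Definition linear_subspace : Prop :=
  D 0 /\ forall (c : R[i]) x y, D x -> D y -> D (c *: x + y).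

Definition seminorm_family : Prop :=
  forall i, [/\ forall x, D x -> (0 <= p i x < +oo)%E,
                forall x y, D x -> D y -> (p i (x + y)%R <= p i x + p i y)%E &
                forall (c : R[i]) x, D x ->
                  (p i (c *: x)%R = (complex.Re `|c|)%:E * p i x)%E].

(* Sequential completeness is completeness here, because the topology is
   required to be given by a countable subfamily of the seminorms. *)
Definition frechet_space : Prop :=
  [/\ linear_subspace,
      seminorm_family,
      forall x, D x -> (forall i, p i x = 0%E) -> x = 0,
      exists s : nat -> I, forall i, exists (n : nat) (C : R),
        forall x, D x -> (p i x <= C%:E * p (s n) x)%E &
      forall u : nat -> V, (forall n, D (u n)) ->
        (forall i (eps : R), 0 < eps ->
           \forall m & n \near \oo, (p i (u m - u n)%R < eps%:E)%E) ->
        exists2 l, D l & forall i, p i (u n - l) @[n --> \oo] --> 0%E].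

Definition algebra_product (mul : V -> V -> V) : Prop :=
  [/\ forall x y, D x -> D y -> D (mul x y),
      forall (c : R[i]) x y z, D x -> D y -> D z ->
        mul (c *: x + y) z = c *: mul x z + mul y z,
      forall (c : R[i]) x y z, D x -> D y -> D z ->
        mul z (c *: x + y) = c *: mul z x + mul z y &
      forall x y z, D x -> D y -> D z -> mul x (mul y z) = mul (mul x y) z].

Definition algebra_involution (mul : V -> V -> V) (inv : V -> V) : Prop :=
  [/\ forall x, D x -> D (inv x),
      forall (c : R[i]) x y, D x -> D y ->
        inv (c *: x + y) = (c^*)%R *: inv x + inv y,
      forall x, D x -> inv (inv x) = x &
      forall x y, D x -> D y -> inv (mul x y) = mul (inv y) (inv x)].

(* "Frechet algebra" is meant with a jointly continuous product; the seminorms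
   are not required to be submultiplicative. *)
Definition frechet_star_algebra (mul : V -> V -> V) (inv : V -> V) : Prop :=
  [/\ frechet_space,
      algebra_product mul,
      jointly_continuous mul,
      algebra_involution mul inv &
      continuous_self_map inv].

End frechet.

Section randomization.
Context {R : realType} {d : measure_display} {Omega : measurableType d}
  (P : probability Omega R).

Definition mutually_independent (I : choiceType) (xi : I -> Omega -> R) : Prop :=
  forall (F : {fset I}) (B : I -> set R), (forall i, measurable (B i)) ->
    P (\bigcap_(i in [set` F]) (xi i @^-1` B i)) =
    (\prod_(i <- F) P (xi i @^-1` B i))%E.

Definition independent_signs (I : choiceType) (xi : I -> Omega -> R) : Prop :=
  [/\ forall i, measurable_fun setT (xi i),
      forall i, P (xi i @^-1` [set 1]) = (2^-1)%:E /\
                P (xi i @^-1` [set -1]) = (2^-1)%:E &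
      mutually_independent xi].

Context {J : countType} (xi : J * nat -> Omega -> R).

(* The second index of xi runs over {0, ..., N-1} instead of {1, ..., N}.  The
   sum is empty, hence Q = 0, for k > N. *)
Definition Qpoly (N : nat) (j : J) (k : nat) (w : Omega) : R :=
  k`!%:R * (Num.sqrt N%:R) ^- k *
  \sum_(I : {set 'I_N} | #|I| == k) \prod_(a in I) xi (j, nat_of_ord a) w.

Definition Psi (N : nat) (alpha : mindex J) (w : Omega) : R :=
  \prod_(j <- finsupp alpha)
    (Qpoly N j (alpha j) w / Num.sqrt (alpha j)`!%:R).

Context {E : lmodType R[i]} (dot : E -> E -> R[i]) {K : countType} (e : K -> E).

Definition Phi_partial (N : nat) (A : array E J) (F : {fset mindex J})
    (w : Omega) : E -> E :=
  \sum_(alpha <- F) (Psi N alpha w)%:C *: A alpha.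

(* X is a representative of the class Phi_N(A): a Borel random element of the
   Hilbert-Schmidt operators, in L^2, which is the unconditional L^2 sum of the
   series. *)
Definition is_Phi (N : nat) (A : array E J) (X : Omega -> E -> E) : Prop :=
  [/\ forall w, hilbert_schmidt dot e (X w),
      forall U, hs_open dot e U -> measurable (X @^-1` U),
      (\int[P]_w (hsnorm dot e (X w) ^+ 2) < +oo)%E &
      forall eps : R, 0 < eps -> exists F0 : {fset mindex J},
        forall F : {fset mindex J}, F0 `<=` F ->
          (\int[P]_w (hsnorm dot e (X w - Phi_partial N A F w)%R ^+ 2)
             <= eps%:E)%E].

End randomization.

(* Main.v *)
Require Import Defs.
From HB Require Import structures.
From mathcomp Require Import all_boot all_order all_algebra finmap.
From mathcomp Require Import sesquilinear.
From mathcomp Require Import all_classical all_reals all_analysis.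
From mathcomp Require Import measurable_realfun.
From mathcomp Require Import complex.
From mathcomp Require Import ring lra zify.

Set Implicit Arguments.
Unset Strict Implicit.
Unset Printing Implicit Defensive.

Import Order.TTheory GRing.Theory Num.Theory.
Import numFieldNormedType.Exports.

Local Open Scope classical_set_scope.
Local Open Scope ring_scope.

(** Norm inequality. With [mu = alpha - r] and [nu = beta - r] the square of
    the structure coefficient is a product of three binomials, one for each
    of the pairs [(mu, r)], [(nu, r)], [(mu, nu)] ([coef_cE]).  For arrays
    living on single levels [m] and [n], pairing the level [l] of the product
    with a test vector gives a sum over triples [(mu, nu, r)] of a product of
    three functions of two variables each, which the Hilbert-Schmidt form of
    the Loomis-Whitney inequality bounds by three square sums.  Put
    [a = 1 / (1 + rho^2)], [b = 1 / (1 + eta^2)] and [d = 1 - a - b]; powers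
    of [a], [b], [d] are distributed over the three factors so that each
    square sum is evaluated by the multinomial theorem, and admissibility is
    exactly [sigma^2 <= d / (a + b)], which makes the weights cancel
    ([level_prod_bound], [level_prod_sum]).  The triangle inequality over the
    levels gives [pnorm_prod_le] with constant one.  A weight in [0, 1] does
    not harm the estimate, so it holds for every [star_N] as well.  Moreover
    [1 - vartheta_N <= 'C(m + n, 2) / N] ([vartheta_lower]), and
    ['C(k, 2) q^k <= q^2 / (1 - q)^3], whence the rate of convergence.

    Extension. A bounded bilinear product of finitely supported arrays is
    evaluated on general arrays as the limit of the products of truncations
    ([ext_prod]); density of the finite arrays makes this the only continuous
    extension.

    Algebra. The product of two elementary symmetric polynomials in signs is
    a combination of such polynomials, the coefficients counting the sets with
    a prescribed symmetric difference ([esym_mul]); after normalization these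
    coefficients are the [coef_c * vartheta_N] ([Psi_mul]).  Hence the finite
    sums [psum] of [Psi alpha * A alpha] turn [star_N] into composition.  The
    [Psi alpha] with [alpha] in range are orthogonal and nonzero
    ([mean_PsiM], [psi_norm_gt0]), so [psum] is injective on the arrays in
    range: [star_N] inherits associativity from composition, first for finitely
    supported arrays, then by continuity.  Completeness and the involution are
    coefficientwise matters.

    Random operators. [psum] is a contraction from square summable arrays to
    L^2 ([integral_psum_le]).  A sequence of finite sums with rapidly
    decreasing L^2 increments converges almost surely; its limit is Borel
    because the finite sums take finitely many values, and it represents
    [Phi_N A] ([Phi_limit_is_Phi]).  Multiplicativity passes to the limit along
    a subsequence on which both factors and the product converge almost surely
    ([L2sum_mul]).

    Necessity. On one coordinate axis and with a fixed rank one projection, a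
    uniform constant bounds [\sum_s sigma^(m + n - 2 s) c(m, n, s)] by
    [C rho^m eta^n], letting [N] tend to infinity.  Multiplying by
    [x^m y^n / sqrt (m! n!)] and summing compares, up to constants and
    arbitrarily small losses in the exponent, [exp (x y + sigma^2 (x + y)^2 / 2)]
    with [exp ((rho^2 x^2 + eta^2 y^2) / 2)]; scaling [x] and [y] to infinity
    leaves an inequality between quadratic forms, which is admissibility
    ([bound_admissible]).  The term [m = n = 0] gives [1 <= C]. *)

(** * Square sums and seminorms with values in the extended reals *)

Section finite_sums.
Context {R : realType} {T : eqType}.
Implicit Types (s : seq T) (f g : T -> R).

(** The discriminant of the nonnegative quadratic polynomial
    [t |-> \sum (f + t g)^2]. *)
Lemma sum_cauchy_schwarz s f g :
  (\sum_(t <- s) f t * g t) ^+ 2 <=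
  (\sum_(t <- s) f t ^+ 2) * (\sum_(t <- s) g t ^+ 2).
Proof.
set a := \sum_(t <- s) f t ^+ 2; set b := \sum_(t <- s) f t * g t.
set c := \sum_(t <- s) g t ^+ 2.
have quad x y : 0 <= x ^+ 2 * a + 2 * x * y * b + y ^+ 2 * c.
  rewrite /a /b /c !mulr_sumr -!big_split /= sumr_ge0 // => t _.
  by rewrite (_ : _ + _ = (x * f t + y * g t) ^+ 2) ?sqr_ge0 //; ring.
have a0 : 0 <= a by rewrite sumr_ge0 // => t _; rewrite sqr_ge0.
have c0 : 0 <= c by rewrite sumr_ge0 // => t _; rewrite sqr_ge0.
have [a_gt0|a_le0] := ltP 0 a.
  have := quad (- b) a.
  rewrite (_ : _ + _ = a * (a * c - b ^+ 2)); last by ring.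
  by rewrite pmulr_rge0 // subr_ge0.
have aE : a = 0 by apply/le_anti/andP.
have := quad (- (c + 1) * b) (b ^+ 2).
rewrite aE mul0r (_ : _ + _ = - ((c + 2) * (b ^+ 2) ^+ 2)); last by ring.
have c2 : 0 < c + 2 by lra.
rewrite oppr_ge0 pmulr_rle0 // => h.
have : b ^+ 2 == 0 by rewrite -sqrf_eq0 eq_le h sqr_ge0.
by move=> /eqP ->.
Qed.

Lemma sum_cauchy_schwarz_sqrt s f g :
  \sum_(t <- s) f t * g t <=
  Num.sqrt (\sum_(t <- s) f t ^+ 2) * Num.sqrt (\sum_(t <- s) g t ^+ 2).
Proof.
have a0 : 0 <= \sum_(t <- s) f t ^+ 2.
  by rewrite sumr_ge0 // => t _; rewrite sqr_ge0.
rewrite -sqrtrM // (le_trans (ler_norm _)) // -sqrtr_sqr.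
by rewrite ler_wsqrtr // sum_cauchy_schwarz.
Qed.

Lemma sum_minkowski s f g :
  Num.sqrt (\sum_(t <- s) (f t + g t) ^+ 2) <=
  Num.sqrt (\sum_(t <- s) f t ^+ 2) + Num.sqrt (\sum_(t <- s) g t ^+ 2).
Proof.
have a0 : 0 <= \sum_(t <- s) f t ^+ 2.
  by rewrite sumr_ge0 // => t _; rewrite sqr_ge0.
have c0 : 0 <= \sum_(t <- s) g t ^+ 2.
  by rewrite sumr_ge0 // => t _; rewrite sqr_ge0.
set u := (X in _ <= X + _); set v := (X in _ <= _ + X).
have uv0 : 0 <= u + v by rewrite addr_ge0 ?sqrtr_ge0.
rewrite -(ger0_norm uv0) -sqrtr_sqr ler_wsqrtr //.
rewrite [leRHS]sqrrD !sqr_sqrtr //.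
under eq_bigr do rewrite sqrrD.
rewrite !big_split /= lerD2r lerD2l.
by rewrite mulr2n lerD ?sum_cauchy_schwarz_sqrt.
Qed.

End finite_sums.

Section esum_seq.
Context {R : realType} {T : choiceType}.
Local Open Scope ereal_scope.
Implicit Types (D : set T) (a : T -> \bar R).

Lemma esum_le_seq D a c :
  (forall s : seq T, uniq s -> (forall t, t \in s -> D t) ->
     \sum_(t <- s) a t <= c) ->
  \esum_(t in D) a t <= c.
Proof.
move=> h; apply: ge_ereal_sup => _ [X [finX XD] <-].
rewrite fsbig_finite //; apply: h => [|t]; first exact: fset_uniq.
by rewrite in_fset_set // inE; apply: XD.
Qed.

Lemma seq_le_esum D a (s : seq T) : uniq s -> (forall t, t \in s -> D t) ->
  \sum_(t <- s) a t <= \esum_(t in D) a t.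
Proof.
move=> us sD; apply: ereal_sup_ubound; exists [set` s]; last by rewrite -fsbig_seq.
by split => [|t /=]; [exact: finite_seq|exact: sD].
Qed.

Lemma esum_ge_term D a t : D t -> a t <= \esum_(t in D) a t.
Proof.
move=> Dt; have -> : a t = \sum_(u <- [:: t]) a u by rewrite big_seq1.
apply: seq_le_esum => //.
by move=> u; rewrite inE => /eqP ->.
Qed.

Lemma esum_seqE D a (s : seq T) : uniq s -> (forall t, t \in s -> D t) ->
  (forall t, D t -> 0 <= a t) -> (forall t, D t -> t \notin s -> a t = 0) ->
  \esum_(t in D) a t = \sum_(t <- s) a t.
Proof.
move=> us sD a0 aN; rewrite (esumID [set` s]) //.
have -> : D `&` [set` s] = [set` s].
  by apply/seteqP; split => [t []//|t ts]; split => //; exact: sD.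
rewrite esum_fset //; last by move=> t /set_mem /sD /a0.
rewrite -fsbig_seq //.
by rewrite [X in _ + X]esum1 ?adde0 // => t [Dt /= /negP]; exact: aN.
Qed.

Lemma esum_tail D a (eps : R) : (forall t, D t -> 0 <= a t) ->
  \esum_(t in D) a t < +oo -> (0 < eps)%R ->
  exists2 s : seq T, uniq s /\ (forall t, t \in s -> D t) &
    \esum_(t in D `\` [set` s]) a t <= eps%:E.
Proof.
move=> a0 afin eps0.
have E0 : 0 <= \esum_(t in D) a t by apply: esum_ge0.
have : \esum_(t in D) a t - eps%:E < \esum_(t in D) a t.
  rewrite lteBlDr //.
  by rewrite lteDl ?ge0_fin_numE // lte_fin.
rewrite {2}/esum => /ereal_sup_gt[_ [X [finX XD] <-]].
rewrite fsbig_finite // => Xlt.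
have sD t : t \in finmap.enum_fset (fset_set X) -> D t.
  by rewrite in_fset_set // inE; apply: XD.
exists (fset_set X); first by split => //; exact: fset_uniq.
move: Xlt; rewrite (esumID [set` fset_set X]) //.
have -> : D `&` [set` fset_set X] = [set` fset_set X].
  by apply/seteqP; split => [t []//|t tX]; split => //; exact: sD.
rewrite esum_fset //; last by move=> t /set_mem /sD /a0.
rewrite -fsbig_seq ?fset_uniq //.
set u := \sum_(t <- _) _; set v := esum _ _.
have u0 : 0 <= u by rewrite /u big_seq sume_ge0 // => t /sD /a0.
have v0 : 0 <= v by apply: esum_ge0 => t [/a0].
have : u + v < +oo.
  rewrite (le_lt_trans _ afin) // (esumID [set` fset_set X]) //.
  have -> : D `&` [set` fset_set X] = [set` fset_set X].
    by apply/seteqP; split => [t []//|t tX]; split => //; exact: sD.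
  rewrite esum_fset //; last by move=> t /set_mem /sD /a0.
  by rewrite -fsbig_seq ?fset_uniq.
move: u0 v0; case: u => [u| |] //; case: v => [v| |] //= _ _ _.
rewrite -?EFinN -?EFinD ?lte_fin ?lee_fin; lra.
Qed.

End esum_seq.

Section ell2.
Context {R : realType} {T : choiceType}.
Local Open Scope ereal_scope.
Implicit Types (D : set T) (f g : T -> \bar R).

Definition ell2 D f := sqrte (\esum_(t in D) f t ^+ 2).

Lemma ell2_ge0 D f : 0 <= ell2 D f. Proof. exact: sqrte_ge0. Qed.

Lemma expe2_ge0 (x : \bar R) : 0 <= x ^+ 2.
Proof.
case: x => [x| |]; rewrite expe2 ?mulyy ?mulNyNy ?leey //.
by rewrite -EFinM lee_fin -expr2 sqr_ge0.
Qed.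

Lemma le_expe2 (x y : \bar R) : 0 <= x -> x <= y -> x ^+ 2 <= y ^+ 2.
Proof. by move=> x0 xy; rewrite !expe2 lee_pmul. Qed.

Lemma sqr_ell2 D f : ell2 D f ^+ 2 = \esum_(t in D) f t ^+ 2.
Proof. by rewrite sqr_sqrte // esum_ge0 // => t _; exact: expe2_ge0. Qed.

Lemma ell2_le D f c : 0 <= c ->
  (forall s : seq T, uniq s -> (forall t, t \in s -> D t) ->
     \sum_(t <- s) f t ^+ 2 <= c ^+ 2) ->
  ell2 D f <= c.
Proof.
move=> c0 h; have -> : c = sqrte (c ^+ 2) by rewrite sqrte_sqr gee0_abs.
by rewrite lee_sqrt ?expe2_ge0 //; apply: esum_le_seq.
Qed.

Lemma seq_le_ell2 D f (s : seq T) : uniq s -> (forall t, t \in s -> D t) ->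
  \sum_(t <- s) f t ^+ 2 <= ell2 D f ^+ 2.
Proof. by move=> us sD; rewrite sqr_ell2 seq_le_esum. Qed.

Lemma ell2_ge_term D f t : D t -> 0 <= f t -> f t <= ell2 D f.
Proof.
move=> Dt f0; rewrite -(gee0_abs f0) -sqrte_sqr lee_sqrt; last first.
  by rewrite esum_ge0 // => *; exact: expe2_ge0.
exact: (@esum_ge_term R T D (fun t => f t ^+ 2)).
Qed.

Lemma le_ell2 D f g : (forall t, D t -> 0 <= f t <= g t) ->
  ell2 D f <= ell2 D g.
Proof.
move=> fg; rewrite lee_sqrt; last by rewrite esum_ge0 // => *; exact: expe2_ge0.
by apply: le_esum => t /fg /andP[? ?]; exact: le_expe2.
Qed.

Lemma eq_ell2 D f g : (forall t, D t -> f t = g t) -> ell2 D f = ell2 D g.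
Proof. by move=> fg; rewrite /ell2; congr sqrte; apply: eq_esum => t /fg ->. Qed.

Lemma ell2Z D f (c : R) : (0 <= c)%R -> (forall t, D t -> 0 <= f t) ->
  ell2 D (fun t => c%:E * f t) = c%:E * ell2 D f.
Proof.
move=> c0 f0; apply/eqP; rewrite eq_le.
have le1 (g : T -> \bar R) (k : R) : (0 <= k)%R -> (forall t, D t -> 0 <= g t) ->
    ell2 D (fun t => k%:E * g t) <= k%:E * ell2 D g.
  move=> k0 g0; apply: ell2_le; first by rewrite mule_ge0 ?ell2_ge0.
  move=> s us sD; under eq_bigr do rewrite expe2 muleACA -!expe2.
  rewrite -ge0_sume_distrr; last by move=> *; exact: expe2_ge0.
  rewrite [leRHS]expe2 muleACA -!expe2 lee_wpmul2l ?expe2_ge0 //.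
  exact: seq_le_ell2.
rewrite le1 //=; have [->|cN0] := eqVneq c 0%R; first by rewrite mul0e ell2_ge0.
have c_gt0 : (0 < c)%R by rewrite lt_def cN0.
have -> : ell2 D f = ell2 D (fun t => (c^-1)%:E * (c%:E * f t)).
  by apply: eq_ell2 => t _; rewrite muleA -EFinM mulVf // mul1e.
apply: (@le_trans _ _ (c%:E * ((c^-1)%:E * ell2 D (fun t => c%:E * f t)))).
  rewrite lee_wpmul2l ?lee_fin // le1 ?invr_ge0 // => t /f0 ft0.
  by rewrite mule_ge0 ?lee_fin.
by rewrite muleA -EFinM mulfV // mul1e.
Qed.

Lemma ell2D D f g : (forall t, D t -> 0 <= f t) -> (forall t, D t -> 0 <= g t) ->
  ell2 D (fun t => f t + g t) <= ell2 D f + ell2 D g.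
Proof.
move=> f0 g0.
have [finf|] := ltP (ell2 D f) +oo; last first.
  by rewrite leye_eq => /eqP ->; rewrite addye ?leey // gt_eqF // (lt_le_trans _ (ell2_ge0 _ _)).
have [fing|] := ltP (ell2 D g) +oo; last first.
  by rewrite leye_eq => /eqP ->; rewrite addey ?leey // gt_eqF // (lt_le_trans _ (ell2_ge0 _ _)).
have fE t : D t -> f t = (fine (f t))%:E.
  move=> Dt; rewrite fineK // ge0_fin_numE ?f0 //.
  by rewrite (le_lt_trans _ finf) // ell2_ge_term ?f0.
have gE t : D t -> g t = (fine (g t))%:E.
  move=> Dt; rewrite fineK // ge0_fin_numE ?g0 //.
  by rewrite (le_lt_trans _ fing) // ell2_ge_term ?g0.
apply: ell2_le => [|s us sD]; first by rewrite adde_ge0 ?ell2_ge0.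
have toR (h : T -> \bar R) : (forall t, D t -> h t = (fine (h t))%:E) ->
    \sum_(t <- s) h t ^+ 2 = (\sum_(t <- s) fine (h t) ^+ 2)%:E.
  move=> hE; rewrite -sumEFin big_seq [in RHS]big_seq.
  by apply: eq_bigr => t /sD /hE ->; rewrite EFin_expe.
have fgE t : D t -> f t + g t = (fine (f t + g t))%:E.
  by move=> Dt; rewrite (fE _ Dt) (gE _ Dt) -EFinD.
have := seq_le_ell2 f us sD; have := seq_le_ell2 g us sD.
rewrite !toR //.
have -> : (\sum_(t <- s) fine (f t + g t) ^+ 2 =
           \sum_(t <- s) (fine (f t) + fine (g t)) ^+ 2)%R.
  rewrite big_seq [RHS]big_seq; apply: eq_bigr => t /sD Dt.
  by rewrite (fE _ Dt) (gE _ Dt) -EFinD.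
move: (ell2_ge0 D f) (ell2_ge0 D g) finf fing.
case: (ell2 D f) => [u| |] //; case: (ell2 D g) => [v| |] //.
move=> u0 v0 _ _; rewrite -EFinD -!EFin_expe !lee_fin in u0 v0 *=> hg hf.
have := sum_minkowski s (fun t => fine (f t)) (fun t => fine (g t)).
set A := (X in (Num.sqrt X <= _)%R).
have A0 : (0 <= A)%R by rewrite sumr_ge0 // => t _; exact: sqr_ge0.
move=> mk; have : (Num.sqrt A <= u + v)%R.
  apply: (le_trans mk); apply: lerD; apply: (le_trans (ler_wsqrtr _)).
  - exact: hf.
  - by rewrite sqrtr_sqr ger0_norm.
  - exact: hg.
  - by rewrite sqrtr_sqr ger0_norm.
move=> h; apply: (@le_trans _ _ (Num.sqrt A ^+ 2)%R).
  by rewrite sqr_sqrtr.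
rewrite lerXn2r // ?nnegrE ?sqrtr_ge0 //.
exact: addr_ge0.
Qed.

End ell2.

Section eseminorm.
Context {R : realType} {V : lmodType R[i]}.
Local Open Scope ereal_scope.
Implicit Types (p : V -> \bar R) (x y : V) (c : R[i]).

Definition eseminorm p : Prop :=
  [/\ forall x, 0 <= p x,
      forall x y, p (x + y)%R <= p x + p y &
      forall c x, p (c *: x)%R = (complex.Re `|c|)%:E * p x].

Lemma Re_norm_ge0 c : (0 <= complex.Re `|c|)%R.
Proof. by have := normr_ge0 c; rewrite lecE /= => /andP[]. Qed.

Section theory.
Variables (p : V -> \bar R) (hp : eseminorm p).

Lemma eseminorm_ge0 x : 0 <= p x. Proof. by case: hp. Qed.

Lemma eseminormD x y : p (x + y)%R <= p x + p y. Proof. by case: hp. Qed.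

Lemma eseminormZ c x : p (c *: x)%R = (complex.Re `|c|)%:E * p x.
Proof. by case: hp. Qed.

Lemma eseminorm0 : p 0%R = 0.
Proof. by rewrite -(scale0r 0%R) eseminormZ normr0 mul0e. Qed.

Lemma eseminormN x : p (- x)%R = p x.
Proof. by rewrite -scaleN1r eseminormZ normrN1 mul1e. Qed.

Lemma eseminormBC x y : p (x - y)%R = p (y - x)%R.
Proof. by rewrite -eseminormN opprB. Qed.

Lemma eseminormB x y : p (x - y)%R <= p x + p y.
Proof. by rewrite (le_trans (eseminormD _ _)) // eseminormN. Qed.

Lemma eseminorm_split x y z : p (x - z)%R <= p (x - y)%R + p (y - z)%R.
Proof.
by rewrite (le_trans _ (eseminormD _ _)) // addrA subrK.
Qed.

Lemma eseminorm_sum (I : Type) (s : seq I) (P : pred I) (F : I -> V) :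
  p (\sum_(i <- s | P i) F i)%R <= \sum_(i <- s | P i) p (F i).
Proof.
elim/big_rec2 : _ => [|i y x _ h]; first by rewrite eseminorm0.
by rewrite (le_trans (eseminormD _ _)) // leeD2l.
Qed.

End theory.

Lemma eseminorm_ell2 (T : choiceType) (D : set T) (p : T -> V -> \bar R) :
  (forall t, eseminorm (p t)) -> eseminorm (fun x => ell2 D (fun t => p t x)).
Proof.
move=> hp; split => [x|x y|c x]; first exact: ell2_ge0.
- apply: (le_trans (y := ell2 D (fun t => p t x + p t y))); last first.
    by apply: ell2D => t _; exact: eseminorm_ge0.
  by apply: le_ell2 => t _; rewrite eseminorm_ge0 ?eseminormD.
- rewrite -ell2Z ?Re_norm_ge0 //; last by move=> t _; exact: eseminorm_ge0.
  by apply: eq_ell2 => t _; rewrite eseminormZ.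
Qed.

Lemma eseminorm_series (w : nat -> R) (p : nat -> V -> \bar R) :
  (forall m, 0 <= w m)%R -> (forall m, eseminorm (p m)) ->
  eseminorm (fun x => \sum_(0 <= m <oo) (w m)%:E * p m x).
Proof.
move=> w0 hp.
have wp0 m x : 0 <= (w m)%:E * p m x.
  by rewrite mule_ge0 ?lee_fin ?eseminorm_ge0.
split => [x|x y|c x]; first exact: nneseries_ge0.
- rewrite -nneseriesD //; apply: lee_nneseries => // m _.
  by rewrite -ge0_muleDr ?eseminorm_ge0 // lee_wpmul2l ?lee_fin ?eseminormD.
- rewrite -nneseriesZl //; apply: eq_eseriesr => m _.
  by rewrite eseminormZ // muleCA.
Qed.

End eseminorm.

Section lower_semicontinuity.
Context {R : realType}.
Local Open Scope ereal_scope.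
Implicit Types (f : nat -> \bar R) (l : \bar R).

(** [l] is at most the lower limit of [f]. *)
Definition lsc f l : Prop :=
  forall c : R, c%:E < l -> \forall n \near \oo, c%:E < f n.

Lemma lsc_cvg (u : nat -> R) (l : R) :
  u n @[n --> \oo] --> l -> lsc (fun n => (u n)%:E) l%:E.
Proof.
move=> ul c; rewrite lte_fin => cl.
have : \forall n \near \oo, (c < u n)%R by apply: (cvgr_gt l).
by apply: filterS => n; rewrite lte_fin.
Qed.

Lemma lsc_le f l (C : \bar R) : lsc f l ->
  (\forall n \near \oo, f n <= C) -> l <= C.
Proof.
move=> fl fC; rewrite leNgt; apply/negP => Cl.
have [c /andP[Cc cl]] : exists c : R, (C <= c%:E) && (c%:E < l).
  case: C fC Cl => [C| |] fC Cl.
  - by exists C; rewrite lexx.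
  - by move: Cl; rewrite ltNge leey.
  - case: l fl Cl => [l| |] // _ _; last by exists 0%R; rewrite leNye ltry.
    by exists (l - 1)%R; rewrite leNye lte_fin ltrBlDr ltrDl ltr01.
have : \forall n \near \oo, False.
  near=> n; have : f n <= C by near: n.
  rewrite leNgt; apply/negP; rewrite negbK (le_lt_trans Cc) //; near: n.
  exact: fl.
by case=> N _ /(_ N (leqnn _)).
Unshelve. all: by end_near. Qed.

Lemma lscD f g l k : (forall n, 0 <= f n) -> (forall n, 0 <= g n) ->
  0 <= l -> 0 <= k ->
  lsc f l -> lsc g k -> lsc (fun n => f n + g n) (l + k).
Proof.
move=> f0 g0 l0 k0 fl gk c clk.
have [c_lt0|c0] := ltP c 0%R.
  by near=> n; rewrite (lt_le_trans (y := 0)) ?lte_fin // adde_ge0.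
case: l l0 fl clk => [l| |] // l0 fl clk; last first.
  near=> n; rewrite (lt_le_trans (y := f n)) ?leeDl //; near: n.
  by apply: fl; rewrite ltry.
case: k k0 gk clk => [k| |] // k0 gk clk; last first.
  near=> n; rewrite (lt_le_trans (y := g n)) ?leeDr //; near: n.
  by apply: gk; rewrite ltry.
rewrite -EFinD lte_fin in clk.
pose e := ((l + k - c) / 2)%R.
have e0 : (0 < e)%R by rewrite divr_gt0 // subr_gt0.
have -> : c%:E = (l - e)%:E + (k - e)%:E.
  by rewrite -EFinD; congr EFin; rewrite /e; field.
near=> n; apply: lteD; near: n.
- by apply: fl; rewrite lte_fin ltrBlDr ltrDl.
- by apply: gk; rewrite lte_fin ltrBlDr ltrDl.
Unshelve. all: by end_near. Qed.

Lemma lsc_sum (T : eqType) (s : seq T) (f : nat -> T -> \bar R) (l : T -> \bar R) :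
  (forall n t, 0 <= f n t) -> (forall t, 0 <= l t) ->
  (forall t, t \in s -> lsc (f^~ t) (l t)) ->
  lsc (fun n => \sum_(t <- s) f n t) (\sum_(t <- s) l t).
Proof.
move=> f0 l0; elim: s => [|t s ih] h.
  by rewrite big_nil => c c0; near=> n; rewrite big_nil.
rewrite big_cons; under eq_fun do rewrite big_cons.
apply: lscD => [n|n||||]; rewrite ?sume_ge0 //.
- by apply: h; rewrite mem_head.
- by apply: ih => u us; apply: h; rewrite inE us orbT.
Unshelve. all: by end_near. Qed.

Lemma lsc_esum (T : choiceType) (D : set T) (f : nat -> T -> \bar R)
    (l : T -> \bar R) :
  (forall n t, 0 <= f n t) -> (forall t, 0 <= l t) ->
  (forall t, D t -> lsc (f^~ t) (l t)) ->
  lsc (fun n => \esum_(t in D) f n t) (\esum_(t in D) l t).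
Proof.
move=> f0 l0 h c; rewrite {1}/esum => /ereal_sup_gt[_ [X [finX XD] <-]].
rewrite fsbig_finite // => cX.
have sD t : t \in finmap.enum_fset (fset_set X) -> D t.
  by rewrite in_fset_set // inE; apply: XD.
have := lsc_sum f0 l0 (fun t ts => h t (sD t ts)) cX.
apply: filterS => n cn; rewrite (lt_le_trans cn) //.
by apply: seq_le_esum => //; exact: fset_uniq.
Qed.

Lemma lsc_sqr f l : (forall n, 0 <= f n) -> 0 <= l -> lsc f l ->
  lsc (fun n => f n ^+ 2) (l ^+ 2).
Proof.
move=> f0 l0 fl c cl.
have [c_lt0|c0] := ltP c 0%R.
  by near=> n; rewrite (lt_le_trans (y := 0)) ?lte_fin // expe2_ge0.
have : (Num.sqrt c)%:E < l.
  rewrite ltNge; apply/negP => lc; move: cl; rewrite ltNge => /negP; apply.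
  by rewrite (le_trans (le_expe2 l0 lc)) // -EFin_expe lee_fin sqr_sqrtr.
move/fl; apply: filterS => n; rewrite !ltNge; apply: contraNN => fc.
have := f0 n; case: (f n) fc => [x| |] // fc x0.
rewrite -EFin_expe !lee_fin in fc x0 *.
by rewrite -(ger0_norm x0) -sqrtr_sqr ler_wsqrtr.
Unshelve. all: by end_near. Qed.

Lemma lsc_sqrt f l : (forall n, 0 <= f n) -> 0 <= l -> lsc f l ->
  lsc (fun n => sqrte (f n)) (sqrte l).
Proof.
move=> f0 l0 fl c cl.
have [c_lt0|c0] := ltP c 0%R.
  by near=> n; rewrite (lt_le_trans (y := 0)) ?lte_fin // sqrte_ge0.
have cE : c%:E = sqrte (c ^+ 2)%:E by rewrite /= sqrtr_sqr ger0_norm.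
have /fl : (c ^+ 2)%:E < l.
  by move: cl; rewrite !ltNge cE lee_sqrt // lee_fin sqr_ge0.
apply: filterS => n; rewrite !ltNge cE lee_sqrt //.
by rewrite lee_fin sqr_ge0.
Unshelve. all: by end_near. Qed.

Lemma lsc_ell2 (T : choiceType) (D : set T) (f : nat -> T -> \bar R)
    (l : T -> \bar R) :
  (forall n t, 0 <= f n t) -> (forall t, 0 <= l t) ->
  (forall t, D t -> lsc (f^~ t) (l t)) ->
  lsc (fun n => ell2 D (f n)) (ell2 D l).
Proof.
move=> f0 l0 h; apply: lsc_sqrt => [n||].
- by apply: esum_ge0 => t _; exact: expe2_ge0.
- by apply: esum_ge0 => t _; exact: expe2_ge0.
apply: lsc_esum => [n t|t|t Dt]; do ?exact: expe2_ge0.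
by apply: lsc_sqr => //; exact: h.
Qed.

Lemma lscZ f l (c : R) : (0 <= c)%R -> (forall n, 0 <= f n) -> lsc f l ->
  lsc (fun n => c%:E * f n) (c%:E * l).
Proof.
move=> c0 f0 fl b bl.
have [cE|cN0] := eqVneq c 0%R.
  by move: bl; rewrite cE mul0e => b0; near=> n; rewrite mul0e.
have c_gt0 : (0 < c)%R by rewrite lt_def cN0.
have /fl : (b / c)%:E < l by rewrite mulrC EFinM lte_pdivrMl.
by apply: filterS => n; rewrite mulrC EFinM lte_pdivrMl.
Unshelve. all: by end_near. Qed.

Lemma lsc_series (w : nat -> R) (f : nat -> nat -> \bar R) (l : nat -> \bar R) :
  (forall m, 0 <= w m)%R ->
  (forall n m, 0 <= f n m) -> (forall m, 0 <= l m) ->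
  (forall m, lsc (f^~ m) (l m)) ->
  lsc (fun n => \sum_(0 <= m <oo) (w m)%:E * f n m)
      (\sum_(0 <= m <oo) (w m)%:E * l m).
Proof.
move=> w0 f0 l0 h.
have wf0 n m : 0 <= (w m)%:E * f n m by rewrite mule_ge0 ?lee_fin.
have wl0 m : 0 <= (w m)%:E * l m by rewrite mule_ge0 ?lee_fin.
rewrite nneseries_esumT //; under eq_fun do rewrite nneseries_esumT //.
by apply: lsc_esum => // m _; exact: lscZ.
Qed.

End lower_semicontinuity.

(** * Hilbert spaces and Hilbert-Schmidt operators *)

Section modulus.
Context {R : realType}.
Implicit Types (c : R[i]) (r : R).
Local Open Scope complex_scope.

(** The modulus as an element of [R] rather than of [R[i]]. *)
Definition modc c : R := complex.Re `|c|.

Lemma real_complexM r r' : (r * r')%:C = r%:C * r'%:C :> R[i].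
Proof. exact: rmorphM. Qed.

Lemma real_complexB r r' : (r - r')%:C = r%:C - r'%:C :> R[i].
Proof. exact: rmorphB. Qed.

Lemma real_complexD r r' : (r + r')%:C = r%:C + r'%:C :> R[i].
Proof. exact: rmorphD. Qed.

Lemma modcE c : (modc c)%:C = `|c|.
Proof. by rewrite /modc RRe_real // normr_real. Qed.

Lemma modc_ge0 c : 0 <= modc c. Proof. exact: Re_norm_ge0. Qed.

Lemma modcD c c' : modc (c + c') <= modc c + modc c'.
Proof. by rewrite -lecR rmorphD /= !modcE ler_normD. Qed.

Lemma modc_real r : modc r%:C = `|r|.
Proof. by rewrite /modc normc_def /= expr0n /= addr0 sqrtr_sqr. Qed.

Lemma modc0 : modc 0 = 0. Proof. by rewrite /modc normr0. Qed.

Lemma modc1 : modc 1 = 1. Proof. by rewrite /modc normr1. Qed.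

Lemma modcJ c : modc (c^*)%R = modc c.
Proof. by apply: complexI; rewrite !modcE norm_conjC. Qed.

Lemma modcN c : modc (- c) = modc c. Proof. by rewrite /modc normrN. Qed.

Lemma modc_eq0 c : (modc c == 0) = (c == 0).
Proof. by rewrite -(inj_eq (@complexI _)) modcE normr_eq0. Qed.

Lemma sqr_modc c : ((modc c) ^+ 2)%:C = c * (c^*)%R.
Proof. by rewrite rmorphXn /= modcE normCK. Qed.

Lemma sqr_modcE c : modc c ^+ 2 = complex.Re c ^+ 2 + complex.Im c ^+ 2.
Proof. by apply: complexI; rewrite rmorphXn /= modcE add_Re2_Im2. Qed.

Lemma Re_le_modc c : `|complex.Re c| <= modc c.
Proof. by rewrite -lecR modcE normc_ge_Re. Qed.

End modulus.

Section inner_product.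
Context {R : realType} {E : lmodType R[i]} (dot : {dot E for Num.conj}).
Local Notation N := (cnorm dot).
Implicit Types (x y z : E) (c : R[i]).
Local Open Scope complex_scope.

Lemma dotDl x y z : dot (x + y) z = dot x z + dot y z.
Proof. exact: linearDl. Qed.

Lemma dotBl x y z : dot (x - y) z = dot x z - dot y z.
Proof. exact: linearBl. Qed.

Lemma dotZl c x z : dot (c *: x) z = c * dot x z.
Proof. exact: linearZl_LR. Qed.

Lemma dotDr x y z : dot z (x + y) = dot z x + dot z y.
Proof. exact: linearDr. Qed.

Lemma dotBr x y z : dot z (x - y) = dot z x - dot z y.
Proof. exact: linearBr. Qed.

Lemma dotZr c x z : dot z (c *: x) = (c^*)%R * dot z x.
Proof. exact: linearZr_LR. Qed.

Lemma dot0l x : dot 0 x = 0. Proof. exact: linear0l. Qed.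

Lemma dot0r x : dot x 0 = 0. Proof. exact: linear0r. Qed.

Lemma dotC x y : dot x y = (dot y x)^*%R.
Proof. by rewrite (hermC dot) expr0 mul1r. Qed.

Lemma dot_suml (I : Type) (s : seq I) (P : pred I) (F : I -> E) y :
  dot (\sum_(i <- s | P i) F i) y = \sum_(i <- s | P i) dot (F i) y.
Proof.
by elim/big_rec2 : _ => [|i u v _ <-]; rewrite ?dot0l // dotDl.
Qed.

Lemma dot_sumr (I : Type) (s : seq I) (P : pred I) (F : I -> E) y :
  dot y (\sum_(i <- s | P i) F i) = \sum_(i <- s | P i) dot y (F i).
Proof.
by elim/big_rec2 : _ => [|i u v _ <-]; rewrite ?dot0r // dotDr.
Qed.

Lemma dotxx x : dot x x = ((N x) ^+ 2)%:C.
Proof.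
have := dnorm_ge0 dot x; rewrite lecE /= => /andP[/eqP im0 re0].
rewrite /cnorm sqr_sqrtr // [LHS]complexE im0.
by rewrite rmorph0 mulr0 addr0.
Qed.

Lemma sqr_cnorm x : N x ^+ 2 = complex.Re (dot x x).
Proof. by rewrite dotxx. Qed.

Lemma cnorm_ge0 x : 0 <= N x. Proof. exact: sqrtr_ge0. Qed.

Lemma cnorm0 : N 0 = 0. Proof. by rewrite /cnorm dot0l sqrtr0. Qed.

Lemma cnorm_eq0 x : (N x == 0) = (x == 0).
Proof.
by rewrite -(dnorm_eq0 dot) dotxx (inj_eq (@complexI _) _ 0) sqrf_eq0.
Qed.

Lemma cnormZ c x : N (c *: x) = modc c * N x.
Proof.
apply/eqP; rewrite -(eqrXn2 (n := 2)) ?mulr_ge0 ?cnorm_ge0 ?modc_ge0 //.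
apply/eqP/complexI; rewrite -dotxx dotZl dotZr dotxx exprMn [RHS]real_complexM.
by rewrite sqr_modc mulrA.
Qed.

Lemma cnormN x : N (- x) = N x.
Proof. by rewrite -scaleN1r cnormZ modcN modc1 mul1r. Qed.

Lemma cnormBC x y : N (x - y) = N (y - x).
Proof. by rewrite -cnormN opprB. Qed.

Lemma dot_cauchy_schwarz x y : modc (dot x y) <= N x * N y.
Proof.
have [->|y0] := eqVneq y 0; first by rewrite dot0r modc0 cnorm0 mulr0.
rewrite -(@ler_pXn2r _ 2) ?nnegrE ?mulr_ge0 ?cnorm_ge0 ?modc_ge0 // exprMn.
set a := N y ^+ 2; have a_gt0 : 0 < a.
  by rewrite exprn_gt0 // lt_def cnorm_ge0 cnorm_eq0 y0.
have : 0 <= N (a%:C *: x - dot x y *: y) ^+ 2 by rewrite sqr_ge0.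
rewrite (_ : _ ^+ 2 = a * (N x ^+ 2 * a - modc (dot x y) ^+ 2)).
  by rewrite pmulr_rge0 // subr_ge0.
apply: complexI; rewrite -dotxx dotBl !dotBr !dotZl !dotZr.
rewrite (dotC y x) !dotxx -/a.
set b := N x ^+ 2; set m := modc (dot x y) ^+ 2.
have -> : (a * (b * a - m))%:C = a%:C * (b%:C * a%:C - m%:C).
  by rewrite real_complexM real_complexB real_complexM.
have -> : (a%:C^*)%R = a%:C by rewrite conj_Creal // complex_real.
by rewrite /m sqr_modc; ring.
Qed.

Lemma cnormD x y : N (x + y) <= N x + N y.
Proof.
rewrite -(@ler_pXn2r _ 2) ?nnegrE ?addr_ge0 ?cnorm_ge0 //.
rewrite sqr_cnorm dotDl !dotDr (dotC y x) !raddfD /= -!sqr_cnorm.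
have -> : complex.Re ((dot x y)^*)%R = complex.Re (dot x y).
  by case: (dot x y).
have h := le_trans (ler_norm _) (le_trans (Re_le_modc (dot x y)) (dot_cauchy_schwarz x y)).
by rewrite sqrrD; nra.
Qed.

Lemma cnorm_split x y z : N (x - z) <= N (x - y) + N (y - z).
Proof. by rewrite (le_trans _ (cnormD _ _)) // addrA subrK. Qed.

Lemma cnorm_dist x y : `|N x - N y| <= N (x - y).
Proof.
have h1 := cnormD (x - y) y; have h2 := cnormD (y - x) x.
rewrite !subrK cnormBC in h1 h2.
by rewrite ler_norml cnormBC; apply/andP; split; lra.
Qed.

Lemma cnorm_sum (I : Type) (s : seq I) (P : pred I) (F : I -> E) :
  N (\sum_(i <- s | P i) F i) <= \sum_(i <- s | P i) N (F i).
Proof.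
elim/big_rec2 : _ => [|i u v _ h]; first by rewrite cnorm0.
by rewrite (le_trans (cnormD _ _)) // lerD2l.
Qed.

Lemma eseminorm_cnorm : eseminorm (fun x => (N x)%:E).
Proof.
split => [x|x y|c x]; first by rewrite lee_fin cnorm_ge0.
- by rewrite -EFinD lee_fin cnormD.
- by rewrite -EFinM cnormZ.
Qed.

Definition ncvg (u : nat -> E) (l : E) : Prop := N (u n - l) @[n --> \oo] --> (0 : R).

Lemma ncvgP u l : ncvg u l <->
  (forall eps : R, 0 < eps -> \forall n \near \oo, N (u n - l) < eps).
Proof.
split => [ul eps eps0|h].
  exact: (cvgr_lt (0 : R) ul).
apply/cvgrPdist_lt => eps /h; apply: filterS => n.
by rewrite sub0r normrN ger0_norm // cnorm_ge0.
Qed.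

Lemma ncvg_unique u l l' : ncvg u l -> ncvg u l' -> l = l'.
Proof.
move=> ul ul'; apply/eqP; rewrite -subr_eq0 -cnorm_eq0 eq_le cnorm_ge0 andbT.
rewrite leNgt; apply/negP => d0; have d2 : 0 < N (l - l') / 2 by rewrite divr_gt0.
have : \forall n \near \oo, False.
  move/ncvgP : ul => /(_ _ d2); move/ncvgP : ul' => /(_ _ d2).
  apply: filterS2 => n a b.
  have := cnorm_split l (u n) l'; rewrite (cnormBC l (u n)).
  by move=> h; have := le_lt_trans h (ltrD b a); rewrite -splitr ltxx.
by case=> n _ /(_ n (leqnn _)).
Qed.

Lemma ncvg_cst l : ncvg (fun=> l) l.
Proof. by rewrite /ncvg subrr cnorm0; exact: cvg_cst. Qed.

Lemma ncvg_le0 u l (b : nat -> R) : b n @[n --> \oo] --> (0 : R) ->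
  (\forall n \near \oo, N (u n - l) <= b n) -> ncvg u l.
Proof.
move=> b0 h; apply: (squeeze_cvgr (f := fun=> 0) (h := b)) => //.
  by apply: filterS h => n ->; rewrite cnorm_ge0.
exact: cvg_cst.
Qed.

Lemma ncvgP_linear c u v l k : ncvg u l -> ncvg v k ->
  ncvg (fun n => c *: u n + v n) (c *: l + k).
Proof.
move=> ul vk.
apply: (ncvg_le0 (b := fun n => modc c * N (u n - l) + N (v n - k))).
  rewrite -[0 in X in _ --> X](addr0 (0 : R)).
  rewrite -[X in _ --> X + _](mulr0 (modc c)).
  by apply: cvgD => //; apply: cvgMr.
apply: nearW => n; rewrite opprD addrACA -scalerBr.
by rewrite (le_trans (cnormD _ _)) // cnormZ.
Qed.

Lemma ncvgZ c u l : ncvg u l -> ncvg (fun n => c *: u n) (c *: l).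
Proof.
move=> ul; have := ncvgP_linear c ul (ncvg_cst 0); rewrite addr0.
by under eq_fun do rewrite addr0.
Qed.

Lemma ncvgD u v l k : ncvg u l -> ncvg v k -> ncvg (fun n => u n + v n) (l + k).
Proof.
move=> ul vk; have := ncvgP_linear 1 ul vk; rewrite scale1r.
by under eq_fun do rewrite scale1r.
Qed.

Lemma ncvgB u v l k : ncvg u l -> ncvg v k -> ncvg (fun n => u n - v n) (l - k).
Proof.
move=> ul vk; apply: ncvgD => //; rewrite -scaleN1r.
by under eq_fun do rewrite -scaleN1r; exact: ncvgZ.
Qed.

Lemma ncvg_norm u l : ncvg u l -> N (u n) @[n --> \oo] --> N l.
Proof.
move=> /ncvgP ul; apply/cvgrPdist_lt => eps /ul; apply: filterS => n.
by apply: le_lt_trans; rewrite distrC cnorm_dist.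
Qed.

Lemma ncvg_dot u l y : ncvg u l -> modc (dot (u n) y - dot l y) @[n --> \oo] --> (0 : R).
Proof.
move=> ul; apply: (squeeze_cvgr (f := fun=> 0) (h := fun n => N (u n - l) * N y)).
- by apply: nearW => n; rewrite modc_ge0 -dotBl dot_cauchy_schwarz.
- exact: cvg_cst.
- by rewrite -(mul0r (N y)); apply: cvgMl.
Qed.

Lemma ncvg_norm_le u l C : ncvg u l -> (\forall n \near \oo, N (u n) <= C) -> N l <= C.
Proof.
by move=> /ncvg_norm ul; exact: cvgr_to_le.
Qed.

End inner_product.

Section countable_enumeration.
Context {T : countType}.

(** The elements of code less than [n]: an exhausting sequence of finite
    sets. *)
Definition cenum (n : nat) : seq T := pmap (@pickle_inv T) (iota 0 n).

Lemma cenum_uniq n : uniq (cenum n).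
Proof. by apply: (pmap_uniq (@pickle_invK T)); exact: iota_uniq. Qed.

Lemma mem_cenum n x : (x \in cenum n) = (choice.pickle x < n)%N.
Proof.
rewrite mem_pmap; apply/mapP/idP => [[k]|xn].
  rewrite mem_iota add0n => /= kn xk.
  by have := @pickle_invK T k; rewrite -xk /= => ->.
by exists (choice.pickle x); rewrite ?mem_iota ?pickleK_inv.
Qed.

Lemma cenum_sub (s : seq T) : exists n, forall m, (n <= m)%N -> {subset s <= cenum m}.
Proof.
elim: s => [|x s [n h]]; first by exists 0%N.
exists (maxn n (choice.pickle x).+1) => m; rewrite geq_max => /andP[nm xm] y.
by rewrite inE => /predU1P[->|/(h _ nm)//]; rewrite mem_cenum.
Qed.

End countable_enumeration.
Arguments cenum : clear implicits.

Lemma near2P (P : nat -> nat -> Prop) :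
  (\forall m & n \near \oo, P m n) <->
  exists n0, forall m n, (n0 <= m)%N -> (n0 <= n)%N -> P m n.
Proof.
split => [[[A B] /= [[a _ ha] [b _ hb]] h]|[n0 h]].
  exists (maxn a b) => m n; rewrite !geq_max => /andP[am bm] /andP[an bn].
  by apply: (h (m, n)); split; [exact: ha|exact: hb].
by exists ([set m | (n0 <= m)%N], [set n | (n0 <= n)%N]) => /=;
  [split; exists n0|move=> [m n] [/= ? ?]; exact: h].
Qed.

Section orthonormal_basis.
Context {R : realType} {E : lmodType R[i]} (dot : {dot E for Num.conj})
  {K : countType} (e : K -> E).
Hypothesis E_complete : complete_norm (cnorm dot).
Hypothesis e_basis : orthonormal_basis dot (cnorm dot) e.
Local Notation N := (cnorm dot).
Implicit Types (x y : E) (s : seq K) (c : K -> R[i]).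
Local Open Scope complex_scope.

Lemma dot_basis i k : dot (e i) (e k) = (i == k)%:R.
Proof. by case: e_basis => + _; apply. Qed.

Lemma cnorm_basis k : N (e k) = 1.
Proof. by rewrite /cnorm dot_basis eqxx sqrtr1. Qed.

Definition comb s c : E := \sum_(k <- s) c k *: e k.

Definition proj s x : E := comb s (fun k => dot x (e k)).

Lemma dot_comb s c k : uniq s -> dot (comb s c) (e k) = if k \in s then c k else 0.
Proof.
move=> us; rewrite dot_suml; under eq_bigr do rewrite dotZl dot_basis.
case: ifPn => ks; last first.
  rewrite big_seq big1 // => i si; rewrite (negPf (_ : i != k)) ?mulr0 //.
  by apply: contraNneq ks => <-.
rewrite (bigD1_seq k) //= eqxx mulr1 big1 ?addr0 // => i /negPf ->.
by rewrite mulr0.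
Qed.

Lemma sqr_cnorm_comb s c : uniq s -> N (comb s c) ^+ 2 = \sum_(k <- s) modc (c k) ^+ 2.
Proof.
move=> us; apply: complexI; rewrite -dotxx {2}/comb dot_sumr rmorph_sum /=.
rewrite big_seq [RHS]big_seq; apply: eq_bigr => k ks.
by rewrite dotZr dot_comb // ks sqr_modc mulrC.
Qed.

Lemma dot_sub_proj s x c : uniq s -> dot (comb s c) (x - proj s x) = 0.
Proof.
move=> us; rewrite dot_suml big_seq big1 // => k ks.
by rewrite dotZl dotBr (dotC _ (e k) (proj s x)) dot_comb // ks -dotC subrr mulr0.
Qed.

Lemma pythagoras x y : dot x y = 0 -> N (x + y) ^+ 2 = N x ^+ 2 + N y ^+ 2.
Proof.
move=> xy; apply: complexI; rewrite -dotxx dotDl !dotDr (dotC _ y x) xy.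
by rewrite conjC0 addr0 add0r !dotxx real_complexD.
Qed.

Lemma bessel s x : uniq s ->
  N x ^+ 2 = \sum_(k <- s) modc (dot x (e k)) ^+ 2 + N (x - proj s x) ^+ 2.
Proof.
move=> us; rewrite -sqr_cnorm_comb // -pythagoras ?dot_sub_proj //.
by rewrite -/(proj s x) addrC subrK.
Qed.

Lemma proj_best s x c : uniq s -> N (x - proj s x) <= N (x - comb s c).
Proof.
move=> us; rewrite -(@ler_pXn2r _ 2) ?nnegrE ?cnorm_ge0 //.
have -> : x - comb s c = comb s (fun k => dot x (e k) - c k) + (x - proj s x).
  have -> : comb s (fun k => dot x (e k) - c k) = proj s x - comb s c.
    by rewrite /proj /comb -sumrB; apply: eq_bigr => k _; rewrite scalerBl.
  by rewrite [RHS]addrC addrA subrK.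
by rewrite [leRHS]pythagoras ?dot_sub_proj // lerDr sqr_ge0.
Qed.

Lemma proj_dense x (eps : R) : 0 < eps -> exists2 s, uniq s & N (x - proj s x) < eps.
Proof.
move=> eps0; case: e_basis => _ /(_ x _ eps0)[s [c h]].
exists (undup s); first exact: undup_uniq.
apply: le_lt_trans h.
have -> : \sum_(i <- s) c i *: e i =
          comb (undup s) (fun i => c i *+ count_mem i s).
  rewrite /comb -big_undup_iterop_count; apply: eq_bigr => i _.
  by rewrite Monoid.iteropE /= iter_addr_0 scalerMnl.
by apply: proj_best; exact: undup_uniq.
Qed.

Lemma proj_mono s s' x : uniq s -> uniq s' -> {subset s <= s'} ->
  N (x - proj s' x) <= N (x - proj s x).
Proof.
move=> us us' ss'.
have -> : proj s x = comb s' (fun k => if k \in s then dot x (e k) else 0).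
  rewrite /proj /comb [RHS](bigID (mem s)) /= [X in _ + X]big1 ?addr0; last first.
    by move=> k /negPf ->; rewrite scale0r.
  rewrite [RHS](eq_bigr (fun k => dot x (e k) *: e k)); last by move=> k ->.
  rewrite -[RHS]big_filter; apply: perm_big; apply: uniq_perm => //.
    exact: filter_uniq.
  by move=> k; rewrite mem_filter andb_idr //; exact: ss'.
exact: proj_best.
Qed.

Lemma ncvg_proj x : ncvg dot (fun n => proj (cenum K n) x) x.
Proof.
apply/ncvgP => eps /(proj_dense x)[s us h].
have [n0 sub] := cenum_sub s.
exists n0 => // n /= n0n; rewrite cnormBC.
by apply: le_lt_trans h; apply: proj_mono => //; [exact: cenum_uniq|exact: sub].
Qed.

Lemma parseval x :
  ((N x) ^+ 2)%:E = (\esum_(k in [set: K]) ((modc (dot x (e k))) ^+ 2)%:E)%E.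
Proof.
apply/eqP; rewrite eq_le; apply/andP; split; last first.
  apply: esum_le_seq => s us _.
  by rewrite sumEFin lee_fin (bessel x us) lerDl sqr_ge0.
apply/lee_addgt0Pr => eps eps0.
have e1 : 0 < Num.sqrt eps by rewrite sqrtr_gt0.
have [s us h] := proj_dense x e1.
rewrite (bessel x us) EFinD leeD //.
  by rewrite -sumEFin; apply: seq_le_esum.
rewrite lee_fin -[leRHS](sqr_sqrtr (ltW eps0)).
by rewrite ler_pXn2r ?nnegrE ?cnorm_ge0 ?sqrtr_ge0 // ltW.
Qed.

Lemma riesz_fischer c :
  (\esum_(k in [set: K]) ((modc (c k)) ^+ 2)%:E < +oo)%E ->
  exists2 y, forall k, dot y (e k) = c k & ncvg dot (fun n => comb (cenum K n) c) y.
Proof.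
move=> cfin.
have c0 k : [set: K] k -> (0 <= ((modc (c k)) ^+ 2)%:E)%E.
  by rewrite lee_fin sqr_ge0.
have [y /= yl] : exists y, ncvg dot (fun n => comb (cenum K n) c) y.
  apply: E_complete => eps eps0; apply/near2P.
  have e2 : 0 < (eps / 4) ^+ 2 by rewrite exprn_gt0 // divr_gt0.
  have [s [us _] h] := esum_tail c0 cfin e2.
  have [n0 sub] := cenum_sub s.
  exists n0.
  have near0 m : (n0 <= m)%N ->
      N (comb (cenum K m) c - comb (cenum K n0) c) <= eps / 4.
    move=> n0m.
    have -> : comb (cenum K m) c - comb (cenum K n0) c =
        comb [seq k <- cenum K m | k \notin cenum K n0] c.
      rewrite /comb (bigID (mem (cenum K n0))) /= addrC -big_filter.
      rewrite -[X in _ + X - _]big_filter.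
      rewrite (_ : \sum_(i <- [seq i <- cenum K m | i \in cenum K n0]) _ =
        \sum_(i <- cenum K n0) c i *: e i); last first.
        apply: perm_big; apply: uniq_perm; rewrite ?filter_uniq ?cenum_uniq //.
        move=> k; rewrite mem_filter andb_idr // !mem_cenum => kn.
        exact: leq_trans n0m.
      by rewrite addrK.
    have e4 : 0 <= eps / 4 by rewrite divr_ge0 // ltW.
    rewrite -(@ler_pXn2r _ 2) ?nnegrE ?cnorm_ge0 //.
    rewrite sqr_cnorm_comb ?filter_uniq ?cenum_uniq //.
    rewrite -lee_fin -sumEFin (le_trans _ h) //.
    apply: seq_le_esum; first by rewrite filter_uniq ?cenum_uniq.
    move=> k; rewrite mem_filter => /andP[kn0 _]; split => //= ks.
    by move: kn0; rewrite (sub n0).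
  move=> m n /near0 hm /near0 hn.
  rewrite (le_lt_trans (cnorm_split _ _ (comb (cenum K n0) c) _)) //.
  rewrite [X in _ + X]cnormBC (le_lt_trans (lerD hm hn)) //.
  by lra.
exists y => // k; apply/eqP; rewrite -subr_eq0 -modc_eq0; apply/eqP.
have h1 := ncvg_dot (e k) yl.
have h2 : modc (dot (comb (cenum K n) c) (e k) - dot y (e k)) @[n --> \oo] -->
    modc (dot y (e k) - c k).
  apply: cvg_near_cst; exists (choice.pickle k).+1 => // n /= kn.
  by rewrite dot_comb ?cenum_uniq // mem_cenum kn -modcN opprB.
exact: (norm_cvg_unique h2 h1).
Qed.

End orthonormal_basis.

Section hilbert_schmidt_theory.
Context {R : realType} {E : lmodType R[i]} (dot : {dot E for Num.conj})
  {K : countType} (e : K -> E).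
Hypothesis E_complete : complete_norm (cnorm dot).
Hypothesis e_basis : orthonormal_basis dot (cnorm dot) e.
Local Notation N := (cnorm dot).
Local Notation hs := (hilbert_schmidt dot e).
Local Notation hsnorm := (hsnorm dot e).
Implicit Types (x y : E) (T S : E -> E) (c : R[i]).
Local Open Scope complex_scope.

Lemma op_linE c T S x : (c *: T + S) x = c *: T x + S x. Proof. by []. Qed.

Lemma op_subE T S x : (T - S) x = T x - S x. Proof. by []. Qed.

Lemma hsnormE T : hsnorm T = ell2 [set: K] (fun k => (N (T (e k)))%:E).
Proof.
by rewrite /Defs.hsnorm /ell2; congr sqrte; apply: eq_esum => k _; rewrite EFin_expe.
Qed.

Lemma eseminorm_hs : eseminorm hsnorm.
Proof.
rewrite (_ : hsnorm = fun T => ell2 [set: K] (fun k => (N (T (e k)))%:E)).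
  apply: (eseminorm_ell2 [set: K] (p := fun k T => (N (T (e k)))%:E)) => k.
  split => [T|T S|c T]; first exact: (eseminorm_ge0 (eseminorm_cnorm dot)).
  - exact: (eseminormD (eseminorm_cnorm dot)).
  - exact: (eseminormZ (eseminorm_cnorm dot)).
by apply/funext => T; exact: hsnormE.
Qed.

Lemma sqr_hsnorm T : (hsnorm T ^+ 2 = \esum_(k in [set: K]) ((N (T (e k))) ^+ 2)%:E)%E.
Proof. by rewrite hsnormE sqr_ell2; apply: eq_esum => k _; rewrite EFin_expe. Qed.

(** Pointwise convergence of operators is enough for Fatou's lemma. *)
Lemma lsc_hsnorm (u : nat -> E -> E) T :
  (forall k, ncvg dot (fun n => u n (e k)) (T (e k))) ->
  lsc (fun n => hsnorm (u n)) (hsnorm T).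
Proof.
move=> uT; rewrite hsnormE; under eq_fun do rewrite hsnormE.
apply: lsc_ell2 => [n k|k|k _]; rewrite ?lee_fin ?cnorm_ge0 //.
by apply: lsc_cvg; exact: ncvg_norm.
Qed.

Lemma lin0 T : linear T -> T 0 = 0.
Proof. by move=> lT; have := lT (-1) 0 0; rewrite scaler0 addr0 scaleN1r addNr. Qed.

Lemma linZ T c x : linear T -> T (c *: x) = c *: T x.
Proof. by move=> lT; have := lT c x 0; rewrite !addr0 (lin0 lT) addr0. Qed.

Lemma linD T x y : linear T -> T (x + y) = T x + T y.
Proof. by move=> lT; have := lT 1 x y; rewrite !scale1r. Qed.

Lemma linB T x y : linear T -> T (x - y) = T x - T y.
Proof. by move=> lT; rewrite addrC -scaleN1r lT scaleN1r addrC. Qed.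

Lemma lin_sum T (I : Type) (s : seq I) (P : pred I) (F : I -> E) : linear T ->
  T (\sum_(i <- s | P i) F i) = \sum_(i <- s | P i) T (F i).
Proof.
move=> lT; elim/big_rec2 : _ => [|i u v _ <-]; first exact: lin0.
exact: linD.
Qed.

Lemma bounded_cvg T (u : nat -> E) l : bounded_operator dot T -> ncvg dot u l ->
  ncvg dot (fun n => T (u n)) (T l).
Proof.
move=> [lT [M bT]] ul.
apply: (ncvg_le0 (b := fun n => M * N (u n - l))).
  by rewrite -(mulr0 M); apply: cvgMr.
by apply: nearW => n; rewrite -linB.
Qed.

(** The operators agree on the partial Fourier sums, hence on their limits. *)
Lemma bounded_eq T S : bounded_operator dot T -> bounded_operator dot S ->
  (forall k, T (e k) = S (e k)) -> T = S.
Proof.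
move=> bT bS TS; apply/funext => x; have xl := ncvg_proj e_basis x.
apply: (ncvg_unique (bounded_cvg bT xl)).
have -> : (fun n => T (proj dot e (cenum K n) x)) =
    (fun n => S (proj dot e (cenum K n) x)).
  apply/funext => n; case: bT bS => lT _ [lS _].
  by rewrite !lin_sum //; apply: eq_bigr => k _; rewrite !linZ // TS.
exact: bounded_cvg.
Qed.

Definition hsn T : R := fine (hsnorm T).

Lemma hsn_ge0 T : 0 <= hsn T.
Proof. by rewrite fine_ge0 // eseminorm_ge0 //; exact: eseminorm_hs. Qed.

Lemma hsnK T : hs T -> (hsn T)%:E = hsnorm T.
Proof.
by case=> _ fT; rewrite fineK // ge0_fin_numE // (eseminorm_ge0 eseminorm_hs).
Qed.

Lemma hs_bound T x : hs T -> N (T x) <= hsn T * N x.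
Proof.
move=> hT; have [[lT bT] _] := hT.
have xl := ncvg_proj e_basis x.
apply: (ncvg_norm_le (bounded_cvg (conj lT bT) xl)); apply: nearW => n.
rewrite lin_sum //; apply: (le_trans (cnorm_sum _ _ _ _)).
under eq_bigr do rewrite linZ // cnormZ.
apply: (le_trans (sum_cauchy_schwarz_sqrt _ _ _)).
rewrite mulrC ler_pM ?sqrtr_ge0 //.
- rewrite -[leRHS]ger0_norm ?hsn_ge0 // -sqrtr_sqr ler_wsqrtr //.
  rewrite -lee_fin -sumEFin EFin_expe hsnK // sqr_hsnorm.
  by apply: seq_le_esum => //; exact: cenum_uniq.
- rewrite -[leRHS]ger0_norm ?cnorm_ge0 // -sqrtr_sqr ler_wsqrtr //.
  by rewrite (bessel e_basis x (cenum_uniq n)) lerDl sqr_ge0.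
Qed.

Lemma bounded_lin c T S : bounded_operator dot T -> bounded_operator dot S ->
  bounded_operator dot (c *: T + S).
Proof.
move=> [lT [M bT]] [lS [M' bS]]; split.
  move=> a x y; rewrite !op_linE lT lS.
  by rewrite !scalerDr !scalerA (mulrC c) addrACA.
exists (modc c * M + M') => x.
apply: (le_trans (cnormD _ (c *: T x) (S x))).
by rewrite cnormZ mulrDl -mulrA lerD // ler_wpM2l ?modc_ge0.
Qed.

Lemma hs_lin c T S : hs T -> hs S -> hs (c *: T + S).
Proof.
move=> [bT fT] [bS fS]; split; first exact: bounded_lin.
rewrite (le_lt_trans (eseminormD eseminorm_hs _ _)) // lte_add_pinfty //.
by rewrite (eseminormZ eseminorm_hs) lte_mul_pinfty ?lee_fin ?Re_norm_ge0.
Qed.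

Lemma hs0 : hs 0.
Proof.
split; last by rewrite (eseminorm0 eseminorm_hs).
split; first by move=> a x y; rewrite /GRing.zero /= scaler0 addr0.
by exists 0 => x; rewrite mul0r /GRing.zero /= cnorm0.
Qed.

Lemma hsZ c T : hs T -> hs (c *: T).
Proof. by move=> hT; rewrite -[_ *: _]addr0; apply: hs_lin => //; exact: hs0. Qed.

Lemma hsD T S : hs T -> hs S -> hs (T + S).
Proof. by move=> hT hS; rewrite -(scale1r T); exact: hs_lin. Qed.

Lemma hsB T S : hs T -> hs S -> hs (T - S).
Proof. by move=> hT hS; rewrite addrC -scaleN1r; exact: hs_lin. Qed.

Lemma hs_sum (I : Type) (s : seq I) (P : pred I) (F : I -> E -> E) :
  (forall i, P i -> hs (F i)) -> hs (\sum_(i <- s | P i) F i).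
Proof.
move=> h; elim/big_rec : _ => [|i T Pi hT]; first exact: hs0.
by apply: hsD => //; exact: h.
Qed.

Lemma hsnD T S : hs T -> hs S -> hsn (T + S) <= hsn T + hsn S.
Proof.
move=> hT hS; rewrite -lee_fin EFinD !hsnK //; last exact: hsD.
exact: (eseminormD eseminorm_hs).
Qed.

Lemma hsnZ c T : hs T -> hsn (c *: T) = modc c * hsn T.
Proof.
move=> hT; apply/EFin_inj; rewrite EFinM !hsnK //; last exact: hsZ.
exact: (eseminormZ eseminorm_hs).
Qed.

Lemma hsn0 : hsn 0 = 0. Proof. by rewrite /hsn (eseminorm0 eseminorm_hs). Qed.

Lemma hsnorm_eq0 T : bounded_operator dot T -> hsnorm T = 0%E -> T = 0.
Proof.
move=> bT T0; apply: bounded_eq => //; first by case: hs0.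
move=> k; apply/eqP; rewrite -(cnorm_eq0 dot) eq_le cnorm_ge0 andbT -lee_fin.
rewrite (_ : (0 : R)%:E = hsnorm T) // hsnormE; apply: (ell2_ge_term (f := fun k => (N (T (e k)))%:E)) => //.
by rewrite lee_fin cnorm_ge0.
Qed.

Lemma bounded_comp T S : bounded_operator dot T -> bounded_operator dot S ->
  bounded_operator dot (T \o S).
Proof.
move=> [lT [M bT]] [lS [M' bS]]; split; first by move=> a x y /=; rewrite lS lT.
exists (`|M| * M') => x /=; rewrite (le_trans (bT _)) //.
rewrite (le_trans (ler_wpM2r (cnorm_ge0 _ _) (ler_norm M))) //.
by rewrite -mulrA ler_wpM2l.
Qed.

Lemma hsnorm_comp_le T S : hs T -> hs S ->
  (hsnorm (T \o S) <= hsnorm T * hsnorm S)%E.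
Proof.
move=> hT hS; rewrite -(hsnK hT) !hsnormE -ell2Z ?hsn_ge0 //; last first.
  by move=> k _; rewrite lee_fin cnorm_ge0.
apply: le_ell2 => k _; rewrite lee_fin cnorm_ge0 /= -EFinM lee_fin.
exact: hs_bound.
Qed.

Lemma hs_comp T S : hs T -> hs S -> hs (T \o S).
Proof.
move=> hT hS; split; first by case: hT hS => bT _ [bS _]; exact: bounded_comp.
by rewrite (le_lt_trans (hsnorm_comp_le hT hS)) // -!hsnK // -EFinM ltry.
Qed.

Lemma hsn_comp T S : hs T -> hs S -> hsn (T \o S) <= hsn T * hsn S.
Proof.
move=> hT hS; rewrite -lee_fin EFinM !hsnK //; last exact: hs_comp.
exact: hsnorm_comp_le.
Qed.

Lemma sum_comp_l (I : Type) (s : seq I) (P : pred I) (F : I -> E -> E) S :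
  (\sum_(i <- s | P i) F i) \o S = \sum_(i <- s | P i) (F i \o S).
Proof. by apply/funext => x /=; rewrite !fct_sumE. Qed.

(** The adjoint of [T] sends [y] to the vector with Fourier coefficients
    [dot y (T (e k))]. *)
Lemma adjoint_exists T : hs T -> exists S, forall x y, dot (T x) y = dot x (S y).
Proof.
move=> hT; have [bT _] := hT.
suff h y : exists y', forall x, dot (T x) y = dot x y'.
  by exists (fun y => sval (cid (h y))) => x y; case: (cid _).
have [|y' y'E _] := @riesz_fischer _ _ _ _ _ E_complete e_basis
    (fun k => dot y (T (e k))).
  apply: (@le_lt_trans _ _ (((N y) ^+ 2)%:E * hsnorm T ^+ 2)%E); last first.
    by rewrite -hsnK // -EFin_expe -EFinM ltry.
  rewrite sqr_hsnorm; apply: esum_le_seq => s us _.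
  apply: (@le_trans _ _ (((N y) ^+ 2)%:E * \sum_(k <- s) ((N (T (e k))) ^+ 2)%:E)%E).
    rewrite !sumEFin -EFinM lee_fin mulr_sumr ler_sum // => k _.
    by rewrite -exprMn lerXn2r ?nnegrE ?modc_ge0 ?mulr_ge0 ?cnorm_ge0 ?dot_cauchy_schwarz.
  by rewrite lee_wpmul2l ?lee_fin ?sqr_ge0 // seq_le_esum.
exists y' => x; have xl := ncvg_proj e_basis x.
apply/eqP; rewrite -subr_eq0 -modc_eq0; apply/eqP.
have h2 := ncvg_dot y' xl.
have Pxy n : dot (T (proj dot e (cenum K n) x)) y = dot (proj dot e (cenum K n) x) y'.
  case: bT => lT _; rewrite lin_sum // !dot_suml; apply: eq_bigr => k _.
  by rewrite linZ // !dotZl (dotC _ (T _)) -y'E -dotC.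
have h1 : modc (dot (proj dot e (cenum K n) x) y' - dot (T x) y)
    @[n --> \oo] --> (0 : R).
  under eq_fun do rewrite -Pxy.
  exact: (ncvg_dot y (bounded_cvg bT xl)).
apply/le_anti; rewrite modc_ge0 andbT.
rewrite -[leRHS](addr0 (0 : R)); apply: (cvgr_to_ge (cvgD h1 h2)).
apply: nearW => n /=.
rewrite -[X in _ <= X + _]modcN (le_trans _ (modcD _ _)) //.
by rewrite opprB addrA subrK.
Qed.

Lemma adjointP T x y : hs T -> dot (T x) y = dot x (adjoint dot T y).
Proof.
move=> /adjoint_exists h; rewrite /adjoint.
by case: xgetP => [S _ ->//|]; case: h => S hS /(_ S).
Qed.

Lemma dot_inj y z : (forall x, dot x y = dot x z) -> y = z.
Proof.
move=> h; apply/eqP; rewrite -subr_eq0 -(cnorm_eq0 dot) -sqrf_eq0 sqr_cnorm.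
by rewrite dotBr h subrr.
Qed.

Lemma adjoint_unique T S : hs T -> (forall x y, dot (T x) y = dot x (S y)) ->
  adjoint dot T = S.
Proof.
by move=> hT h; apply/funext => y; apply: dot_inj => x; rewrite -adjointP // h.
Qed.

Lemma dot_adjointl T x y : hs T -> dot (adjoint dot T x) y = dot x (T y).
Proof. by move=> hT; rewrite dotC -adjointP // -dotC. Qed.

Lemma bounded_adjoint T : hs T -> bounded_operator dot (adjoint dot T).
Proof.
move=> hT; split.
  move=> a x y; apply: dot_inj => z; rewrite -adjointP //.
  by rewrite !dotDr !dotZr -!adjointP.
exists (hsn T) => x.
have [->|x0] := eqVneq (N (adjoint dot T x)) 0.
  by rewrite mulr_ge0 ?hsn_ge0 ?cnorm_ge0.
have Nx_gt0 : 0 < N (adjoint dot T x) by rewrite lt_def x0 cnorm_ge0.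
rewrite -(ler_pM2r Nx_gt0) -expr2 sqr_cnorm -adjointP //.
apply: (le_trans (ler_norm _)); apply: (le_trans (Re_le_modc _)).
apply: (le_trans (dot_cauchy_schwarz _ _ _)).
by rewrite mulrAC ler_wpM2r ?cnorm_ge0 // hs_bound.
Qed.

Lemma hsnorm_adjoint T : hs T -> hsnorm (adjoint dot T) = hsnorm T.
Proof.
move=> hT; rewrite /Defs.hsnorm; congr sqrte.
under eq_esum do rewrite (parseval e_basis).
under [RHS]eq_esum do rewrite (parseval e_basis).
have f0 (k l : K) : (0 <= ((modc (dot (T (e l)) (e k))) ^+ 2)%:E)%E.
  by rewrite lee_fin sqr_ge0.
rewrite [RHS]esum_esum //.
under eq_esum do under eq_esum do rewrite dotC -adjointP // modcJ.
rewrite esum_esum //.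
rewrite [LHS](@reindex_esum _ _ _ ([set: K] `*`` (fun=> [set: K])) _
  (fun kl : K * K => (kl.2, kl.1))) //.
split => [? //|[i j] [k l] _ _ /= [-> ->]//|[k l] _].
by exists (l, k).
Qed.

Lemma hs_adjoint T : hs T -> hs (adjoint dot T).
Proof.
by move=> hT; split; [exact: bounded_adjoint|rewrite hsnorm_adjoint //; case: hT].
Qed.

Lemma adjointK T : hs T -> adjoint dot (adjoint dot T) = T.
Proof.
move=> hT; apply: adjoint_unique; first exact: hs_adjoint.
by move=> x y; rewrite dot_adjointl.
Qed.

Lemma adjoint_lin c T S : hs T -> hs S ->
  adjoint dot (c *: T + S) = (c^*)%R *: adjoint dot T + adjoint dot S.
Proof.
move=> hT hS; apply: adjoint_unique; first exact: hs_lin.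
move=> x y; rewrite !op_linE dotDl dotZl.
by rewrite (adjointP _ _ hT) (adjointP _ _ hS) dotDr dotZr conjCK.
Qed.

Lemma adjoint_comp T S : hs T -> hs S ->
  adjoint dot (T \o S) = adjoint dot S \o adjoint dot T.
Proof.
move=> hT hS; apply: adjoint_unique; first exact: hs_comp.
by move=> x y /=; rewrite !adjointP.
Qed.

Lemma adjoint0 : adjoint dot 0 = 0.
Proof.
apply: adjoint_unique; first exact: hs0.
by move=> x y; rewrite /GRing.zero /= dot0l dot0r.
Qed.

(** [\sum_k v_k (x) e_k^*], the operator with columns [v]. *)
Definition finop (s : seq K) (v : K -> E) : E -> E :=
  fun x => \sum_(k <- s) dot x (e k) *: v k.

Lemma finop_basis s v k : uniq s -> finop s v (e k) = if k \in s then v k else 0.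
Proof.
move=> us; rewrite /finop; under eq_bigr do rewrite (dot_basis e_basis).
case: ifPn => ks; last first.
  rewrite big_seq big1 // => i si; rewrite (negPf (_ : k != i)) ?scale0r //.
  by apply: contraNneq ks => ->.
rewrite (bigD1_seq k) //= eqxx scale1r big1 ?addr0 // => i.
by rewrite eq_sym => /negPf ->; rewrite scale0r.
Qed.

Lemma bounded_finop s v : bounded_operator dot (finop s v).
Proof.
split.
  move=> a x y; rewrite /finop scaler_sumr -big_split; apply: eq_bigr => k _ /=.
  by rewrite dotDl dotZl scalerDl scalerA.
exists (\sum_(k <- s) N (v k)) => x.
apply: (le_trans (cnorm_sum _ _ _ _)); rewrite mulr_suml ler_sum // => k _.
rewrite cnormZ mulrC ler_wpM2l ?cnorm_ge0 //.
by rewrite (le_trans (dot_cauchy_schwarz _ _ _)) // (cnorm_basis e_basis) mulr1.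
Qed.

Lemma sqr_hsnorm_finop s v : uniq s ->
  (hsnorm (finop s v) ^+ 2 = \sum_(k <- s) ((N (v k)) ^+ 2)%:E)%E.
Proof.
move=> us; rewrite sqr_hsnorm.
rewrite (esum_seqE us) // => [|k _|k _ ks].
- rewrite big_seq [RHS]big_seq; apply: eq_bigr => k ks.
  by rewrite finop_basis // ks.
- by rewrite lee_fin sqr_ge0.
- by rewrite finop_basis // (negPf ks) cnorm0 expr0n.
Qed.

Lemma hs_finop s v : uniq s -> hs (finop s v).
Proof.
move=> us; split; first exact: bounded_finop.
have h := sqr_hsnorm_finop v us.
rewrite -[X in (X < _)%E](gee0_abs (eseminorm_ge0 eseminorm_hs _)) -sqrte_sqr h.
by rewrite sumEFin ltry.
Qed.

Lemma proj_dense_seq (s : seq K) (v : K -> E) (b : R) : 0 < b -> exists n,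
  forall k, k \in s -> N (v k - proj dot e (cenum K n) (v k)) ^+ 2 <= b.
Proof.
move=> b0; have sb : 0 < Num.sqrt b by rewrite sqrtr_gt0.
suff [n hn] : exists n, forall k, k \in s -> forall m, (n <= m)%N ->
    N (v k - proj dot e (cenum K m) (v k)) ^+ 2 <= b.
  by exists n => k /hn; exact.
elim: s => [|k s [n ihn]]; first by exists 0%N.
have /ncvgP/(_ _ sb) [n0 _ hn0] := ncvg_proj e_basis (v k).
exists (maxn n n0) => l; rewrite inE => /predU1P[->|ls] m.
  rewrite geq_max => /andP[_ /hn0 /=]; rewrite cnormBC => /ltW hle.
  by rewrite -[leRHS](sqr_sqrtr (ltW b0)) lerXn2r ?nnegrE ?cnorm_ge0 ?sqrtr_ge0.
by rewrite geq_max => /andP[+ _]; exact: ihn.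
Qed.

(** Keep finitely many columns, then project each of them on finitely many
    basis vectors. *)
Lemma hs_finite_dense T (eps : R) : hs T -> 0 < eps ->
  exists S, [/\ hs S, finite_set [set kl : K * K | dot (S (e kl.2)) (e kl.1) <> 0] &
    (hsnorm (T - S)%R <= eps%:E)%E].
Proof.
move=> hT eps0.
have e2 : 0 < eps ^+ 2 / 2 by rewrite divr_gt0 // exprn_gt0.
have T2 : (\esum_(k in [set: K]) ((N (T (e k))) ^+ 2)%:E < +oo)%E.
  by rewrite -sqr_hsnorm -hsnK // -EFin_expe ltry.
have T0 k : [set: K] k -> (0 <= ((N (T (e k))) ^+ 2)%:E)%E.
  by rewrite lee_fin sqr_ge0.
have [s [us _] hs_tail] := esum_tail T0 T2 e2.
pose b := eps ^+ 2 / 2 / (size s).+1%:R.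
have b0 : 0 < b by rewrite divr_gt0.
have [n hn] := proj_dense_seq s (fun k => T (e k)) b0.
pose S := finop s (fun k => proj dot e (cenum K n) (T (e k))).
have hS : hs S by exact: hs_finop.
exists S; split => //.
  apply: (@sub_finite_set _ _ [set` [seq (l, k) | l <- cenum K n, k <- s]]).
    move=> [l k] /= h; apply/allpairsP; exists (l, k) => /=; split => //.
      apply: contra_notT h => lN; rewrite /S finop_basis //; case: ifP => _.
        by rewrite (dot_comb e_basis) ?cenum_uniq // (negPf lN).
      by rewrite dot0l.
    by apply: contra_notT h => /negPf kN; rewrite /S finop_basis // kN dot0l.
  exact: finite_seq.
rewrite -[leLHS](gee0_abs (eseminorm_ge0 eseminorm_hs _)) -sqrte_sqr.
have -> : eps%:E = sqrte (eps ^+ 2)%:E by rewrite /= sqrtr_sqr gtr0_norm.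
rewrite lee_sqrt ?lee_fin ?sqr_ge0 //.
rewrite sqr_hsnorm (esumID [set` s]) ?setTI; last by move=> k _; rewrite lee_fin sqr_ge0.
have -> : ((eps ^+ 2)%:E = (eps ^+ 2 / 2)%:E + (eps ^+ 2 / 2)%:E)%E.
  by rewrite -EFinD -splitr.
apply: leeD.
  rewrite esum_fset //; last by move=> k _; rewrite lee_fin sqr_ge0.
  rewrite -fsbig_seq // sumEFin lee_fin big_seq.
  apply: (@le_trans _ _ (\sum_(k <- s | k \in s) b)).
    apply: ler_sum => k ks.
    rewrite op_subE /S finop_basis // ks.
    exact: hn.
  rewrite -big_seq big_const_seq count_predT iter_addr_0.
  apply: (@le_trans _ _ (b * (size s).+1%:R)); last by rewrite /b divfK.
  by rewrite -[b *+ _]mulr_natr ler_wpM2l ?ler_nat // ltW.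
rewrite setTD in hs_tail; apply: le_trans hs_tail.
apply: le_esum => k /= ks.
rewrite op_subE /S finop_basis //.
by rewrite (negPf (introN idP ks)) subr0.
Qed.

End hilbert_schmidt_theory.

(** * Coefficient arrays and their norms *)

Section array_norms.
Context {R : realType} {E : lmodType R[i]} (dot : {dot E for Num.conj})
  {K : countType} (e : K -> E) {J : countType}.
Hypothesis E_complete : complete_norm (cnorm dot).
Hypothesis e_basis : orthonormal_basis dot (cnorm dot) e.
Local Notation N := (cnorm dot).
Local Notation hs := (hilbert_schmidt dot e).
Local Notation hsnorm := (hsnorm dot e).
Local Notation hsn := (hsn dot e).
Local Notation pnorm := (@Defs.pnorm R E dot K e J).
Local Notation level := (@level_norm R E dot K e J).
Local Notation pspace := (@Defs.pspace R E dot K e J).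
Implicit Types (A B : array E J) (rho sigma : R) (alpha : mindex J).

Lemma levelE m A : level m A = ell2 [set alpha | mdegree alpha = m] (fun alpha => hsnorm (A alpha)).
Proof. by []. Qed.

Lemma pnormE rho A :
  pnorm rho A = (\sum_(0 <= m <oo) (rho ^+ m)%:E * level m A)%E.
Proof. by []. Qed.

Lemma eseminorm_level m : eseminorm (level m).
Proof.
apply: (eseminorm_ell2 [set alpha | mdegree alpha = m] (p := fun alpha A => hsnorm (A alpha))) => alpha.
split => [A|A B|c A]; first exact: (eseminorm_ge0 (eseminorm_hs dot e)).
- exact: (eseminormD (eseminorm_hs dot e)).
- exact: (eseminormZ (eseminorm_hs dot e)).
Qed.

Lemma level_ge0 m A : (0 <= level m A)%E.
Proof. exact: (eseminorm_ge0 (eseminorm_level m)). Qed.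

Lemma eseminorm_pnorm rho : 0 <= rho -> eseminorm (pnorm rho).
Proof.
move=> rho0; apply: eseminorm_series => m; first exact: exprn_ge0.
exact: eseminorm_level.
Qed.

Lemma pnorm_ge0 rho A : 0 <= rho -> (0 <= pnorm rho A)%E.
Proof. by move=> rho0; exact: (eseminorm_ge0 (eseminorm_pnorm rho0)). Qed.

Lemma pnormD rho A B : 0 <= rho -> (pnorm rho (A + B)%R <= pnorm rho A + pnorm rho B)%E.
Proof. by move=> rho0; case: (eseminorm_pnorm rho0) => _ + _; apply. Qed.

Lemma pnormZ rho c A : 0 <= rho -> (pnorm rho (c *: A)%R = (modc c)%:E * pnorm rho A)%E.
Proof. by move=> rho0; case: (eseminorm_pnorm rho0) => _ _; apply. Qed.

Lemma pnorm0 rho : 0 <= rho -> pnorm rho 0 = 0%E.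
Proof. by move=> rho0; exact: (eseminorm0 (eseminorm_pnorm rho0)). Qed.

Lemma pnormBC rho A B : 0 <= rho -> pnorm rho (A - B) = pnorm rho (B - A).
Proof. by move=> rho0; exact: (eseminormBC (eseminorm_pnorm rho0)). Qed.

Lemma pnormB rho A B : 0 <= rho -> (pnorm rho (A - B)%R <= pnorm rho A + pnorm rho B)%E.
Proof. by move=> rho0; exact: (eseminormB (eseminorm_pnorm rho0)). Qed.

Lemma pnorm_split rho A B C : 0 <= rho ->
  (pnorm rho (A - C)%R <= pnorm rho (A - B)%R + pnorm rho (B - C)%R)%E.
Proof. by move=> rho0; exact: (eseminorm_split (eseminorm_pnorm rho0)). Qed.

Lemma pnorm_sum rho (I : Type) (s : seq I) (P : pred I) (F : I -> array E J) :
  0 <= rho ->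
  (pnorm rho (\sum_(i <- s | P i) F i)%R <= \sum_(i <- s | P i) pnorm rho (F i))%E.
Proof. by move=> rho0; exact: (eseminorm_sum (eseminorm_pnorm rho0)). Qed.

(** Convergence on the basis vectors is all that the lower semicontinuity of
    the norms requires. *)
Definition acvg (u : nat -> array E J) A :=
  forall alpha k, ncvg dot (fun n => u n alpha (e k)) (A alpha (e k)).

Lemma lsc_pnorm rho u A : 0 <= rho -> acvg u A ->
  lsc (fun n => pnorm rho (u n)) (pnorm rho A).
Proof.
move=> rho0 uA.
apply: (lsc_series (w := fun m => rho ^+ m) (f := fun n m => level m (u n)));
  [by move=> m; exact: exprn_ge0|by move=> *; exact: level_ge0..|].
move=> m; apply: lsc_ell2 => [n alpha|alpha|alpha _];
  do ?exact: (eseminorm_ge0 (eseminorm_hs dot e)).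
by apply: lsc_hsnorm => k; exact: uA.
Qed.

Lemma pnorm_term_ge0 rho m A : 0 <= rho -> (0 <= (rho ^+ m)%:E * level m A)%E.
Proof. by move=> rho0; rewrite mule_ge0 ?level_ge0 // lee_fin exprn_ge0. Qed.

Lemma le_pnorm_level rho rho' A B : 0 <= rho -> 
  (forall m, ((rho ^+ m)%:E * level m A <= (rho' ^+ m)%:E * level m B)%E) ->
  (pnorm rho A <= pnorm rho' B)%E.
Proof.
by move=> rho0 h; apply: lee_nneseries => m _; [move=> _; exact: pnorm_term_ge0|exact: h].
Qed.

Opaque Defs.pnorm level_norm Defs.hsnorm.

Lemma hsnorm_le_level A alpha : (hsnorm (A alpha) <= level (mdegree alpha) A)%E.
Proof.
rewrite levelE; apply: (@ell2_ge_term _ _ _ (fun alpha => hsnorm (A alpha))) => //.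
exact: (eseminorm_ge0 (eseminorm_hs dot e)).
Qed.

Lemma level_le_pnorm rho m A : 0 <= rho -> ((rho ^+ m)%:E * level m A <= pnorm rho A)%E.
Proof.
move=> rho0; rewrite pnormE nneseries_esumT; last first.
  by move=> *; exact: pnorm_term_ge0.
exact: (@esum_ge_term _ _ _ (fun m => (rho ^+ m)%:E * level m A)%E).
Qed.

Lemma hsnorm_le_pnorm rho A alpha : 0 <= rho ->
  ((rho ^+ mdegree alpha)%:E * hsnorm (A alpha) <= pnorm rho A)%E.
Proof.
move=> rho0; apply: le_trans (level_le_pnorm (mdegree alpha) A rho0).
by rewrite lee_wpmul2l ?lee_fin ?exprn_ge0 ?hsnorm_le_level.
Qed.

Lemma le_pnorm rho rho' A : 0 <= rho -> rho <= rho' -> (pnorm rho A <= pnorm rho' A)%E.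
Proof.
move=> rho0 rr; apply: le_pnorm_level => // m.
by rewrite lee_wpmul2r ?level_ge0 // lee_fin lerXn2r ?nnegrE // (le_trans rho0).
Qed.

Lemma pspace_le rho rho' A : 0 <= rho -> rho <= rho' -> pspace rho' A -> pspace rho A.
Proof. by move=> r0 rr [hA fA]; split => //; rewrite (le_lt_trans (le_pnorm A r0 rr)). Qed.

Lemma pspace_lin rho c A B : 0 <= rho -> pspace rho A -> pspace rho B ->
  pspace rho (c *: A + B).
Proof.
move=> rho0 [hA fA] [hB fB]; split.
  by move=> alpha; apply: hs_lin; [exact: hA|exact: hB].
apply: (le_lt_trans (pnormD _ _ rho0)).
apply: lte_add_pinfty; last exact: fB.
rewrite pnormZ; last exact: rho0.
apply: lte_mul_pinfty; [|by []|exact: fA].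
by rewrite lee_fin modc_ge0.
Qed.

Lemma hs_array0 : hs_array dot e (0 : array E J).
Proof. by move=> alpha; exact: hs0. Qed.

Lemma pspaceB rho A B : 0 <= rho -> pspace rho A -> pspace rho B -> pspace rho (A - B).
Proof. by move=> rho0 hA hB; rewrite addrC -scaleN1r; exact: pspace_lin. Qed.

Definition single alpha (T : E -> E) : array E J :=
  fun beta => if beta == alpha then T else 0.

Lemma hs_single alpha T : hs T -> hs_array dot e (single alpha T).
Proof. by move=> hT beta; rewrite /single; case: ifP => // _; exact: hs0. Qed.

Lemma level_single alpha T m :
  level m (single alpha T) = if mdegree alpha == m then hsnorm T else 0%E.
Proof.
have T0 := eseminorm_ge0 (eseminorm_hs dot e) T.
have zero beta : beta != alpha -> (hsnorm (single alpha T beta) ^+ 2 = 0)%E.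
  move=> /negPf ba; rewrite /single ba (eseminorm0 (eseminorm_hs dot e)).
  by rewrite expe2 mul0e.
rewrite levelE /ell2; case: eqP => dm.
  rewrite (@esum_seqE _ _ _ _ [:: alpha]) //.
  - by rewrite big_seq1 /single eqxx sqrte_sqr gee0_abs.
  - by move=> beta; rewrite inE => /eqP ->.
  - by move=> *; exact: expe2_ge0.
  - by move=> beta _; rewrite inE => /zero.
rewrite esum1 ?sqrte0 // => beta dbeta; apply: zero.
by apply/negP => /eqP ba; apply: dm; rewrite -dbeta ba.
Qed.

Lemma pnorm_single rho alpha T : 0 <= rho ->
  pnorm rho (single alpha T) = ((rho ^+ mdegree alpha)%:E * hsnorm T)%E.
Proof.
move=> rho0; rewrite pnormE nneseries_esumT; last first.
  by move=> *; exact: pnorm_term_ge0.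
rewrite (@esum_seqE _ _ _ _ [:: mdegree alpha]) //.
- by rewrite big_seq1 level_single eqxx.
- by move=> *; exact: pnorm_term_ge0.
- by move=> m _; rewrite inE level_single eq_sym => /negPf ->; rewrite mule0.
Qed.

Definition supported (s : seq (mindex J)) A : Prop :=
  hs_array dot e A /\ forall alpha, alpha \notin s -> A alpha = 0.

Lemma supported_sum s A : uniq s -> supported s A ->
  A = \sum_(alpha <- s) single alpha (A alpha).
Proof.
move=> us [_ h]; apply/funext => beta; rewrite fct_sumE /single.
have [bs|bs] := boolP (beta \in s).
  rewrite (bigD1_seq beta) //= eqxx big1 ?addr0 // => i.
  by rewrite eq_sym => /negPf ->.
rewrite (h _ bs) big_seq big1 // => i si; case: eqP => // bi.
by move: bs; rewrite bi si.
Qed.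

Lemma supported_undup s A : supported s A -> supported (undup s) A.
Proof. by case=> hA h; split => // alpha; rewrite mem_undup; exact: h. Qed.

Lemma supported_pspace rho s A : 0 <= rho -> supported s A -> pspace rho A.
Proof.
move=> rho0 sA; have hA := sA.1; split => //.
rewrite (supported_sum (undup_uniq s) (supported_undup sA)).
apply: (le_lt_trans (pnorm_sum _ _ _ rho0)).
rewrite lte_sum_pinfty // => alpha _; rewrite pnorm_single // -hsnK //.
by rewrite -EFinM ltry.
Qed.

Lemma supported_lin s c A B : supported s A -> supported s B -> supported s (c *: A + B).
Proof.
move=> [hA zA] [hB zB]; split => [alpha|alpha als].
  by apply: hs_lin; [exact: hA|exact: hB].
by rewrite -[LHS]/(c *: A alpha + B alpha) zA // zB // scaler0 addr0.
Qed.

Lemma supported_sub s s' A : {subset s <= s'} -> supported s A -> supported s' A.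
Proof.
by move=> ss' [hA zA]; split => // alpha as'; apply: zA; apply: contra as' => /ss'.
Qed.

Definition restr (s : seq (mindex J)) A : array E J :=
  fun alpha => if alpha \in s then A alpha else 0.

Lemma restr_supported s A : hs_array dot e A -> supported s (restr s A).
Proof.
move=> hA; split => [alpha|alpha /negPf h]; rewrite /restr.
  by case: ifP => // _; exact: hs0.
by rewrite h.
Qed.

Lemma restr_lin s c A B : restr s (c *: A + B) = c *: restr s A + restr s B.
Proof.
apply/funext => alpha; rewrite -[RHS]/(c *: restr s A alpha + restr s B alpha) /restr.
by case: ifP => // _; rewrite scaler0 addr0.
Qed.

Lemma restr_id s A : supported s A -> restr s A = A.
Proof.
by move=> [_ h]; apply/funext => alpha; rewrite /restr; case: ifPn => // /h.
Qed.

Lemma level_restr m s A : (level m (restr s A) <= level m A)%E.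
Proof.
rewrite levelE; apply: le_ell2 => alpha _.
rewrite (eseminorm_ge0 (eseminorm_hs dot e)) /restr /=; case: ifP => // _.
by rewrite (eseminorm0 (eseminorm_hs dot e)) (eseminorm_ge0 (eseminorm_hs dot e)).
Qed.

Lemma pnorm_restr rho s A : 0 <= rho -> (pnorm rho (restr s A) <= pnorm rho A)%E.
Proof.
move=> rho0; apply: le_pnorm_level => // m.
by rewrite lee_wpmul2l ?lee_fin ?exprn_ge0 ?level_restr.
Qed.

Lemma level_sub_restr_le m s A : (level m (A - restr s A)%R <= level m A)%E.
Proof.
rewrite levelE; apply: le_ell2 => alpha _.
rewrite (eseminorm_ge0 (eseminorm_hs dot e)) -[(A - _) alpha]/(A alpha - restr s A alpha).
rewrite /restr /=; case: ifP => _; last by rewrite subr0.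
by rewrite subrr (eseminorm0 (eseminorm_hs dot e)) (eseminorm_ge0 (eseminorm_hs dot e)).
Qed.

Definition exhausting (F : nat -> seq (mindex J)) : Prop :=
  forall alpha, \forall n \near \oo, alpha \in F n.

Lemma exhausting_seq F (s : seq (mindex J)) : exhausting F -> \forall n \near \oo, {subset s <= F n}.
Proof.
move=> hF; elim: s => [|alpha s ih]; first by near=> n => x; rewrite in_nil.
near=> n; move=> beta; rewrite inE => /predU1P[->|].
  by near: n; exact: hF.
by move: beta; near: n.
Unshelve. all: by end_near. Qed.

Lemma level_restr_cvg F m A (eps : R) : exhausting F -> (level m A < +oo)%E -> 0 < eps ->
  \forall n \near \oo, (level m (A - restr (F n) A)%R <= eps%:E)%E.
Proof.
move=> hF fA eps0.
have f0 alpha : [set alpha | mdegree alpha = m] alpha -> (0 <= hsnorm (A alpha) ^+ 2)%E.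
  by move=> _; exact: expe2_ge0.
have fin2 : (\esum_(alpha in [set alpha | mdegree alpha = m]) hsnorm (A alpha) ^+ 2 < +oo)%E.
  rewrite -sqr_ell2 -levelE; move: fA (level_ge0 m A).
  by case: (level m A) => // r _ _; rewrite -EFin_expe ltry.
have e2 : 0 < eps ^+ 2 by rewrite exprn_gt0.
have [s [us sD] tail] := esum_tail f0 fin2 e2.
apply: filterS (exhausting_seq s hF) => n sF.
have -> : eps%:E = sqrte (eps ^+ 2)%:E by rewrite /= sqrtr_sqr gtr0_norm.
rewrite levelE /ell2 lee_sqrt ?lee_fin ?sqr_ge0 //.
rewrite (esumID [set` s]); last by move=> *; exact: expe2_ge0.
rewrite esum1 ?add0e; last first.
  move=> alpha [_ /= als]; rewrite -[(A - _) alpha]/(A alpha - restr (F n) A alpha).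
  rewrite /restr sF // subrr (eseminorm0 (eseminorm_hs dot e)).
  by rewrite mul0e.
apply: le_trans tail; apply: le_esum => alpha _.
apply: le_expe2; first exact: (eseminorm_ge0 (eseminorm_hs dot e)).
rewrite -[(A - _) alpha]/(A alpha - restr (F n) A alpha).
rewrite /restr; case: ifP => _; last by rewrite subr0.
by rewrite subrr (eseminorm0 (eseminorm_hs dot e)) (eseminorm_ge0 (eseminorm_hs dot e)).
Qed.

Lemma pnorm_restr_cvg F rho A (eps : R) : exhausting F -> 0 < rho ->
  (pnorm rho A < +oo)%E -> 0 < eps ->
  \forall n \near \oo, (pnorm rho (A - restr (F n) A)%R <= eps%:E)%E.
Proof.
move=> hF rho_gt0 fA eps0; have rho0 := ltW rho_gt0.
have flevel m : (level m A < +oo)%E.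
  have := level_le_pnorm m A rho0 => /le_lt_trans/(_ fA).
  have := level_ge0 m A; case: (level m A) => [r||] //; first by move=> _ _; rewrite ltry.
  by rewrite gt0_muley // lte_fin exprn_gt0.
have tail : (\sum_(M <= m <oo) (rho ^+ m)%:E * level m A)%E @[M --> \oo] --> 0%E.
  apply: (@nneseries_tail_cvg _ (fun m => (rho ^+ m)%:E * level m A)%E xpredT) => //.
  by move=> *; exact: pnorm_term_ge0.
have e2 : 0 < eps / 2 by rewrite divr_gt0.
have [M _ hM] : \forall M \near \oo,
    (\sum_(M <= m <oo) (rho ^+ m)%:E * level m A < (eps / 2)%:E)%E.
  have /fine_cvgP[tail_fin tail0] := tail.
  have : \forall M \near \oo,
      fine (\sum_(M <= m <oo) (rho ^+ m)%:E * level m A)%E < eps / 2.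
    exact: (cvgr_lt (0 : R) tail0).
  by apply: filterS2 tail_fin => n nfin; rewrite -lte_fin fineK.
have {}hM := hM M (leqnn M).
have head : forall d : R, 0 < d -> \forall n \near \oo,
    (\sum_(0 <= m < M) (rho ^+ m)%:E * level m (A - restr (F n) A)%R <= d%:E)%E.
  elim: M {hM} => [|M ih] d d0.
    by near=> n; rewrite big_geq // lee_fin ltW.
  have d2 : 0 < d / 2 by rewrite divr_gt0.
  have dr : 0 < d / 2 / rho ^+ M by rewrite divr_gt0 // exprn_gt0.
  near=> n; rewrite big_nat_recr //= (_ : d%:E = (d / 2)%:E + (d / 2)%:E)%E; last first.
    by rewrite -EFinD -splitr.
  apply: leeD; first by near: n; exact: ih.
  rewrite muleC -lee_pdivlMr ?exprn_gt0 // -EFinM.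
  by near: n; exact: level_restr_cvg.
near=> n; rewrite pnormE (nneseries_split 0 M); last first.
  by move=> m _; exact: pnorm_term_ge0.
rewrite add0n (_ : eps%:E = (eps / 2)%:E + (eps / 2)%:E)%E; last first.
  by rewrite -EFinD -splitr.
apply: leeD; first by near: n; exact: head.
apply: le_trans (ltW hM); apply: lee_nneseries => m _.
  by move=> _; exact: pnorm_term_ge0.
by rewrite lee_wpmul2l ?lee_fin ?exprn_ge0 ?level_sub_restr_le.
Unshelve. all: by end_near. Qed.

End array_norms.

Section array_completeness.
Context {R : realType} {E : lmodType R[i]} (dot : {dot E for Num.conj})
  {K : countType} (e : K -> E) {J : countType}.
Hypothesis E_complete : complete_norm (cnorm dot).
Hypothesis e_basis : orthonormal_basis dot (cnorm dot) e.
Local Notation N := (cnorm dot).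
Local Notation hs := (hilbert_schmidt dot e).
Local Notation hsnorm := (Defs.hsnorm dot e).
Local Notation hsn := (hsn dot e).
Local Notation pnorm := (@Defs.pnorm R E dot K e J).
Local Notation pspace := (@Defs.pspace R E dot K e J).
Implicit Types (A B : array E J) (rho sigma : R) (alpha : mindex J)
  (u v : nat -> array E J).

Lemma hs_array_lin c A B : hs_array dot e A -> hs_array dot e B ->
  hs_array dot e (c *: A + B).
Proof. by move=> hA hB alpha; apply: hs_lin; [exact: hA|exact: hB]. Qed.

Lemma hs_arrayB A B : hs_array dot e A -> hs_array dot e B -> hs_array dot e (A - B).
Proof. by move=> hA hB alpha; apply: hsB; [exact: hA|exact: hB]. Qed.

Definition pwcvg u A : Prop := forall alpha x, ncvg dot (fun n => u n alpha x) (A alpha x).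

Definition pcvg sigma u A : Prop :=
  forall eps : R, 0 < eps -> \forall n \near \oo, (pnorm sigma (u n - A)%R <= eps%:E)%E.

Lemma pwcvg_unique u A B : pwcvg u A -> pwcvg u B -> A = B.
Proof.
move=> uA uB; apply/funext => alpha; apply/funext => x.
exact: (ncvg_unique (uA alpha x) (uB alpha x)).
Qed.

Lemma pwcvg_lin c u v A B : pwcvg u A -> pwcvg v B ->
  pwcvg (fun n => c *: u n + v n) (c *: A + B).
Proof. by move=> uA vB alpha x; exact: ncvgP_linear. Qed.

Lemma pwcvgB u v A B : pwcvg u A -> pwcvg v B -> pwcvg (fun n => u n - v n) (A - B).
Proof. by move=> uA vB alpha x; exact: ncvgB. Qed.

Lemma pwcvg_acvg u A : pwcvg u A -> acvg dot e u A.
Proof. by move=> uA alpha k; exact: uA. Qed.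

Lemma pwcvg_cst A : pwcvg (fun=> A) A.
Proof. by move=> alpha x; exact: ncvg_cst. Qed.

Lemma norm_le_pnorm sigma A c alpha x : 0 < sigma -> hs_array dot e A ->
  (pnorm sigma A <= c%:E)%E -> N (A alpha x) <= c / sigma ^+ mdegree alpha * N x.
Proof.
move=> s0 hA Ac; have sm : 0 < sigma ^+ mdegree alpha by rewrite exprn_gt0.
apply: (le_trans (hs_bound e_basis x (hA alpha))); rewrite ler_wpM2r ?cnorm_ge0 //.
rewrite ler_pdivlMr // mulrC -lee_fin EFinM hsnK; last exact: hA.
by apply: le_trans Ac; apply: hsnorm_le_pnorm; exact: ltW.
Qed.

Lemma scaled_lt (eps s t : R) : 0 < eps -> 0 < s -> 0 <= t ->
  eps * s / (t + 1) / s * t < eps.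
Proof.
move=> eps0 s0 t0; have t1 : 0 < t + 1 by rewrite ltr_wpDl.
have -> : eps * s / (t + 1) / s * t = eps * t / (t + 1) by field; rewrite !gt_eqF.
by rewrite ltr_pdivrMr // ltr_pM2l // ltrDl.
Qed.

Lemma pcvg_pwcvg sigma u A : 0 < sigma -> (forall n, hs_array dot e (u n)) ->
  hs_array dot e A -> pcvg sigma u A -> pwcvg u A.
Proof.
move=> s0 hu hA uA alpha x; apply/ncvgP => eps eps0.
have sm : 0 < sigma ^+ mdegree alpha by rewrite exprn_gt0.
have Nx : 0 < N x + 1 by rewrite ltr_wpDl ?cnorm_ge0.
have c0 : 0 < eps * sigma ^+ mdegree alpha / (N x + 1) by rewrite divr_gt0 ?mulr_gt0.
apply: filterS (uA _ c0) => n h.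
have := norm_le_pnorm alpha x s0 (hs_arrayB (hu n) hA) h.
move=> h'; apply: (le_lt_trans h').
by apply: scaled_lt => //; exact: cnorm_ge0.
Qed.

Lemma pcvg_bound sigma u A C : 0 <= sigma -> acvg dot e u A ->
  (\forall n \near \oo, (pnorm sigma (u n) <= C)%E) -> (pnorm sigma A <= C)%E.
Proof. by move=> s0 uA; apply: lsc_le; exact: lsc_pnorm. Qed.

Definition pcauchy sigma u : Prop := forall eps : R, 0 < eps ->
  \forall m & n \near \oo, (pnorm sigma (u m - u n)%R <= eps%:E)%E.

Section cauchy.
Variables (sigma : R) (u : nat -> array E J).
Hypotheses (s0 : 0 < sigma) (hu : forall n, hs_array dot e (u n))
  (cu : pcauchy sigma u).

Lemma pcauchy_limit : exists A, pwcvg u A.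
Proof.
suff h alpha x : exists y, ncvg dot (fun n => u n alpha x) y.
  by exists (fun alpha x => sval (cid (h alpha x))) => alpha x; case: (cid _).
apply: E_complete => eps eps0.
have sm : 0 < sigma ^+ mdegree alpha by rewrite exprn_gt0.
have Nx : 0 < N x + 1 by rewrite ltr_wpDl ?cnorm_ge0.
have c0 : 0 < eps * sigma ^+ mdegree alpha / (N x + 1) by rewrite divr_gt0 ?mulr_gt0.
have /near2P[n0 h] := cu c0; apply/near2P; exists n0 => m n n0m n0n.
have h' := norm_le_pnorm alpha x s0 (hs_arrayB (hu m) (hu n)) (h m n n0m n0n).
apply: (le_lt_trans h').
by apply: scaled_lt => //; exact: cnorm_ge0.
Qed.

Lemma pcauchy_bound A (eps : R) n0 : pwcvg u A ->
  (forall m n, (n0 <= m)%N -> (n0 <= n)%N -> (pnorm sigma (u m - u n)%R <= eps%:E)%E) ->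
  forall n, (n0 <= n)%N -> (pnorm sigma (u n - A)%R <= eps%:E)%E.
Proof.
move=> uA h n n0n.
apply: (pcvg_bound (u := fun m => u n - u m)); first exact: ltW.
  by apply: pwcvg_acvg; apply: pwcvgB => //; exact: pwcvg_cst.
by exists n0 => // m /= n0m; exact: h.
Qed.

Lemma pcauchy_hs_array A : pwcvg u A -> hs_array dot e A.
Proof.
move=> uA alpha; have /near2P[n0 h] := cu ltr01.
have sm : 0 < sigma ^+ mdegree alpha by rewrite exprn_gt0.
have hb := pcauchy_bound uA h (leqnn n0).
have hsb : (hsnorm ((u n0 - A)%R alpha) <= ((sigma ^+ mdegree alpha)^-1)%:E)%E.
  rewrite -[leRHS]mule1 muleC lee_pdivlMr // muleC.
  by apply: le_trans hb; apply: hsnorm_le_pnorm; exact: ltW.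
split; last first.
  rewrite (_ : A alpha = u n0 alpha - (u n0 - A) alpha); last first.
    by apply/funext => x; rewrite !op_subE opprB addrC subrK.
  apply: (le_lt_trans (eseminormB (eseminorm_hs dot e) _ _)).
  apply: lte_add_pinfty; first by case: (hu n0 alpha).
  by apply: (le_lt_trans hsb); exact: ltry.
split.
  move=> a x y; apply: (ncvg_unique (uA alpha (a *: x + y))).
  have -> : (fun n => u n alpha (a *: x + y)) = fun n => a *: u n alpha x + u n alpha y.
    by apply/funext => n; case: (hu n alpha) => -[lin _] _; rewrite lin.
  exact: ncvgP_linear.
exists (hsn (u n0 alpha) + (sigma ^+ mdegree alpha)^-1) => x.
apply: (ncvg_norm_le (uA alpha x)); exists n0 => // m /= n0m.
have -> : u m alpha x = u n0 alpha x + (u m - u n0) alpha x.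
  by rewrite -[(u m - u n0) alpha x]/(u m alpha x - u n0 alpha x) addrC subrK.
apply: (le_trans (cnormD _ _ _)); rewrite mulrDl; apply: lerD.
  by apply: hs_bound => //; exact: hu.
have := norm_le_pnorm alpha x s0 (hs_arrayB (hu m) (hu n0)) (h m n0 n0m (leqnn _)).
by rewrite div1r.
Qed.

Lemma pcauchy_pcvg A : pwcvg u A -> pcvg sigma u A.
Proof.
move=> uA eps eps0; have /near2P[n0 h] := cu eps0.
by exists n0 => // n /= n0n; exact: (pcauchy_bound uA h).
Qed.

End cauchy.

Lemma pcvg_cauchy sigma u A : 0 <= sigma -> pcvg sigma u A -> pcauchy sigma u.
Proof.
move=> s0 uA eps eps0; have e2 : 0 < eps / 2 by rewrite divr_gt0.
have [n0 _ h] := uA _ e2; apply/near2P; exists n0 => m n hm hn.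
apply: (le_trans (pnorm_split dot e _ A _ s0)).
rewrite (splitr eps) EFinD; apply: leeD; first exact: h.
by rewrite pnormBC //; exact: h.
Qed.

Lemma pcvg_unique sigma u A B : 0 < sigma -> (forall n, hs_array dot e (u n)) ->
  hs_array dot e A -> hs_array dot e B -> pcvg sigma u A -> pcvg sigma u B -> A = B.
Proof.
move=> s0 hu hA hB uA uB; apply: (@pwcvg_unique u).
  exact: (pcvg_pwcvg s0).
exact: (pcvg_pwcvg s0).
Qed.

Lemma pcvg_restr (F : nat -> seq (mindex J)) rho A : exhausting F -> 0 < rho -> pspace rho A ->
  pcvg rho (fun n => restr (F n) A) A.
Proof.
move=> hF r0 [hA fA] eps eps0.
apply: filterS (pnorm_restr_cvg hF r0 fA eps0) => n.
by rewrite pnormBC //; exact: ltW.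
Qed.

(** Truncate the index set first, then each of the finitely many remaining
    coefficients. *)
Lemma finite_array_dense (F : nat -> seq (mindex J)) rho A (eps : R) : exhausting F -> 0 < rho ->
  pspace rho A -> 0 < eps ->
  exists2 B, finite_array dot e B & (pnorm rho (B - A)%R <= eps%:E)%E.
Proof.
move=> hF r0 pA eps0; have [hA _] := pA.
have e2 : 0 < eps / 2 by rewrite divr_gt0.
have [n0 _ h] := pcvg_restr hF r0 pA e2.
have {h} := h n0 (leqnn _); set s := undup (F n0).
have -> : restr (F n0) A = restr s A.
  by apply/funext => alpha; rewrite /restr mem_undup.
move=> h1.
pose d alpha := eps / 2 / (size s).+1%:R / rho ^+ mdegree alpha.
have d0 alpha : 0 < d alpha by rewrite !divr_gt0 // exprn_gt0.
pose S alpha := sval (cid (hs_finite_dense e_basis (hA alpha) (d0 alpha))).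
have SP alpha : [/\ hs (S alpha),
    finite_set [set kl : K * K | dot (S alpha (e kl.2)) (e kl.1) <> 0] &
    (hsnorm (A alpha - S alpha)%R <= (d alpha)%:E)%E].
  by rewrite /S; case: (cid _).
pose B : array E J := restr s S.
have sB : supported dot e s B.
  by apply: restr_supported => alpha; case: (SP alpha).
exists B.
  split; first by case: sB.
    apply: (@sub_finite_set _ _ [set` s]); last exact: finite_seq.
    move=> alpha /= Ba; apply/negP => /negP as'; apply: Ba.
    by case: sB => _; apply.
  move=> alpha; rewrite /B /restr; case: ifP => _; first by case: (SP alpha).
  rewrite (_ : [set _ | _] = set0); first exact: finite_set0.
  by apply/seteqP; split => // kl /=; rewrite dot0l.
have rr : 0 <= rho by exact: ltW.
apply: (le_trans (pnorm_split dot e _ (restr s A) _ rr)).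
rewrite (_ : eps%:E = (eps / 2)%:E + (eps / 2)%:E)%E; last first.
  by rewrite -EFinD -splitr.
apply: leeD; last exact: h1.
rewrite pnormBC; last exact: rr.
have sAB : supported dot e s (restr s A - B).
  rewrite addrC -scaleN1r; apply: supported_lin => //.
  exact: restr_supported.
rewrite (supported_sum (undup_uniq _) sAB).
apply: (le_trans (pnorm_sum _ _ _ _ _ rr)).
apply: (@le_trans _ _ (\sum_(alpha <- s) (eps / 2 / (size s).+1%:R)%:E)%E).
  rewrite big_seq [leRHS]big_seq; apply: lee_sum => alpha als.
  rewrite pnorm_single //.
  have -> : (restr s A - B) alpha = A alpha - S alpha.
    by rewrite -[LHS]/(restr s A alpha - B alpha) /B /restr als.
  rewrite muleC -lee_pdivlMr ?exprn_gt0 // -EFinM.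
  by case: (SP alpha).
rewrite sumEFin lee_fin big_const_seq count_predT iter_addr_0.
rewrite -[_ *+ _]mulr_natr mulrAC ler_pdivrMr // ler_wpM2l ?ler_nat //.
exact: ltW.
Qed.

End array_completeness.

(** * Multi-indices *)

Section multi_index_theory.
Context {J : countType}.
Implicit Types (alpha beta r mu nu : mindex J) (s : seq J).
Local Open Scope fset_scope.
Local Open Scope nat_scope.

Definition mk s (f : J -> nat) : mindex J := [fsfun j in [fset j in s] => f j | 0].

Lemma mkE s f j : mk s f j = if j \in s then f j else 0.
Proof. by rewrite fsfunE !inE. Qed.

Definition mzero : mindex J := mk [::] (fun=> 0).

Definition madd mu nu : mindex J :=
  mk (finsupp mu ++ finsupp nu) (fun j => mu j + nu j).

Definition msub alpha r : mindex J := mk (finsupp alpha) (fun j => alpha j - r j).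

Lemma mzeroE j : mzero j = 0. Proof. by rewrite mkE. Qed.

Lemma maddE mu nu j : madd mu nu j = mu j + nu j.
Proof.
rewrite mkE mem_cat !mem_finsupp; case: ifP => //.
by move/negbT; rewrite negb_or !negbK => /andP[/eqP -> /eqP ->].
Qed.

Lemma msubE alpha r j : msub alpha r j = alpha j - r j.
Proof. by rewrite mkE mem_finsupp; case: eqP => //= ->. Qed.

Lemma mcontractE alpha beta r j :
  mcontract alpha beta r j = alpha j + beta j - 2 * r j.
Proof.
rewrite fsfunE inE !mem_finsupp; case: ifP => //.
by move/negbT; rewrite negb_or !negbK => /andP[/eqP -> /eqP ->].
Qed.

Lemma mindexP alpha beta : (forall j, alpha j = beta j) -> alpha = beta.
Proof. by move=> h; apply/fsfunP. Qed.

Lemma mcontractC alpha beta r : mcontract alpha beta r = mcontract beta alpha r.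
Proof. by apply: mindexP => j; rewrite !mcontractE addnC. Qed.

Lemma msub_madd mu r : msub (madd mu r) r = mu.
Proof. by apply: mindexP => j; rewrite msubE maddE addnK. Qed.

Lemma madd_msub alpha r : mle r alpha -> madd (msub alpha r) r = alpha.
Proof. by move=> ra; apply: mindexP => j; rewrite maddE msubE subnK. Qed.

Lemma mle_madd mu r : mle r (madd mu r).
Proof. by move=> j; rewrite maddE leq_addl. Qed.

Definition mleb r alpha : bool := all (fun j => r j <= alpha j) (finsupp r).

Lemma mlebP r alpha : reflect (mle r alpha) (mleb r alpha).
Proof.
apply: (iffP allP) => [h j|h j _]; last exact: h.
have [jr|] := boolP (j \in finsupp r); first exact: h.
by rewrite mem_finsupp negbK => /eqP ->.
Qed.

Lemma mle_finsupp r alpha : mle r alpha -> {subset finsupp r <= finsupp alpha}.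
Proof. by move=> ra j; rewrite !mem_finsupp -!lt0n => /leq_trans; apply. Qed.

(** Used to evaluate several multi-indices on a common list of coordinates. *)
Lemma big_finsupp (T : Type) (idx : T) (op : Monoid.com_law idx) alpha s (F : J -> T) :
  uniq s -> {subset finsupp alpha <= s} ->
  (forall j, alpha j = 0 -> F j = idx) ->
  \big[op/idx]_(j <- finsupp alpha) F j = \big[op/idx]_(j <- s) F j.
Proof.
move=> us sub F0; rewrite [RHS](bigID (mem (finsupp alpha))) /=.
rewrite [X in op _ X]big1 ?Monoid.mulm1; last first.
  by move=> j; rewrite mem_finsupp negbK => /eqP; exact: F0.
rewrite -[RHS]big_filter; apply: perm_big; apply: uniq_perm.
- exact: fset_uniq.
- exact: filter_uniq.
- by move=> j; rewrite mem_filter andb_idr //; exact: sub.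
Qed.

Lemma mdegree_sup alpha s : uniq s -> {subset finsupp alpha <= s} ->
  mdegree alpha = \sum_(j <- s) alpha j.
Proof. by move=> us sub; rewrite /mdegree (big_finsupp _ us). Qed.

Lemma mfact_sup alpha s : uniq s -> {subset finsupp alpha <= s} ->
  mfact alpha = \prod_(j <- s) (alpha j)`!.
Proof. by move=> us sub; rewrite /mfact (big_finsupp _ us) // => j ->. Qed.

Lemma mbin_sup alpha r s : uniq s -> {subset finsupp alpha <= s} -> mle r alpha ->
  mbin alpha r = \prod_(j <- s) 'C(alpha j, r j).
Proof.
move=> us sub ra; rewrite /mbin (big_finsupp _ us) // => j aj.
by have := ra j; rewrite aj leqn0 => /eqP ->.
Qed.

Definition supp2 alpha beta : seq J := finsupp alpha `|` finsupp beta.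

Lemma supp2_uniq alpha beta : uniq (supp2 alpha beta).
Proof. exact: fset_uniq. Qed.

Lemma supp2l alpha beta : {subset finsupp alpha <= supp2 alpha beta}.
Proof. by move=> j ja; rewrite /supp2 inE ja. Qed.

Lemma supp2r alpha beta : {subset finsupp beta <= supp2 alpha beta}.
Proof. by move=> j ja; rewrite /supp2 inE ja orbT. Qed.

Lemma supp2_mcontract alpha beta r :
  {subset finsupp (mcontract alpha beta r) <= supp2 alpha beta}.
Proof.
move=> j; rewrite /supp2 inE !mem_finsupp mcontractE; apply: contraNT.
by rewrite negb_or !negbK => /andP[/eqP -> /eqP ->].
Qed.

Lemma mdegree_madd mu nu : mdegree (madd mu nu) = mdegree mu + mdegree nu.
Proof.
have sub : {subset finsupp (madd mu nu) <= supp2 mu nu}.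
  move=> j; rewrite /supp2 inE !mem_finsupp maddE; apply: contraNT.
  by rewrite negb_or !negbK => /andP[/eqP -> /eqP ->].
rewrite (mdegree_sup (supp2_uniq mu nu) sub).
rewrite (mdegree_sup (supp2_uniq mu nu) (@supp2l mu nu)).
rewrite (mdegree_sup (supp2_uniq mu nu) (@supp2r mu nu)).
by rewrite -big_split; apply: eq_bigr => j _; rewrite maddE.
Qed.

Lemma mdegree_msub alpha r : mle r alpha ->
  mdegree alpha = mdegree (msub alpha r) + mdegree r.
Proof. by move=> ra; rewrite -mdegree_madd madd_msub. Qed.

Lemma mcontractEmadd alpha beta r : mle r alpha -> mle r beta ->
  mcontract alpha beta r = madd (msub alpha r) (msub beta r).
Proof.
move=> ra rb; apply: mindexP => j; rewrite mcontractE maddE !msubE.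
by have := ra j; have := rb j; lia.
Qed.

Lemma mdegree_mcontract alpha beta r : mle r alpha -> mle r beta ->
  mdegree (mcontract alpha beta r) + 2 * mdegree r = mdegree alpha + mdegree beta.
Proof.
move=> ra rb; rewrite mcontractEmadd // mdegree_madd.
by rewrite (mdegree_msub ra) (mdegree_msub rb); lia.
Qed.

Lemma le_mdegree alpha j : alpha j <= mdegree alpha.
Proof.
have [ja|] := boolP (j \in finsupp alpha); last first.
  by rewrite mem_finsupp negbK => /eqP ->.
by rewrite /mdegree (bigD1_seq j) ?fset_uniq //= leq_addr.
Qed.

Fixpoint mbox s (b : J -> nat) : seq (mindex J) :=
  if s is j :: s' then
    [seq [fsfun r with j |-> k] | k <- iota 0 (b j).+1, r <- mbox s' b]
  else [:: mzero].

Lemma mbox_cons j s b : mbox (j :: s) b =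
  [seq [fsfun r with j |-> k] | k <- iota 0 (b j).+1, r <- mbox s b].
Proof. by []. Qed.

Lemma mem_mbox s b r : uniq s ->
  (r \in mbox s b) <-> forall j, if j \in s then is_true (r j <= b j) else r j = 0.
Proof.
elim: s r => [|i s ih] r.
  move=> _; rewrite inE; split => [/eqP -> j|h]; first by rewrite mzeroE.
  by apply/eqP; apply: mindexP => j; rewrite mzeroE; exact: h.
rewrite cons_uniq mbox_cons => /andP[iNs us]; split.
  move=> /allpairsPdep[k [q [kb qb ->]]] j; rewrite inE fsfun_withE.
  have := (ih q us).1 qb j; rewrite mem_iota add0n ltnS in kb.
  by case: eqP => [->|//].
move=> h; apply/allpairsPdep; exists (r i), [fsfun r with i |-> 0]; split.
- by have := h i; rewrite mem_head mem_iota.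
- apply/(ih _ us) => j; rewrite fsfun_withE.
  have := h j; rewrite inE; case: eqP => [->|_ //].
  by rewrite (negPf iNs).
- by apply: mindexP => j; rewrite !fsfun_withE; case: eqP => // ->.
Qed.

Lemma mbox_uniq s b : uniq s -> uniq (mbox s b).
Proof.
elim: s => [//|i s ih]; rewrite cons_uniq mbox_cons => /andP[iNs us].
apply: allpairs_uniq; [exact: iota_uniq|exact: ih|].
move=> [k q] [l t] /allpairsPdep[k' [q' [_ qs [-> ->]]]] /allpairsPdep[l' [t' [_ ts [-> ->]]]] /=.
move=> /fsfunP h; congr pair.
  by have := h i; rewrite !fsfun_withE eqxx.
apply: mindexP => j; have := h j; rewrite !fsfun_withE; case: eqP => // -> _.
have := (mem_mbox b q' us).1 qs i; have := (mem_mbox b t' us).1 ts i.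
by rewrite (negPf iNs) => -> ->.
Qed.

(** A product over coordinates of sums over exponents is a sum over
    multi-indices: every identity between multi-index sums used below reduces
    to its one-variable case through this. *)
Lemma mbox_distr (R : comNzRingType) s b (g : J -> nat -> R) : uniq s ->
  (\sum_(r <- mbox s b) \prod_(j <- s) g j (r j) =
   \prod_(j <- s) \sum_(k <- iota 0 (b j).+1) g j k)%R.
Proof.
elim: s => [|i s ih]; first by rewrite big_seq1 !big_nil.
rewrite cons_uniq mbox_cons => /andP[iNs us]; rewrite big_allpairs_dep [RHS]big_cons -ih //.
rewrite big_distrl /=; apply: eq_bigr => k _.
rewrite big_distrr /=; apply: eq_bigr => r _.
rewrite big_cons fsfun_withE eqxx; congr (_ * _)%R.
rewrite big_seq [RHS]big_seq; apply: eq_bigr => j js.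
by rewrite fsfun_withE; case: eqP => // ji; move: iNs; rewrite -ji js.
Qed.

Definition below2 alpha beta : seq (mindex J) :=
  mbox (supp2 alpha beta) (fun j => minn (alpha j) (beta j)).

Definition below alpha : seq (mindex J) := below2 alpha alpha.

Lemma below2_uniq alpha beta : uniq (below2 alpha beta).
Proof. by apply: mbox_uniq; exact: supp2_uniq. Qed.

Lemma mem_below2 alpha beta r : (r \in below2 alpha beta) = mleb r alpha && mleb r beta.
Proof.
apply/idP/idP => [/(mem_mbox _ _ (supp2_uniq _ _)) h|/andP[/mlebP ra /mlebP rb]].
  apply/andP; split; apply/mlebP => j; have := h j; case: ifP => _.
  - by rewrite leq_min => /andP[].
  - by move=> ->.
  - by rewrite leq_min => /andP[].
  - by move=> ->.
apply/(mem_mbox _ _ (supp2_uniq _ _)) => j; case: ifP => [_|jN].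
  by rewrite leq_min ra rb.
have : j \notin finsupp alpha by apply: contraFN jN; exact: supp2l.
rewrite mem_finsupp negbK => /eqP a0.
by have := ra j; rewrite a0 leqn0 => /eqP.
Qed.

Lemma mem_below alpha r : (r \in below alpha) = mleb r alpha.
Proof. by rewrite mem_below2 andbb. Qed.

Lemma mbox_exhausting : @exhausting J (fun n => mbox (cenum J n) (fun=> n)).
Proof.
move=> alpha; have [n0 h] := cenum_sub (finsupp alpha).
exists (maxn n0 (mdegree alpha)) => // n /=; rewrite geq_max => /andP[hn dn].
apply/(mem_mbox _ _ (cenum_uniq n)) => j; case: ifPn => jn.
  exact: leq_trans (le_mdegree _ _) dn.
have : j \notin finsupp alpha by apply: contra jn; exact: h.
by rewrite mem_finsupp negbK => /eqP.
Qed.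

Lemma belowE alpha : below alpha = mbox (supp2 alpha alpha) alpha.
Proof. by congr mbox; apply/funext => j; rewrite minnn. Qed.

Lemma multinomial (R : comNzRingType) alpha (x y : R) :
  (\sum_(r <- below alpha) (mbin alpha r)%:R * x ^+ mdegree r * y ^+ mdegree (msub alpha r)
   = (x + y) ^+ mdegree alpha)%R.
Proof.
have su := supp2_uniq alpha alpha; have sl := @supp2l alpha alpha.
transitivity (\prod_(j <- supp2 alpha alpha)
    \sum_(k <- iota 0 (alpha j).+1) ('C(alpha j, k)%:R * x ^+ k * y ^+ (alpha j - k)))%R.
  rewrite -(mbox_distr _ (fun j k => 'C(alpha j, k)%:R * x ^+ k * y ^+ (alpha j - k))%R) //.
  rewrite -belowE big_seq [RHS]big_seq; apply: eq_bigr => r.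
  rewrite mem_below => /mlebP ra.
  rewrite !big_split /= -natr_prod -(mbin_sup su sl ra) !prodrXr.
  rewrite -(mdegree_sup su); last by move=> j /(mle_finsupp ra); exact: sl.
  rewrite (@mdegree_sup (msub alpha r) _ su).
    by congr (_ * _ ^+ _)%R; apply: eq_bigr => j _; rewrite msubE.
  move=> j; rewrite mem_finsupp msubE => h; apply: sl; rewrite mem_finsupp.
  by apply: contraNneq h => ->; rewrite sub0n.
rewrite (mdegree_sup su sl) -prodrXr; apply: eq_bigr => j _.
have -> : iota 0 (alpha j).+1 = index_iota 0 (alpha j).+1 by rewrite /index_iota subn0.
rewrite addrC exprDn big_mkord; apply: eq_bigr => k _.
by rewrite -[RHS]mulr_natl -mulrA [(x ^+ _ * _)%R]mulrC.
Qed.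

End multi_index_theory.
Arguments mzero {J}.

(** * The structure coefficients *)

Section structure_coefficients.
Context (R : realType) {J : countType}.
Implicit Types (alpha beta r gamma mu nu : mindex J).

Lemma coef_c_ge0 alpha beta r : 0 <= coef_c R alpha beta r.
Proof. by rewrite /coef_c mulr_ge0 ?sqrtr_ge0. Qed.

Lemma coef_cC alpha beta r : coef_c R alpha beta r = coef_c R beta alpha r.
Proof.
rewrite /coef_c mcontractC [X in _ / X]mulrC; congr (_%:R * _).
by rewrite -!mulnA [X in (_ * X)%N]mulnC.
Qed.

Lemma varthetaC n alpha beta r : vartheta R n alpha beta r = vartheta R n beta alpha r.
Proof.
rewrite /vartheta mcontractC.
have -> : `[< [/\ in_range n alpha, in_range n beta &
      in_range n (mcontract beta alpha r)] >] =
    `[< [/\ in_range n beta, in_range n alpha &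
      in_range n (mcontract beta alpha r)] >].
  by apply/idP/idP => /asboolP[? ? ?]; apply/asboolP.
by [].
Qed.

Lemma fact_identity a b k : (k <= a)%N -> (k <= b)%N ->
  ((k`! * 'C(a, k) * 'C(b, k)) ^ 2 * (a + b - 2 * k)`! =
   'C(a, k) * 'C(b, k) * 'C(a + b - 2 * k, a - k) * (a`! * b`!))%N.
Proof.
move=> ka kb; have -> : (a + b - 2 * k = (a - k) + (b - k))%N by lia.
have h := @bin_fact (a - k + (b - k)) (a - k) (leq_addr _ _).
rewrite addKn in h; rewrite -h -(bin_fact ka) -(bin_fact kb).
by rewrite expnS expn1; ring.
Qed.

Lemma mfact_gt0 alpha : (0 < mfact alpha)%N.
Proof. by rewrite prodn_gt0 // => j; exact: fact_gt0. Qed.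

(** In terms of [mu = alpha - r] and [nu = beta - r] the squared coefficient
    is the product of the three binomials attached to the pairs
    [(mu, r)], [(nu, r)] and [(mu, nu)]. *)
Lemma coef_cE alpha beta r : mle r alpha -> mle r beta ->
  coef_c R alpha beta r =
  Num.sqrt (mbin alpha r * mbin beta r * mbin (mcontract alpha beta r) (msub alpha r))%:R.
Proof.
move=> ra rb; have su := supp2_uniq alpha beta.
have sr : {subset finsupp r <= supp2 alpha beta}.
  by move=> j /(mle_finsupp ra); exact: supp2l.
have mg : mle (msub alpha r) (mcontract alpha beta r).
  by move=> j; rewrite mcontractE msubE; have := ra j; have := rb j; lia.
have id2 : ((mfact r * mbin alpha r * mbin beta r) ^ 2 * mfact (mcontract alpha beta r) =
   mbin alpha r * mbin beta r * mbin (mcontract alpha beta r) (msub alpha r) *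
   (mfact alpha * mfact beta))%N.
  rewrite (mfact_sup su sr) (mbin_sup su (@supp2l _ _ _) ra) (mbin_sup su (@supp2r _ _ _) rb).
  rewrite (mfact_sup su (@supp2_mcontract _ _ _ _)) (mbin_sup su (@supp2_mcontract _ _ _ _) mg).
  rewrite (mfact_sup su (@supp2l _ _ _)) (mfact_sup su (@supp2r _ _ _)).
  rewrite !expnS expn0 muln1 -!big_split /=; apply: eq_bigr => j _.
  by rewrite mcontractE msubE -(fact_identity (ra j) (rb j)) expnS expn1.
rewrite /coef_c; set p := (mfact r * _ * _)%N.
rewrite -[p%:R]ger0_norm // -sqrtr_sqr -sqrtrM ?sqr_ge0 //; congr Num.sqrt.
have ab0 : (mfact alpha)%:R * (mfact beta)%:R != 0 :> R.
  by rewrite mulf_neq0 // pnatr_eq0 -lt0n mfact_gt0.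
rewrite mulrA; apply: (mulIf ab0); rewrite divfK //.
by rewrite -natrX -!natrM id2.
Qed.

Section vartheta_bounds.
Variables (n : nat) (n0 : (0 < n)%N).

Let nR : 0 < n%:R :> R. Proof. by rewrite ltr0n. Qed.

Lemma bin2D a b : ('C(a + b, 2) = 'C(a, 2) + 'C(b, 2) + a * b)%N.
Proof.
elim: a => [|a ih]; first by rewrite add0n mul0n addn0.
by rewrite addSn !binS !bin1 ih mulSn; lia.
Qed.

(** By induction on [k]: each new factor is [(n - g - k) / n] or zero. *)
Lemma falling_ratio g k : (0 <= (((n - g) ^_ k)%:R / n%:R ^+ k : R) <= 1) /\
  ((g <= n)%N -> 1 - (k * g + 'C(k, 2))%:R / n%:R <= (((n - g) ^_ k)%:R / n%:R ^+ k : R)).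
Proof.
elim: k => [|k [/andP[ih0 ih1] ih2]].
  by rewrite ffactn0 expr0 divr1 ler01 lexx mul0n add0n mul0r subr0 lexx.
set t := _ / _ in ih0 ih1 ih2; pose f : R := (n - g - k)%:R / n%:R.
have tE : ((n - g) ^_ k.+1)%:R / n%:R ^+ k.+1 = t * f.
  by rewrite ffactnSr natrM exprSr invfM mulrACA.
have f0 : 0 <= f by rewrite divr_ge0.
have f1 : f <= 1 by rewrite ler_pdivrMr // mul1r ler_nat; lia.
rewrite tE; split; first by rewrite mulr_ge0 //= mulr_ile1.
move=> gn; have {ih2} := ih2 gn.
have fg : 1 - (g + k)%:R / n%:R <= f.
  by rewrite lerBlDr /f -mulrDl ler_pdivlMr // mul1r -natrD ler_nat; lia.
have -> : (k.+1 * g + 'C(k.+1, 2))%:R / n%:R =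
    (k * g + 'C(k, 2))%:R / n%:R + (g + k)%:R / n%:R :> R.
  by rewrite -mulrDl -natrD; congr (_%:R / _); rewrite binS bin1; lia.
move: fg; set x := _ / n%:R; set y := _ / n%:R; nra.
Qed.

Lemma prod_ge_1B (I : Type) (s : seq I) (t x : I -> R) :
  (forall i, 0 <= t i <= 1) -> (forall i, 1 - x i <= t i) ->
  0 <= \prod_(i <- s) t i <= 1 /\ 1 - \sum_(i <- s) x i <= \prod_(i <- s) t i.
Proof.
move=> t01 xt; elim: s => [|i s [/andP[ih0 ih1] ih2]].
  by rewrite !big_nil ler01 lexx subr0 lexx.
rewrite !big_cons; have /andP[ti0 ti1] := t01 i; have := xt i.
by rewrite mulr_ge0 // mulr_ile1 //; split => //; nra.
Qed.

Lemma sum_bin2 (I : Type) (s : seq I) (k : I -> nat) :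
  (\sum_(i <- s) 'C(k i, 2) <= 'C(\sum_(i <- s) k i, 2))%N.
Proof.
elim: s => [|i s ih]; first by rewrite !big_nil.
by rewrite !big_cons bin2D; lia.
Qed.

Lemma vartheta_range alpha beta r : 0 <= vartheta R n alpha beta r <= 1.
Proof.
rewrite /vartheta; case: asboolP => _; last by rewrite lexx ler01.
have h0 j : 0 <= (((n - mcontract alpha beta r j) ^_ (r j))%:R / n%:R ^+ r j : R) <= 1.
  by case: (falling_ratio (mcontract alpha beta r j) (r j)).
apply/andP; split; first by rewrite prodr_ge0 // => j _; case/andP: (h0 j).
by rewrite prodr_ile1 // => j _; exact: h0.
Qed.

(** [vartheta] is a product of factors [1 - x] with [x] small; the sum of the
    [x] is at most the number of pairs among the [m + n] slots, divided by
    [n].  Out of range [m + n > n] and the right-hand side exceeds 1. *)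
Lemma vartheta_lower alpha beta r : mle r alpha -> mle r beta ->
  1 - vartheta R n alpha beta r <= 'C(mdegree alpha + mdegree beta, 2)%:R / n%:R.
Proof.
move=> ra rb; set g := mcontract alpha beta r.
have le_out : (n < mdegree alpha + mdegree beta)%N ->
    1 <= 'C(mdegree alpha + mdegree beta, 2)%:R / n%:R :> R.
  move=> h; rewrite ler_pdivlMr // mul1r ler_nat.
  have -> : (mdegree alpha + mdegree beta = n.+1 + (mdegree alpha + mdegree beta - n.+1))%N.
    by lia.
  rewrite bin2D binS bin1; set z := (n.+1 * _)%N; lia.
rewrite /vartheta; case: asboolP => [[na nb ng]|]; last first.
  move=> out; rewrite subr0; apply: le_out.
  rewrite ltnNge; apply/negP => h; apply: out; split => j.
  - by apply: leq_trans h; rewrite (leq_trans (le_mdegree alpha j)) // leq_addr.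
  - by apply: leq_trans h; rewrite (leq_trans (le_mdegree beta j)) // leq_addl.
  - apply: leq_trans h; rewrite -(mdegree_mcontract ra rb).
    by rewrite (leq_trans (le_mdegree _ j)) // leq_addr.
have su := supp2_uniq alpha beta.
have sr : {subset finsupp r <= supp2 alpha beta}.
  by move=> j /(mle_finsupp ra); exact: supp2l.
rewrite -/g; set P := \prod_(j <- _) _.
have [_] := @prod_ge_1B J (finsupp r)
  (fun j => ((n - g j) ^_ (r j))%:R / n%:R ^+ r j)
  (fun j => (r j * g j + 'C(r j, 2))%:R / n%:R)
  (fun j => (falling_ratio (g j) (r j)).1) (fun j => (falling_ratio (g j) (r j)).2 (ng j)).
rewrite -/P -mulr_suml => h.
rewrite lerBlDr -lerBlDl; apply: le_trans h; rewrite lerD2l lerN2.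
rewrite ler_pM2r ?invr_gt0 // -natr_sum ler_nat.
have -> : (\sum_(j <- finsupp r) (r j * g j + 'C(r j, 2)) =
    \sum_(j <- supp2 alpha beta) (r j * g j + 'C(r j, 2)))%N.
  by rewrite (big_finsupp _ su sr) // => j ->; rewrite mul0n.
rewrite (mdegree_sup su (@supp2l _ _ _)) (mdegree_sup su (@supp2r _ _ _)).
rewrite -big_split /=; apply: leq_trans (sum_bin2 _ _).
apply: leq_sum => j _.
have -> : (alpha j + beta j = g j + (r j + r j))%N.
  by rewrite /g mcontractE; have := ra j; have := rb j; lia.
by rewrite !bin2D mulnDr [(g j * _)%N]mulnC; set z := (r j * g j)%N; set y := (r j * r j)%N; lia.
Qed.

End vartheta_bounds.

End structure_coefficients.

(** * The fundamental inequality for one pair of levels *)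

Section sum_tools.
Context {R : realType}.

Lemma sum_inj_le (T T' : eqType) (L : seq T) (L' : seq T') (phi : T -> T')
    (f : T -> R) (g : T' -> R) :
  uniq L -> uniq L' ->
  (forall t, t \in L -> f t != 0 -> phi t \in L' /\ f t <= g (phi t)) ->
  (forall t u, t \in L -> u \in L -> f t != 0 -> f u != 0 -> phi t = phi u -> t = u) ->
  (forall u, u \in L' -> 0 <= g u) ->
  \sum_(t <- L) f t <= \sum_(u <- L') g u.
Proof.
move=> uL uL' h inj g0.
rewrite (bigID (fun t => f t != 0)) /= [X in _ + X]big1 ?addr0; last first.
  by move=> t; rewrite negbK => /eqP.
rewrite -big_filter; set L0 := [seq t <- L | f t != 0].
have uL0 : uniq L0 by rewrite filter_uniq.
have inL0 t : t \in L0 -> t \in L /\ f t != 0 by rewrite mem_filter => /andP[].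
apply: (@le_trans _ _ (\sum_(t <- L0) g (phi t))).
  by rewrite big_seq [leRHS]big_seq; apply: ler_sum => t /inL0[tL ft]; case: (h t tL ft).
have um : uniq (map phi L0).
  rewrite map_inj_in_uniq // => t u /inL0[tL ft] /inL0[uL1 fu]; exact: inj.
have -> : \sum_(t <- L0) g (phi t) = \sum_(u <- map phi L0) g u by rewrite big_map.
have -> : \sum_(u <- map phi L0) g u = \sum_(u <- L' | u \in map phi L0) g u.
  rewrite -[RHS]big_filter; apply: perm_big; apply: uniq_perm => //.
    exact: filter_uniq.
  move=> u; rewrite mem_filter andb_idr // => /mapP[t /inL0[tL ft] ->].
  by case: (h t tL ft).
rewrite [leRHS](bigID (fun u => u \in map phi L0)) /= lerDl big_seq_cond.
by apply: sumr_ge0 => u /andP[uL1 _]; exact: g0.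
Qed.

(** The Hilbert-Schmidt form of the Loomis-Whitney inequality. *)
Lemma loomis_whitney (T1 T2 T3 : eqType) (s1 : seq T1) (s2 : seq T2) (s3 : seq T3)
    (f : T1 -> T2 -> R) (g : T1 -> T3 -> R) (h : T2 -> T3 -> R) :
  (\sum_(i <- s1) \sum_(j <- s2) \sum_(k <- s3) f i j * g i k * h j k) ^+ 2 <=
  (\sum_(i <- s1) \sum_(j <- s2) f i j ^+ 2) *
  ((\sum_(i <- s1) \sum_(k <- s3) g i k ^+ 2) *
   (\sum_(j <- s2) \sum_(k <- s3) h j k ^+ 2)).
Proof.
pose w i j := \sum_(k <- s3) g i k * h j k.
have -> : \sum_(i <- s1) \sum_(j <- s2) \sum_(k <- s3) f i j * g i k * h j k =
    \sum_(p <- [seq (i, j) | i <- s1, j <- s2]) f p.1 p.2 * w p.1 p.2.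
  rewrite big_allpairs_dep; apply: eq_bigr => i _; apply: eq_bigr => j _ /=.
  by rewrite /w mulr_sumr; apply: eq_bigr => k _; rewrite mulrA.
apply: le_trans (sum_cauchy_schwarz _ _ _) _; rewrite !big_allpairs_dep /=.
rewrite ler_wpM2l //.
  by apply: sumr_ge0 => i _; apply: sumr_ge0 => j _; rewrite sqr_ge0.
rewrite mulr_suml; apply: ler_sum => i _.
rewrite mulr_sumr; apply: ler_sum => j _.
exact: sum_cauchy_schwarz.
Qed.

End sum_tools.

Section level_product.
Context {R : realType} {J : countType}.
Implicit Types (alpha beta r gamma mu nu : mindex J).

Variables (sigma rho eta : R).
Hypotheses (sigma0 : 0 < sigma) (rho0 : 0 < rho) (eta0 : 0 < eta)
  (adm : admissible sigma rho eta).

Let a : R := (1 + rho ^+ 2)^-1.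
Let b : R := (1 + eta ^+ 2)^-1.
Let d : R := 1 - a - b.

Lemma split_constants :
  [/\ 0 < a, 0 < b, 0 < d, b / a + d / a = rho ^+ 2 & a / b + d / b = eta ^+ 2].
Proof.
have p1 (t : R) : 0 < t -> 0 < 1 + t ^+ 2 by move=> t0; rewrite addr_gt0 ?exprn_gt0.
have a0 : 0 < a by rewrite invr_gt0 p1.
have b0 : 0 < b by rewrite invr_gt0 p1.
have d0 : 0 < d.
  rewrite /d -addrA -opprD subr_gt0; apply: (le_lt_trans adm).
  by rewrite invf_lt1 ?p1 // ltrDl exprn_gt0.
split=> //.
- rewrite -mulrDl /d (_ : b + (1 - a - b) = 1 - a); last by ring.
  by rewrite mulrBl divff ?gt_eqF // mul1r /a invrK addrC addKr.
- rewrite -mulrDl /d (_ : a + (1 - a - b) = 1 - b); last by ring.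
  by rewrite mulrBl divff ?gt_eqF // mul1r /b invrK addrC addKr.
Qed.

Lemma sigma_le : sigma ^+ 2 <= d / (a + b).
Proof.
have [a0 b0 d0 _ _] := split_constants.
have s1 : 0 < 1 + sigma ^+ 2 by rewrite addr_gt0 ?exprn_gt0.
rewrite ler_pdivlMr ?addr_gt0 // /d.
have : (a + b) * (1 + sigma ^+ 2) <= 1.
  by rewrite -ler_pdivlMr // mul1r; exact: adm.
by set t := sigma ^+ 2; lra.
Qed.

Let regroup (t t' p q u v A B C : R) (i j k : nat) :
  C * (t ^+ i * t' ^+ j) * (A * (u ^+ k * p ^+ i)) * (B * (v ^+ k * q ^+ j)) =
  (t * p) ^+ i * (t' * q) ^+ j * (u * v) ^+ k * (A * B * C).
Proof. by rewrite !exprMn; ring. Qed.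

Variables (m n : nat) (S S' : seq (mindex J)) (x y : mindex J -> R).
Hypotheses (uS : uniq S) (uS' : uniq S')
  (degS : forall alpha, alpha \in S -> mdegree alpha = m)
  (degS' : forall beta, beta \in S' -> mdegree beta = n)
  (x0 : forall alpha, 0 <= x alpha) (y0 : forall beta, 0 <= y beta).

Definition level_prod gamma : R :=
  \sum_(alpha <- S) \sum_(beta <- S')
    \sum_(r <- below2 alpha beta | mcontract alpha beta r == gamma)
      coef_c R alpha beta r * x alpha * y beta.

Definition half_norm (S : seq (mindex J)) (x : mindex J -> R) (u v : R) (l : nat) : R :=
  \sum_(alpha <- S) \sum_(r <- below alpha | (2 * mdegree r + l == m + n)%N)
    x alpha ^+ 2 * ((mbin alpha r)%:R * u ^+ mdegree r * v ^+ mdegree (msub alpha r)).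

Let X := half_norm S x (b / a) (d / a).
Let Y := half_norm S' y (a / b) (d / b).

Lemma half_norm_ge0 T z u v l : 0 <= u -> 0 <= v -> 0 <= half_norm T z u v l.
Proof.
move=> u0 v0; apply: sumr_ge0 => alpha _; apply: sumr_ge0 => r _.
by rewrite mulr_ge0 ?sqr_ge0 // !mulr_ge0 ?exprn_ge0.
Qed.

Lemma level_prod_ge0 gamma : 0 <= level_prod gamma.
Proof.
apply: sumr_ge0 => alpha _; apply: sumr_ge0 => beta _; apply: sumr_ge0 => r _.
by rewrite !mulr_ge0 ?coef_c_ge0.
Qed.

Let M := undup ([seq r | alpha <- S ++ S', r <- below alpha] ++
                [seq msub alpha r | alpha <- S ++ S', r <- below alpha]).

Let mem_M1 alpha r : alpha \in S ++ S' -> mle r alpha -> r \in M.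
Proof.
move=> aS /mlebP ra; rewrite mem_undup mem_cat; apply/orP; left.
by apply/allpairsPdep; exists alpha, r; split => //; rewrite mem_below.
Qed.

Let mem_M2 alpha r : alpha \in S ++ S' -> mle r alpha -> msub alpha r \in M.
Proof.
move=> aS /mlebP ra; rewrite mem_undup mem_cat; apply/orP; right.
by apply/allpairsPdep; exists alpha, r; split => //; rewrite mem_below.
Qed.

Section one_level.
Variables (l : nat) (G : seq (mindex J)).
Hypotheses (uG : uniq G) (degG : forall gamma, gamma \in G -> mdegree gamma = l).

Let z gamma := if gamma \in G then sigma ^+ l * level_prod gamma else 0.
Let th := a / (a + b).

Let F mu nu := z (madd mu nu) *
  Num.sqrt ((mbin (madd mu nu) mu)%:R * th ^+ mdegree mu * (1 - th) ^+ mdegree nu).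
Let Gx (S : seq (mindex J)) (x : mindex J -> R) (u v : R) mu r :=
  if (madd mu r \in S) && (2 * mdegree r + l == m + n)%N then
    x (madd mu r) * Num.sqrt ((mbin (madd mu r) r)%:R * u ^+ mdegree r * v ^+ mdegree mu)
  else 0.

Let z_ge0 gamma : 0 <= z gamma.
Proof. by rewrite /z; case: ifP => // _; rewrite mulr_ge0 ?level_prod_ge0 // exprn_ge0 ?ltW. Qed.

Let th01 : 0 < th < 1.
Proof.
have [a0 b0 _ _ _] := split_constants.
by rewrite /th divr_gt0 ?addr_gt0 //= ltr_pdivrMr ?addr_gt0 // mul1r ltrDl.
Qed.

(** The exponents of [a], [b], [d] and [a + b] match because
   [l = mdegree mu + mdegree nu]; the weights on [r] cancel. *)
Let term_le alpha beta r : alpha \in S -> beta \in S' -> mle r alpha -> mle r beta ->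
  z (mcontract alpha beta r) * (sigma ^+ l * (coef_c R alpha beta r * x alpha * y beta)) <=
  F (msub alpha r) (msub beta r) * Gx S x (b / a) (d / a) (msub alpha r) r *
  Gx S' y (a / b) (d / b) (msub beta r) r.
Proof.
move=> aS bS' ra rb; have [a0 b0 d0 _ _] := split_constants.
have [gG|gG] := boolP (mcontract alpha beta r \in G); last first.
  rewrite [X in X * _ <= _]/z (negPf gG) mul0r.
  rewrite !mulr_ge0 ?sqrtr_ge0 ?z_ge0 //.
  - by rewrite /Gx; case: ifP => // _; rewrite mulr_ge0 ?sqrtr_ge0.
  - by rewrite /Gx; case: ifP => // _; rewrite mulr_ge0 ?sqrtr_ge0.
have dl := degG gG; have := mdegree_mcontract ra rb; rewrite dl (degS aS) (degS' bS') => deg.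
have lE : l = (mdegree (msub alpha r) + mdegree (msub beta r))%N.
  by rewrite -dl mcontractEmadd // mdegree_madd.
have deg2 : (2 * mdegree r + l == m + n)%N by rewrite -deg addnC.
rewrite /F /Gx !madd_msub // aS bS' deg2 /= -mcontractEmadd //.
rewrite coef_cE // (mcontractEmadd ra rb).
set mu := msub alpha r; set nu := msub beta r.
rewrite -!mulrA ler_wpM2l ?z_ge0 //.
set A := (mbin alpha r)%:R; set B := (mbin beta r)%:R; set C := (mbin _ mu)%:R.
rewrite !natrM -/A -/B -/C.
rewrite [leRHS](_ : _ = (Num.sqrt (C * (th ^+ mdegree mu * (1 - th) ^+ mdegree nu)) *
   Num.sqrt (A * ((b / a) ^+ mdegree r * (d / a) ^+ mdegree mu)) *
   Num.sqrt (B * ((a / b) ^+ mdegree r * (d / b) ^+ mdegree nu))) * (x alpha * y beta));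
  last by ring.
rewrite [leLHS](_ : _ = (sigma ^+ l * Num.sqrt (A * B * C)) * (x alpha * y beta));
  last by ring.
rewrite ler_wpM2r ?mulr_ge0 //.
have /andP[th0 th1] := th01.
have A0 : 0 <= A by []. have B0 : 0 <= B by []. have C0 : 0 <= C by [].
have p1 : 0 <= C * (th ^+ mdegree mu * (1 - th) ^+ mdegree nu).
  by rewrite !mulr_ge0 ?exprn_ge0 // ?subr_ge0 ltW.
have p2 : 0 <= A * ((b / a) ^+ mdegree r * (d / a) ^+ mdegree mu).
  by rewrite !mulr_ge0 // exprn_ge0 // divr_ge0 // ltW.
rewrite -sqrtrM // -sqrtrM; last by rewrite mulr_ge0.
rewrite -[sigma ^+ l](ger0_norm (exprn_ge0 _ (ltW sigma0))) -sqrtr_sqr -sqrtrM ?sqr_ge0 //.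
apply: ler_wsqrtr.
rewrite [leRHS](_ : _ = (th * (d / a)) ^+ mdegree mu * ((1 - th) * (d / b)) ^+ mdegree nu *
   ((b / a) * (a / b)) ^+ mdegree r * (A * B * C)); last exact: regroup.
rewrite ler_wpM2r ?mulr_ge0 //.
have -> : (b / a) * (a / b) = 1 by field; rewrite !gt_eqF.
have -> : th * (d / a) = d / (a + b).
  by rewrite /th; field; rewrite !gt_eqF ?addr_gt0.
have -> : (1 - th) * (d / b) = d / (a + b).
  by rewrite /th; field; rewrite !gt_eqF ?addr_gt0.
rewrite expr1n mulr1 -exprD -lE -exprM mulnC exprM.
have dab : 0 <= d / (a + b).
  by apply: divr_ge0; [exact: ltW|apply: addr_ge0; exact: ltW].
by rewrite lerXn2r ?nnegrE ?sqr_ge0 ?sigma_le.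
Qed.

Let sum_F : \sum_(mu <- M) \sum_(nu <- M) F mu nu ^+ 2 <= \sum_(gamma <- G) z gamma ^+ 2.
Proof.
have /andP[th0 th1] := th01.
have w0 (k i j : nat) : 0 <= k%:R * th ^+ i * (1 - th) ^+ j.
  by rewrite !mulr_ge0 ?exprn_ge0 // ?subr_ge0 ltW.
have -> : \sum_(mu <- M) \sum_(nu <- M) F mu nu ^+ 2 =
    \sum_(p <- [seq (mu, nu) | mu <- M, nu <- M]) F p.1 p.2 ^+ 2.
  by rewrite big_allpairs_dep.
have -> : \sum_(gamma <- G) z gamma ^+ 2 =
    \sum_(p <- [seq (gamma, mu) | gamma <- G, mu <- below gamma])
      z p.1 ^+ 2 * ((mbin p.1 p.2)%:R * th ^+ mdegree p.2 * (1 - th) ^+ mdegree (msub p.1 p.2)).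
  rewrite big_allpairs_dep; apply: eq_bigr => gamma _ /=.
  by rewrite -mulr_sumr multinomial [th + _]addrC subrK expr1n mulr1.
apply: (@sum_inj_le _ _ _ _ _ (fun p => (madd p.1 p.2, p.1))).
- by apply: allpairs_uniq; rewrite ?undup_uniq // => -[? ?] [? ?].
- apply: allpairs_uniq_dep => // [gamma _|]; first exact: below2_uniq.
  by move=> [g1 m1] [g2 m2] _ _ /= [<- <-].
- move=> p0 /allpairsP[[mu nu] /= [muM nuM ->]] /= Fn0; split.
    apply/allpairsPdep; exists (madd mu nu), mu; split => //.
      by move: Fn0; rewrite /F /z; case: ifP => //; rewrite mul0r expr0n eqxx.
    by rewrite mem_below; apply/mlebP => j; rewrite maddE leq_addr.
  have -> : msub (madd mu nu) mu = nu.
    by apply: mindexP => j; rewrite msubE maddE addKn.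
  by rewrite /F exprMn sqr_sqrtr.
- move=> [m1 n1] [m2 n2] _ _ _ _ /= [h e]; rewrite e in h *; congr pair.
  by apply: mindexP => j; have /fsfunP/(_ j) := h; rewrite !maddE => /addnI.
- move=> p _; rewrite mulr_ge0 ?sqr_ge0 //.
Qed.

Let sum_G T w u v : uniq T -> 0 <= u -> 0 <= v ->
  \sum_(mu <- M) \sum_(r <- M) Gx T w u v mu r ^+ 2 <= half_norm T w u v l.
Proof.
move=> uT u0 v0.
have -> : \sum_(mu <- M) \sum_(r <- M) Gx T w u v mu r ^+ 2 =
    \sum_(p <- [seq (mu, r) | mu <- M, r <- M]) Gx T w u v p.1 p.2 ^+ 2.
  by rewrite big_allpairs_dep.
have -> : half_norm T w u v l =
    \sum_(p <- [seq (alpha, r) | alpha <- T, r <- below alpha])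
      if (2 * mdegree p.2 + l == m + n)%N then
      w p.1 ^+ 2 * ((mbin p.1 p.2)%:R * u ^+ mdegree p.2 * v ^+ mdegree (msub p.1 p.2))
      else 0.
  rewrite big_allpairs_dep; apply: eq_bigr => alpha _ /=.
  by rewrite -big_mkcond.
apply: (@sum_inj_le _ _ _ _ _ (fun p => (madd p.1 p.2, p.2))).
- by apply: allpairs_uniq; rewrite ?undup_uniq // => -[? ?] [? ?].
- apply: allpairs_uniq_dep => // [gamma _|]; first exact: below2_uniq.
  by move=> [g1 m1] [g2 m2] _ _ /= [<- <-].
- move=> p0 /allpairsP[[mu r] /= [muM nuM ->]] /=; rewrite /Gx.
  case: ifP; last by rewrite expr0n eqxx.
  move=> /andP[mT ->] _; split.
    apply/allpairsPdep; exists (madd mu r), r; split => //.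
    by rewrite mem_below; apply/mlebP; exact: mle_madd.
  by rewrite msub_madd exprMn sqr_sqrtr // !mulr_ge0 ?exprn_ge0.
- move=> [m1 n1] [m2 n2] _ _ _ _ /= [h e]; rewrite e in h *; congr pair.
  by apply: mindexP => j; have /fsfunP/(_ j) := h; rewrite !maddE => /addIn.
- by move=> p _; case: ifP => // _; rewrite mulr_ge0 ?sqr_ge0 // !mulr_ge0 ?exprn_ge0.
Qed.

(** The square sum on the left is a sum over triples [(mu, nu, r)] once one
    factor is kept as a test vector [z]; after the Loomis-Whitney inequality
    the square sum of [z] reappears and cancels. *)
Lemma level_prod_bound : \sum_(gamma <- G) (sigma ^+ l * level_prod gamma) ^+ 2 <= X l * Y l.
Proof.
have [a0 b0 d0 _ _] := split_constants.
have ba0 : 0 <= b / a by rewrite divr_ge0 // ltW.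
have ab0 : 0 <= a / b by rewrite divr_ge0 // ltW.
have da0 : 0 <= d / a by rewrite divr_ge0 // ltW.
have db0 : 0 <= d / b by rewrite divr_ge0 // ltW.
set Q := \sum_(gamma <- G) _.
have Qz : Q = \sum_(gamma <- G) z gamma ^+ 2.
  by rewrite /Q big_seq [RHS]big_seq; apply: eq_bigr => gamma gG; rewrite /z gG.
have Q0 : 0 <= Q by apply: sumr_ge0 => gamma _; rewrite sqr_ge0.
pose T alpha beta r := z (mcontract alpha beta r) *
  (sigma ^+ l * (coef_c R alpha beta r * x alpha * y beta)).
have QE : Q = \sum_(alpha <- S) \sum_(beta <- S') \sum_(r <- below2 alpha beta) T alpha beta r.
  rewrite /Q; transitivity (\sum_(gamma <- G) \sum_(alpha <- S) \sum_(beta <- S')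
      \sum_(r <- below2 alpha beta) if mcontract alpha beta r == gamma then T alpha beta r else 0).
    rewrite big_seq [RHS]big_seq; apply: eq_bigr => gamma gG.
    have zE : z gamma = sigma ^+ l * level_prod gamma by rewrite /z gG.
    rewrite expr2 -{1}zE /level_prod !mulr_sumr; apply: eq_bigr => alpha _.
    rewrite !mulr_sumr; apply: eq_bigr => beta _.
    rewrite !mulr_sumr -big_mkcond; apply: eq_bigr => r /eqP <-.
    by [].
  rewrite exchange_big; apply: eq_bigr => alpha _.
  rewrite exchange_big; apply: eq_bigr => beta _.
  rewrite exchange_big; apply: eq_bigr => r _ /=.
  have [gG|gG] := boolP (mcontract alpha beta r \in G).
    rewrite (bigD1_seq (mcontract alpha beta r)) //= eqxx big1 ?addr0 // => g.
    by rewrite eq_sym => /negPf ->.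
  rewrite big_seq big1; first by rewrite /T /z (negPf gG) mul0r.
  by move=> g gG1; case: eqP => // gE; move: gG; rewrite gE gG1.
have Qle : Q <= \sum_(mu <- M) \sum_(nu <- M) \sum_(r <- M)
    F mu nu * Gx S x (b / a) (d / a) mu r * Gx S' y (a / b) (d / b) nu r.
  pose W (p : mindex J * mindex J * mindex J) :=
    F p.1.1 p.1.2 * Gx S x (b / a) (d / a) p.1.1 p.2 * Gx S' y (a / b) (d / b) p.1.2 p.2.
  have -> : \sum_(mu <- M) \sum_(nu <- M) \sum_(r <- M)
      F mu nu * Gx S x (b / a) (d / a) mu r * Gx S' y (a / b) (d / b) nu r =
      \sum_(p <- [seq (q, r) | q <- [seq (mu, nu) | mu <- M, nu <- M], r <- M]) W p.
    by rewrite !big_allpairs_dep.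
  rewrite QE; have -> : \sum_(alpha <- S) \sum_(beta <- S')
      \sum_(r <- below2 alpha beta) T alpha beta r =
      \sum_(p <- [seq (q, r) | q <- [seq (alpha, beta) | alpha <- S, beta <- S'],
                               r <- below2 q.1 q.2]) T p.1.1 p.1.2 p.2.
    by rewrite !big_allpairs_dep.
  apply: (@sum_inj_le _ _ _ _ _
    (fun p => (msub p.1.1 p.2, msub p.1.2 p.2, p.2))).
  - apply: allpairs_uniq_dep => [|q _|]; last by move=> [? ?] [? ?] _ _ /= [<- <-].
      by apply: allpairs_uniq => // -[? ?] [? ?].
    exact: below2_uniq.
  - apply: allpairs_uniq => [||[? ?] [? ?]//]; rewrite ?undup_uniq //.
    by apply: allpairs_uniq; rewrite ?undup_uniq // => -[? ?] [? ?].
  - move=> p0 /allpairsPdep[q0 [r [/allpairsP[[al be] /= [aS bS ->]] /=]]].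
    rewrite mem_below2 => /andP[/mlebP ra /mlebP rb] -> _ /=.
    have aSS : al \in S ++ S' by rewrite mem_cat aS.
    have bSS : be \in S ++ S' by rewrite mem_cat bS orbT.
    split; last by rewrite /W /= /T; exact: term_le.
    apply/allpairsP; exists ((msub al r, msub be r), r) => /=; split => //.
      by apply/allpairsP; exists (msub al r, msub be r); split => //=; exact: mem_M2.
    exact: (mem_M1 aSS).
  - move=> p0 p1 /allpairsPdep[q0 [r [/allpairsP[[al be] /= [aS bS ->]] /= hr ->]]].
    move=> /allpairsPdep[q1 [q [/allpairsP[[al' be'] /= [aS' bS' ->]] /= hq ->]]] /= _ _.
    move: hr hq; rewrite !mem_below2 => /andP[/mlebP ra /mlebP rb] /andP[/mlebP qa /mlebP qb].
    move=> [h1 h2 rq]; rewrite -rq in h1 h2 qa qb *; congr (_, _, _).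
      by rewrite -(madd_msub ra) h1 madd_msub.
    by rewrite -(madd_msub rb) h2 madd_msub.
  - move=> p _; rewrite /W /F !mulr_ge0 ?sqrtr_ge0 ?z_ge0 //.
    + by rewrite /Gx; case: ifP => // _; rewrite mulr_ge0 ?sqrtr_ge0.
    + by rewrite /Gx; case: ifP => // _; rewrite mulr_ge0 ?sqrtr_ge0.
have Q2 : Q ^+ 2 <= Q * (X l * Y l).
  apply: (@le_trans _ _ ((\sum_(mu <- M) \sum_(nu <- M) \sum_(r <- M)
    F mu nu * Gx S x (b / a) (d / a) mu r * Gx S' y (a / b) (d / b) nu r) ^+ 2)).
    by rewrite lerXn2r // nnegrE // (le_trans Q0).
  apply: (le_trans (loomis_whitney _ _ _ _ _ _)).
  have sq (f : mindex J -> mindex J -> R) : 0 <= \sum_(i <- M) \sum_(j <- M) f i j ^+ 2.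
    by apply: sumr_ge0 => i _; apply: sumr_ge0 => j _; rewrite sqr_ge0.
  apply: ler_pM; rewrite ?mulr_ge0 ?sq //; first by rewrite Qz; exact: sum_F.
  by apply: ler_pM; rewrite ?sq //; exact: sum_G.
have [Qp|Qn] := ltP 0 Q; last first.
  by rewrite (le_trans Qn) // mulr_ge0 // half_norm_ge0.
by move: Q2; rewrite expr2 ler_pM2l.
Qed.

End one_level.

(** Summed over [l] the restriction on the degree of [r] disappears, and the
    multinomial theorem gives [(u + v) ^ k]. *)
Lemma half_norm_sum T w u v t k k0 : 0 <= u -> 0 <= v -> u + v = t ^+ 2 ->
  (forall alpha, alpha \in T -> mdegree alpha = k) ->
  \sum_(0 <= l < k0) half_norm T w u v l <= (t ^+ k) ^+ 2 * \sum_(alpha <- T) w alpha ^+ 2.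
Proof.
move=> u0 v0 uv degT; rewrite exchange_big /= mulr_sumr big_seq [leRHS]big_seq.
apply: ler_sum => alpha aT; rewrite mulrC -exprM mulnC exprM -uv -(degT _ aT).
rewrite -multinomial mulr_sumr.
under eq_bigr do rewrite big_mkcond.
rewrite exchange_big; apply: ler_sum => r _.
set c := _ * _; have c0 : 0 <= c.
  by rewrite /c mulr_ge0 ?sqr_ge0 // !mulr_ge0 ?exprn_ge0.
have [h|h] := boolP (2 * mdegree r <= m + n)%N; last first.
  by rewrite big1 // => l _; case: eqP => // lE; move: h; rewrite -lE leq_addr.
have [lk|lk] := boolP ((m + n - 2 * mdegree r)%N \in index_iota 0 k0).
  rewrite (bigD1_seq (m + n - 2 * mdegree r)%N) ?iota_uniq //= subnKC // eqxx.
  rewrite big1 ?addr0 // => l lN; case: eqP => // lE; move: lN.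
  by rewrite -lE addKn eqxx.
rewrite big_seq big1 // => l lk'; case: eqP => // lE.
by move: lk; rewrite -lE addKn lk'.
Qed.

(** Here [b / a + d / a = rho ^ 2] and [a / b + d / b = eta ^ 2]. *)
Lemma level_prod_sum k0 : \sum_(0 <= l < k0) Num.sqrt (X l) * Num.sqrt (Y l) <=
  rho ^+ m * eta ^+ n *
  (Num.sqrt (\sum_(alpha <- S) x alpha ^+ 2) * Num.sqrt (\sum_(beta <- S') y beta ^+ 2)).
Proof.
have [a0 b0 d0 r2 e2] := split_constants.
have ba0 : 0 <= b / a by rewrite divr_ge0 // ltW.
have ab0 : 0 <= a / b by rewrite divr_ge0 // ltW.
have da0 : 0 <= d / a by rewrite divr_ge0 // ltW.
have db0 : 0 <= d / b by rewrite divr_ge0 // ltW.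
apply: (le_trans (sum_cauchy_schwarz_sqrt _ _ _)).
rewrite mulrACA ler_pM ?sqrtr_ge0 //.
- under eq_bigr do rewrite sqr_sqrtr ?half_norm_ge0 //.
  rewrite -[rho ^+ m](ger0_norm (exprn_ge0 _ (ltW rho0))) -sqrtr_sqr -(sqrtrM _ (sqr_ge0 _)).
  by apply: ler_wsqrtr; apply: half_norm_sum.
- under eq_bigr do rewrite sqr_sqrtr ?half_norm_ge0 //.
  rewrite -[eta ^+ n](ger0_norm (exprn_ge0 _ (ltW eta0))) -sqrtr_sqr -(sqrtrM _ (sqr_ge0 _)).
  by apply: ler_wsqrtr; apply: half_norm_sum.
Qed.

End level_product.

(** * Weighted products of finitely supported arrays *)

Section finite_products.
Context {R : realType} {E : lmodType R[i]} (dot : {dot E for Num.conj})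
  {K : countType} (e : K -> E) {J : countType}.
Hypothesis e_basis : orthonormal_basis dot (cnorm dot) e.
Local Notation hs := (hilbert_schmidt dot e).
Local Notation hsnorm := (Defs.hsnorm dot e).
Local Notation hsn := (hsn dot e).
Local Notation pnorm := (@Defs.pnorm R E dot K e J).
Local Notation level := (@level_norm R E dot K e J).
Local Notation supported := (@supported R E dot K e J).
Implicit Types (A B : array E J) (alpha beta r gamma : mindex J)
  (s : seq (mindex J)) (w : mindex J -> mindex J -> mindex J -> R).
Local Open Scope complex_scope.

Definition triples s s' : seq (mindex J * mindex J * mindex J) :=
  [seq (q, r) | q <- [seq (alpha, beta) | alpha <- s, beta <- s'], r <- below2 q.1 q.2].

Lemma triples_uniq s s' : uniq s -> uniq s' -> uniq (triples s s').
Proof.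
move=> us us'; apply: allpairs_uniq_dep => [|q _|].
- by apply: allpairs_uniq => // -[? ?] [? ?].
- exact: below2_uniq.
- by move=> [? ?] [? ?] _ _ /= [<- <-].
Qed.

Lemma mem_triples s s' alpha beta r : ((alpha, beta, r) \in triples s s') =
  [&& alpha \in s, beta \in s', mleb r alpha & mleb r beta].
Proof.
apply/idP/idP => [/allpairsPdep[q [q' [/allpairsP[[al be] /= [aS bS ->]] /=]]]|].
  by rewrite mem_below2 => /andP[ra rb] [-> -> ->]; apply/and4P.
move=> /and4P[aS bS ra rb]; apply/allpairsPdep; exists (alpha, beta), r; split => //.
  by apply/allpairsP; exists (alpha, beta).
by rewrite mem_below2 ra.
Qed.

(** The product of supported arrays as a sum over lists: every algebraic
    property below is read off from this form. *)
Lemma prodE w s s' A B gamma : uniq s -> uniq s' -> supported s A -> supported s' B ->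
  weighted_product w A B gamma =
  \sum_(alpha <- s) \sum_(beta <- s')
    \sum_(r <- below2 alpha beta | mcontract alpha beta r == gamma)
      (coef_c R alpha beta r * w alpha beta r)%:C *: (A alpha \o B beta).
Proof.
move=> us us' [hA zA] [hB zB].
set L := [seq t <- triples s s' | mcontract t.1.1 t.1.2 t.2 == gamma].
have LD : [set` L] `<=` [set t : mindex J * mindex J * mindex J |
    [/\ mle t.2 t.1.1, mle t.2 t.1.2 & mcontract t.1.1 t.1.2 t.2 = gamma]].
  move=> [[alpha beta] r] /=; rewrite mem_filter mem_triples /=.
  by move=> /andP[/eqP tg /and4P[_ _ /mlebP ra /mlebP rb]].
rewrite /weighted_product (fsbigE L) //.
- rewrite big_seq_cond (eq_bigl (mem L)); last first.
    by move=> t /=; rewrite andb_idr // => /LD; rewrite inE.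
  rewrite -big_seq /L big_filter /triples big_mkcond !big_allpairs_dep.
  apply: eq_bigr => alpha _; apply: eq_bigr => beta _.
  by rewrite -big_mkcond.
- by rewrite filter_uniq ?triples_uniq.
move=> [[alpha beta] r] /= [/mlebP ra /mlebP rb tg].
rewrite mem_filter mem_triples /= tg eqxx ra rb !andbT /= negb_and => tN.
suff -> : A alpha \o B beta = 0 by rewrite scaler0.
case/orP: tN => h; first by rewrite (zA _ h).
rewrite (zB _ h); by apply/funext => u /=; rewrite lin0 //; case: (hA alpha) => -[].
Qed.

Lemma prod_linl w c s s' A A' B : supported s A -> supported s A' -> supported s' B ->
  weighted_product w (c *: A + A') B =
  c *: weighted_product w A B + weighted_product w A' B.
Proof.
move=> /supported_undup sA /supported_undup sA' /supported_undup sB; apply/funext => gamma.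
rewrite -[RHS]/(c *: weighted_product w A B gamma + weighted_product w A' B gamma).
rewrite !(prodE _ _ (undup_uniq s) (undup_uniq s') _ sB) //; last exact: supported_lin.
rewrite scaler_sumr -big_split; apply: eq_bigr => alpha _ /=.
rewrite scaler_sumr -big_split; apply: eq_bigr => beta _ /=.
rewrite scaler_sumr -big_split; apply: eq_bigr => r _ /=.
set k := (_ * _)%:C; apply/funext => u.
rewrite -[LHS]/(k *: (c *: A alpha (B beta u) + A' alpha (B beta u))).
rewrite -[RHS]/(c *: (k *: A alpha (B beta u)) + k *: A' alpha (B beta u)).
by rewrite scalerDr !scalerA mulrC.
Qed.

Lemma prod_linr w c s s' A B B' : supported s A -> supported s' B -> supported s' B' ->
  weighted_product w A (c *: B + B') =
  c *: weighted_product w A B + weighted_product w A B'.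
Proof.
move=> /supported_undup sA /supported_undup sB /supported_undup sB'; apply/funext => gamma.
rewrite -[RHS]/(c *: weighted_product w A B gamma + weighted_product w A B' gamma).
rewrite !(prodE _ _ (undup_uniq s) (undup_uniq s') sA) //; last exact: supported_lin.
rewrite scaler_sumr -big_split; apply: eq_bigr => alpha _ /=.
rewrite scaler_sumr -big_split; apply: eq_bigr => beta _ /=.
rewrite scaler_sumr -big_split; apply: eq_bigr => r _ /=.
set k := (_ * _)%:C; apply/funext => u.
rewrite -[LHS]/(k *: (A alpha (c *: B beta u + B' beta u))).
rewrite -[RHS]/(c *: (k *: A alpha (B beta u)) + k *: A alpha (B' beta u)).
have -> : A alpha (c *: B beta u + B' beta u) = c *: A alpha (B beta u) + A alpha (B' beta u).
  by case: sA => /(_ alpha) [[lA _] _] _; rewrite lA.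
by rewrite scalerDr !scalerA mulrC.
Qed.

Definition contractions s s' : seq (mindex J) :=
  [seq mcontract t.1.1 t.1.2 t.2 | t <- triples s s'].

Lemma hs_prod w s s' A B gamma : supported s A -> supported s' B ->
  hs (weighted_product w A B gamma).
Proof.
move=> /supported_undup sA /supported_undup sB.
rewrite (prodE _ _ (undup_uniq s) (undup_uniq s') sA sB).
do 3 (apply: hs_sum => ? _); apply: hsZ; apply: hs_comp => //.
  by case: sA.
by case: sB.
Qed.

Lemma supported_prod w s s' A B : supported s A -> supported s' B ->
  supported (contractions s s') (weighted_product w A B).
Proof.
move=> sA sB; split => [gamma|gamma gN]; first exact: hs_prod sA sB.
move: sA sB => /supported_undup sA /supported_undup sB.
rewrite (prodE _ _ (undup_uniq s) (undup_uniq s') sA sB).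
rewrite big_seq big1 // => alpha aS; rewrite big_seq big1 // => beta bS.
rewrite big_seq_cond big1 // => r /andP[]; rewrite mem_below2 => /andP[ra rb] /eqP rg.
move: gN; rewrite -rg => /negP; case; apply/mapP; exists (alpha, beta, r) => //.
by rewrite mem_triples ra rb -(mem_undup s) aS -(mem_undup s') bS.
Qed.

Section level_bound.
Variables (sigma rho eta : R).
Hypotheses (sigma0 : 0 < sigma) (rho0 : 0 < rho) (eta0 : 0 < eta)
  (adm : admissible sigma rho eta).
Variables (w : mindex J -> mindex J -> mindex J -> R) (W : R) (m n : nat)
  (s s' : seq (mindex J)) (A B : array E J).
Hypotheses (us : uniq s) (us' : uniq s') (sA : supported s A) (sB : supported s' B)
  (degs : forall alpha, alpha \in s -> mdegree alpha = m)
  (degs' : forall beta, beta \in s' -> mdegree beta = n)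
  (W0 : 0 <= W)
  (wW : forall alpha beta r, alpha \in s -> beta \in s' -> mle r alpha -> mle r beta ->
     `|w alpha beta r| <= W).

Let x alpha := hsn (A alpha).
Let y beta := hsn (B beta).

Let hsn_prod gamma : hsn (weighted_product w A B gamma) <= W * level_prod s s' x y gamma.
Proof.
have hsum (I : Type) (t : seq I) (P : pred I) (F : I -> E -> E) :
    (forall i, hs (F i)) -> hsn (\sum_(i <- t | P i) F i) <= \sum_(i <- t | P i) hsn (F i).
  move=> hF; have [] : hs (\sum_(i <- t | P i) F i) /\
      hsn (\sum_(i <- t | P i) F i) <= \sum_(i <- t | P i) hsn (F i); last by [].
  elim/big_ind2 : _ => [|T a S b [hT Ta] [hS Sb]|i _].
  - by split; [exact: hs0|rewrite hsn0].
  - by split; [exact: hsD|rewrite (le_trans (hsnD hT hS)) // lerD].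
  - by split.
have hterm alpha beta r : hs ((coef_c R alpha beta r * w alpha beta r)%:C *: (A alpha \o B beta)).
  by apply: hsZ; apply: hs_comp => //; [case: sA|case: sB].
rewrite (prodE _ _ us us' sA sB) /level_prod mulr_sumr.
apply: (le_trans (hsum _ _ _ _ _)) => [alpha|].
  by do 2 (apply: hs_sum => ? _).
rewrite big_seq [leRHS]big_seq; apply: ler_sum => alpha aS; rewrite mulr_sumr.
apply: (le_trans (hsum _ _ _ _ _)) => [beta|]; first by apply: hs_sum => ? _.
rewrite big_seq [leRHS]big_seq; apply: ler_sum => beta bS; rewrite mulr_sumr.
apply: (le_trans (hsum _ _ _ _ _)) => [r|]; first exact: hterm.
rewrite big_seq_cond [leRHS]big_seq_cond; apply: ler_sum => r.
rewrite mem_below2 => /andP[/andP[/mlebP ra /mlebP rb] _].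
have hA : hs (A alpha) by case: sA.
have hB : hs (B beta) by case: sB.
rewrite hsnZ ?modc_real //; last exact: hs_comp.
move: (coef_c R alpha beta r) (coef_c_ge0 R alpha beta r) => k k0.
rewrite normrM (ger0_norm k0) -!mulrA [leRHS]mulrCA ler_wpM2l //.
apply: ler_pM; [by []|exact: hsn_ge0|exact: wW|exact: hsn_comp].
Qed.

Let a : R := (1 + rho ^+ 2)^-1.
Let b : R := (1 + eta ^+ 2)^-1.
Let X l := half_norm m n s x (b / a) ((1 - a - b) / a) l.
Let Y l := half_norm m n s' y (a / b) ((1 - a - b) / b) l.

Let level_prod_le l : ((sigma ^+ l)%:E * level l (weighted_product w A B) <=
  (W * (Num.sqrt (X l) * Num.sqrt (Y l)))%:E)%E.
Proof.
have [a0 b0 d0 _ _] := split_constants sigma0 rho0 eta0 adm.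
have X0 : 0 <= X l by apply: half_norm_ge0; apply: divr_ge0; exact: ltW.
have Y0 : 0 <= Y l by apply: half_norm_ge0; apply: divr_ge0; exact: ltW.
have s0 : 0 <= sigma ^+ l by rewrite exprn_ge0 // ltW.
rewrite levelE -ell2Z //; last by move=> *; exact: (eseminorm_ge0 (eseminorm_hs dot e)).
apply: ell2_le; first by rewrite lee_fin !mulr_ge0 ?sqrtr_ge0.
move=> G uG degG.
have hp gamma : hs (weighted_product w A B gamma) by exact: hs_prod sA sB.
apply: (@le_trans _ _ (\sum_(gamma <- G) ((W * (sigma ^+ l * level_prod s s' x y gamma)) ^+ 2)%:E)%E).
  apply: lee_sum => gamma _; rewrite -hsnK // -EFinM -EFin_expe lee_fin.
  rewrite lerXn2r ?nnegrE ?mulr_ge0 ?hsn_ge0 ?level_prod_ge0 //; try by move=> ?; exact: hsn_ge0.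
  by rewrite mulrCA ler_wpM2l.
rewrite sumEFin -EFin_expe lee_fin exprMn.
under eq_bigr do rewrite exprMn.
rewrite -mulr_sumr ler_wpM2l ?sqr_ge0 // exprMn !sqr_sqrtr //.
apply: (level_prod_bound sigma0 rho0 eta0 adm us us' degs degs') => //.
- by move=> ?; exact: hsn_ge0.
- by move=> ?; exact: hsn_ge0.
Qed.

Lemma pnorm_level_prod : (pnorm sigma (weighted_product w A B) <=
  (W * (rho ^+ m * eta ^+ n *
    (Num.sqrt (\sum_(alpha <- s) hsn (A alpha) ^+ 2) *
     Num.sqrt (\sum_(beta <- s') hsn (B beta) ^+ 2))))%:E)%E.
Proof.
have s0 : 0 <= sigma by exact: ltW.
rewrite pnormE; apply: lime_le.
  by apply: is_cvg_nneseries => l _ _; exact: pnorm_term_ge0.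
apply: nearW => k0.
apply: (@le_trans _ _ (\sum_(0 <= l < k0) (W * (Num.sqrt (X l) * Num.sqrt (Y l)))%:E)%E).
  by apply: lee_sum => l _; exact: level_prod_le.
rewrite sumEFin lee_fin -mulr_sumr ler_wpM2l //.
exact: (level_prod_sum sigma0 rho0 eta0 adm).
Qed.

End level_bound.

End finite_products.

Section product_bound.
Context {R : realType} {E : lmodType R[i]} (dot : {dot E for Num.conj})
  {K : countType} (e : K -> E) {J : countType}.
Hypothesis e_basis : orthonormal_basis dot (cnorm dot) e.
Local Notation hs := (hilbert_schmidt dot e).
Local Notation hsnorm := (Defs.hsnorm dot e).
Local Notation hsn := (hsn dot e).
Local Notation pnorm := (@Defs.pnorm R E dot K e J).
Local Notation level := (@level_norm R E dot K e J).
Local Notation supported := (@supported R E dot K e J).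
Implicit Types (A B : array E J) (alpha beta r gamma : mindex J)
  (s : seq (mindex J)) (w : mindex J -> mindex J -> mindex J -> R).

Lemma supported0 s : supported s 0.
Proof. by split => // alpha; exact: hs0. Qed.

Lemma supportedD s A B : supported s A -> supported s B -> supported s (A + B).
Proof. by move=> sA sB; rewrite -(scale1r A); exact: supported_lin. Qed.

Lemma prod0l w s B : supported s B -> weighted_product w (0 : array E J) B = 0.
Proof.
move=> sB; have := prod_linl w (-1) (supported0 [::]) (supported0 [::]) sB.
by rewrite scaler0 addr0 scaleN1r addNr.
Qed.

Lemma prod0r w s A : supported s A -> weighted_product w A (0 : array E J) = 0.
Proof.
move=> sA; have := prod_linr w (-1) sA (supported0 [::]) (supported0 [::]).
by rewrite scaler0 addr0 scaleN1r addNr.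
Qed.

Lemma prod_suml w s s' (I : Type) (t : seq I) (F : I -> array E J) B :
  (forall i, supported s (F i)) -> supported s' B ->
  weighted_product w (\sum_(i <- t) F i) B = \sum_(i <- t) weighted_product w (F i) B.
Proof.
move=> hF sB; elim: t => [|i t ih]; first by rewrite !big_nil (prod0l _ sB).
rewrite !big_cons -ih -[F i in LHS]scale1r.
have hsum : supported s (\sum_(j <- t) F j).
  by elim/big_rec : _ => [|j A _ sA]; [exact: supported0|exact: supportedD].
by rewrite (prod_linl w 1 (hF i) hsum sB) scale1r.
Qed.

Lemma prod_sumr w s s' (I : Type) (t : seq I) A (F : I -> array E J) :
  supported s A -> (forall i, supported s' (F i)) ->
  weighted_product w A (\sum_(i <- t) F i) = \sum_(i <- t) weighted_product w A (F i).
Proof.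
move=> sA hF; elim: t => [|i t ih]; first by rewrite !big_nil (prod0r _ sA).
rewrite !big_cons -ih -[F i in LHS]scale1r.
have hsum : supported s' (\sum_(j <- t) F j).
  by elim/big_rec : _ => [|j B _ sB]; [exact: supported0|exact: supportedD].
by rewrite (prod_linr w 1 sA (hF i) hsum) scale1r.
Qed.

Definition at_level s m := [seq alpha <- s | mdegree alpha == m].

Definition top_level s := (\max_(alpha <- s) mdegree alpha).+1.

Lemma level_decomposition s A : supported s A ->
  A = \sum_(0 <= m < top_level s) restr (at_level s m) A.
Proof.
move=> sA; apply/funext => alpha; rewrite fct_sumE.
have [as_|asN] := boolP (alpha \in s); last first.
  have [_ zA] := sA; rewrite (zA _ asN) big1 // => m _.
  by rewrite /restr mem_filter (negPf asN) andbF.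
have lt_top : (mdegree alpha < top_level s)%N.
  by rewrite ltnS; apply: leq_bigmax_seq.
rewrite (bigD1_seq (mdegree alpha)) ?iota_uniq ?mem_index_iota //=.
rewrite {1}/restr mem_filter eqxx as_ big1 ?addr0 // => m.
by rewrite /restr mem_filter eq_sym => /negPf ->.
Qed.

Lemma at_level_supported s m A : hs_array dot e A -> supported s (restr (at_level s m) A).
Proof.
move=> hA; apply: (@supported_sub _ _ _ _ _ _ (at_level s m)).
  by move=> alpha; rewrite mem_filter => /andP[].
exact: restr_supported.
Qed.

Definition lvl s A m : R := Num.sqrt (\sum_(alpha <- at_level s m) hsn (A alpha) ^+ 2).

Lemma lvl_le s A m : uniq s -> hs_array dot e A -> ((lvl s A m)%:E <= level m A)%E.
Proof.
move=> us hA; have s0 : 0 <= \sum_(alpha <- at_level s m) hsn (A alpha) ^+ 2.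
  by apply: sumr_ge0 => alpha _; rewrite sqr_ge0.
rewrite -[leRHS](gee0_abs (level_ge0 dot e m A)) -sqrte_sqr.
rewrite (_ : (lvl s A m)%:E = sqrte (\sum_(alpha <- at_level s m) hsn (A alpha) ^+ 2)%:E) //.
rewrite lee_sqrt ?expe2_ge0 //.
apply: (@le_trans _ _ (\sum_(alpha <- at_level s m) (hsnorm (A alpha) ^+ 2))%E).
  by rewrite -sumEFin; apply: lee_sum => alpha _; rewrite EFin_expe hsnK.
rewrite levelE; apply: seq_le_ell2; first by rewrite filter_uniq.
by move=> alpha; rewrite mem_filter => /andP[/eqP].
Qed.

Lemma sum_lvl_le t s A k : 0 <= t -> uniq s -> hs_array dot e A ->
  ((\sum_(0 <= m < k) t ^+ m * lvl s A m)%:E <= pnorm t A)%E.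
Proof.
move=> t0 us hA; rewrite pnormE -sumEFin.
apply: (@le_trans _ _ (\sum_(0 <= m < k) (t ^+ m)%:E * level m A)%E).
  by apply: lee_sum => m _; rewrite EFinM lee_wpmul2l ?lee_fin ?exprn_ge0 ?lvl_le.
by apply: nneseries_lim_ge => m _ _; exact: pnorm_term_ge0.
Qed.

(** The estimate behind both the norm inequality ([w] in [0, 1], [c = 1],
    [t = rho], [u = eta]) and the rate of convergence ([w] the defect
    [vartheta - 1], which is small for the larger weights [t] and [u]). *)
Theorem pnorm_prod_le (sigma rho eta t u c : R) w s s' A B :
  0 < sigma -> 0 < rho -> 0 < eta -> admissible sigma rho eta ->
  0 <= t -> 0 <= u -> 0 <= c ->
  (forall alpha beta r, mle r alpha -> mle r beta ->
    `|w alpha beta r| * (rho ^+ mdegree alpha * eta ^+ mdegree beta) <=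
    c * (t ^+ mdegree alpha * u ^+ mdegree beta)) ->
  supported s A -> supported s' B ->
  (pnorm sigma (weighted_product w A B) <= c%:E * (pnorm t A * pnorm u B))%E.
Proof.
move=> sigma0 rho0 eta0 adm t0 u0 c0 hw /supported_undup sA /supported_undup sB.
move: sA sB (undup_uniq s) (undup_uniq s'); move: (undup s) (undup s') => {}s {}s'.
move=> sA sB us us'; have [hA _] := sA; have [hB _] := sB.
have s0 : 0 <= sigma by exact: ltW.
rewrite {1}(level_decomposition sA) {1}(level_decomposition sB).
rewrite (prod_suml w _ _ (s := s) (s' := s')); first last.
- by elim/big_rec : _ => [|j D _ sD]; [exact: supported0|apply: supportedD => //; exact: at_level_supported].
- by move=> i; exact: at_level_supported.
apply: (le_trans (pnorm_sum dot e _ _ _ s0)).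
pose T m n := c * ((t ^+ m * lvl s A m) * (u ^+ n * lvl s' B n)).
apply: (@le_trans _ _ (\sum_(0 <= m < top_level s) \sum_(0 <= n < top_level s') (T m n)%:E)%E).
  apply: lee_sum => m _.
  rewrite (prod_sumr w _ (s := s) (s' := s')); first last.
  - by move=> i; exact: at_level_supported.
  - exact: at_level_supported.
  apply: (le_trans (pnorm_sum dot e _ _ _ s0)); apply: lee_sum => n _.
  have rm : 0 < rho ^+ m by rewrite exprn_gt0.
  have en : 0 < eta ^+ n by rewrite exprn_gt0.
  have W0 : 0 <= c * (t ^+ m * u ^+ n) / (rho ^+ m * eta ^+ n).
    by apply: divr_ge0; [rewrite !mulr_ge0 ?exprn_ge0|rewrite ltW ?mulr_gt0].
  have sAm : supported (at_level s m) (restr (at_level s m) A) by exact: restr_supported.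
  have sBn : supported (at_level s' n) (restr (at_level s' n) B) by exact: restr_supported.
  have dm alpha : alpha \in at_level s m -> mdegree alpha = m.
    by rewrite mem_filter => /andP[/eqP].
  have dn beta : beta \in at_level s' n -> mdegree beta = n.
    by rewrite mem_filter => /andP[/eqP].
  have ww alpha beta r : alpha \in at_level s m -> beta \in at_level s' n ->
      mle r alpha -> mle r beta ->
      `|w alpha beta r| <= c * (t ^+ m * u ^+ n) / (rho ^+ m * eta ^+ n).
    move=> /dm da /dn db ra rb; rewrite ler_pdivlMr ?mulr_gt0 //.
    by have := hw _ _ _ ra rb; rewrite da db.
  apply: (le_trans (pnorm_level_prod e_basis sigma0 rho0 eta0 adm (filter_uniq _ us)
    (filter_uniq _ us') sAm sBn dm dn W0 ww)).
  rewrite lee_fin mulrA divfK ?gt_eqF ?mulr_gt0 //.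
  have rE (s1 : seq (mindex J)) k (C : array E J) :
     \sum_(alpha <- at_level s1 k) hsn (restr (at_level s1 k) C alpha) ^+ 2 =
     \sum_(alpha <- at_level s1 k) hsn (C alpha) ^+ 2.
    by rewrite big_seq [RHS]big_seq; apply: eq_bigr => alpha h; rewrite /restr h.
  rewrite (rE s m A) (rE s' n B) -/(lvl s A m) -/(lvl s' B n) /T.
  move: (lvl s A m) (lvl s' B n) => p q.
  by rewrite le_eqVlt; apply/orP; left; apply/eqP; ring.
have -> : (\sum_(0 <= m < top_level s) \sum_(0 <= n < top_level s') (T m n)%:E)%E =
   (c%:E * ((\sum_(0 <= m < top_level s) t ^+ m * lvl s A m)%:E *
          (\sum_(0 <= n < top_level s') u ^+ n * lvl s' B n)%:E))%E.
  rewrite -!EFinM; under eq_bigr do rewrite sumEFin.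
  rewrite sumEFin; congr EFin; rewrite big_distrlr mulr_sumr; apply: eq_bigr => m _ /=.
  by rewrite mulr_sumr.
apply: lee_wpmul2l; first by rewrite lee_fin.
apply: lee_pmul; rewrite ?lee_fin.
- by apply: sumr_ge0 => m _; rewrite mulr_ge0 ?exprn_ge0 ?sqrtr_ge0.
- by apply: sumr_ge0 => m _; rewrite mulr_ge0 ?exprn_ge0 ?sqrtr_ge0.
- exact: sum_lvl_le.
- exact: sum_lvl_le.
Qed.

End product_bound.

(** * Extension of the products by continuity *)

Lemma bilinear_small {R : realType} (c a b eps : R) :
  0 <= c -> 0 <= a -> 0 <= b -> 0 < eps ->
  exists2 delta : R, 0 < delta & forall x y p q : \bar R,
    (0 <= x <= delta%:E)%E -> (0 <= y <= delta%:E)%E ->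
    (0 <= p <= b%:E)%E -> (0 <= q <= a%:E)%E ->
    (c%:E * (x * p) + c%:E * (q * y) <= eps%:E)%E.
Proof.
move=> c0 a0 b0 eps0; have k0 : 0 < c * (a + b) + 1 by rewrite ltr_wpDl // mulr_ge0 ?addr_ge0.
exists (eps / (c * (a + b) + 1)); first by rewrite divr_gt0.
set delta := eps / _ => x y p q /andP[x0 xd] /andP[y0 yd] /andP[p0 pb] /andP[q0 qa].
have h : c * (delta * b) + c * (a * delta) <= eps.
  have -> : c * (delta * b) + c * (a * delta) = eps * ((c * (a + b)) / (c * (a + b) + 1)).
    by rewrite /delta; field; rewrite gt_eqF.
  by rewrite ger_pMr // ler_pdivrMr // mul1r lerDl.
apply: (@le_trans _ _ (c * (delta * b) + c * (a * delta))%:E); last by rewrite lee_fin.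
rewrite EFinD !EFinM; apply: leeD; apply: lee_wpmul2l; rewrite ?lee_fin //; exact: lee_pmul.
Qed.

Section extension.
Context {R : realType} {E : lmodType R[i]} (dot : {dot E for Num.conj})
  {K : countType} (e : K -> E) {J : countType}.
Hypothesis E_complete : complete_norm (cnorm dot).
Hypothesis e_basis : orthonormal_basis dot (cnorm dot) e.
Local Notation pnorm := (@Defs.pnorm R E dot K e J).
Local Notation pspace := (@Defs.pspace R E dot K e J).
Local Notation supported := (@supported R E dot K e J).
Implicit Types (A B : array E J) (alpha beta r gamma : mindex J)
  (s : seq (mindex J)) (w : mindex J -> mindex J -> mindex J -> R).

Definition box n : seq (mindex J) := mbox (cenum J n) (fun=> n).

Definition trunc n A : array E J := restr (box n) A.

Definition trunc_prod w n A B : array E J := weighted_product w (trunc n A) (trunc n B).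

(** Defined coefficient by coefficient and vector by vector, so that no
    choice of norms enters: one array serves all admissible weights. *)
Definition ext_prod w A B : array E J := fun gamma x =>
  xget 0 [set y | ncvg dot (fun n => trunc_prod w n A B gamma x) y].

Lemma trunc_supported n A : hs_array dot e A -> supported (box n) (trunc n A).
Proof. exact: restr_supported. Qed.

Lemma trunc_lin n (c : R[i]) A B : trunc n (c *: A + B) = c *: trunc n A + trunc n B.
Proof. exact: restr_lin. Qed.

Lemma ext_prod_limit w A B C : pwcvg dot (fun n => trunc_prod w n A B) C ->
  ext_prod w A B = C.
Proof.
move=> h; apply/funext => gamma; apply/funext => x; rewrite /ext_prod.
case: xgetP => [y _ hy|/(_ (C gamma x))]; first exact: (ncvg_unique hy (h gamma x)).
by case; exact: h.
Qed.

Lemma trunc_eventually s A : supported s A -> \forall n \near \oo, trunc n A = A.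
Proof.
move=> sA; apply: filterS (exhausting_seq s mbox_exhausting) => n sub.
by apply: restr_id; exact: (supported_sub sub sA).
Qed.

Lemma ext_prod_supported w s s' A B : supported s A -> supported s' B ->
  ext_prod w A B = weighted_product w A B.
Proof.
move=> sA sB; apply: ext_prod_limit => gamma x; apply/ncvgP => eps eps0.
apply: filterS2 (trunc_eventually sA) (trunc_eventually sB) => n hA hB.
by rewrite /trunc_prod hA hB subrr cnorm0.
Qed.

Lemma prod_diff w s s' A A' B B' : supported s A -> supported s A' ->
  supported s' B -> supported s' B' ->
  weighted_product w A' B' - weighted_product w A B =
  weighted_product w (A' - A) B' + weighted_product w A (B' - B).
Proof.
move=> sA sA' sB sB'; rewrite [A' - A]addrC -[- A]scaleN1r.
rewrite (prod_linl _ _ sA sA' sB') [B' - B]addrC -[- B]scaleN1r.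
rewrite (prod_linr _ _ sA sB sB') !scaleN1r.
by rewrite [X in _ = X + _]addrC [X in _ = _ + X]addrC addrA subrK.
Qed.

Definition prod_bounded w (sigma t u c : R) : Prop :=
  forall s s' A B, supported s A -> supported s' B ->
    (pnorm sigma (weighted_product w A B) <= c%:E * (pnorm t A * pnorm u B))%E.

Section bounded_weight.
Variables (w : mindex J -> mindex J -> mindex J -> R) (sigma t u c : R).
Hypotheses (sigma0 : 0 < sigma) (t0 : 0 < t) (u0 : 0 < u) (c0 : 0 <= c)
  (bw : prod_bounded w sigma t u c).

Lemma pspace_fin rho A : 0 < rho -> pspace rho A -> exists2 a : R, 0 <= a & pnorm rho A = a%:E.
Proof.
move=> rho0 [_ fA]; exists (fine (pnorm rho A)).
  by rewrite fine_ge0 // pnorm_ge0 // ltW.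
by rewrite fineK // ge0_fin_numE // pnorm_ge0 // ltW.
Qed.

(** The truncations of the factors are Cauchy and the product is bounded. *)
Lemma trunc_prod_cauchy A B : pspace t A -> pspace u B ->
  pcauchy dot e sigma (fun n => trunc_prod w n A B).
Proof.
move=> pA pB eps eps0.
have [a a0 aE] := pspace_fin t0 pA; have [b b0 bE] := pspace_fin u0 pB.
have [delta d0 small] := bilinear_small c0 a0 b0 eps0.
have /near2P[nA hA] := pcvg_cauchy (ltW t0) (pcvg_restr mbox_exhausting t0 pA) d0.
have /near2P[nB hB] := pcvg_cauchy (ltW u0) (pcvg_restr mbox_exhausting u0 pB) d0.
apply/near2P; exists (maxn nA nB) => m n; rewrite !geq_max => /andP[Am Bm] /andP[An Bn].
have [hsA _] := pA; have [hsB _] := pB.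
have sup C k k' : hs_array dot e C -> supported (box k ++ box k') (trunc k C) /\
    supported (box k ++ box k') (trunc k' C).
  move=> hC; split; apply: supported_sub (trunc_supported _ hC) => x;
  by rewrite mem_cat => ->; rewrite ?orbT.
have [sAm sAn] := sup A m n hsA; have [sBm sBn] := sup B m n hsB.
rewrite /trunc_prod (prod_diff w sAn sAm sBn sBm).
apply: (le_trans (pnormD dot e _ _ (ltW sigma0))).
have sAd : supported (box m ++ box n) (trunc m A - trunc n A).
  by rewrite addrC -scaleN1r; exact: supported_lin.
have sBd : supported (box m ++ box n) (trunc m B - trunc n B).
  by rewrite addrC -scaleN1r; exact: supported_lin.
apply: (le_trans (leeD (bw sAd sBm) (bw sAn sBd))).
apply: small; rewrite pnorm_ge0 ?(ltW t0) ?(ltW u0) //=.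
- exact: hA.
- exact: hB.
- by rewrite -bE; apply: pnorm_restr; exact: ltW.
- by rewrite -aE; apply: pnorm_restr; exact: ltW.
Qed.

Lemma hs_trunc_prod A B n : pspace t A -> pspace u B -> hs_array dot e (trunc_prod w n A B).
Proof.
move=> [hA _] [hB _] gamma; apply: hs_prod; first exact: e_basis.
  exact: trunc_supported.
exact: trunc_supported.
Qed.

Lemma ext_prod_pwcvg A B : pspace t A -> pspace u B ->
  pwcvg dot (fun n => trunc_prod w n A B) (ext_prod w A B).
Proof.
move=> pA pB.
have [C hC] := pcauchy_limit E_complete e_basis sigma0 (fun n => hs_trunc_prod n pA pB)
  (trunc_prod_cauchy pA pB).
by rewrite (ext_prod_limit hC).
Qed.

Lemma ext_prod_pcvg A B : pspace t A -> pspace u B ->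
  pcvg dot e sigma (fun n => trunc_prod w n A B) (ext_prod w A B).
Proof.
move=> pA pB; apply: pcauchy_pcvg => //.
  exact: trunc_prod_cauchy.
exact: ext_prod_pwcvg.
Qed.

Lemma hs_ext_prod A B : pspace t A -> pspace u B -> hs_array dot e (ext_prod w A B).
Proof.
move=> pA pB; apply: (pcauchy_hs_array e_basis sigma0 (fun n => hs_trunc_prod n pA pB)
  (trunc_prod_cauchy pA pB)).
exact: ext_prod_pwcvg.
Qed.

Lemma ext_prod_bound A B : pspace t A -> pspace u B ->
  (pnorm sigma (ext_prod w A B) <= c%:E * (pnorm t A * pnorm u B))%E.
Proof.
move=> pA pB; apply: (pcvg_bound (ltW sigma0) (pwcvg_acvg e (ext_prod_pwcvg pA pB))).
apply: nearW => n; have [hA _] := pA; have [hB _] := pB.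
apply: (le_trans (bw (trunc_supported n hA) (trunc_supported n hB))).
apply: lee_wpmul2l; first by rewrite lee_fin.
apply: lee_pmul; do ?(apply: pnorm_ge0; exact: ltW).
- by apply: pnorm_restr; exact: ltW.
- by apply: pnorm_restr; exact: ltW.
Qed.

Lemma ext_prod_pspace A B : pspace t A -> pspace u B -> pspace sigma (ext_prod w A B).
Proof.
move=> pA pB; split; first exact: hs_ext_prod.
apply: (le_lt_trans (ext_prod_bound pA pB)).
have [a a0 ->] := pspace_fin t0 pA; have [b b0 ->] := pspace_fin u0 pB.
by rewrite -!EFinM ltry.
Qed.

Lemma ext_prod_linl (k : R[i]) A A' B : pspace t A -> pspace t A' -> pspace u B ->
  ext_prod w (k *: A + A') B = k *: ext_prod w A B + ext_prod w A' B.
Proof.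
move=> pA pA' pB; apply: ext_prod_limit.
have -> : (fun n => trunc_prod w n (k *: A + A') B) =
    (fun n => k *: trunc_prod w n A B + trunc_prod w n A' B).
  apply/funext => n; have [hA _] := pA; have [hA' _] := pA'; have [hB _] := pB.
  rewrite /trunc_prod trunc_lin.
  exact: (prod_linl _ _ (trunc_supported n hA) (trunc_supported n hA') (trunc_supported n hB)).
by apply: pwcvg_lin; exact: ext_prod_pwcvg.
Qed.

Lemma ext_prod_linr (k : R[i]) A B B' : pspace t A -> pspace u B -> pspace u B' ->
  ext_prod w A (k *: B + B') = k *: ext_prod w A B + ext_prod w A B'.
Proof.
move=> pA pB pB'; apply: ext_prod_limit.
have -> : (fun n => trunc_prod w n A (k *: B + B')) =
    (fun n => k *: trunc_prod w n A B + trunc_prod w n A B').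
  apply/funext => n; have [hA _] := pA; have [hB _] := pB; have [hB' _] := pB'.
  rewrite /trunc_prod trunc_lin.
  exact: (prod_linr _ _ (trunc_supported n hA) (trunc_supported n hB) (trunc_supported n hB')).
by apply: pwcvg_lin; exact: ext_prod_pwcvg.
Qed.

Lemma ext_prod_diff A A' B B' : pspace t A -> pspace t A' -> pspace u B -> pspace u B' ->
  ext_prod w A' B' - ext_prod w A B = ext_prod w (A' - A) B' + ext_prod w A (B' - B).
Proof.
move=> pA pA' pB pB'; rewrite [A' - A]addrC -[- A]scaleN1r ext_prod_linl //.
rewrite [B' - B]addrC -[- B]scaleN1r ext_prod_linr // !scaleN1r.
by rewrite [X in _ = X + _]addrC [X in _ = _ + X]addrC addrA subrK.
Qed.

Lemma ext_prod_continuous A B (eps : R) : pspace t A -> pspace u B -> 0 < eps ->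
  exists2 delta : R, 0 < delta & forall A' B', pspace t A' -> pspace u B' ->
    (pnorm t (A' - A)%R <= delta%:E)%E -> (pnorm u (B' - B)%R <= delta%:E)%E ->
    (pnorm sigma (ext_prod w A' B' - ext_prod w A B)%R <= eps%:E)%E.
Proof.
move=> pA pB eps0.
have [a a0 aE] := pspace_fin t0 pA; have [b b0 bE] := pspace_fin u0 pB.
have b1 : 0 <= b + 1 by rewrite addr_ge0.
have [delta d0 small] := bilinear_small c0 a0 b1 eps0.
exists (Num.min delta 1); first by rewrite lt_min d0 ltr01.
move=> A' B' pA' pB' dA dB; rewrite (ext_prod_diff pA pA' pB pB').
apply: (le_trans (pnormD dot e _ _ (ltW sigma0))).
have pdA := pspaceB (ltW t0) pA' pA; have pdB := pspaceB (ltW u0) pB' pB.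
apply: (le_trans (leeD (ext_prod_bound pdA pB') (ext_prod_bound pA pdB))).
have dd : ((Num.min delta 1)%:E <= delta%:E)%E by rewrite lee_fin ge_min lexx.
apply: small; rewrite pnorm_ge0 ?(ltW t0) ?(ltW u0) //=.
- exact: le_trans dA dd.
- exact: le_trans dB dd.
- have -> : B' = (B' - B) + B by rewrite subrK.
  apply: (le_trans (pnormD dot e _ _ (ltW u0))); rewrite bE addeC EFinD.
  apply: leeD => //; apply: (le_trans dB).
  by rewrite lee_fin ge_min lexx orbT.
- by rewrite aE.
Qed.

Lemma finite_supported A : finite_array dot e A -> exists s, supported s A.
Proof.
move=> [hA finA _]; exists (fset_set [set alpha | A alpha <> 0]); split => // alpha.
rewrite in_fset_set // notin_setE /= => h; apply/eqP; apply: contra_notT h.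
by move=> /eqP.
Qed.

Lemma finite_pspace rho A : 0 < rho -> finite_array dot e A -> pspace rho A.
Proof. by move=> r0 /finite_supported[s sA]; apply: (supported_pspace _ sA); exact: ltW. Qed.

Lemma ext_prod_continuous_extension :
  continuous_extension dot e (weighted_product w) sigma t u (ext_prod w).
Proof.
split.
- move=> A B /finite_supported[s sA] /finite_supported[s' sB].
  exact: (ext_prod_supported _ sA sB).
- by move=> A B; exact: ext_prod_pspace.
move=> A B pA pB eps eps0; have e2 : 0 < eps / 2 by rewrite divr_gt0.
have [delta d0 h] := ext_prod_continuous pA pB e2.
exists delta => // A' B' pA' pB' /ltW dA /ltW dB.
apply: (le_lt_trans (h _ _ pA' pB' dA dB)).
by rewrite lte_fin ltr_pdivrMr // ltr_pMr // ltr1n.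
Qed.

(** Two continuous extensions are compared at a finite array close to both
    factors. *)
Lemma continuous_extension_unique M :
  continuous_extension dot e (weighted_product w) sigma t u M ->
  forall A B, pspace t A -> pspace u B -> M A B = ext_prod w A B.
Proof.
move=> [Mfin Mpsp Mcont] A B pA pB.
have pM := Mpsp _ _ pA pB; have pX := ext_prod_pspace pA pB.
have small (eps : R) : 0 < eps -> (pnorm sigma (M A B - ext_prod w A B)%R <= eps%:E)%E.
  move=> eps0; have e2 : 0 < eps / 2 by rewrite divr_gt0.
  have [d1 d10 h1] := Mcont _ _ pA pB _ e2.
  have [d2 d20 h2] := ext_prod_continuous pA pB e2.
  pose delta := Num.min d1 d2 / 2.
  have m0 : 0 < Num.min d1 d2 by rewrite lt_min d10.
  have delta0 : 0 < delta by rewrite divr_gt0.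
  have dlt : delta < Num.min d1 d2 by rewrite ltr_pdivrMr // ltr_pMr // ltr1n.
  have [A' fA' hA'] := finite_array_dense e_basis mbox_exhausting t0 pA delta0.
  have [B' fB' hB'] := finite_array_dense e_basis mbox_exhausting u0 pB delta0.
  have pA' := finite_pspace t0 fA'; have pB' := finite_pspace u0 fB'.
  have lt1 (x : \bar R) : (x <= delta%:E)%E -> (x < d1%:E)%E.
    by move/le_lt_trans; apply; rewrite lte_fin (lt_le_trans dlt) // ge_min lexx.
  have le2 (x : \bar R) : (x <= delta%:E)%E -> (x <= d2%:E)%E.
    by move/le_trans; apply; rewrite lee_fin (le_trans (ltW dlt)) // ge_min lexx orbT.
  apply: (le_trans (pnorm_split dot e _ (M A' B') _ (ltW sigma0))).
  rewrite (splitr eps) EFinD; apply: leeD.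
    rewrite (pnormBC dot e _ _ (ltW sigma0)); apply: ltW.
    exact: (h1 _ _ pA' pB' (lt1 _ hA') (lt1 _ hB')).
  rewrite (Mfin _ _ fA' fB').
  have [s sA'] := finite_supported fA'; have [s' sB'] := finite_supported fB'.
  rewrite -(ext_prod_supported w sA' sB').
  exact: (h2 _ _ pA' pB' (le2 _ hA') (le2 _ hB')).
apply: (pwcvg_unique (dot := dot) (u := fun=> M A B)); first exact: pwcvg_cst.
apply: (pcvg_pwcvg e_basis sigma0).
- by move=> n; case: pM.
- by case: pX.
- by move=> eps eps0; apply: nearW => n; exact: small.
Qed.

End bounded_weight.

Lemma ext_prod_weightB w w' sigma t u c c' A B :
  0 < sigma -> 0 < t -> 0 < u -> 0 <= c -> 0 <= c' ->
  prod_bounded w sigma t u c -> prod_bounded w' sigma t u c' ->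
  pspace t A -> pspace u B ->
  ext_prod w A B - ext_prod w' A B =
  ext_prod (fun alpha beta r => w alpha beta r - w' alpha beta r) A B.
Proof.
move=> s0 t0 u0 c0 c0' bw bw' pA pB; symmetry; apply: ext_prod_limit.
have -> : (fun n => trunc_prod (fun alpha beta r => w alpha beta r - w' alpha beta r) n A B) =
    (fun n => trunc_prod w n A B - trunc_prod w' n A B).
  apply/funext => n; have [hA _] := pA; have [hB _] := pB; apply/funext => gamma.
  rewrite -[RHS]/(trunc_prod w n A B gamma - trunc_prod w' n A B gamma) /trunc_prod.
  have sA := trunc_supported n hA; have sB := trunc_supported n hB.
  have ub : uniq (box n) by apply: mbox_uniq; exact: cenum_uniq.
  rewrite !(prodE _ _ ub ub sA sB).
  do 3 (rewrite -sumrB; apply: eq_bigr => ? _).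
  by rewrite mulrBr real_complexB scalerBl.
by apply: pwcvgB; [exact: (ext_prod_pwcvg s0 t0 u0 c0 bw)|exact: (ext_prod_pwcvg s0 t0 u0 c0' bw')].
Qed.

End extension.

(** * The products [star_N] and [star] *)

Section star_products.
Context {R : realType} {E : lmodType R[i]} (dot : {dot E for Num.conj})
  {K : countType} (e : K -> E) {J : countType}.
Hypothesis E_complete : complete_norm (cnorm dot).
Hypothesis e_basis : orthonormal_basis dot (cnorm dot) e.
Local Notation pnorm := (@Defs.pnorm R E dot K e J).
Local Notation pspace := (@Defs.pspace R E dot K e J).
Local Notation frakA2 := (@Defs.frakA2 R E dot K e J).
Local Notation seminorm := (@frakA2_seminorm R E dot K e J).
Implicit Types (A B : array E J) (alpha beta r gamma : mindex J)
  (w : mindex J -> mindex J -> mindex J -> R).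

Definition one_weight alpha beta r : R := 1.

Lemma vartheta_bounded n sigma rho eta : (0 < n)%N -> 0 < sigma -> 0 < rho -> 0 < eta ->
  admissible sigma rho eta -> prod_bounded dot e (vartheta R (J := J) n) sigma rho eta 1.
Proof.
move=> n0 s0 r0 e0 adm s s' A B sA sB.
apply: (pnorm_prod_le e_basis s0 r0 e0 adm (ltW r0) (ltW e0) ler01 _ sA sB).
move=> alpha beta r _ _; have /andP[v0 v1] := vartheta_range R n0 alpha beta r.
by rewrite ger0_norm // ler_wpM2r // mulr_ge0 // exprn_ge0 // ltW.
Qed.

Lemma one_bounded sigma rho eta : 0 < sigma -> 0 < rho -> 0 < eta ->
  admissible sigma rho eta -> prod_bounded dot e one_weight sigma rho eta 1.
Proof.
move=> s0 r0 e0 adm s s' A B sA sB.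
apply: (pnorm_prod_le e_basis s0 r0 e0 adm (ltW r0) (ltW e0) ler01 _ sA sB).
by move=> alpha beta r _ _; rewrite /one_weight normr1.
Qed.

(** One term of the binomial expansion of [(q + (1 - q)) ^ (k + 1)]. *)
Lemma bin2_geometric (q : R) k : 0 <= q -> q < 1 ->
  'C(k, 2)%:R * q ^+ k <= q ^+ 2 / (1 - q) ^+ 3.
Proof.
move=> q0 q1; have p0 : 0 < 1 - q by rewrite subr_gt0.
have [k2|k2] := ltnP k 2.
  by rewrite bin_small // mul0r divr_ge0 // exprn_ge0 // ltW.
rewrite ler_pdivlMr ?exprn_gt0 //.
have -> : q ^+ k = q ^+ 2 * q ^+ (k - 2) by rewrite -exprD subnKC.
have -> : 'C(k, 2)%:R * (q ^+ 2 * q ^+ (k - 2)) * (1 - q) ^+ 3 =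
    q ^+ 2 * ('C(k, 2)%:R * (q ^+ (k - 2) * (1 - q) ^+ 3)).
  by move: ((1 - q) ^+ 3) (q ^+ (k - 2)) => a b; ring.
rewrite ler_piMr ?exprn_ge0 //.
have := exprDn q (1 - q) k.+1; rewrite addrCA subrr addr0 expr1n => one.
have i3 : (3 < k.+2)%N by [].
rewrite {1}(bigD1 (Ordinal i3)) //= in one.
have : 'C(k.+1, 3)%:R * (q ^+ (k - 2) * (1 - q) ^+ 3) <= 1.
  rewrite [leRHS]one mulr_natl (_ : k.+1 - 3 = k - 2)%N; last by lia.
  rewrite lerDl; apply: sumr_ge0 => i _.
  by rewrite mulrn_wge0 // mulr_ge0 ?exprn_ge0 // ltW.
apply: le_trans; rewrite ler_wpM2r //.
  by rewrite mulr_ge0 ?exprn_ge0 // ltW.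
by rewrite ler_nat binS leq_addl.
Qed.

Lemma defect_bounded n sigma rho eta t u : (0 < n)%N -> 0 < sigma -> 0 < rho -> 0 < eta ->
  admissible sigma rho eta -> rho < t -> eta < u ->
  let q := Num.max (rho / t) (eta / u) in
  prod_bounded dot e (fun alpha beta r => vartheta R (J := J) n alpha beta r - one_weight alpha beta r)
    sigma t u (q ^+ 2 / (n%:R * (1 - q) ^+ 3)).
Proof.
move=> n0 s0 r0 e0 adm rt eu q s s' A B sA sB.
have t0 : 0 < t by exact: lt_trans rt.
have u0 : 0 < u by exact: lt_trans eu.
have q1 : q < 1 by rewrite /q gt_max !ltr_pdivrMr // !mul1r rt eu.
have q0 : 0 <= q by rewrite /q le_max divr_ge0 // ltW.
have nR : 0 < n%:R :> R by rewrite ltr0n.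
have p3 : 0 < (1 - q) ^+ 3 by rewrite exprn_gt0 // subr_gt0.
apply: (pnorm_prod_le e_basis s0 r0 e0 adm (ltW t0) (ltW u0) _ _ sA sB).
  by rewrite divr_ge0 ?exprn_ge0 // ltW // mulr_gt0.
move=> alpha beta r ra rb; have /andP[v0 v1] := vartheta_range R n0 alpha beta r.
rewrite /one_weight distrC ger0_norm ?subr_ge0 //.
set m := mdegree alpha; set k := mdegree beta.
have rq : rho <= q * t by rewrite -ler_pdivrMr // le_max lexx.
have eq_ : eta <= q * u by rewrite -ler_pdivrMr // le_max lexx orbT.
have re : rho ^+ m * eta ^+ k <= q ^+ (m + k) * (t ^+ m * u ^+ k).
  rewrite exprD mulrACA -!exprMn; apply: ler_pM; rewrite ?exprn_ge0 ?(ltW r0) ?(ltW e0) //.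
    by rewrite lerXn2r // nnegrE ?mulr_ge0 // ltW.
  by rewrite lerXn2r // nnegrE ?mulr_ge0 // ltW.
have re0 : 0 <= rho ^+ m * eta ^+ k by rewrite mulr_ge0 // exprn_ge0 // ltW.
have tu0 : 0 <= t ^+ m * u ^+ k by rewrite mulr_ge0 // exprn_ge0 // ltW.
apply: (le_trans (ler_wpM2r re0 (vartheta_lower R n0 ra rb))).
have b0 : 0 <= 'C(m + k, 2)%:R / n%:R :> R by rewrite divr_ge0.
apply: (le_trans (ler_wpM2l b0 re)).
rewrite [leLHS]mulrA ler_wpM2r //; apply: (@le_trans _ _ (q ^+ 2 / (1 - q) ^+ 3 / n%:R)).
  by rewrite mulrAC ler_wpM2r ?invr_ge0 ?(ltW nR) // bin2_geometric.
by rewrite -[leLHS]mulrA -invfM [_ * n%:R]mulrC.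
Qed.

Section one_pair.
Variables (sigma rho eta : R).
Hypotheses (s1 : 1 <= sigma) (rho0 : 0 < rho) (eta0 : 0 < eta)
  (adm : admissible sigma rho eta).

Let sigma0 : 0 < sigma. Proof. exact: lt_le_trans s1. Qed.

Lemma star_extension w : prod_bounded dot e w sigma rho eta 1 ->
  unique_continuous_extension dot e (weighted_product w) sigma rho eta (ext_prod dot w) /\
  forall A B, pspace rho A -> pspace eta B ->
    (pnorm sigma (ext_prod dot w A B) <= pnorm rho A * pnorm eta B)%E.
Proof.
move=> bw; split; [split|].
- exact: (ext_prod_continuous_extension E_complete e_basis sigma0 rho0 eta0 ler01 bw).
- exact: (continuous_extension_unique E_complete e_basis sigma0 rho0 eta0 ler01 bw).
move=> A B pA pB; rewrite -[leRHS]mul1e.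
exact: (ext_prod_bound E_complete e_basis sigma0 rho0 eta0 ler01 bw).
Qed.

Lemma star_rate n t u : (0 < n)%N -> rho < t -> eta < u ->
  let q := Num.max (rho / t) (eta / u) in q < 1 /\
  forall A B, pspace t A -> pspace u B ->
    (pnorm sigma (ext_prod dot (vartheta R (J := J) n) A B - ext_prod dot one_weight A B)%R <=
     (q ^+ 2 / (n%:R * (1 - q) ^+ 3))%:E * (pnorm t A * pnorm u B))%E.
Proof.
move=> n0 rt eu q.
have t0 : 0 < t by exact: lt_trans rt.
have u0 : 0 < u by exact: lt_trans eu.
have q1 : q < 1 by rewrite /q gt_max !ltr_pdivrMr // !mul1r rt eu.
have q0 : 0 <= q by rewrite /q le_max divr_ge0 // ltW.
split => // A B pA pB.
have pA' := pspace_le (ltW rho0) (ltW rt) pA; have pB' := pspace_le (ltW eta0) (ltW eu) pB.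
rewrite (ext_prod_weightB E_complete e_basis sigma0 rho0 eta0 ler01 ler01
  (vartheta_bounded n0 sigma0 rho0 eta0 adm) (one_bounded sigma0 rho0 eta0 adm) pA' pB').
have c0 : 0 <= q ^+ 2 / (n%:R * (1 - q) ^+ 3).
  by rewrite divr_ge0 ?exprn_ge0 // mulr_ge0 // exprn_ge0 // subr_ge0 ltW.
exact: (ext_prod_bound E_complete e_basis sigma0 t0 u0 c0
  (defect_bounded n0 sigma0 rho0 eta0 adm rt eu)).
Qed.

End one_pair.

(** The weights [2 sigma] serve for every [sigma >= 1], so that the products
    act on the intersection of all the weighted spaces. *)
Lemma admissible_double (sigma : R) : 1 <= sigma -> admissible sigma (2 * sigma) (2 * sigma).
Proof.
move=> s1; have s2 : 1 <= sigma ^+ 2 by rewrite exprn_ege1.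
rewrite /admissible exprMn; set t := sigma ^+ 2 in s2 *.
have t1 : 0 < 1 + t by lra.
have t4 : 0 < 1 + 2 ^+ 2 * t by lra.
rewrite -[leRHS]mul1r ler_pdivlMr //.
have xE : (1 + 2 ^+ 2 * t)^-1 * (1 + 2 ^+ 2 * t) = 1 by rewrite mulVf // gt_eqF.
have x0 : 0 < (1 + 2 ^+ 2 * t)^-1 by rewrite invr_gt0.
have h : (1 + 2 ^+ 2 * t)^-1 * (2 + 2 * t) <= 1 by rewrite -[leRHS]xE ler_wpM2l ?ltW //; lra.
by move: h; set x := _^-1; lra.
Qed.

Definition double_bounded w : Prop :=
  forall sigma : R, 1 <= sigma -> prod_bounded dot e w sigma (2 * sigma) (2 * sigma) 1.

Lemma vartheta_double n : (0 < n)%N -> double_bounded (vartheta R (J := J) n).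
Proof.
move=> n0 sigma s1; have s0 : 0 < sigma by exact: lt_le_trans s1.
by apply: vartheta_bounded => //; rewrite ?mulr_gt0 //; exact: admissible_double.
Qed.

Lemma one_double : double_bounded one_weight.
Proof.
move=> sigma s1; have s0 : 0 < sigma by exact: lt_le_trans s1.
by apply: one_bounded => //; rewrite ?mulr_gt0 //; exact: admissible_double.
Qed.

Lemma frakA2_pspace A rho : frakA2 A -> 0 < rho -> pspace rho A.
Proof.
move=> [hA fA] r0; have [r1|r1] := leP 1 rho; first by split => //; exact: fA.
by apply: (pspace_le (ltW r0) (ltW r1)); split => //; exact: fA.
Qed.

Lemma frakA2_ext_prod w A B : double_bounded w -> frakA2 A -> frakA2 B ->
  frakA2 (ext_prod dot w A B).
Proof.
move=> bw fA fB.
have h (rho : R) : 1 <= rho -> pspace rho (ext_prod dot w A B).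
  move=> r1; have r0 : 0 < rho by exact: lt_le_trans r1.
  have r2 : 0 < 2 * rho by rewrite mulr_gt0.
  exact: (ext_prod_pspace E_complete e_basis r0 r2 r2 ler01 (bw _ r1)
    (frakA2_pspace fA r2) (frakA2_pspace fB r2)).
split; first by case: (h 1 (lexx _)).
by move=> rho /h[].
Qed.

Lemma jointly_continuous_sub (D : set (array E J)) w : double_bounded w ->
  (forall A, D A -> frakA2 A) -> jointly_continuous D seminorm (ext_prod dot w).
Proof.
move=> bw sub A B /sub fA /sub fB [rho r1] eps eps0 /=.
have r0 : 0 < rho by exact: lt_le_trans r1.
have r2 : 0 < 2 * rho by rewrite mulr_gt0.
have r21 : 1 <= 2 * rho by rewrite (le_trans r1) // ler_peMl ?ler1n // ltW.
have e2 : 0 < eps / 2 by rewrite divr_gt0.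
have [delta d0 h] := ext_prod_continuous E_complete e_basis r0 r2 r2 ler01 (bw _ r1)
  (frakA2_pspace fA r2) (frakA2_pspace fB r2) e2.
exists [:: exist (fun rho : R => 1 <= rho) (2 * rho) r21], delta; split => // A' B' /sub fA' /sub fB' near.
have [dA dB] := near _ (mem_head _ _).
apply: (le_lt_trans (h _ _ (frakA2_pspace fA' r2) (frakA2_pspace fB' r2) (ltW dA) (ltW dB))).
by rewrite lte_fin ltr_pdivrMr // ltr_pMr // ltr1n.
Qed.

End star_products.

(** * Products of elementary symmetric polynomials in signs *)

Section sign_polynomials.
Context {R : realType} (n : nat) (eps : 'I_n -> R).
Hypothesis sign_eps : forall i, eps i ^+ 2 = 1.
Implicit Types (I D : {set 'I_n}).

Definition chi I : R := \prod_(i in I) eps i.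

Definition esym (k : nat) : R := \sum_(I : {set 'I_n} | #|I| == k) chi I.

Definition symdiff I D : {set 'I_n} := [set i | (i \in I) (+) (i \in D)]%SET.

Lemma symdiffK I : involutive (symdiff I).
Proof. by move=> D; apply/finset.setP => i; rewrite !inE addbA addbb. Qed.

Lemma chi_mul I D : chi I * chi D = chi (symdiff I D).
Proof.
rewrite /chi !(big_mkcond (fun i => i \in _)) /= -big_split; apply: eq_bigr => i _ /=.
rewrite !inE; case: (i \in I); case: (i \in D); rewrite ?mulr1 ?mul1r //=.
by rewrite -expr2 sign_eps.
Qed.

Lemma card_symdiff I D : #|symdiff I D| = (#|D| - #|I :&: D| + #|I :\: D|)%N.
Proof.
have -> : symdiff I D = (D :\: I) :|: (I :\: D).
  by apply/finset.setP => i; rewrite !inE; case: (i \in I); case: (i \in D).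
rewrite cardsU (_ : _ :&: _ = finset.set0) ?cards0 ?subn0; last first.
  by apply/finset.setP => i; rewrite !inE; case: (i \in I); case: (i \in D).
by rewrite -(cardsID I D) [D :&: I]finset.setIC addKn.
Qed.

(** A set is determined by its traces on [D] and on the complement of [D]. *)
Lemma card_split D p q :
  #|[set I : {set 'I_n} | (#|I :&: D| == p) && (#|I :\: D| == q)]%SET| =
  ('C(#|D|, p) * 'C(n - #|D|, q))%N.
Proof.
have -> : (n - #|D|)%N = #|~: D| by have := cardsC D; rewrite card_ord; lia.
rewrite -!cards_draws -cardsX.
set A := [set B : {set 'I_n} | (B \subset D) && (#|B| == p)]%SET.
set B := [set C : {set 'I_n} | (C \subset ~: D) && (#|C| == q)]%SET.
pose f (x : {set 'I_n} * {set 'I_n}) := x.1 :|: x.2.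
have fD (x : {set 'I_n} * {set 'I_n}) : x \in finset.setX A B -> f x :&: D = x.1 /\ f x :\: D = x.2.
  case: x => x y /=; rewrite !inE /= => /andP[/andP[xD _] /andP[yD _]]; rewrite /f /=; split.
    rewrite finset.setIUl (finset.setIidPl xD) (_ : y :&: D = finset.set0) ?finset.setU0 //.
    by apply/eqP; rewrite finset.setI_eq0 finset.disjoints_subset.
  rewrite finset.setDUl (_ : x :\: D = finset.set0) ?finset.set0U; last by apply/eqP; rewrite finset.setD_eq0.
  by rewrite finset.setDE (finset.setIidPl yD).
rewrite -(@card_in_imset _ _ f (mem (finset.setX A B))); last first.
  move=> x y xX yX fxy; have [h1 h2] := fD _ xX; have [h3 h4] := fD _ yX.
  by rewrite (surjective_pairing x) (surjective_pairing y) -h1 -h2 -h3 -h4 fxy.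
apply: eq_card => I; rewrite !inE; apply/idP/imsetP => [/andP[Ip Iq]|[x xX ->]].
  exists (I :&: D, I :\: D); last by rewrite /f /= finset.setID.
  by rewrite !inE /= Ip Iq finset.subsetIr finset.setDE finset.subsetIr.
have [-> ->] := fD _ xX.
by move: xX; rewrite !inE => /andP[/andP[_ ->] /andP[_ ->]].
Qed.

(** [chi I * chi D] depends on the symmetric difference only.  A set [D] of
    cardinal [k + l - 2 r] is the symmetric difference of a [k]-set [I] and an
    [l]-set exactly when [I] has [k - r] points in [D] and [r] outside. *)
Lemma esym_mul (k l : nat) : esym k * esym l =
  \sum_(r <- iota 0 (minn k l).+1)
    ('C(k + l - 2 * r, k - r) * 'C(n - (k + l - 2 * r), r))%N%:R * esym (k + l - 2 * r)%N.
Proof.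
have -> : esym k * esym l = \sum_D chi D *
    #|[set I : {set 'I_n} | (#|I| == k) && (#|symdiff I D| == l)]%SET|%:R.
  rewrite /esym big_distrlr /=.
  transitivity (\sum_(I : {set 'I_n} | #|I| == k) \sum_(D | #|symdiff I D| == l) chi D).
    apply: eq_bigr => I _; rewrite (reindex_inj (inv_inj (symdiffK I))) /=.
    by apply: eq_bigr => D _; rewrite chi_mul symdiffK.
  rewrite (exchange_big_dep predT) //=; apply: eq_bigr => D _.
  rewrite sumr_const -[LHS]mulr_natr; congr (_ * _); by congr _%:R; apply: eq_card => I; rewrite !inE.
have cnt D : #|[set I : {set 'I_n} | (#|I| == k) && (#|symdiff I D| == l)]%SET| =
    (\sum_(r <- iota 0 (minn k l).+1 | #|D| == k + l - 2 * r)
      'C(#|D|, k - r) * 'C(n - #|D|, r))%N.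
  under [RHS]eq_bigr do rewrite -card_split.
  rewrite -sum1dep_card.
  transitivity (\sum_(I : {set 'I_n}) \sum_(r <- iota 0 (minn k l).+1 | #|D| == k + l - 2 * r)
      ((#|I :&: D| == k - r) && (#|I :\: D| == r)))%N.
    rewrite big_mkcond; apply: eq_bigr => I _.
    have := cardsID D I; have := subset_leq_card (finset.subsetIr I D); rewrite card_symdiff.
    move: #|I :&: D| #|I :\: D| #|D| #|I| => u v d i ud uv.
    case: ifPn => [/andP[/eqP ik /eqP dl]|h].
      have vs : v \in iota 0 (minn k l).+1.
        by rewrite mem_iota ltnS leq_min; apply/andP; split; lia.
      have us : uniq (iota 0 (minn k l).+1) by exact: iota_uniq.
      rewrite big_mkcond (bigD1_seq v vs us) [X in _ = (_ + X)%N]big1 ?addn0.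
        have -> : d == (k + l - 2 * v)%N by apply/eqP; lia.
        have -> : u == (k - v)%N by apply/eqP; lia.
        by rewrite eqxx.
      by move=> r /negPf rv; rewrite [v == r]eq_sym rv andbF; case: ifP.
    rewrite big_seq_cond big1; [by []|move=> r]. rewrite mem_iota ltnS leq_min /= => /andP[/andP[rk rl] /eqP dE].
    case: eqP => // uE; case: eqP => // vE; exfalso; move: h => /negP; apply.
    by apply/andP; split; apply/eqP; lia.
  rewrite exchange_big /=; apply: eq_bigr => r _.
  by rewrite -sum1dep_card [RHS]big_mkcond; apply: eq_bigr => I _; case: ifP.
under eq_bigr do rewrite cnt natr_sum mulr_sumr big_mkcond.
rewrite exchange_big /=; apply: eq_bigr => r _.
rewrite /esym mulr_sumr [RHS]big_mkcond; apply: eq_bigr => D _.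
by case: eqP => // ->; rewrite mulrC.
Qed.

Lemma esym_gt k : (n < k)%N -> esym k = 0.
Proof.
move=> nk; rewrite /esym big1 // => I /eqP Ik.
by have := max_card (mem I); rewrite card_ord Ik leqNgt nk.
Qed.

Lemma esym0 : esym 0 = 1.
Proof.
rewrite /esym (big_pred1 finset.set0) => [|I]; last by rewrite cards_eq0.
by rewrite /chi big_set0.
Qed.

End sign_polynomials.

Section psi_products.
Context {R : realType} {J : countType} {d : measure_display} {Omega : measurableType d}
  (xi : J * nat -> Omega -> R).
Implicit Types (alpha beta r gamma : mindex J).

Lemma QpolyE n j k x : Qpoly xi n j k x =
  k`!%:R * (Num.sqrt n%:R) ^- k * esym (fun i : 'I_n => xi (j, nat_of_ord i) x) k.
Proof. by []. Qed.

Definition psi n j (k : nat) x : R := Qpoly xi n j k x / Num.sqrt k`!%:R.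

Lemma Psi_sup n alpha s x : uniq s -> {subset finsupp alpha <= s} ->
  Psi xi n alpha x = \prod_(j <- s) psi n j (alpha j) x.
Proof.
move=> us sub; rewrite /Psi (big_finsupp _ us) // => j ->.
rewrite /psi /= QpolyE esym0 expr0 invr1 !mulr1 fact0 sqrtr1 divr1 //.
Qed.

Lemma Psi0 n x : Psi xi n mzero x = 1.
Proof.
rewrite (@Psi_sup n mzero [::]) ?big_nil // => j.
by rewrite mem_finsupp mzeroE.
Qed.

Lemma Psi_out n alpha x : ~ in_range n alpha -> Psi xi n alpha x = 0.
Proof.
move=> /existsNP[j /negP]; rewrite -ltnNge => nj.
have ja : j \in finsupp alpha by rewrite mem_finsupp -lt0n (leq_trans _ nj).
by rewrite /Psi (bigD1_seq j) ?fset_uniq //= QpolyE esym_gt // mulr0 !mul0r.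
Qed.

Variables (n : nat) (x : Omega).
Hypotheses (n0 : (0 < n)%N) (sign_x : forall i, xi i x ^+ 2 = 1).

Lemma psi_mul j k l : psi n j k x * psi n j l x =
  \sum_(r <- iota 0 (minn k l).+1)
    ((r`! * 'C(k, r) * 'C(l, r))%:R * Num.sqrt ((k + l - 2 * r)%N`!%:R / (k`!%:R * l`!%:R)) *
     (((n - (k + l - 2 * r)%N) ^_ r)%:R / n%:R ^+ r)) * psi n j (k + l - 2 * r)%N x.
Proof.
rewrite /psi !QpolyE; set es := esym _.
have -> : k`!%:R * Num.sqrt n%:R ^- k * es k / Num.sqrt k`!%:R *
    (l`!%:R * Num.sqrt n%:R ^- l * es l / Num.sqrt l`!%:R) =
    (k`!%:R * l`!%:R * (Num.sqrt n%:R ^- k * Num.sqrt n%:R ^- l) /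
     (Num.sqrt k`!%:R * Num.sqrt l`!%:R)) * (es k * es l) by rewrite invfM; ring.
rewrite /es esym_mul // mulr_sumr big_seq [RHS]big_seq; apply: eq_bigr => r.
rewrite mem_iota ltnS leq_min /= => /andP[rk rl]; rewrite -/es.
set g := (k + l - 2 * r)%N.
have f0 m : 0 < m`!%:R :> R by rewrite ltr0n fact_gt0.
have sf m : 0 < Num.sqrt m`!%:R :> R by rewrite sqrtr_gt0.
have nR : 0 < n%:R :> R by rewrite ltr0n.
have sn : 0 < Num.sqrt n%:R :> R by rewrite sqrtr_gt0.
have sE : Num.sqrt n%:R ^- k * Num.sqrt n%:R ^- l =
    Num.sqrt n%:R ^- g / n%:R ^+ r :> R.
  have -> : n%:R ^+ r = Num.sqrt n%:R ^+ (2 * r) :> R by rewrite exprM sqr_sqrtr // ltW.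
  by rewrite -!invfM -!exprD; congr (_ ^- _); rewrite /g; lia.
have fE : k`!%:R * l`!%:R * 'C(g, k - r)%:R =
    r`!%:R * r`!%:R * 'C(k, r)%:R * 'C(l, r)%:R * g`!%:R :> R.
  rewrite -!natrM; congr _%:R.
  have := @bin_fact g (k - r); have -> : (g - (k - r) = l - r)%N by rewrite /g; lia.
  by move=> <-; [rewrite -(bin_fact rk) -(bin_fact rl); ring|rewrite /g; lia].
have qE : Num.sqrt (g`!%:R / (k`!%:R * l`!%:R)) / Num.sqrt g`!%:R =
    (Num.sqrt k`!%:R * Num.sqrt l`!%:R)^-1 :> R.
  rewrite sqrtrM ?(ltW (f0 _)) // sqrtrV ?mulr_ge0 ?(ltW (f0 _)) // sqrtrM ?(ltW (f0 _)) //.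
  by rewrite mulrAC divff ?mul1r // gt_eqF.
have -> : (r`! * 'C(k, r) * 'C(l, r))%:R * Num.sqrt (g`!%:R / (k`!%:R * l`!%:R)) *
    (((n - g) ^_ r)%:R / n%:R ^+ r) * (g`!%:R * Num.sqrt n%:R ^- g * es g / Num.sqrt g`!%:R) =
    (r`!%:R * r`!%:R * 'C(k, r)%:R * 'C(l, r)%:R * g`!%:R) * 'C(n - g, r)%:R *
    (Num.sqrt n%:R ^- g / n%:R ^+ r) *
    (Num.sqrt (g`!%:R / (k`!%:R * l`!%:R)) / Num.sqrt g`!%:R) * es g.
  by rewrite -bin_ffact !natrM; ring.
rewrite -fE sE qE natrM.
by move: (es g) ('C(g, _)%:R) => p q; ring.
Qed.

(** Coordinatewise this is [psi_mul]; the product over the coordinates of the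
    sums over exponents is a sum over multi-indices.  A contraction out of
    range has both [vartheta = 0] and [Psi = 0]. *)
Lemma Psi_mul alpha beta : Psi xi n alpha x * Psi xi n beta x =
  \sum_(r <- below2 alpha beta)
    coef_c R alpha beta r * vartheta R n alpha beta r * Psi xi n (mcontract alpha beta r) x.
Proof.
have su := supp2_uniq alpha beta; have sl := @supp2l _ alpha beta; have sr := @supp2r _ alpha beta.
case: (pselect (in_range n alpha /\ in_range n beta)) => [[an bn]|h]; last first.
  rewrite big1 => [|r _].
    by apply/eqP; rewrite mulf_eq0; case/not_andP: h => /Psi_out ->; rewrite eqxx ?orbT.
  by rewrite /vartheta asboolF ?mulr0 ?mul0r // => -[? ? _]; exact: h.
rewrite (Psi_sup _ _ su sl) (Psi_sup _ _ su sr) -big_split /=.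
under eq_bigr do rewrite psi_mul.
rewrite -(mbox_distr _ (fun (j : J) (r : nat) => ((r`! * 'C(alpha j, r) * 'C(beta j, r))%:R *
  Num.sqrt ((alpha j + beta j - 2 * r)%N`!%:R / ((alpha j)`!%:R * (beta j)`!%:R)) *
     (((n - (alpha j + beta j - 2 * r)%N) ^_ r)%:R / n%:R ^+ r)) *
  psi n j (alpha j + beta j - 2 * r)%N x)) //.
rewrite -/(below2 alpha beta) big_seq [RHS]big_seq; apply: eq_bigr => r.
rewrite mem_below2 => /andP[/mlebP ra /mlebP rb].
rewrite (Psi_sup _ _ su (@supp2_mcontract _ alpha beta r)) big_split /=.
under [X in _ = _ * X]eq_bigr do rewrite mcontractE.
case: (pselect (in_range n (mcontract alpha beta r))) => [gn|gN]; last first.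
  move: (gN) => /existsNP[j /negP]; rewrite -ltnNge mcontractE => nj.
  have js : j \in supp2 alpha beta.
    by apply: (@supp2_mcontract _ alpha beta r); rewrite mem_finsupp mcontractE -lt0n (leq_trans _ nj).
  have p0 : psi n j (alpha j + beta j - 2 * r j) x = 0 by rewrite /psi QpolyE esym_gt // mulr0 mul0r.
  rewrite [X in _ * X = _](bigD1_seq j) //= p0 mul0r mulr0.
  by rewrite /vartheta asboolF ?mulr0 ?mul0r // => -[].
congr (_ * _); rewrite big_split /=; congr (_ * _).
  rewrite big_split /= /coef_c; congr (_ * _).
    by rewrite -natr_prod !big_split /= -(mfact_sup su) -?(mbin_sup su) // => j /(mle_finsupp ra) /sl.
  rewrite (mfact_sup su sl) (mfact_sup su sr) (mfact_sup su (@supp2_mcontract _ alpha beta r)).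
  rewrite !natr_prod -big_split /= -prodf_div /=.
  under [in RHS]eq_bigr do rewrite mcontractE.
  elim: (supp2 alpha beta) => [|j s ih]; first by rewrite !big_nil sqrtr1.
  rewrite !big_cons [in RHS]sqrtrM ?divr_ge0 ?mulr_ge0 ?ler0n //; congr (_ * _); exact: ih.
rewrite /vartheta asboolT; last by split.
rewrite (@big_finsupp J R 1 *%R r _ _ su) /=.
- by apply: eq_bigr => j _; rewrite mcontractE.
- by move=> j /(mle_finsupp ra) /sl.
- by move=> j ->; rewrite ffactn0 expr0 divr1.
Qed.

End psi_products.

(** * Expectations of sign polynomials *)

Section bounded_random_variables.
Context {R : realType} {d : measure_display} {Omega : measurableType d}
  (P : probability Omega R).
Implicit Types f g : Omega -> R.

Definition bounded_variable f : Prop :=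
  measurable_fun setT f /\ exists M, forall x, `|f x| <= M.

Lemma bounded_variable_cst c : bounded_variable (fun=> c).
Proof. by split; [exact: measurable_cst|exists `|c|]. Qed.

Lemma bounded_variableD f g : bounded_variable f -> bounded_variable g ->
  bounded_variable (fun x => f x + g x).
Proof.
move=> [mf [a fa]] [mg [b gb]]; split; first exact: measurable_funD.
by exists (a + b) => x; rewrite (le_trans (ler_normD _ _)) // lerD.
Qed.

Lemma bounded_variableM f g : bounded_variable f -> bounded_variable g ->
  bounded_variable (fun x => f x * g x).
Proof.
move=> [mf [a fa]] [mg [b gb]]; split; first exact: measurable_funM.
by exists (a * b) => x; rewrite normrM ler_pM.
Qed.

Lemma bounded_variableZ c f : bounded_variable f -> bounded_variable (fun x => c * f x).
Proof. by move=> bf; apply: bounded_variableM => //; exact: bounded_variable_cst. Qed.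

Lemma bounded_variable_sum (T : Type) (s : seq T) (Q : pred T) (F : T -> Omega -> R) :
  (forall i, bounded_variable (F i)) -> bounded_variable (fun x => \sum_(i <- s | Q i) F i x).
Proof.
move=> bF; elim: s => [|i s ih].
  under [X in bounded_variable X]eq_fun do rewrite big_nil.
  exact: bounded_variable_cst.
under [X in bounded_variable X]eq_fun do rewrite big_cons.
by case: (Q i) => //; apply: bounded_variableD.
Qed.

Lemma bounded_variable_prod (T : Type) (s : seq T) (Q : pred T) (F : T -> Omega -> R) :
  (forall i, bounded_variable (F i)) -> bounded_variable (fun x => \prod_(i <- s | Q i) F i x).
Proof.
move=> bF; elim: s => [|i s ih].
  under [X in bounded_variable X]eq_fun do rewrite big_nil.
  exact: bounded_variable_cst.
under [X in bounded_variable X]eq_fun do rewrite big_cons.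
by case: (Q i) => //; apply: bounded_variableM.
Qed.

Lemma bounded_variable_indic (A : set Omega) : measurable A -> bounded_variable (\1_A).
Proof.
move=> mA; split; first exact: measurable_indic.
by exists 1 => x; rewrite indicE ger0_norm ?ler0n // lern1 leq_b1.
Qed.

Lemma bounded_variable_integrable f : bounded_variable f -> P.-integrable setT (EFin \o f).
Proof.
move=> [mf [M fM]]; apply: measurable_bounded_integrable => //.
  by apply: le_lt_trans (probability_le1 P measurableT) _; rewrite ltry.
exists M; split; first exact: num_real.
by move=> y My x _; exact: le_trans (fM x) (ltW My).
Qed.

Definition mean f : R := Rintegral P setT f.

Lemma mean_cst c : mean (fun=> c) = c.
Proof.
rewrite /mean Rintegral_cst; last exact: measurableT.
by rewrite -[RHS]mulr1; congr (_ * _); exact: (congr1 fine (probability_setT P)).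
Qed.

Lemma meanD f g : bounded_variable f -> bounded_variable g ->
  mean (fun x => f x + g x) = mean f + mean g.
Proof. by move=> bf bg; rewrite /mean RintegralD //; exact: bounded_variable_integrable. Qed.

Lemma meanZ c f : bounded_variable f -> mean (fun x => c * f x) = c * mean f.
Proof. by move=> bf; rewrite /mean RintegralZl //; exact: bounded_variable_integrable. Qed.

Lemma mean_sum (T : Type) (s : seq T) (Q : pred T) (F : T -> Omega -> R) :
  (forall i, bounded_variable (F i)) ->
  mean (fun x => \sum_(i <- s | Q i) F i x) = \sum_(i <- s | Q i) mean (F i).
Proof.
move=> bF; elim: s => [|i s ih].
  rewrite big_nil; under [X in mean X]eq_fun do rewrite big_nil.
  exact: mean_cst.
rewrite big_cons; under [X in mean X]eq_fun do rewrite big_cons.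
case: (Q i) => //; rewrite meanD ?ih //; exact: bounded_variable_sum.
Qed.

Lemma mean_indic (A : set Omega) : measurable A -> mean (\1_A) = fine (P A).
Proof. by move=> mA; rewrite /mean /Rintegral integral_indic // setIT. Qed.

Lemma integral_mean f : bounded_variable f -> (\int[P]_x (f x)%:E = (mean f)%:E)%E.
Proof.
by move=> bf; rewrite /mean fineK //; apply: integrable_fin_num => //; exact: bounded_variable_integrable.
Qed.

End bounded_random_variables.

Section random_signs.
Context {R : realType} {d : measure_display} {Omega : measurableType d}
  (P : probability Omega R) {I : choiceType} (xi : I -> Omega -> R).
Hypothesis xi_signs : independent_signs P xi.

(** A version of [xi] that takes the values 1 and -1 everywhere. *)
Definition sign i w : R := if xi i w == 1 then 1 else -1.

Lemma sign_sqr i w : sign i w ^+ 2 = 1.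
Proof. by rewrite /sign; case: ifP; rewrite ?sqrrN expr1n. Qed.

Definition positive (s : seq I) : set Omega := \bigcap_(i in [set` s]) (xi i @^-1` [set 1]).

Lemma measurable_positive s : measurable (positive s).
Proof.
have [mxi _ _] := xi_signs.
apply: (fin_bigcap_measurable (finite_seq s)) => i _.
by rewrite -[_ @^-1` _]setTI; apply: mxi.
Qed.

Lemma indic_positive_cons i s w :
  \1_(positive (i :: s)) w = (xi i w == 1)%:R * \1_(positive s) w :> R.
Proof.
rewrite !indicE -natrM mulnb; congr (_%:R); congr nat_of_bool.
apply/idP/andP => [/set_mem h|[/eqP h /set_mem hs]].
  split; first by apply/eqP; apply: h; rewrite /= mem_head.
  by apply/mem_set => k ks; apply: h; rewrite /= inE ks orbT.
by apply/mem_set => k; rewrite /= inE => /orP[/eqP ->|ks] //; exact: hs.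
Qed.

Lemma prob_positive s : uniq s -> fine (P (positive s)) = 2 ^- size s.
Proof.
have [_ half indep] := xi_signs; move=> us.
have -> : positive s = \bigcap_(i in [set` [fset i in s]%fset]) (xi i @^-1` [set 1]).
  by apply/seteqP; split => w h i; rewrite /= ?inE => si; apply: h; rewrite /= ?inE.
rewrite (indep _ (fun=> [set 1])) //.
have -> : (\prod_(i <- [fset i in s]%fset) P (xi i @^-1` [set 1%R]) =
    \prod_(i <- s) (2^-1 : R)%:E)%E.
  under eq_bigr do rewrite (half _).1.
  by apply: perm_big; apply: uniq_perm => // i; rewrite inE.
suff -> : (\prod_(i <- s) (2^-1 : R)%:E)%E = (2 ^- size s : R)%:E by [].
elim: s {us} => [|i s ih]; first by rewrite big_nil expr0 invr1.
by rewrite big_cons ih -EFinM exprS invfM.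
Qed.

Lemma bounded_sign i : bounded_variable (sign i).
Proof.
have -> : sign i = (fun w => 2 * \1_(positive [:: i]) w + -1).
  apply/funext => w; rewrite indic_positive_cons /sign.
  have -> : positive [::] = setT by apply/seteqP; split => // ? _ ?.
  by rewrite indicT; case: ifP => _ /=; ring.
apply: bounded_variableD; last exact: bounded_variable_cst.
by apply: bounded_variableZ; apply: bounded_variable_indic; exact: measurable_positive.
Qed.

(** Since [sign i = 2 * \1_(xi i = 1) - 1], the expectation splits into two
    equal probabilities of opposite signs. *)
Lemma mean_signs_positive s t : uniq (s ++ t) ->
  mean P (fun w => \prod_(i <- s) sign i w * \1_(positive t) w) =
  (s == [::])%:R * 2 ^- size t.
Proof.
have bp u : bounded_variable (\1_(positive u) : Omega -> R).
  by apply: bounded_variable_indic; exact: measurable_positive.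
have bs u v : bounded_variable (fun w => \prod_(i <- u) sign i w * \1_(positive v) w).
  by apply: bounded_variableM => //; apply: bounded_variable_prod; exact: bounded_sign.
elim: s t => [|i s ih] t.
  move=> ut; under [X in mean P X]eq_fun do rewrite big_nil mul1r.
  by rewrite mean_indic ?prob_positive ?mul1r //; exact: measurable_positive.
rewrite cat_cons cons_uniq mem_cat negb_or -andbA => /and3P[iNs iNt ust].
have -> : (fun w => \prod_(k <- i :: s) sign k w * \1_(positive t) w) =
    (fun w => 2 * (\prod_(k <- s) sign k w * \1_(positive (i :: t)) w) +
              -1 * (\prod_(k <- s) sign k w * \1_(positive t) w)).
  apply/funext => w; rewrite indic_positive_cons big_cons {1}/sign.
  by move: (\prod_(_ <- s) _) (\1_(positive t) w) => p q; case: ifP => _ /=; ring.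
rewrite meanD ?meanZ ?ih //; do ?exact: bounded_variableZ.
  by rewrite mul0r /= exprS invfM; case: eqP => _; rewrite /= ?mul1r ?mul0r ?mulr0 ?addr0 // mulrA divff ?mul1r ?mulN1r ?subrr.
by rewrite -cat1s uniq_catCA /= mem_cat negb_or iNs iNt.
Qed.

Lemma mean_signs s : uniq s -> mean P (fun w => \prod_(i <- s) sign i w) = (s == [::])%:R.
Proof.
move=> us; have := @mean_signs_positive s [::]; rewrite cats0 => /(_ us).
rewrite expr0 invr1 mulr1 => <-; congr mean; apply/funext => w.
have -> : positive [::] = setT by apply/seteqP; split => // ? _ ?.
by rewrite indicT mulr1.
Qed.

End random_signs.

Section psi_moments.
Context {R : realType} {J : countType} {d : measure_display} {Omega : measurableType d}
  (P : probability Omega R) (xi : J * nat -> Omega -> R).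
Hypothesis xi_signs : independent_signs P xi.
Variable n : nat.
Hypothesis n0 : (0 < n)%N.
Implicit Types (alpha beta r gamma : mindex J).
Local Notation sgn := (sign xi).

Lemma bounded_psi j k : bounded_variable (psi sgn n j k).
Proof.
apply: bounded_variableM; last exact: bounded_variable_cst.
apply: bounded_variableZ; apply: bounded_variable_sum => D.
by apply: bounded_variable_prod => i; exact: (bounded_sign xi_signs).
Qed.

Lemma bounded_Psi alpha : bounded_variable (Psi sgn n alpha).
Proof. by apply: bounded_variable_prod => j; exact: bounded_psi. Qed.

(** The factors of different coordinates involve different signs, so the
    product is a combination of monomials in distinct signs; these are
    nonempty as soon as one of the orders [g j] is positive. *)
Lemma mean_prod_psi (s : seq (J * nat)) (L : seq J) (g : J -> nat) :
  uniq s -> uniq L -> (forall i, i \in s -> i.1 \notin L) ->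
  s != [::] \/ (exists2 j, j \in L & (0 < g j)%N) ->
  mean P (fun w => \prod_(i <- s) sgn i w * \prod_(j <- L) psi sgn n j (g j) w) = 0.
Proof.
elim: L s => [|j L ih] s us uL sL ne.
  under [X in mean P X]eq_fun do rewrite big_nil mulr1.
  rewrite (mean_signs xi_signs us); case: ne => [/negPf -> //|[j]].
  by rewrite in_nil.
move: uL; rewrite cons_uniq => /andP[jL uL].
pose mon (D : {set 'I_n}) : seq (J * nat) := [seq (j, nat_of_ord i) | i <- enum D].
have mon_mem D i : i \in mon D -> i.1 = j by move=> /mapP[k _ ->].
have us' D : uniq (s ++ mon D).
  rewrite cat_uniq us map_inj_uniq ?enum_uniq; last by move=> a b [] /val_inj.
  rewrite andbT; apply/hasPn => i /mon_mem ij; apply/negP => /sL.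
  by rewrite ij mem_head.
pose c := (g j)`!%:R * (Num.sqrt n%:R) ^- (g j) / Num.sqrt (g j)`!%:R : R.
have -> : (fun w => \prod_(i <- s) sgn i w * \prod_(k <- j :: L) psi sgn n k (g k) w) =
    (fun w => \sum_(D : {set 'I_n} | #|D| == g j)
       c * (\prod_(i <- s ++ mon D) sgn i w * \prod_(k <- L) psi sgn n k (g k) w)).
  apply/funext => w; rewrite big_cons.
  have -> : psi sgn n j (g j) w = c * \sum_(D : {set 'I_n} | #|D| == g j) \prod_(i <- mon D) sgn i w.
    rewrite /psi QpolyE mulrAC; congr (_ * _); apply: eq_bigr => D _.
    by rewrite big_map big_enum.
  clearbody c; rewrite mulrCA -mulrA mulr_suml mulr_sumr; apply: eq_bigr => D _.
  by rewrite big_cat /= -!mulrA; congr (c * _); exact: mulrCA.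
have bnd D : bounded_variable (fun w => \prod_(i <- s ++ mon D) sgn i w * \prod_(k <- L) psi sgn n k (g k) w).
  apply: bounded_variableM; apply: bounded_variable_prod => i; last exact: bounded_psi.
  exact: (bounded_sign xi_signs).
rewrite mean_sum; last by move=> D; exact: bounded_variableZ.
apply: big1 => D /eqP Dj; rewrite meanZ // ih ?mulr0 //.
  move=> i; rewrite mem_cat => /orP[/sL|/mon_mem ->] //.
  by rewrite inE negb_or => /andP[].
case: ne => [sne|[k]]; first by left; apply: contra sne; rewrite -!size_eq0 size_cat addn_eq0 => /andP[].
rewrite inE => /orP[/eqP -> gj|kL gk]; last by right; exists k.
by left; rewrite -size_eq0 size_cat size_map -cardE Dj addn_eq0 negb_and orbC -lt0n gj.
Qed.

Lemma mean_Psi gamma : mean P (Psi sgn n gamma) = (gamma == mzero)%:R.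
Proof.
have [->|g0] := eqVneq gamma mzero.
  have -> : Psi sgn n mzero = (fun=> 1) by apply/funext => w; exact: Psi0.
  exact: mean_cst.
have [j gj] : exists j, (0 < gamma j)%N.
  apply: contrapT => h; case/eqP: g0; apply: mindexP => j; rewrite mzeroE.
  by apply/eqP; rewrite -leqn0 leqNgt; apply/negP => gj; apply: h; exists j.
rewrite -[RHS](@mean_prod_psi [::] (finsupp gamma) gamma) //.
- by congr mean; apply/funext => w; rewrite big_nil mul1r.
- exact: fset_uniq.
- by right; exists j => //; rewrite mem_finsupp -lt0n.
Qed.

Definition psi_norm alpha : R := vartheta R n alpha alpha alpha.

Lemma mcontract_diag alpha : mcontract alpha alpha alpha = mzero.
Proof. by apply: mindexP => j; rewrite mcontractE mzeroE; lia. Qed.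

Lemma coef_c_diag alpha : coef_c R alpha alpha alpha = 1.
Proof.
rewrite coef_cE // mcontract_diag.
have b1 : mbin alpha alpha = 1%N by rewrite /mbin big1 // => j _; rewrite binn.
have -> : msub alpha alpha = mzero by apply: mindexP => j; rewrite msubE mzeroE subnn.
have -> : mbin mzero (mzero : mindex J) = 1%N by rewrite /mbin big1 // => j _; rewrite !mzeroE.
by rewrite b1 sqrtr1.
Qed.

Lemma psi_norm_gt0 alpha : in_range n alpha -> 0 < psi_norm alpha.
Proof.
move=> an; rewrite /psi_norm /vartheta mcontract_diag asboolT; last first.
  by split => // j; rewrite mzeroE.
apply: prodr_gt0 => j _; rewrite mzeroE subn0 divr_gt0 ?exprn_gt0 ?ltr0n //.
by rewrite ffact_gt0.
Qed.

Lemma psi_norm_le1 alpha : 0 <= psi_norm alpha <= 1.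
Proof. exact: vartheta_range. Qed.

(** Only the term of full contraction has a nonzero mean. *)
Lemma mean_PsiM alpha beta :
  mean P (fun w => Psi sgn n alpha w * Psi sgn n beta w) = (alpha == beta)%:R * psi_norm alpha.
Proof.
under [X in mean P X]eq_fun => w do rewrite (Psi_mul n0 (fun i => sign_sqr xi i w)).
rewrite mean_sum => [|r]; last by apply: bounded_variableZ; exact: bounded_Psi.
transitivity (\sum_(r <- below2 alpha beta | r == alpha) ((alpha == beta)%:R * psi_norm alpha)).
  rewrite [RHS]big_mkcond big_seq [RHS]big_seq; apply: eq_bigr => r.
  rewrite mem_below2 => /andP[/mlebP ra /mlebP rb].
  rewrite meanZ ?mean_Psi; last exact: bounded_Psi.
  have [/eqP c0|cN] := boolP (mcontract alpha beta r == mzero).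
    have rE j : r j = alpha j /\ r j = beta j.
      by have := congr1 (fun g : mindex J => g j) c0; rewrite mcontractE mzeroE;
        have := ra j; have := rb j; lia.
    have -> : r = alpha by apply: mindexP => j; case: (rE j).
    have -> : beta = alpha by apply: mindexP => j; case: (rE j) => <- ->.
    by rewrite eqxx coef_c_diag !mul1r mulr1.
  rewrite mulr0; case: eqP => // rE; case: eqP => [ab|_]; last by rewrite mul0r.
  by move: cN; rewrite rE -ab mcontract_diag eqxx.
have [<-|ab] := eqVneq alpha beta; last by rewrite mul0r big1.
rewrite -big_filter (perm_big [:: alpha]); first by rewrite big_seq1.
apply: uniq_perm; rewrite ?filter_uniq ?below2_uniq // => r.
rewrite mem_filter inE; case: eqP => // ->.
by rewrite mem_below2 andbb; apply/mlebP.
Qed.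

End psi_moments.

(** * The realization of finitely supported arrays *)

Section realization.
Context {R : realType} {E : lmodType R[i]} (dot : {dot E for Num.conj})
  {K : countType} (e : K -> E) {J : countType}.
Local Open Scope complex_scope.
Hypothesis E_complete : complete_norm (cnorm dot).
Hypothesis e_basis : orthonormal_basis dot (cnorm dot) e.
Local Notation supported := (@supported R E dot K e J).
Implicit Types (A B C : array E J) (alpha beta r gamma : mindex J) (s : seq (mindex J)).
Variable n : nat.
Hypothesis n0 : (0 < n)%N.
Local Notation prodn := (weighted_product (vartheta R n)).

Section pointwise.
Context {d : measure_display} {Omega : measurableType d} (xi : J * nat -> Omega -> R).

Definition psum s A x : E -> E := \sum_(alpha <- s) (Psi xi n alpha x)%:C *: A alpha.

Lemma psum_sup s t A x : uniq s -> uniq t -> {subset s <= t} -> supported s A ->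
  psum t A x = psum s A x.
Proof.
move=> us ut st [_ zA]; rewrite /psum (bigID (mem s)) /= [X in _ + X]big1 ?addr0; last first.
  by move=> alpha /zA ->; rewrite scaler0.
rewrite -big_filter; apply: perm_big; apply: uniq_perm => //; first exact: filter_uniq.
by move=> alpha; rewrite mem_filter andb_idr //; exact: st.
Qed.

Lemma psumB s A B x : psum s (A - B) x = psum s A x - psum s B x.
Proof.
by rewrite /psum -sumrB; apply: eq_bigr => alpha _; rewrite -scalerBr.
Qed.

(** Expanding the product of two realizations and collecting the products
    [Psi alpha * Psi beta] gives the coefficients of the contracted product. *)
Lemma psum_prod s s' A B x : (forall i, xi i x ^+ 2 = 1) ->
  uniq s -> uniq s' -> supported s A -> supported s' B ->
  psum (undup (contractions s s')) (prodn A B) x = psum s A x \o psum s' B x.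
Proof.
move=> sx us us' sA sB; rewrite /psum sum_comp_l.
under eq_bigr => gamma _ do rewrite (prodE _ _ us us' sA sB) scaler_sumr.
rewrite exchange_big /= big_seq [RHS]big_seq; apply: eq_bigr => alpha aS.
under eq_bigr => gamma _ do rewrite scaler_sumr.
rewrite exchange_big /=.
have -> : ((Psi xi n alpha x)%:C *: A alpha) \o \sum_(beta <- s') (Psi xi n beta x)%:C *: B beta =
    \sum_(beta <- s') (Psi xi n alpha x * Psi xi n beta x)%:C *: (A alpha \o B beta).
  have [[lA _] _] := sA.1 alpha.
  apply/funext => y; rewrite /= -[LHS]/(_ *: A alpha _) !fct_sumE lin_sum // scaler_sumr.
  apply: eq_bigr => beta _.
  by rewrite -[RHS]/(_ *: A alpha (B beta y)) -[X in A alpha X]/(_ *: B beta y) linZ // scalerA real_complexM.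
rewrite big_seq [RHS]big_seq; apply: eq_bigr => beta bS.
rewrite Psi_mul //; under eq_bigr => gamma _ do rewrite scaler_sumr.
rewrite (exchange_big_dep predT) //= rmorph_sum /= scaler_suml big_seq [RHS]big_seq.
apply: eq_bigr => r rS; rewrite big_mkcond (bigD1_seq (mcontract alpha beta r)) ?undup_uniq //=.
  rewrite eqxx big1 ?addr0 => [|gamma gr]; last by rewrite eq_sym (negPf gr).
  by rewrite scalerA -real_complexM mulrC.
rewrite mem_undup; apply/mapP; exists (alpha, beta, r) => //.
by rewrite mem_triples aS bS -mem_below2.
Qed.

End pointwise.

Definition ranged A : Prop := forall alpha, ~ in_range n alpha -> A alpha = 0.

Lemma prod_ranged s s' A B : supported s A -> supported s' B -> ranged (prodn A B).
Proof.
move=> /supported_undup sA /supported_undup sB gamma gN.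
rewrite (prodE _ _ (undup_uniq s) (undup_uniq s') sA sB) big1 // => alpha _.
rewrite big1 // => beta _; rewrite big1 // => r /eqP rg.
rewrite /vartheta asboolF ?mulr0 ?scale0r // => -[_ _]; rewrite rg; exact: gN.
Qed.

Context {d : measure_display} {Omega : measurableType d} (P : probability Omega R)
  (xi : J * nat -> Omega -> R).
Hypothesis xi_signs : independent_signs P xi.

(** Orthogonality of the [Psi alpha] recovers the coefficients. *)
Lemma psum_inj s D : uniq s -> supported s D -> ranged D ->
  (forall x, psum (sign xi) s D x = 0) -> D = 0.
Proof.
move=> us sD rD D0; apply/funext => alpha.
have [an|/rD//] := pselect (in_range n alpha).
have [aS|/sD.2//] := boolP (alpha \in s).
apply/funext => y; apply/eqP; rewrite -(cnorm_eq0 dot) -sqrf_eq0 sqr_cnorm.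
set v := D alpha y; pose f beta : R := complex.Re (dot (D beta y) v).
have fsum x : \sum_(beta <- s) f beta * Psi (sign xi) n beta x = 0.
  have := congr1 (fun T : E -> E => complex.Re (dot (T y) v)) (D0 x).
  rewrite /psum fct_sumE dot_suml dot0l raddf_sum /= => h; rewrite -[RHS]h.
  apply: eq_bigr => beta _.
  rewrite -[X in dot X v]/((Psi (sign xi) n beta x)%:C *: D beta y) dotZl /f.
  by case: (dot _ _) => a b; rewrite /= mul0r subr0 mulrC.
have bP beta : bounded_variable (Psi (sign xi) n beta) by exact: (bounded_Psi xi_signs).
have : mean P (fun x => \sum_(beta <- s) f beta * (Psi (sign xi) n beta x * Psi (sign xi) n alpha x)) = 0.
  rewrite -[RHS](mean_cst P 0); congr mean; apply/funext => x.
  under eq_bigr do rewrite mulrA.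
  by rewrite -mulr_suml fsum mul0r.
rewrite mean_sum => [|beta]; last by apply: bounded_variableZ; exact: bounded_variableM.
have mE beta : mean P (fun x => f beta * (Psi (sign xi) n beta x * Psi (sign xi) n alpha x)) =
    f beta * ((beta == alpha)%:R * psi_norm n beta).
  by rewrite meanZ ?(mean_PsiM xi_signs n0) //; exact: bounded_variableM.
rewrite (eq_bigr _ (fun beta _ => mE beta)).
rewrite (bigD1_seq alpha) //= eqxx mul1r big1 ?addr0 => [/eqP|beta /negPf ->]; last by rewrite mul0r mulr0.
by rewrite mulf_eq0 (gt_eqF (psi_norm_gt0 n0 an)) orbF.
Qed.

(** Both sides have the same realization, by associativity of composition,
    and both vanish out of range. *)
Lemma prodA s s' s'' A B C : supported s A -> supported s' B -> supported s'' C ->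
  prodn A (prodn B C) = prodn (prodn A B) C.
Proof.
move=> hA hB hC; have sA := supported_undup hA; have sB := supported_undup hB; have sC := supported_undup hC.
have sAB := supported_undup (supported_prod e_basis (vartheta R n) sA sB).
have sBC := supported_undup (supported_prod e_basis (vartheta R n) sB sC).
have sL := supported_undup (supported_prod e_basis (vartheta R n) sA sBC).
have sR := supported_undup (supported_prod e_basis (vartheta R n) sAB sC).
set l := undup _ in sL; set r := undup _ in sR.
have ut := undup_uniq (l ++ r).
have lt : {subset l <= undup (l ++ r)} by move=> a al; rewrite mem_undup mem_cat al.
have rt : {subset r <= undup (l ++ r)} by move=> a ar; rewrite mem_undup mem_cat ar orbT.
apply/eqP; rewrite -subr_eq0; apply/eqP; apply: (psum_inj ut).
- have := supported_lin (-1) (supported_sub rt sR) (supported_sub lt sL).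
  by rewrite scaleN1r addrC.
- move=> alpha aN; rewrite -[LHS]/(prodn A (prodn B C) alpha - prodn (prodn A B) C alpha).
  by rewrite (prod_ranged sA sBC aN) (prod_ranged sAB sC aN) subrr.
move=> x; have sx i : sign xi i x ^+ 2 = 1 by exact: sign_sqr.
rewrite psumB (psum_sup _ _ (undup_uniq _) ut lt sL) (psum_sup _ _ (undup_uniq _) ut rt sR).
rewrite /l /r (psum_prod sx (undup_uniq _) (undup_uniq _) sA sBC).
rewrite (psum_prod sx _ _ sAB sC) ?undup_uniq //.
by rewrite (psum_prod sx _ _ sA sB) ?undup_uniq // (psum_prod sx _ _ sB sC) ?undup_uniq // subrr.
Qed.

End realization.

(** * The Frechet algebras *)

Section frechet_algebras.
Context {R : realType} {E : lmodType R[i]} (dot : {dot E for Num.conj})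
  {K : countType} (e : K -> E) {J : countType}.
Local Open Scope complex_scope.
Hypothesis E_complete : complete_norm (cnorm dot).
Hypothesis e_basis : orthonormal_basis dot (cnorm dot) e.
Local Notation pnorm := (@Defs.pnorm R E dot K e J).
Local Notation pspace := (@Defs.pspace R E dot K e J).
Local Notation hsnorm := (Defs.hsnorm dot e).
Local Notation supported := (@supported R E dot K e J).
Local Notation frakA2 := (@Defs.frakA2 R E dot K e J).
Local Notation adj := (@array_adjoint R E dot J).
Implicit Types (A B C : array E J) (alpha beta r gamma : mindex J)
  (s : seq (mindex J)) (w : mindex J -> mindex J -> mindex J -> R).

Definition fcvg (u : nat -> array E J) A : Prop :=
  forall rho : R, 1 <= rho -> pcvg dot e rho u A.

Lemma fcvg_trunc A : frakA2 A -> fcvg (fun n => trunc n A) A.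
Proof.
move=> fA rho r1; have r0 : 0 < rho by exact: lt_le_trans r1.
exact: (pcvg_restr mbox_exhausting r0 (frakA2_pspace fA r0)).
Qed.

Lemma frakA2_supported s A : supported s A -> frakA2 A.
Proof.
move=> sA; split; first exact: sA.1.
by move=> rho r1; have [] := supported_pspace (le_trans ler01 r1) sA.
Qed.

Lemma fcvg_unique u A B : (forall n, frakA2 (u n)) -> frakA2 A -> frakA2 B ->
  fcvg u A -> fcvg u B -> A = B.
Proof.
move=> hu fA fB uA uB.
apply: (pcvg_unique e_basis ltr01 (fun n => (hu n).1) fA.1 fB.1 (uA _ _) (uB _ _)) => //.
Qed.

(** The weight [2 rho] on the factors controls the weight [rho] of the
    product. *)
Lemma fcvg_ext_prod w u v A B : double_bounded dot e w ->
  (forall n, frakA2 (u n)) -> (forall n, frakA2 (v n)) -> frakA2 A -> frakA2 B ->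
  fcvg u A -> fcvg v B ->
  fcvg (fun n => ext_prod dot w (u n) (v n)) (ext_prod dot w A B).
Proof.
move=> bw hu hv fA fB uA vB rho r1 eps eps0.
have r0 : 0 < rho by exact: lt_le_trans r1.
have r2 : 0 < 2 * rho by rewrite mulr_gt0.
have r21 : 1 <= 2 * rho by rewrite (le_trans r1) // ler_peMl ?ler1n // ltW.
have [delta d0 h] := ext_prod_continuous E_complete e_basis r0 r2 r2 ler01 (bw _ r1)
  (frakA2_pspace fA r2) (frakA2_pspace fB r2) eps0.
apply: filterS2 (uA _ r21 _ d0) (vB _ r21 _ d0) => n un vn.
exact: (h _ _ (frakA2_pspace (hu n) r2) (frakA2_pspace (hv n) r2) un vn).
Qed.

Lemma trunc_frakA2 n A : frakA2 A -> frakA2 (trunc n A).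
Proof. by move=> fA; exact: (frakA2_supported (trunc_supported n fA.1)). Qed.

Lemma hsnorm_adjoint_array A alpha : hs_array dot e A -> hsnorm (adj A alpha) = hsnorm (A alpha).
Proof. by move=> hA; exact: (hsnorm_adjoint E_complete e_basis). Qed.

Lemma pnorm_adjoint rho A : hs_array dot e A -> pnorm rho (adj A) = pnorm rho A.
Proof.
move=> hA; rewrite !pnormE; apply: eq_eseriesr => m _; congr (_ * _)%E.
by rewrite !levelE; apply: eq_ell2 => alpha _; exact: hsnorm_adjoint_array.
Qed.

Lemma hs_array_adjoint A : hs_array dot e A -> hs_array dot e (adj A).
Proof. by move=> hA alpha; exact: hs_adjoint. Qed.

Lemma frakA2_adjoint A : frakA2 A -> frakA2 (adj A).
Proof.
move=> [hA fA]; split; first exact: hs_array_adjoint.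
by move=> rho r1; rewrite pnorm_adjoint //; exact: fA.
Qed.

Lemma array_adjoint_lin (c : R[i]) A B : hs_array dot e A -> hs_array dot e B ->
  adj (c *: A + B) = (c^*)%R *: adj A + adj B.
Proof. by move=> hA hB; apply/funext => alpha; exact: (adjoint_lin E_complete e_basis). Qed.

Lemma array_adjointB A B : hs_array dot e A -> hs_array dot e B ->
  adj (A - B) = adj A - adj B.
Proof.
move=> hA hB; rewrite addrC -[- B]scaleN1r array_adjoint_lin // addrC.
by rewrite rmorphN1 scaleN1r.
Qed.

Lemma fcvg_adjoint u A : (forall n, hs_array dot e (u n)) -> hs_array dot e A ->
  fcvg u A -> fcvg (fun n => adj (u n)) (adj A).
Proof.
move=> hu hA uA rho r1 eps eps0; apply: filterS (uA _ r1 _ eps0) => n h.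
by rewrite -(array_adjointB (hu n) hA) (pnorm_adjoint _ (hs_arrayB (hu n) hA)); exact: h.
Qed.

Lemma supported_adjoint s A : supported s A -> supported s (adj A).
Proof.
move=> [hA zA]; split; first exact: hs_array_adjoint.
by move=> alpha /zA; rewrite /array_adjoint => ->; exact: (adjoint0 E_complete e_basis).
Qed.

Lemma adjoint_sum (I : Type) (l : seq I) (Q : pred I) (F : I -> E -> E) :
  (forall i, hilbert_schmidt dot e (F i)) ->
  adjoint dot (\sum_(i <- l | Q i) F i) = \sum_(i <- l | Q i) adjoint dot (F i).
Proof.
move=> hF; elim: l => [|i l ih]; first by rewrite !big_nil (adjoint0 E_complete e_basis).
rewrite !big_cons; case: (Q i) => //.
have := adjoint_lin E_complete e_basis 1 (hF i) (hs_sum l (P := Q) (fun k _ => hF k)).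
by rewrite !scale1r rmorph1 scale1r ih.
Qed.

(** The coefficients are real and symmetric in the two factors. *)
Lemma prod_adjoint w s s' A B : (forall alpha beta r, w alpha beta r = w beta alpha r) ->
  supported s A -> supported s' B ->
  adj (weighted_product w A B) = weighted_product w (adj B) (adj A).
Proof.
move=> wC hA hB; apply/funext => gamma; rewrite /array_adjoint.
have sA := supported_undup hA; have sB := supported_undup hB.
have us := undup_uniq s; have us' := undup_uniq s'.
rewrite (prodE _ _ us us' sA sB) (prodE _ _ us' us (supported_adjoint sB) (supported_adjoint sA)).
have hsAB alpha beta : hilbert_schmidt dot e (A alpha \o B beta).
  exact: (hs_comp e_basis (sA.1 alpha) (sB.1 beta)).
rewrite exchange_big adjoint_sum => [|beta]; last by do 2 apply: (hs_sum) => ? _; exact: hsZ.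
apply: eq_bigr => beta _; rewrite adjoint_sum => [|alpha]; last by apply: (hs_sum) => ? _; exact: hsZ.
apply: eq_bigr => alpha _; rewrite adjoint_sum => [|r]; last exact: hsZ.
have pb : perm_eq (below2 alpha beta) (below2 beta alpha).
  by apply: uniq_perm; rewrite ?below2_uniq // => r; rewrite !mem_below2 andbC.
rewrite (perm_big _ pb) /=.
rewrite (eq_bigl (fun r => mcontract beta alpha r == gamma)); last by move=> r; rewrite mcontractC.
apply: eq_bigr => r _.
have := adjoint_lin E_complete e_basis (coef_c R alpha beta r * w alpha beta r)%:C (hsAB alpha beta) (hs0 dot e).
rewrite addr0 (adjoint0 E_complete e_basis) addr0 => ->.
by rewrite (adjoint_comp E_complete e_basis (sA.1 alpha) (sB.1 beta)) coef_cC wC; congr (_ *: _); exact: conjc_real.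
Qed.

Lemma ext_prod_adjoint w A B : double_bounded dot e w ->
  (forall alpha beta r, w alpha beta r = w beta alpha r) -> frakA2 A -> frakA2 B ->
  adj (ext_prod dot w A B) = ext_prod dot w (adj B) (adj A).
Proof.
move=> bw wC fA fB.
have fAB := frakA2_ext_prod E_complete e_basis bw fA fB.
have tA k := trunc_frakA2 k fA; have tB k := trunc_frakA2 k fB.
have tAB k := frakA2_ext_prod E_complete e_basis bw (tA k) (tB k).
have hA k := (tA k).1; have hB k := (tB k).1.
have lA := fcvg_trunc fA; have lB := fcvg_trunc fB.
apply: (@fcvg_unique (fun k => adj (ext_prod dot w (trunc k A) (trunc k B)))).
- by move=> k; exact: (frakA2_adjoint (tAB k)).
- exact: (frakA2_adjoint fAB).
- exact: (frakA2_ext_prod E_complete e_basis bw (frakA2_adjoint fB) (frakA2_adjoint fA)).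
- exact: (fcvg_adjoint (fun k => (tAB k).1) fAB.1 (fcvg_ext_prod bw tA tB fA fB lA lB)).
have -> : (fun k => adj (ext_prod dot w (trunc k A) (trunc k B))) =
    (fun k => ext_prod dot w (adj (trunc k B)) (adj (trunc k A))).
  apply/funext => k; have sA := trunc_supported k fA.1; have sB := trunc_supported k fB.1.
  rewrite (ext_prod_supported _ sA sB).
  rewrite (ext_prod_supported _ (supported_adjoint sB) (supported_adjoint sA)).
  exact: (prod_adjoint wC sA sB).
exact: (fcvg_ext_prod bw (fun k => frakA2_adjoint (tB k)) (fun k => frakA2_adjoint (tA k))
  (frakA2_adjoint fB) (frakA2_adjoint fA) (fcvg_adjoint hB fB.1 lB) (fcvg_adjoint hA fA.1 lA)).
Qed.

Lemma ext_prodA w A B C : double_bounded dot e w ->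
  (forall s s' s'' A B C, supported s A -> supported s' B -> supported s'' C ->
    weighted_product w A (weighted_product w B C) = weighted_product w (weighted_product w A B) C) ->
  frakA2 A -> frakA2 B -> frakA2 C ->
  ext_prod dot w A (ext_prod dot w B C) = ext_prod dot w (ext_prod dot w A B) C.
Proof.
move=> bw wA fA fB fC.
have tA k := trunc_frakA2 k fA; have tB k := trunc_frakA2 k fB; have tC k := trunc_frakA2 k fC.
have fp A' B' (fA' : frakA2 A') (fB' : frakA2 B') := frakA2_ext_prod E_complete e_basis bw fA' fB'.
have lA := fcvg_trunc fA; have lB := fcvg_trunc fB; have lC := fcvg_trunc fC.
have fAB := fp _ _ fA fB; have fBC := fp _ _ fB fC.
have tAB k := fp _ _ (tA k) (tB k); have tBC k := fp _ _ (tB k) (tC k).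
apply: (@fcvg_unique (fun k => ext_prod dot w (trunc k A) (ext_prod dot w (trunc k B) (trunc k C)))).
- by move=> k; exact: (fp _ _ (tA k) (tBC k)).
- exact: (fp _ _ fA fBC).
- exact: (fp _ _ fAB fC).
- exact: (fcvg_ext_prod bw tA tBC fA fBC lA (fcvg_ext_prod bw tB tC fB fC lB lC)).
have -> : (fun k => ext_prod dot w (trunc k A) (ext_prod dot w (trunc k B) (trunc k C))) =
    (fun k => ext_prod dot w (ext_prod dot w (trunc k A) (trunc k B)) (trunc k C)).
  apply/funext => k; have sA := trunc_supported k fA.1; have sB := trunc_supported k fB.1.
  have sC := trunc_supported k fC.1.
  rewrite (ext_prod_supported _ sB sC) (ext_prod_supported _ sA sB).
  rewrite (ext_prod_supported _ sA (supported_prod e_basis w sB sC)).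
  rewrite (ext_prod_supported _ (supported_prod e_basis w sA sB) sC).
  exact: (wA _ _ _ _ _ _ sA sB sC).
exact: (fcvg_ext_prod bw tAB tC fAB fC (fcvg_ext_prod bw tA tB fA fB lA lB) lC).
Qed.

End frechet_algebras.

Section frechet_structure.
Context {R : realType} {E : lmodType R[i]} (dot : {dot E for Num.conj})
  {K : countType} (e : K -> E) {J : countType}.
Local Open Scope complex_scope.
Hypothesis E_complete : complete_norm (cnorm dot).
Hypothesis e_basis : orthonormal_basis dot (cnorm dot) e.
Local Notation pnorm := (@Defs.pnorm R E dot K e J).
Local Notation pspace := (@Defs.pspace R E dot K e J).
Local Notation hsnorm := (Defs.hsnorm dot e).
Local Notation supported := (@supported R E dot K e J).
Local Notation frakA2 := (@Defs.frakA2 R E dot K e J).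
Local Notation frakA2N := (@Defs.frakA2N R E dot K e J).
Local Notation seminorm := (@frakA2_seminorm R E dot K e J).
Local Notation adj := (@array_adjoint R E dot J).
Implicit Types (A B C : array E J) (alpha beta r gamma : mindex J)
  (s : seq (mindex J)).

Lemma pnorm_cutoff n rho A : 0 <= rho -> (pnorm rho (cutoff n A) <= pnorm rho A)%E.
Proof.
move=> rho0; apply: le_pnorm_level => // m.
apply: lee_wpmul2l; first by rewrite lee_fin exprn_ge0.
rewrite !levelE; apply: le_ell2 => alpha _.
rewrite (eseminorm_ge0 (eseminorm_hs dot e)) /cutoff /=; case: asboolP => // _.
by rewrite (eseminorm0 (eseminorm_hs dot e)) (eseminorm_ge0 (eseminorm_hs dot e)).
Qed.

Lemma frakA2NP n A : frakA2N n A <-> frakA2 A /\ ranged n A.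
Proof.
split => [[B [hB fB] <-]|[fA rA]]; last first.
  exists A => //; apply/funext => alpha; rewrite /cutoff; case: asboolP => // h.
  by rewrite rA.
split; last by move=> alpha h; rewrite /cutoff asboolF.
split=> [alpha|rho r1]; first by rewrite /cutoff; case: asboolP => // _; exact: hs0.
exact: (le_lt_trans (pnorm_cutoff n B (le_trans ler01 r1)) (fB rho r1)).
Qed.

Lemma ranged_lin n (c : R[i]) A B : ranged n A -> ranged n B -> ranged n (c *: A + B).
Proof.
move=> rA rB alpha h; rewrite -[LHS]/(c *: A alpha + B alpha) rA // rB //.
by rewrite scaler0 addr0.
Qed.

Lemma frakA2_lin (c : R[i]) A B : frakA2 A -> frakA2 B -> frakA2 (c *: A + B).
Proof.
move=> fA fB; split; first exact: (hs_array_lin c fA.1 fB.1).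
move=> rho r1; have r0 : 0 < rho by exact: lt_le_trans r1.
by have [] := pspace_lin c (ltW r0) (frakA2_pspace fA r0) (frakA2_pspace fB r0).
Qed.

Lemma frakA2N_lin n (c : R[i]) A B : frakA2N n A -> frakA2N n B -> frakA2N n (c *: A + B).
Proof.
move=> /frakA2NP[fA rA] /frakA2NP[fB rB]; apply/frakA2NP.
by split; [exact: frakA2_lin|exact: ranged_lin].
Qed.

Lemma cvg_ereal0 (u : nat -> \bar R) : (forall n, 0 <= u n)%E ->
  (forall eps : R, 0 < eps -> \forall n \near \oo, (u n <= eps%:E)%E) ->
  u n @[n --> \oo] --> 0%E.
Proof.
move=> u0 h; have ufin : \forall n \near \oo, u n \is a fin_num.
  apply: filterS (h _ ltr01) => n u1.
  by rewrite ge0_fin_numE // (le_lt_trans u1) // ltry.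
apply/fine_cvgP; split => //; apply/cvgrPdist_le => eps eps0.
apply: filterS2 ufin (h _ eps0) => n un ue.
by rewrite sub0r normrN ger0_norm ?fine_ge0 // -lee_fin fineK.
Qed.

(** The coefficientwise limit for [rho = 1] serves every [rho], since the
    norms are lower semicontinuous. *)
Lemma frakA2N_complete n (u : nat -> array E J) : (forall k, frakA2N n (u k)) ->
  (forall (i : {rho : R | 1 <= rho}) (eps : R), 0 < eps ->
     \forall k & l \near \oo, (seminorm i (u k - u l)%R < eps%:E)%E) ->
  exists2 A, frakA2N n A & forall i, seminorm i (u k - A)%R @[k --> \oo] --> 0%E.
Proof.
move=> hu cu.
have hsu k : hs_array dot e (u k) by have /frakA2NP[[]] := hu k.
have pc (rho : R) : 1 <= rho -> pcauchy dot e rho u.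
  move=> r1 eps eps0; have /near2P[k0 h] := cu (exist _ rho r1) eps eps0.
  by apply/near2P; exists k0 => k l hk hl; exact: (ltW (h k l hk hl)).
have [A uA] := pcauchy_limit E_complete e_basis ltr01 hsu (pc 1 (lexx _)).
have hA : hs_array dot e A by exact: (pcauchy_hs_array e_basis ltr01 hsu (pc 1 (lexx _)) uA).
have cA (rho : R) : 1 <= rho -> pcvg dot e rho u A.
  move=> r1; exact: (pcauchy_pcvg (lt_le_trans ltr01 r1) (pc rho r1) uA).
exists A.
  apply/frakA2NP; split; [split => // rho r1|move=> alpha an].
    have r0 : 0 <= rho by exact: le_trans r1.
    have [k _ /(_ k (leqnn k)) hk] := cA _ r1 1 ltr01.
    have /frakA2NP[[_ fk] _] := hu k.
    have -> : A = u k - (u k - A) by rewrite opprB addrC subrK.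
    apply: (le_lt_trans (pnormB dot e _ _ r0)).
    by apply: lte_add_pinfty; [exact: fk|apply: (le_lt_trans hk); rewrite ltry].
  apply/funext => x; apply: (ncvg_unique (uA alpha x)).
  have -> : (fun k => u k alpha x) = (fun=> 0).
    by apply/funext => k; have /frakA2NP[_ ->] := hu k.
  exact: ncvg_cst.
move=> [rho r1]; have r0 : 0 <= rho by exact: le_trans r1.
apply: cvg_ereal0 => [k|eps eps0]; first exact: pnorm_ge0.
exact: (cA rho r1 eps eps0).
Qed.

Lemma frakA2N_frechet_space n : frechet_space (frakA2N n) seminorm.
Proof.
split.
- split; last by move=> c A B; exact: frakA2N_lin.
  apply/frakA2NP; split => // ; split; first exact: hs_array0.
  by move=> rho r1; rewrite pnorm0 // (le_trans ler01).
- move=> [rho r1]; have r0 : 0 <= rho by exact: le_trans r1.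
  split => [A /frakA2NP[[_ fA] _]|A B _ _|c A _].
  + by apply/andP; split; [exact: pnorm_ge0|exact: fA].
  + exact: pnormD.
  + exact: pnormZ.
- move=> A /frakA2NP[[hA fA] _] A0; apply/funext => alpha.
  apply: (hsnorm_eq0 e_basis (hA alpha).1).
  have := hsnorm_le_pnorm dot e A alpha (rho := 1) ler01.
  have := A0 (exist _ 1 (lexx 1)); rewrite /frakA2_seminorm /= => ->.
  rewrite expr1n mul1e => h; apply/eqP; rewrite eq_le h.
  exact: (eseminorm_ge0 (eseminorm_hs dot e)).
- have s1 k : 1 <= k.+1%:R :> R by rewrite ler1n.
  exists (fun k => exist (fun rho : R => 1 <= rho) k.+1%:R (s1 k)) => -[rho r1].
  have r0 : 0 <= rho by exact: le_trans r1.
  exists (Num.truncn rho), 1 => A _; rewrite mul1e; apply: le_pnorm => //=.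
  exact: (ltW (truncnS_gt rho)).
exact: frakA2N_complete.
Qed.

Context {d : measure_display} {Omega : measurableType d} (P : probability Omega R)
  (xi : J * nat -> Omega -> R).
Hypothesis xi_signs : independent_signs P xi.
Variable n : nat.
Hypothesis n0 : (0 < n)%N.
Local Notation star := (ext_prod dot (vartheta R (J := J) n)).

Lemma frakA2N_star A B : frakA2 A -> frakA2 B -> frakA2N n (star A B).
Proof.
have bw := vartheta_double (J := J) e_basis n0.
move=> fA fB; apply/frakA2NP; split; first exact: (frakA2_ext_prod E_complete e_basis bw fA fB).
move=> alpha an; apply/funext => x.
have r2 : 0 < 2 * 1 :> R by rewrite mulr_gt0.
apply: (ncvg_unique (ext_prod_pwcvg E_complete e_basis ltr01 r2 r2 ler01 (bw 1 (lexx _))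
  (frakA2_pspace fA r2) (frakA2_pspace fB r2) alpha x)).
have -> : (fun k => trunc_prod (vartheta R n) k A B alpha x) = (fun=> 0).
  apply/funext => k.
  by rewrite /trunc_prod (prod_ranged (trunc_supported k fA.1) (trunc_supported k fB.1) an).
exact: ncvg_cst.
Qed.

Lemma frakA2N_frechet_star_algebra :
  frechet_star_algebra (frakA2N n) seminorm star adj.
Proof.
have bw := vartheta_double (J := J) e_basis n0.
have sub A : frakA2N n A -> frakA2 A by move=> /frakA2NP[].
have r2 : 0 < 2 * 1 :> R by rewrite mulr_gt0.
have ps A : frakA2N n A -> pspace (2 * 1) A by move=> /sub fA; exact: frakA2_pspace.
split.
- exact: frakA2N_frechet_space.
- split => [A B /sub fA /sub fB|c A B C /ps pA /ps pB /ps pC|c A B C /ps pA /ps pB /ps pC|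
    A B C /sub fA /sub fB /sub fC].
  + exact: frakA2N_star.
  + exact: (ext_prod_linl E_complete e_basis ltr01 r2 r2 ler01 (bw 1 (lexx _)) c pA pB pC).
  + exact: (ext_prod_linr E_complete e_basis ltr01 r2 r2 ler01 (bw 1 (lexx _)) c pC pA pB).
  + apply: (ext_prodA E_complete e_basis bw _ fA fB fC).
    move=> s s' s'' A' B' C'; exact: (prodA e_basis n0 xi_signs).
- exact: (jointly_continuous_sub E_complete e_basis bw sub).
- split => [A /frakA2NP[fA rA]|c A B /sub fA /sub fB|A /sub fA|A B /sub fA /sub fB].
  + apply/frakA2NP; split; first exact: (frakA2_adjoint E_complete e_basis fA).
    by move=> alpha /rA; rewrite /array_adjoint => ->; exact: (adjoint0 E_complete e_basis).
  + exact: (array_adjoint_lin E_complete e_basis c fA.1 fB.1).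
  + by apply/funext => alpha; exact: (adjointK E_complete e_basis (fA.1 alpha)).
  + exact: (ext_prod_adjoint E_complete e_basis bw (@varthetaC R J n) fA fB).
move=> A /sub fA [rho r1] eps eps0; exists [:: exist _ rho r1], eps; split => // A' /sub fA' h.
have := h _ (mem_head _ _); rewrite /frakA2_seminorm /=.
rewrite -(array_adjointB E_complete e_basis fA'.1 fA.1).
by rewrite (pnorm_adjoint E_complete e_basis rho (hs_arrayB fA'.1 fA.1)).
Qed.

End frechet_structure.

(** * Square integrable random operators *)

Section countable_sums.
Context {R : realType} {d : measure_display} {Omega : measurableType d}
  (mu : {measure set Omega -> \bar R}) {T : countType}.
Local Open Scope ereal_scope.

Definition nat_term (f : T -> \bar R) (i : nat) : \bar R :=
  if choice.pickle_inv i is Some k then f k else 0.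

Lemma esum_nat (f : T -> \bar R) : (forall k, 0 <= f k) ->
  \esum_(k in [set: T]) f k = \sum_(0 <= i <oo) nat_term f i.
Proof.
move=> f0; have g0 i : 0 <= nat_term f i by rewrite /nat_term; case: (choice.pickle_inv i).
rewrite nneseries_esumT //; apply/eqP; rewrite eq_le; apply/andP; split.
  apply: esum_le_seq => s us _.
  have -> : \sum_(k <- s) f k = \sum_(i <- map choice.pickle s) nat_term f i.
    by rewrite big_map; apply: eq_bigr => k _; rewrite /nat_term choice.pickleK_inv.
  have inj : injective (@choice.pickle T) by exact: (pcan_inj (@choice.pickleK_inv T)).
  by apply: seq_le_esum => //; rewrite (map_inj_uniq inj).
apply: esum_le_seq => t ut _.
have -> : \sum_(i <- t) nat_term f i = \sum_(k <- pmap (@choice.pickle_inv T) t) f k.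
  elim: t {ut} => [|i t ih]; first by rewrite !big_nil.
  rewrite big_cons /= {1}/nat_term ih; case: (choice.pickle_inv i) => [k|] /=.
    by rewrite big_cons.
  by rewrite add0e.
by apply: seq_le_esum => //; exact: (pmap_uniq (@choice.pickle_invK T)).
Qed.

Lemma measurable_esum (f : T -> Omega -> \bar R) :
  (forall k w, 0 <= f k w) -> (forall k, measurable_fun setT (f k)) ->
  measurable_fun setT (fun w => \esum_(k in [set: T]) f k w).
Proof.
move=> f0 mf; under eq_fun => w do rewrite (esum_nat (fun k => f0 k w)).
apply: (@ge0_emeasurable_sum _ _ _ setT (fun i w => nat_term (f^~ w) i) predT).
  by move=> i w _ _; rewrite /nat_term; case: (choice.pickle_inv i).
move=> i _; rewrite /nat_term; case: (choice.pickle_inv i) => [k|]; first exact: mf.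
exact: measurable_cst.
Qed.

Lemma integral_esum (f : T -> Omega -> \bar R) :
  (forall k w, 0 <= f k w) -> (forall k, measurable_fun setT (f k)) ->
  \int[mu]_w (\esum_(k in [set: T]) f k w) = \esum_(k in [set: T]) \int[mu]_w f k w.
Proof.
move=> f0 mf; under eq_integral => w _ do rewrite (esum_nat (fun k => f0 k w)).
rewrite esum_nat => [|k]; last exact: integral_ge0.
rewrite integral_nneseries //.
- apply: eq_eseriesr => i _; rewrite /nat_term; case: (choice.pickle_inv i) => [k|] //.
  exact: integral0.
- move=> i; rewrite /nat_term; case: (choice.pickle_inv i) => [k|]; first exact: mf.
  exact: measurable_cst.
- by move=> i w _; rewrite /nat_term; case: (choice.pickle_inv i).
Qed.

End countable_sums.

Section random_operators.
Context {R : realType} {E : lmodType R[i]} (dot : {dot E for Num.conj})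
  {K : countType} (e : K -> E) {J : countType}.
Local Open Scope complex_scope.
Hypothesis e_basis : orthonormal_basis dot (cnorm dot) e.
Local Notation N := (cnorm dot).
Local Notation pnorm := (@Defs.pnorm R E dot K e J).
Local Notation hsnorm := (Defs.hsnorm dot e).
Local Notation supported := (@supported R E dot K e J).
Implicit Types (A B C : array E J) (alpha beta r gamma : mindex J)
  (s : seq (mindex J)).
Context {d : measure_display} {Omega : measurableType d}.
Implicit Types (X Y : Omega -> E -> E).

(** Measurability of the matrix entries: enough for the norm, and stable under
    differences without separability arguments. *)
Definition weakly_measurable Y : Prop :=
  forall x y, measurable_fun setT (fun w => complex.Re (dot (Y w x) y)).

Lemma weakly_measurableB X Y : weakly_measurable X -> weakly_measurable Y ->
  weakly_measurable (fun w => X w - Y w).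
Proof.
move=> mX mY x y; have := measurable_funB (mX x y) (mY x y).
apply: eq_measurable_fun => w _ /=.
by rewrite -[(X w - Y w) x]/(X w x - Y w x) dotBl raddfB.
Qed.

Lemma measurable_sqr_cnorm Y x : weakly_measurable Y ->
  measurable_fun setT (fun w => ((N (Y w x)) ^+ 2)%:E).
Proof.
move=> mY; under eq_fun do rewrite (parseval e_basis).
apply: measurable_esum => [k w|k]; first by rewrite lee_fin sqr_ge0.
apply/measurable_EFinP.
under eq_fun do rewrite sqr_modcE.
apply: measurable_funD; apply: measurable_funX; first exact: mY.
have := mY x ('i%C *: e k); apply: eq_measurable_fun => w _ /=.
by rewrite dotZr; case: (dot _ _) => a b /=; rewrite mul0r sub0r mulN1r opprK.
Qed.

Lemma measurable_sqr_hsnorm Y : weakly_measurable Y ->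
  measurable_fun setT (fun w => hsnorm (Y w) ^+ 2)%E.
Proof.
move=> mY; under eq_fun do rewrite sqr_hsnorm.
apply: measurable_esum => [k w|k]; first by rewrite lee_fin sqr_ge0.
exact: measurable_sqr_cnorm.
Qed.

Context (P : probability Omega R) (n : nat) (xi : J * nat -> Omega -> R).
Hypothesis xi_signs : independent_signs P xi.
Hypothesis n0 : (0 < n)%N.

Lemma measurable_Qpoly j k : measurable_fun setT (Qpoly xi n j k).
Proof.
have [mxi _ _] := xi_signs.
apply: measurable_funM; first exact: measurable_cst.
under eq_fun do rewrite -big_filter.
apply: measurable_sum => D; under eq_fun do rewrite -big_enum /=.
by apply: measurable_prod => i _; exact: mxi.
Qed.

Lemma measurable_Psi alpha : measurable_fun setT (Psi xi n alpha).
Proof.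
apply: measurable_prod => j _; apply: measurable_funM; last exact: measurable_cst.
exact: measurable_Qpoly.
Qed.

Lemma weakly_measurable_sum (f : mindex J -> Omega -> R) s A :
  (forall alpha, measurable_fun setT (f alpha)) ->
  weakly_measurable (fun w => \sum_(alpha <- s) (f alpha w)%:C *: A alpha).
Proof.
move=> mf x y.
have := @measurable_sum _ _ _ setT _ s
  (fun alpha w => f alpha w * complex.Re (dot (A alpha x) y)).
move=> /(_ (fun alpha => measurable_funM (mf alpha) (measurable_cst _))).
apply: eq_measurable_fun => w _; rewrite fct_sumE dot_suml raddf_sum /=.
apply: eq_bigr => alpha _.
have -> : dot (((f alpha w)%:C *: A alpha) x) y = (f alpha w)%:C * dot (A alpha x) y by exact: dotZl.
by case: (dot _ _) => a b /=; rewrite mul0r subr0.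
Qed.

Local Notation sgn := (sign xi).

Lemma sqr_cnorm_sum s (c : mindex J -> R) (v : mindex J -> E) :
  N (\sum_(alpha <- s) (c alpha)%:C *: v alpha) ^+ 2 =
  \sum_(alpha <- s) \sum_(beta <- s) complex.Re (dot (v alpha) (v beta)) * (c alpha * c beta).
Proof.
rewrite sqr_cnorm dot_suml raddf_sum; apply: eq_bigr => alpha _ /=.
rewrite dot_sumr raddf_sum; apply: eq_bigr => beta _ /=.
rewrite dotZl dotZr conj_Creal ?complex_real //.
by case: (dot _ _) => a b /=; rewrite !mul0r !subr0; ring.
Qed.

(** The realization is an isometry up to the factors [psi_norm alpha <= 1]. *)
Lemma integral_psum_le s A : uniq s ->
  (\int[P]_w (hsnorm (psum n sgn s A w) ^+ 2) <= \sum_(alpha <- s) hsnorm (A alpha) ^+ 2)%E.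
Proof.
move=> us.
have mpsi alpha : measurable_fun setT (Psi sgn n alpha) by have [] := bounded_Psi xi_signs n alpha.
have mX := weakly_measurable_sum s A mpsi.
under eq_integral => w _ do rewrite sqr_hsnorm.
rewrite integral_esum; first last.
- by move=> k; exact: measurable_sqr_cnorm.
- by move=> k w; rewrite lee_fin sqr_ge0.
have bP alpha beta : bounded_variable (fun w => Psi sgn n alpha w * Psi sgn n beta w).
  by apply: bounded_variableM; exact: (bounded_Psi xi_signs).
have kE k : (\int[P]_w ((N (psum n sgn s A w (e k))) ^+ 2)%:E =
    \sum_(alpha <- s) (psi_norm n alpha * N (A alpha (e k)) ^+ 2)%:E)%E.
  have -> : (fun w => ((N (psum n sgn s A w (e k))) ^+ 2)%:E) =
      (fun w => (\sum_(alpha <- s) \sum_(beta <- s) complex.Re (dot (A alpha (e k)) (A beta (e k))) *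
        (Psi sgn n alpha w * Psi sgn n beta w))%:E).
    apply/funext => w; rewrite -sqr_cnorm_sum /psum fct_sumE; congr ((N _ ^+ 2)%:E).
  rewrite integral_mean; last first.
    by do 2 apply: bounded_variable_sum => ?; exact: bounded_variableZ.
  rewrite sumEFin; congr EFin.
  rewrite mean_sum; last by move=> alpha; apply: bounded_variable_sum => beta; exact: bounded_variableZ.
  rewrite big_seq [RHS]big_seq; apply: eq_bigr => alpha aS.
  rewrite mean_sum; last by move=> beta; exact: bounded_variableZ.
  rewrite (bigD1_seq alpha) //= [X in _ + X]big1 ?addr0 => [|beta ba].
    by rewrite meanZ // (mean_PsiM xi_signs n0) eqxx mul1r sqr_cnorm mulrC.
  by rewrite meanZ // (mean_PsiM xi_signs n0) eq_sym (negPf ba) mul0r mulr0.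
under eq_esum => k _ do rewrite kE.
rewrite esum_sum; last first.
  move=> k alpha _ _; rewrite lee_fin mulr_ge0 ?sqr_ge0 //.
  by have /andP[] := psi_norm_le1 (R := R) n0 alpha.
apply: lee_sum => alpha _; rewrite sqr_hsnorm; apply: le_esum => k _.
rewrite lee_fin ler_piMl ?sqr_ge0 //.
by have /andP[] := psi_norm_le1 (R := R) n0 alpha.
Qed.

(** Square summability of the coefficients follows from [p_1 < oo], since
    the square of a sum dominates the sum of the squares. *)
Lemma sum_sqr_hsnorm_le s A : uniq s -> (\sum_(alpha <- s) hsnorm (A alpha) ^+ 2 <= pnorm 1 A ^+ 2)%E.
Proof.
move=> us; pose M := (\sum_(alpha <- s) mdegree alpha).+1.
have degM alpha : alpha \in s -> (mdegree alpha < M)%N.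
  by move=> aS; rewrite ltnS (bigD1_seq alpha) //= leq_addr.
have hs0 alpha : (0 <= hsnorm (A alpha))%E by exact: (eseminorm_ge0 (eseminorm_hs dot e)).
apply: (@le_trans _ _ (\sum_(0 <= m < M) level_norm dot e m A ^+ 2)%E).
  have -> : (\sum_(alpha <- s) hsnorm (A alpha) ^+ 2 =
      \sum_(0 <= m < M) \sum_(alpha <- s | mdegree alpha == m) hsnorm (A alpha) ^+ 2)%E.
    rewrite (exchange_big_dep predT) //= big_seq [RHS]big_seq; apply: eq_bigr => alpha /degM am.
    rewrite (eq_bigl (fun m => m == mdegree alpha)); last by move=> m /=; rewrite eq_sym.
    by rewrite big_nat1_eq /= am.
  apply: lee_sum => m _; rewrite -big_filter levelE; apply: seq_le_ell2; first exact: filter_uniq.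
  by move=> alpha; rewrite mem_filter => /andP[/eqP].
have l0 m : (0 <= level_norm dot e m A)%E by exact: level_ge0.
apply: (@le_trans _ _ ((\sum_(0 <= m < M) level_norm dot e m A) ^+ 2)%E).
  elim: M {degM} => [|k ih]; first by rewrite !big_geq // expe2 mule0.
  rewrite !big_nat_recr //=; set x := (\sum_(0 <= i < k) level_norm _ _ _ _)%E.
  have x0 : (0 <= x)%E by exact: sume_ge0.
  apply: (le_trans (leeD2r _ ih)); rewrite !expe2 ge0_muleDl // !ge0_muleDr //.
  rewrite -[leLHS]adde0 -/x -!addeA; apply: leeD => //; rewrite [leRHS]addeCA adde0.
  by rewrite [leRHS]addeA [leRHS]addeC; rewrite leeDl // adde_ge0 // mule_ge0.
apply: le_expe2; first exact: sume_ge0.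
rewrite pnormE.
under [leRHS]eq_eseriesr => m _ do rewrite expr1n mul1e.
by apply: nneseries_lim_ge => m _ _; exact: l0.
Qed.

End random_operators.

Section integration.
Context {R : realType} {d : measure_display} {Omega : measurableType d}
  (mu : {measure set Omega -> \bar R}).
Local Open Scope ereal_scope.

(** Fatou's lemma for an integrand that is only known to be below the lower
    limit. *)
Lemma fatou_lsc (f : nat -> Omega -> \bar R) (g : Omega -> \bar R) (C : \bar R) :
  (forall n, measurable_fun setT (f n)) -> (forall n w, 0 <= f n w) ->
  measurable_fun setT g -> (forall w, 0 <= g w) ->
  {ae mu, forall w, lsc (f^~ w) (g w)} ->
  (\forall n \near \oo, \int[mu]_w f n w <= C) -> \int[mu]_w g w <= C.
Proof.
move=> mf f0 mg g0 fg [N _ fC].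
have l0 w : 0 <= limn_einf (f^~ w).
  rewrite limn_einf_lim; apply: lime_ge; first exact: is_cvg_einfs.
  by apply: nearW => m; apply: le_ereal_inf_tmp => x [k _ <-].
have measurable_limn_einf : measurable_fun setT (fun w => limn_einf (f^~ w)).
  apply: (emeasurable_fun_cvg (fun m w => einfs (f^~ w) m)).
    exact: measurable_fun_einfs.
  by move=> w _; rewrite limn_einf_lim; exact: is_cvg_einfs.
apply: (@le_trans _ _ (\int[mu]_w limn_einf (f^~ w))).
  apply: ae_ge0_le_integral => //.
  move: fg; apply: filterS => w fgw _; rewrite leNgt; apply/negP => h.
  have [c /andP[c1 c2]] : exists c : R, (limn_einf (f^~ w) < c%:E) && (c%:E < g w).
    have [l lE] : exists l : R, limn_einf (f^~ w) = l%:E.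
      exists (fine (limn_einf (f^~ w))); rewrite fineK // ge0_fin_numE //.
      by apply: (lt_le_trans h); exact: leey.
    rewrite lE in h *; case: (g w) h => [r| |] // h.
      by exists ((l + r) / 2)%R; rewrite !lte_fin midf_lt // midf_lt.
    by exists (l + 1)%R; rewrite lte_fin ltrDl ltr01 ltry.
  have [M _ hM] := fgw c c2.
  move: c1; rewrite ltNge => /negP; apply; rewrite limn_einf_lim.
  apply: lime_ge; first exact: is_cvg_einfs.
  exists M => // m Mm; apply: le_ereal_inf_tmp => x [k mk <-]; apply: ltW.
  by apply: hM; rewrite /= (leq_trans Mm).
apply: (le_trans (fatou mu measurableT mf (fun n w _ => f0 n w))).
rewrite limn_einf_lim; apply: lime_le; first exact: is_cvg_einfs.
apply: nearW => m; apply: (@le_trans _ _ (\int[mu]_w f (maxn m N) w)).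
  by apply: ereal_inf_lbound; exists (maxn m N) => //=; rewrite leq_maxl.
by apply: fC; rewrite /= leq_maxr.
Qed.

Lemma integral_le_double (f g h : Omega -> \bar R) :
  measurable_fun setT f -> measurable_fun setT g -> measurable_fun setT h ->
  (forall w, 0 <= f w) -> (forall w, 0 <= g w) -> (forall w, 0 <= h w) ->
  (forall w, f w <= 2%:E * g w + 2%:E * h w) ->
  \int[mu]_w f w <= 2%:E * \int[mu]_w g w + 2%:E * \int[mu]_w h w.
Proof.
move=> mf mg mh f0 g0 h0 fgh.
have t0 : (0 <= 2 :> R)%R by [].
have mg2 : measurable_fun setT (fun w => 2%:E * g w) by exact: measurable_funeM.
have mh2 : measurable_fun setT (fun w => 2%:E * h w) by exact: measurable_funeM.
have g2 w : 0 <= 2%:E * g w by rewrite mule_ge0.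
have h2 w : 0 <= 2%:E * h w by rewrite mule_ge0.
rewrite -(ge0_integralZl_EFin mu measurableT (fun w _ => g0 w) mg t0).
rewrite -(ge0_integralZl_EFin mu measurableT (fun w _ => h0 w) mh t0).
rewrite -(ge0_integralD mu measurableT (fun w _ => g2 w) mg2 (fun w _ => h2 w) mh2).
apply: ge0_le_integral => //; exact: emeasurable_funD.
Qed.

Lemma ae_series_finite (f : nat -> Omega -> \bar R) :
  (forall n, measurable_fun setT (f n)) -> (forall n w, 0 <= f n w) ->
  (forall n, \int[mu]_w f n w <= (1 / (2 ^ n.+1)%:R)%:E) ->
  {ae mu, forall w, \sum_(0 <= n <oo) f n w < +oo}.
Proof.
move=> mf f0 fb.
have mS : measurable_fun setT (fun w => \sum_(0 <= n <oo) f n w).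
  exact: (@ge0_emeasurable_sum _ _ _ setT f predT).
have S0 w : 0 <= \sum_(0 <= n <oo) f n w by exact: nneseries_ge0.
have iS : mu.-integrable setT (fun w => \sum_(0 <= n <oo) f n w).
  apply/integrableP; split => //; under eq_integral => w _ do rewrite gee0_abs //.
  rewrite integral_nneseries //.
  apply: (@le_lt_trans _ _ (\sum_(0 <= n <oo) (1 / (2 ^ n.+1)%:R)%:E)).
    by apply: lee_nneseries => n *; [exact: integral_ge0|exact: fb].
  apply: (@le_lt_trans _ _ 1%:E); last by rewrite ltry.
  exact: (@epsilon_trick0 R 1 predT ler01).
have := integrable_ae measurableT iS; apply: filterS => w /(_ I).
by rewrite ge0_fin_numE.
Qed.

End integration.

Lemma nneseries_small_term {R : realType} (u : nat -> \bar R) (eps : R) :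
  (forall n, 0 <= u n)%E -> (\sum_(0 <= n <oo) u n < +oo)%E -> 0 < eps ->
  exists n, (u n <= eps%:E)%E.
Proof.
move=> u0 fin eps0; apply: contrapT => /forallNP h.
have S0 : (0 <= \sum_(0 <= n <oo) u n)%E by exact: nneseries_ge0.
set S := (\sum_(0 <= n <oo) u n)%E in fin S0.
have SE : S = (fine S)%:E by rewrite fineK // ge0_fin_numE.
pose N := (Num.truncn (fine S / eps)).+1.
have : ((\sum_(0 <= n < N) eps%:E) <= S)%E.
  apply: (@le_trans _ _ (\sum_(0 <= n < N) u n)%E); last exact: nneseries_lim_ge.
  by apply: lee_sum => n _; apply: ltW; rewrite ltNge; apply/negP; exact: h.
rewrite sumEFin SE lee_fin big_const_nat subn0 iter_addr addr0 => {}h.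
have := truncnS_gt (fine S / eps); rewrite ltr_pdivrMr // -/N => h2.
by rewrite -[eps *+ N]mulr_natl leNgt h2 in h.
Qed.

(** * The random operators [Phi_N] *)

Section L2_sums.
Context {R : realType} {E : lmodType R[i]} (dot : {dot E for Num.conj})
  {K : countType} (e : K -> E) {J : countType}.
Local Open Scope complex_scope.
Hypothesis E_complete : complete_norm (cnorm dot).
Hypothesis e_basis : orthonormal_basis dot (cnorm dot) e.
Local Notation N := (cnorm dot).
Local Notation pnorm := (@Defs.pnorm R E dot K e J).
Local Notation hsnorm := (Defs.hsnorm dot e).
Local Notation hsn := (hsn dot e).
Local Notation hs := (hilbert_schmidt dot e).
Local Notation supported := (@supported R E dot K e J).
Local Notation frakA2 := (@Defs.frakA2 R E dot K e J).
Implicit Types (A B C D : array E J) (alpha beta r gamma : mindex J)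
  (s : seq (mindex J)).
Context {d : measure_display} {Omega : measurableType d}
  (P : probability Omega R) (n : nat) (xi : J * nat -> Omega -> R).
Hypothesis xi_signs : independent_signs P xi.
Hypothesis n0 : (0 < n)%N.
Implicit Types (X Y Z W : Omega -> E -> E).
Local Notation sgn := (sign xi).
Local Notation rsum := (psum n sgn).

Lemma hs_psum s A w : hs_array dot e A -> hs (rsum s A w).
Proof. by move=> hA; apply: hs_sum => alpha _; exact: hsZ. Qed.

Lemma measurable_psum s A : weakly_measurable dot (rsum s A).
Proof.
by apply: weakly_measurable_sum => alpha; have [] := bounded_Psi xi_signs n alpha.
Qed.

Lemma hsnorm_sqr_split (S T : E -> E) : hs S -> hs T ->
  (hsnorm S ^+ 2 <= 2%:E * hsnorm (S - T)%R ^+ 2 + 2%:E * hsnorm T ^+ 2)%E.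
Proof.
move=> hS hT; have hD := hsB hS hT.
rewrite -(hsnK hS) -(hsnK hD) -(hsnK hT) -!EFin_expe -!EFinM -EFinD lee_fin.
have : hsn S <= hsn (S - T) + hsn T by rewrite -{1}(subrK T S) hsnD.
have := hsn_ge0 dot e S; have := hsn_ge0 dot e (S - T); have := hsn_ge0 dot e T.
move: (hsn S) (hsn T) (hsn (S - T)) => x y z y0 z0 x0 xyz.
have : x ^+ 2 <= (z + y) ^+ 2 by rewrite ler_pXn2r ?nnegrE ?addr_ge0.
by have := sqr_ge0 (z - y); rewrite sqrrB sqrrD; lra.
Qed.

Lemma integral_sqr_split X Y : weakly_measurable dot X -> weakly_measurable dot Y ->
  (forall w, hs (X w)) -> (forall w, hs (Y w)) ->
  (\int[P]_w (hsnorm (X w) ^+ 2) <=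
   2%:E * \int[P]_w (hsnorm (X w - Y w)%R ^+ 2) + 2%:E * \int[P]_w (hsnorm (Y w) ^+ 2))%E.
Proof.
move=> mX mY hX hY.
have sq0 (T : E -> E) : (0 <= hsnorm T ^+ 2)%E by exact: expe2_ge0.
exact: (integral_le_double P (measurable_sqr_hsnorm e_basis mX)
  (measurable_sqr_hsnorm e_basis (weakly_measurableB mX mY)) (measurable_sqr_hsnorm e_basis mY)
  (fun w => sq0 _) (fun w => sq0 _) (fun w => sq0 _)
  (fun w => hsnorm_sqr_split (hX w) (hY w))).
Qed.

(** [W] is the unconditional L^2 sum of [D alpha * Psi alpha]. *)
Definition L2sum D W : Prop :=
  [/\ forall w, hs (W w), weakly_measurable dot W &
      forall eps : R, 0 < eps -> exists F0 : {fset mindex J},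
        forall F : {fset mindex J}, (F0 `<=` F)%fset ->
          (\int[P]_w (hsnorm (W w - rsum F D w)%R ^+ 2) <= eps%:E)%E].

(** Compare [W] with one finite sum; the constant 2 is harmless because the
    bound is applied to arrays of small norm. *)
Lemma L2sum_bound D W : hs_array dot e D -> L2sum D W ->
  (\int[P]_w (hsnorm (W w) ^+ 2) <= 2%:E * pnorm 1 D ^+ 2)%E.
Proof.
move=> hD [hW mW app]; apply/lee_addgt0Pr => eps eps0.
have e2 : 0 < eps / 2 by rewrite divr_gt0.
have [F0 /(_ F0 (fsubset_refl _)) hF] := app _ e2.
apply: (le_trans (integral_sqr_split mW (measurable_psum F0 D) hW (fun w => hs_psum F0 w hD))).
rewrite addeC; apply: leeD.
  apply: lee_wpmul2l; first by rewrite lee_fin.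
  apply: le_trans (sum_sqr_hsnorm_le dot e D (fset_uniq F0)).
  exact: (integral_psum_le e_basis xi_signs n0 D (fset_uniq F0)).
apply: (@le_trans _ _ (2%:E * (eps / 2)%:E)%E); first by apply: lee_wpmul2l => //; rewrite lee_fin.
by rewrite -EFinM mulrC divfK.
Qed.

Lemma L2sumB A X s B : supported s B -> L2sum A X -> L2sum (A - B) (fun w => X w - rsum (undup s) B w).
Proof.
move=> /supported_undup sB [hX mX app]; have hB := sB.1; split.
- by move=> w; apply: hsB => //; exact: hs_psum.
- by apply: weakly_measurableB => //; exact: measurable_psum.
move=> eps eps0; have [F0 hF0] := app _ eps0.
exists (F0 `|` [fset alpha in s])%fset => F; rewrite fsubUset => /andP[F0F sF].
rewrite -[X in (X <= _)%E](_ : (\int[P]_w (hsnorm (X w - rsum F A w)%R ^+ 2))%E = _); first exact: hF0.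
apply: eq_integral => w _; congr (hsnorm _ ^+ 2)%E; rewrite psumB.
rewrite (psum_sup _ _ _ (undup_uniq s) (fset_uniq F) _ sB).
  by rewrite opprB addrA subrK.
by move=> alpha; rewrite mem_undup => aS; apply: (fsubsetP sF); rewrite inE.
Qed.

(** The values 1 and -1 exhaust the probability of each [xi i]. *)
Lemma ae_sign : {ae P, forall w, forall i, xi i w = sgn i w}.
Proof.
have [mxi half _] := xi_signs.
have one i : {ae P, forall w, xi i w = sgn i w}.
  have mp c : measurable (xi i @^-1` [set c]) by rewrite -[_ @^-1` _]setTI; exact: mxi.
  exists (~` (xi i @^-1` [set 1] `|` xi i @^-1` [set -1])); split.
  - by apply: measurableC; apply: measurableU.
  - have mU : measurable (xi i @^-1` [set 1] `|` xi i @^-1` [set -1]) by apply: measurableU.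
    have [h1 h2] := half i; have U1 : (P (xi i @^-1` [set 1%R] `|` xi i @^-1` [set (-1)%R]) = 1)%E.
      rewrite measureU //; last first.
        by rewrite -subset0 => w /= [-> /eqP]; rewrite -subr_eq0 opprK gt_eqF.
      transitivity ((2^-1)%:E + (2^-1)%:E : \bar R)%E; first by congr (_ + _)%E; [exact: h1|exact: h2].
      by rewrite -EFinD -[2^-1]mul1r -splitr.
    by rewrite probability_setC // U1 subee.
  move=> w /= h; apply: contra_not h; rewrite /sign => -[->|->]; first by rewrite eqxx.
  by case: eqP => // /eqP; rewrite eq_sym -subr_eq0 opprK gt_eqF.
have : {ae P, forall w, forall k, if choice.pickle_inv k is Some i then xi i w = sgn i w else True}.
  by apply: ae_foralln => k; case: (choice.pickle_inv k) => [i|]; [exact: one|exact: aeW].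
apply: filterS => w h i.
by have := h (choice.pickle i); rewrite choice.pickleK_inv.
Qed.

Lemma weakly_measurable_Phi_partial F A : weakly_measurable dot (Phi_partial xi n A F).
Proof. by apply: weakly_measurable_sum => alpha; exact: (measurable_Psi n xi_signs). Qed.

Lemma integral_Phi_partial F A X : weakly_measurable dot X ->
  (\int[P]_w (hsnorm (X w - Phi_partial xi n A F w)%R ^+ 2) =
   \int[P]_w (hsnorm (X w - rsum F A w)%R ^+ 2))%E.
Proof.
move=> mX; apply: ge0_ae_eq_integral => //.
- apply: measurable_sqr_hsnorm => //; apply: weakly_measurableB => //.
  exact: weakly_measurable_Phi_partial.
- apply: measurable_sqr_hsnorm => //; apply: weakly_measurableB => //.
  exact: measurable_psum.
- by move=> w _; exact: expe2_ge0.
- by move=> w _; exact: expe2_ge0.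
have := ae_sign; apply: filterS => w h _; congr (hsnorm (_ - _)%R ^+ 2)%E.
apply: eq_bigr => alpha _; congr (_%:C *: _); apply: eq_bigr => j _.
by congr (_ * _ / _); apply: eq_bigr => D _; apply: eq_bigr => a _.
Qed.

(** Matrix entries are continuous for the Hilbert-Schmidt norm. *)
Lemma weakly_measurable_borel X : (forall w, hs (X w)) ->
  (forall U, hs_open dot e U -> measurable (X @^-1` U)) -> weakly_measurable dot X.
Proof.
move=> hX mX x y _; apply: (measurability _ (RGenOInfty.measurableE R)) => //.
move=> /= _ [_ [c ->] <-]; rewrite setTI.
have -> : (fun w => complex.Re (dot (X w x) y)) @^-1` `]c, +oo[%classic =
    X @^-1` [set T | c < complex.Re (dot (T x) y)].
  by apply/seteqP; split => w /=; rewrite in_itv /= andbT.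
apply: mX => T /= cT hT.
pose t := complex.Re (dot (T x) y) - c; have t0 : 0 < t by rewrite subr_gt0.
have b0 : 0 < N x * N y + 1 by rewrite ltr_wpDl // mulr_ge0 ?cnorm_ge0.
exists (t / (N x * N y + 1)); first by rewrite divr_gt0.
move=> S hS ST; have hD := hsB hS hT.
have : `|complex.Re (dot (S x) y) - complex.Re (dot (T x) y)| <= hsn (S - T) * (N x * N y).
  rewrite -raddfB -dotBl; apply: (le_trans (Re_le_modc _)).
  apply: (le_trans (dot_cauchy_schwarz _ _ _)); rewrite mulrA ler_wpM2r ?cnorm_ge0 //.
  exact: (hs_bound e_basis x hD).
move: ST; rewrite -(hsnK hD) lte_fin ltr_pdivlMr // => ST.
have h0 := hsn_ge0 dot e (S - T).
move=> /ler_normlP[]; rewrite opprB => h _; move: ST h h0; rewrite mulrDr mulr1 /t /=.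
by lra.
Qed.

Lemma is_Phi_L2sum A X : is_Phi P xi dot e n A X -> L2sum A X.
Proof.
move=> [hX bX _ app]; have mX := weakly_measurable_borel hX bX.
split; [exact: hX|exact: mX|move=> eps eps0].
have [F0 hF0] := app _ eps0; exists F0 => F /hF0 h.
by rewrite -(integral_Phi_partial F A mX); exact: h.
Qed.

(** Both factors and the product are almost sure limits, along a common
    subsequence, of finite sums that multiply exactly. *)
Lemma L2sum_mul A B X Y Z : frakA2 A -> frakA2 B ->
  L2sum A X -> L2sum B Y -> L2sum (ext_prod dot (vartheta R n) A B) Z ->
  {ae P, forall w, Z w = X w \o Y w}.
Proof.
move=> fA fB LX LY LZ.
have bw := vartheta_double (J := J) e_basis n0.
set C := ext_prod _ _ _ _ in LZ *.
have fC : frakA2 C by exact: (frakA2_ext_prod E_complete e_basis bw fA fB).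
pose w1 : R := 1; have r2 : 0 < 2 * 1 :> R by rewrite mulr_gt0.
pose pr k := trunc_prod (vartheta R n) k A B.
have sA k := trunc_supported k fA.1; have sB k := trunc_supported k fB.1.
have sC k := supported_prod e_basis (vartheta R n) (sA k) (sB k).
have cA := pcvg_restr mbox_exhausting ltr01 (frakA2_pspace fA ltr01).
have cB := pcvg_restr mbox_exhausting ltr01 (frakA2_pspace fB ltr01).
have cC : pcvg dot e 1 pr C.
  exact: (ext_prod_pcvg E_complete e_basis ltr01 r2 r2 ler01 (bw 1 (lexx _))
    (frakA2_pspace fA r2) (frakA2_pspace fB r2)).
have sel i : exists k, [/\ (pnorm 1 (A - trunc k A)%R <= (1 / (2 ^ i.+2)%:R)%:E)%E,
    (pnorm 1 (B - trunc k B)%R <= (1 / (2 ^ i.+2)%:R)%:E)%E &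
    (pnorm 1 (C - pr k)%R <= (1 / (2 ^ i.+2)%:R)%:E)%E].
  have d0 : 0 < 1 / (2 ^ i.+2)%:R :> R by rewrite divr_gt0 // ltr0n expn_gt0.
  have [k1 _ h1] := cA _ d0; have [k2 _ h2] := cB _ d0; have [k3 _ h3] := cC _ d0.
  exists (maxn k1 (maxn k2 k3)); split.
  - by rewrite (pnormBC dot e _ _ ler01); apply: h1; rewrite /= leq_maxl.
  - by rewrite (pnormBC dot e _ _ ler01); apply: h2; rewrite /= !leq_max leqnn orbT.
  - by rewrite (pnormBC dot e _ _ ler01); apply: h3; rewrite /= !leq_max leqnn !orbT.
pose k i := sval (cid (sel i)); have kP i := svalP (cid (sel i)).
pose tC i : seq (mindex J) := undup (contractions (undup (box (k i))) (undup (box (k i)))).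
pose Xk i w := X w - rsum (undup (box (k i))) (trunc (k i) A) w.
pose Yk i w := Y w - rsum (undup (box (k i))) (trunc (k i) B) w.
pose Zk i w := Z w - rsum (tC i) (pr (k i)) w.
have sC' i := supported_prod e_basis (vartheta R n) (supported_undup (sA (k i))) (supported_undup (sB (k i))).
have LXk i : L2sum (A - trunc (k i) A) (Xk i) by exact: (L2sumB (sA _) LX).
have LYk i : L2sum (B - trunc (k i) B) (Yk i) by exact: (L2sumB (sB _) LY).
have LZk i : L2sum (C - pr (k i)) (Zk i) by exact: (L2sumB (sC' i) LZ).
have small i D W : hs_array dot e D -> L2sum D W -> (pnorm 1 D <= (1 / (2 ^ i.+2)%:R)%:E)%E ->
    (\int[P]_w (hsnorm (W w) ^+ 2) <= (2 * (1 / (2 ^ i.+2)%:R) ^+ 2)%:E)%E.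
  move=> hD LW hp; apply: (le_trans (L2sum_bound hD LW)).
  rewrite EFinM; apply: lee_wpmul2l; first by rewrite lee_fin.
  by rewrite EFin_expe; apply: le_expe2 => //; exact: pnorm_ge0.
pose f i w := (hsnorm (Xk i w) ^+ 2 + (hsnorm (Yk i w) ^+ 2 + hsnorm (Zk i w) ^+ 2))%E.
have mf2 D W : L2sum D W -> measurable_fun setT (fun w => hsnorm (W w) ^+ 2)%E.
  by case=> _ mW _; exact: (measurable_sqr_hsnorm e_basis mW).
have mX2 i := mf2 _ _ (LXk i); have mY2 i := mf2 _ _ (LYk i); have mZ2 i := mf2 _ _ (LZk i).
have sq0 (T : E -> E) : (0 <= hsnorm T ^+ 2)%E by exact: expe2_ge0.
have f0 i w : (0 <= f i w)%E by rewrite /f !adde_ge0.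
have hsA' i : hs_array dot e (A - trunc (k i) A) by exact: (hs_arrayB fA.1 (sA _).1).
have hsB' i : hs_array dot e (B - trunc (k i) B) by exact: (hs_arrayB fB.1 (sB _).1).
have hsC' i : hs_array dot e (C - pr (k i)) by exact: (hs_arrayB fC.1 (sC _).1).
have : {ae P, forall w, (\sum_(0 <= i <oo) f i w < +oo)%E}.
  apply: ae_series_finite => //.
    by move=> i; apply: emeasurable_funD => //; exact: emeasurable_funD.
  move=> i; have [h1 h2 h3] := kP i.
  have mYZ : measurable_fun setT (fun w => hsnorm (Yk i w) ^+ 2 + hsnorm (Zk i w) ^+ 2)%E.
    exact: emeasurable_funD.
  have YZ0 w : (0 <= hsnorm (Yk i w) ^+ 2 + hsnorm (Zk i w) ^+ 2)%E by rewrite adde_ge0.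
  rewrite ge0_integralD // ge0_integralD //.
  apply: (@le_trans _ _ ((2 * (1 / (2 ^ i.+2)%:R) ^+ 2) + ((2 * (1 / (2 ^ i.+2)%:R) ^+ 2) +
    (2 * (1 / (2 ^ i.+2)%:R) ^+ 2)))%:E).
    rewrite !EFinD; apply: leeD; first exact: (small i _ _ (hsA' i) (LXk i) h1).
    apply: leeD; first exact: (small i _ _ (hsB' i) (LYk i) h2).
    exact: (small i _ _ (hsC' i) (LZk i) h3).
  rewrite lee_fin [(2 ^ i.+2)%N]expnS natrM.
  have p1 : 2 <= (2 ^ i.+1)%:R :> R by rewrite ler_nat expnS leq_pmulr // expn_gt0.
  set p := (2 ^ i.+1)%:R in p1 *; have p0 : 0 < p by lra.
  have -> : 2 * (1 / (2%:R * p)) ^+ 2 + (2 * (1 / (2%:R * p)) ^+ 2 + 2 * (1 / (2%:R * p)) ^+ 2) =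
    (3 / 2) / p * (1 / p) by field; rewrite gt_eqF.
  by apply: ler_piMl; [rewrite divr_ge0 // ltW|rewrite ler_pdivrMr // mul1r; lra].
apply: filterS => w fin.
have hX : hs (X w) by case: LX. have hY : hs (Y w) by case: LY. have hZ : hs (Z w) by case: LZ.
have hXY := hs_comp e_basis hX hY; have hD := hsB hZ hXY.
apply/eqP; rewrite -subr_eq0; apply/eqP; apply: (hsnorm_eq0 e_basis hD.1).
rewrite -(hsnK hD); congr EFin; apply/eqP; rewrite eq_le hsn_ge0 andbT.
apply/ler_addgt0Pr => eps eps0; rewrite add0r.
pose M := 2 + hsn (X w) + hsn (Y w).
have M0 : 0 < M by rewrite /M; have := hsn_ge0 dot e (X w); have := hsn_ge0 dot e (Y w); lra.
pose dl := Num.min 1 (eps / M); have dl0 : 0 < dl by rewrite lt_min ltr01 divr_gt0.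
have dl1 : dl <= 1 by rewrite ge_min lexx.
have dlM : dl * M <= eps by rewrite -ler_pdivlMr // ge_min lexx orbT.
have [i fi] := nneseries_small_term (f0^~ w) fin (exprn_gt0 2 dl0).
have hXk : hs (Xk i w) by case: (LXk i). have hYk : hs (Yk i w) by case: (LYk i).
have hZk : hs (Zk i w) by case: (LZk i).
have le_dl (T : E -> E) : hs T -> (hsnorm T ^+ 2 <= f i w)%E -> hsn T <= dl.
  move=> hT Tf; have := le_trans Tf fi; rewrite -(hsnK hT) -EFin_expe lee_fin.
  by rewrite ler_pXn2r // nnegrE ?hsn_ge0 // ltW.
have dX : hsn (Xk i w) <= dl by apply: le_dl => //; rewrite leeDl // adde_ge0.
have dY : hsn (Yk i w) <= dl by apply: le_dl => //; rewrite /f addeCA leeDl // adde_ge0.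
have dZ : hsn (Zk i w) <= dl by apply: le_dl => //; rewrite /f addeA leeDr // adde_ge0.
set x := rsum (undup (box (k i))) (trunc (k i) A) w.
set y := rsum (undup (box (k i))) (trunc (k i) B) w.
have zE : rsum (tC i) (pr (k i)) w = x \o y.
  have sx j : sgn j w ^+ 2 = 1 by exact: sign_sqr.
  exact: (psum_prod n0 sx (undup_uniq _) (undup_uniq _) (supported_undup (sA (k i))) (supported_undup (sB (k i)))).
have hx : hs x by apply: hs_psum; case: (sA (k i)).
have hy : hs y by apply: hs_psum; case: (sB (k i)).
have hXyD : hs (X w \o Yk i w) := hs_comp e_basis hX hYk.
have hXky : hs (Xk i w \o y) := hs_comp e_basis hXk hy.
have -> : Z w - (X w \o Y w) = Zk i w - ((Xk i w \o y) + (X w \o Yk i w)).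
  have [[lX _] _] := hX.
  apply/funext => v; rewrite -[LHS]/(Z w v - X w (Y w v)).
  rewrite -[RHS]/(Z w v - rsum (tC i) (pr (k i)) w v - (X w (y v) - x (y v) + X w (Y w v - y v))).
  rewrite zE /= linB //; move: (Z w v) (X w (y v)) (x (y v)) (X w (Y w v)) => a b c c'.
  by rewrite [b - c + _]addrC addrA subrK opprB addrA subrK.
have hsnB S T : hs S -> hs T -> hsn (S - T) <= hsn S + hsn T.
  move=> hS hT; rewrite -lee_fin EFinD !hsnK //; last exact: hsB.
  exact: (eseminormB (eseminorm_hs dot e)).
have yE : y = Y w - Yk i w by rewrite /Yk -/y opprB addrC subrK.
have ny : hsn y <= hsn (Y w) + dl by rewrite yE (le_trans (hsnB _ _ hY hYk)) // lerD2l.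
have n1 : hsn (Xk i w \o y) <= dl * (hsn (Y w) + dl).
  by apply: (le_trans (hsn_comp e_basis hXk hy)); rewrite ler_pM ?hsn_ge0.
have n2 : hsn (X w \o Yk i w) <= hsn (X w) * dl.
  by apply: (le_trans (hsn_comp e_basis hX hYk)); rewrite ler_wpM2l ?hsn_ge0.
apply: (le_trans (hsnB _ _ hZk (hsD hXky hXyD))).
apply: le_trans dlM; have := hsnD hXky hXyD.
move: dX dY dZ n1 n2; rewrite /M.
have : dl * dl <= dl by rewrite ger_pMl.
have := hsn_ge0 dot e (X w); have := hsn_ge0 dot e (Y w).
move: (hsn (X w)) (hsn (Y w)) (hsn (Xk i w)) (hsn (Yk i w)) (hsn (Zk i w)) (hsn (_ \o _)) (hsn (_ \o _)) (hsn (_ + _)).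
by move=> a b c c1 c2 c3 c4 c5; lra.
Qed.

End L2_sums.

Section discrete_variables.
Context {d : measure_display} {Omega : measurableType d}.

(** Measurable for every structure on the target. *)
Definition discrete_variable {T : Type} (g : Omega -> T) : Prop :=
  finite_set (range g) /\ forall y, measurable (g @^-1` [set y]).

Lemma discrete_preimage (T : Type) (g : Omega -> T) (U : set T) :
  discrete_variable g -> measurable (g @^-1` U).
Proof.
move=> [fg mg]; have -> : g @^-1` U = \bigcup_(y in range g `&` U) (g @^-1` [set y]).
  apply/seteqP; split => [w Uw|w [y [_ Uy] /= ->//]].
  by exists (g w) => //; split => //; exists w.
apply: fin_bigcup_measurable => [|y _]; last exact: mg.
exact: (sub_finite_set (@subIsetl _ _ _) fg).
Qed.

Lemma discrete_cst (T : Type) (c : T) : discrete_variable (fun=> c).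
Proof.
split; first by apply: (sub_finite_set _ (finite_set1 c)) => _ [w _ <-].
move=> y; have [->|cy] := pselect (c = y).
  by rewrite (_ : _ @^-1` _ = setT) //; apply/seteqP.
by rewrite (_ : _ @^-1` _ = set0) //; apply/seteqP; split => // w /= /cy.
Qed.

Lemma discrete_comp2 (T S V : Type) (h : T -> S -> V) g g' :
  discrete_variable g -> discrete_variable g' -> discrete_variable (fun w => h (g w) (g' w)).
Proof.
move=> [fg mg] [fg' mg']; split.
  apply: (sub_finite_set _ (finite_image2 h fg fg')) => _ [w _ <-].
  by exists (g w); [exists w|exists (g' w); [exists w|]].
move=> y; have -> : (fun w => h (g w) (g' w)) @^-1` [set y] =
    (fun w => (g w, g' w)) @^-1` [set p | h p.1 p.2 = y] by [].
apply: discrete_preimage; split.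
  apply: (sub_finite_set _ (finite_setX fg fg')) => _ [w _ <-].
  by split; exists w.
move=> [a b]; have -> : (fun w => (g w, g' w)) @^-1` [set (a, b)] = g @^-1` [set a] `&` g' @^-1` [set b].
  by apply/seteqP; split => w /= [-> ->].
by apply: measurableI.
Qed.

Lemma discrete_big (T I : Type) (idx : T) (op : T -> T -> T) (s : seq I) (Q : pred I)
    (F : I -> Omega -> T) : (forall i, discrete_variable (F i)) ->
  discrete_variable (fun w => \big[op/idx]_(i <- s | Q i) F i w).
Proof.
move=> dF; elim: s => [|i s ih].
  under [X in discrete_variable X]eq_fun do rewrite big_nil.
  exact: discrete_cst.
under [X in discrete_variable X]eq_fun do rewrite big_cons.
by case: (Q i) => //; exact: (discrete_comp2 op).
Qed.

End discrete_variables.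

Section existence.
Context {R : realType} {E : lmodType R[i]} (dot : {dot E for Num.conj})
  {K : countType} (e : K -> E) {J : countType}.
Local Open Scope complex_scope.
Hypothesis E_complete : complete_norm (cnorm dot).
Hypothesis e_basis : orthonormal_basis dot (cnorm dot) e.
Local Notation pnorm := (@Defs.pnorm R E dot K e J).
Local Notation hsnorm := (Defs.hsnorm dot e).
Local Notation hsn := (hsn dot e).
Local Notation hs := (hilbert_schmidt dot e).
Local Notation supported := (@supported R E dot K e J).
Local Notation frakA2 := (@Defs.frakA2 R E dot K e J).
Implicit Types (A B C D : array E J) (alpha beta r gamma : mindex J)
  (s : seq (mindex J)).

(** Completeness of the Hilbert--Schmidt operators: it is that of the arrays
    with a single coefficient. *)
Lemma hs_complete (u : nat -> E -> E) : (forall n, hs (u n)) ->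
  (forall eps : R, 0 < eps -> exists n0, forall m n, (n0 <= m)%N -> (n0 <= n)%N ->
    (hsnorm (u m - u n)%R <= eps%:E)%E) ->
  exists2 T, hs T & forall eps : R, 0 < eps ->
    exists n0, forall n, (n0 <= n)%N -> (hsnorm (u n - T)%R <= eps%:E)%E.
Proof.
move=> hu cu; pose v n : array E J := single mzero (u n).
have hv n : hs_array dot e (v n) by exact: hs_single.
have vB m n : v m - v n = single mzero (u m - u n).
  apply/funext => beta; rewrite -[LHS]/(v m beta - v n beta) /v /single.
  by case: ifP => // _; rewrite subr0.
have cv : pcauchy dot e 1 v.
  move=> eps eps0; have [n0 h] := cu _ eps0; apply/near2P; exists n0 => m n hm hn.
  by rewrite vB pnorm_single // expr1n mul1e; exact: h.
have [L vL] := pcauchy_limit E_complete e_basis ltr01 hv cv.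
have hL := pcauchy_hs_array e_basis ltr01 hv cv vL.
exists (L mzero); first exact: hL.
move=> eps eps0; have /near2P[n0 h] := cv _ eps0; exists n0 => n hn.
have := pcauchy_bound ltr01 vL h hn; apply: le_trans.
have := hsnorm_le_pnorm dot e (v n - L) mzero (rho := 1) ler01.
by rewrite expr1n mul1e -[(v n - L) mzero]/(v n mzero - L mzero) /v /single eqxx.
Qed.

Lemma hs_geometric (u : nat -> E -> E) (M : R) : (forall n, hs (u n)) -> 0 <= M ->
  (forall n, hsn (u n.+1 - u n) <= M / 2 ^+ n) ->
  exists2 T, hs T & forall eps : R, 0 < eps ->
    exists n0, forall n, (n0 <= n)%N -> (hsnorm (u n - T)%R <= eps%:E)%E.
Proof.
move=> hu M0 hb.
have p2 n : 0 < 2 ^+ n :> R by rewrite exprn_gt0.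
have step m j : hsn (u (m + j)%N - u m) <= 2 * M / 2 ^+ m - 2 * M / 2 ^+ (m + j).
  elim: j => [|j ih]; first by rewrite addn0 !subrr hsn0.
  have -> : u (m + j.+1)%N - u m = (u (m + j).+1 - u (m + j)%N) + (u (m + j)%N - u m).
    by rewrite addnS addrA subrK.
  apply: (le_trans (hsnD (hsB (hu _) (hu _)) (hsB (hu _) (hu _)))).
  apply: (le_trans (lerD (hb _) ih)).
  rewrite addnS exprS invfM !mulrA.
  have -> : 2 * M / 2 = M by rewrite mulrAC divff ?mul1r.
  by move: (M / 2 ^+ (m + j)) (2 * M / 2 ^+ m) (2 * M / 2 ^+ (m + j)) (mulrA 2 M (2 ^+ (m + j))^-1) => a b c; lra.
apply: hs_complete => // eps eps0.
pose n0 := Num.truncn (4 * M / eps); exists n0.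
have hn0 m : (n0 <= m)%N -> 2 * M / 2 ^+ m <= eps / 2.
  move=> h; rewrite ler_pdivrMr //.
  have : 4 * M / eps <= 2 ^+ m.
    apply: (le_trans (ltW (truncnS_gt _))); rewrite -natrX ler_nat.
    exact: (leq_ltn_trans h (ltn_expl m (ltnSn 1))).
  by rewrite ler_pdivrMr //; lra.
have dist m : (n0 <= m)%N -> hsn (u m - u n0) <= eps / 2.
  move=> h; rewrite -(subnKC h); apply: (le_trans (step _ _)).
  apply: le_trans (hn0 _ (leqnn _)); rewrite gerBl divr_ge0 ?(ltW (p2 _)) //.
  by rewrite mulr_ge0.
move=> m n hm hn; have hsb a b := hsB (hu a) (hu b).
rewrite -(hsnK (hsb m n)) lee_fin.
have -> : u m - u n = (u m - u n0) - (u n - u n0) by rewrite opprB addrA subrK.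
have hB S T : hs S -> hs T -> hsn (S - T) <= hsn S + hsn T.
  move=> hS hT; rewrite -lee_fin EFinD !hsnK //; last exact: hsB.
  exact: (eseminormB (eseminorm_hs dot e)).
apply: (le_trans (hB _ _ (hsb _ _) (hsb _ _))).
by rewrite (splitr eps) lerD // dist.
Qed.

(** Enlarging the index set only deletes coefficients of the remainder. *)
Lemma restr_close A (eps : R) : frakA2 A -> 0 < eps -> exists F0 : {fset mindex J},
  forall F : {fset mindex J}, (F0 `<=` F)%fset -> (pnorm 1 (A - restr F A)%R <= eps%:E)%E.
Proof.
move=> fA eps0.
have [k _ /(_ k (leqnn k)) hk] := pcvg_restr mbox_exhausting ltr01 (frakA2_pspace fA ltr01) eps0.
exists [fset alpha in box k]%fset => F F0F.
apply: le_trans hk; rewrite [leRHS](pnormBC dot e _ _ ler01).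
apply: le_pnorm_level; first exact: ler01.
move=> m; rewrite !expr1n !mul1e !levelE; apply: le_ell2 => alpha _.
rewrite (eseminorm_ge0 (eseminorm_hs dot e)) /=.
rewrite -[(A - restr F A) alpha]/(A alpha - restr F A alpha).
rewrite -[X in (_ <= hsnorm X)%E]/(A alpha - restr (box k) A alpha) /restr.
have [aF|aF] := boolP (alpha \in (F : seq (mindex J))).
  by rewrite subrr (eseminorm0 (eseminorm_hs dot e)) (eseminorm_ge0 (eseminorm_hs dot e)).
case: ifP => // ak; move: aF => /negP; case.
by apply: (fsubsetP F0F); rewrite inE.
Qed.

Context {d : measure_display} {Omega : measurableType d}
  (P : probability Omega R) (n : nat) (xi : J * nat -> Omega -> R).
Hypothesis xi_signs : independent_signs P xi.
Hypothesis n0 : (0 < n)%N.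
Local Notation sgn := (sign xi).
Local Notation rsum := (psum n sgn).

Lemma discrete_sign i : discrete_variable (sgn i).
Proof.
split.
  apply: (sub_finite_set _ (finite_set2 1 (-1))) => _ [w _ <-].
  by rewrite /sign; case: ifP => _; [left|right].
by move=> y; rewrite -[_ @^-1` _]setTI; have [mf _] := bounded_sign xi_signs i; exact: mf.
Qed.

Lemma discrete_psum s A : discrete_variable (rsum s A).
Proof.
have -> : rsum s A = (fun w => \sum_(alpha <- s) (Psi sgn n alpha w)%:C *: A alpha) by [].
apply: discrete_big => alpha.
apply: (discrete_comp2 (fun (c : R) (_ : unit) => c%:C *: A alpha) (g' := fun=> tt)); last exact: discrete_cst.
apply: discrete_big => j; rewrite /Qpoly.
apply: (discrete_comp2 (fun (c : R) (_ : unit) => (alpha j)`!%:R * (Num.sqrt n%:R) ^- (alpha j) * c / Num.sqrt (alpha j)`!%:R) (g' := fun=> tt)); last exact: discrete_cst.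
by apply: discrete_big => D; apply: discrete_big => a; exact: discrete_sign.
Qed.

Lemma integral_psum_pnorm s D : uniq s ->
  (\int[P]_w (hsnorm (rsum s D w) ^+ 2) <= pnorm 1 D ^+ 2)%E.
Proof.
move=> us; apply: le_trans (sum_sqr_hsnorm_le dot e D us).
exact: (integral_psum_le e_basis xi_signs n0 D us).
Qed.

Section construction.
Variables (A : array E J) (k : nat -> nat).
Hypothesis fA : frakA2 A.
Hypothesis kP : forall i, (pnorm 1 (A - trunc (k i) A)%R <= (1 / 2 / 4 ^+ i.+1)%:E)%E.

Let X i w := rsum (undup (box (k i))) (trunc (k i) A) w.
Let inc i w : \bar R := ((4 ^+ i)%:E * hsnorm (X i.+1 w - X i w)%R ^+ 2)%E.
Let Om := [set w | (\sum_(0 <= i <oo) inc i w < +oo)%E].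

Let hX i w : hs (X i w).
Proof. by apply: hs_psum; have [] := trunc_supported (k i) fA.1. Qed.

Let mX i : weakly_measurable dot (X i).
Proof. exact: (measurable_psum dot n xi_signs). Qed.

Let inc0 i w : (0 <= inc i w)%E.
Proof. by rewrite /inc mule_ge0 ?lee_fin ?exprn_ge0 //; exact: expe2_ge0. Qed.

Let minc i : measurable_fun setT (inc i).
Proof.
apply: measurable_funeM; apply: measurable_sqr_hsnorm => //.
exact: (weakly_measurableB (mX i.+1) (mX i)).
Qed.

Let psum_diff s s' B B' : supported s B -> supported s' B' -> exists2 t, uniq t &
  forall w, rsum (undup s) B w - rsum (undup s') B' w = rsum t (B - B') w.
Proof.
move=> sB sB'; exists (undup (s ++ s')); first exact: undup_uniq.
move=> w; rewrite psumB; congr (_ - _); symmetry.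
  apply: (psum_sup _ _ _ (undup_uniq s) (undup_uniq _) _ (supported_undup sB)).
  by move=> a; rewrite !mem_undup mem_cat => ->.
apply: (psum_sup _ _ _ (undup_uniq s') (undup_uniq _) _ (supported_undup sB')).
by move=> a; rewrite !mem_undup mem_cat => ->; rewrite orbT.
Qed.

Let inc_small i : (\int[P]_w inc i w <= (1 / (2 ^ i.+1)%:R)%:E)%E.
Proof.
have [t ut tE] := psum_diff (trunc_supported (k i.+1) fA.1) (trunc_supported (k i) fA.1).
rewrite ge0_integralZl_EFin ?exprn_ge0 //; last 2 first.
- by move=> w _; exact: expe2_ge0.
- apply: measurable_sqr_hsnorm => //; exact: (weakly_measurableB (mX i.+1) (mX i)).
under eq_integral => w _ do rewrite tE.
have p4 j : 0 < 4 ^+ j :> R by rewrite exprn_gt0.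
have b : (pnorm 1 (trunc (k i.+1) A - trunc (k i) A)%R <= (1 / 4 ^+ i.+1)%:E)%E.
  apply: (le_trans (pnorm_split dot e _ A _ ler01)).
  rewrite [X in (X + _)%E](pnormBC dot e _ _ ler01).
  apply: (le_trans (leeD (kP i.+1) (kP i))); rewrite -EFinD lee_fin.
  rewrite [4 ^+ i.+2]exprS invfM; have : 0 <= (4 ^+ i.+1)^-1 :> R by rewrite invr_ge0 ltW.
  by move: (4 ^+ i.+1)^-1 => q; lra.
apply: (@le_trans _ _ ((4 ^+ i)%:E * ((1 / 4 ^+ i.+1) ^+ 2)%:E)%E).
  apply: lee_wpmul2l; first by rewrite lee_fin ltW.
  apply: (le_trans (integral_psum_pnorm _ ut)).
  by rewrite EFin_expe; apply: le_expe2 => //; exact: pnorm_ge0.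
rewrite -EFinM lee_fin.
have p2 : 0 < 2 ^+ i :> R by rewrite exprn_gt0.
have p21 : 1 <= 2 ^+ i :> R by rewrite exprn_ege1 // ler1n.
have -> : 4 ^+ i.+1 = 4 * (2 ^+ i * 2 ^+ i) :> R.
  by rewrite exprS -exprMn (_ : 2 * 2 = 4 :> R) //; ring.
have -> : 4 ^+ i = 2 ^+ i * 2 ^+ i :> R by rewrite -exprMn (_ : 2 * 2 = 4 :> R) //; ring.
rewrite natrX [2%:R ^+ i.+1]exprS; move: (2 ^+ i) p2 p21 => p p0 p1.
have -> : p * p * (1 / (4 * (p * p))) ^+ 2 = (1 / (2 * p)) * (1 / (8 * p)).
  by field; rewrite gt_eqF.
apply: ler_piMr; first by rewrite divr_ge0 // ltW // mulr_gt0.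
by rewrite ler_pdivrMr ?mulr_gt0 // mul1r; lra.
Qed.

Let ae_Om : {ae P, forall w, Om w}.
Proof. exact: (ae_series_finite minc inc0 inc_small). Qed.

Let measurable_Om : measurable Om.
Proof.
have mS : measurable_fun setT (fun w => \sum_(0 <= i <oo) inc i w)%E.
  by apply: (@ge0_emeasurable_sum _ _ _ setT inc predT).
by have := emeasurable_fun_infty_o measurableT mS +oo; rewrite setTI.
Qed.

Let limit w : Om w -> exists2 T, hs T & forall eps : R, 0 < eps ->
    exists n0, forall i, (n0 <= i)%N -> (hsnorm (X i w - T)%R <= eps%:E)%E.
Proof.
move=> fin.
have S0 : (0 <= \sum_(0 <= i <oo) inc i w)%E by exact: nneseries_ge0.
pose S := fine (\sum_(0 <= i <oo) inc i w).
have S0' : 0 <= S by exact: fine_ge0.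
have SE : (\sum_(0 <= i <oo) inc i w)%E = S%:E by rewrite /S fineK // ge0_fin_numE.
apply: (@hs_geometric (fun i => X i w) (Num.sqrt S)) => [i||i]; rewrite ?sqrtr_ge0 //.
have hD : hs (X i.+1 w - X i w) := hsB (hX _ _) (hX _ _).
have : (inc i w <= S%:E)%E.
  rewrite -SE nneseries_esumT //.
  exact: (@esum_ge_term R nat setT (inc^~ w)).
rewrite /inc -(hsnK hD) -EFin_expe -EFinM lee_fin => h.
have p2 : 0 < 2 ^+ i :> R by rewrite exprn_gt0.
rewrite ler_pdivlMr // -[leLHS]ger0_norm ?mulr_ge0 ?hsn_ge0 ?(ltW p2) // -sqrtr_sqr.
rewrite ler_sqrt // exprMn mulrC -exprM mulnC exprM; move: h.
by rewrite (_ : 2 ^+ 2 = 4 :> R) //; rewrite expr2; ring.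
Qed.

Definition Phi_limit w : E -> E :=
  xget 0 [set T | Om w /\ hs T /\ forall eps : R, 0 < eps ->
    exists n0, forall i, (n0 <= i)%N -> (hsnorm (X i w - T)%R <= eps%:E)%E].

Let Phi_limitP w : Om w -> forall eps : R, 0 < eps ->
    exists n0, forall i, (n0 <= i)%N -> (hsnorm (X i w - Phi_limit w)%R <= eps%:E)%E.
Proof.
move=> Ow; rewrite /Phi_limit; case: xgetP => [T _ [_ []] //|h].
by have [T hT lT] := limit Ow; case: (h T).
Qed.

Let Phi_limit_out w : ~ Om w -> Phi_limit w = 0.
Proof. by move=> Ow; rewrite /Phi_limit; case: xgetP => // T _ [/Ow]. Qed.

Let hs_Phi_limit w : hs (Phi_limit w).
Proof. by rewrite /Phi_limit; case: xgetP => [T _ [_ []] //|_]; exact: hs0. Qed.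

(** A limit of discrete variables is Borel: it lies in an open set [U] when
    its approximants eventually stay in [U] with a uniform margin. *)
Let borel_Phi_limit U : hs_open dot e U -> measurable (Phi_limit @^-1` U).
Proof.
move=> oU; pose V q : set (E -> E) := [set T | forall S, hs S -> (hsnorm (S - T)%R < (q.+1%:R^-1)%:E)%E -> U S].
have -> : Phi_limit @^-1` U =
    (Om `&` \bigcup_q \bigcup_m \bigcap_(i in [set i | (m <= i)%N]) (X i @^-1` V q)) `|`
    (~` Om `&` [set _ | U 0]).
  apply/seteqP; split => w.
    move=> /= Uw; have [Ow|Ow] := pselect (Om w); last first.
      by right; split => //; rewrite -(Phi_limit_out Ow).
    left; split => //; have [eps eps0 ball] := oU _ Uw (hs_Phi_limit w).
    pose q := Num.truncn (2 / eps).
    have q0 : 0 < q.+1%:R^-1 :> R by rewrite invr_gt0.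
    have qe : 2 * q.+1%:R^-1 < eps.
      have := truncnS_gt (2 / eps); rewrite -/q ltr_pdivrMr // => h.
      by rewrite ltr_pdivrMr // mulrC.
    have [m hm] := Phi_limitP Ow q0; exists q => //; exists m => // i /= mi S hS Si.
    apply: ball => //; apply: (le_lt_trans (eseminorm_split (eseminorm_hs dot e) _ (X i w) _)).
    apply: (@lt_trans _ _ ((2 * q.+1%:R^-1)%:E)); last by rewrite lte_fin.
    have -> : 2 * q.+1%:R^-1 = q.+1%:R^-1 + q.+1%:R^-1 :> R by ring.
    have hD : hs (X i w - Phi_limit w) := hsB (hX i w) (hs_Phi_limit w).
    have := hm i mi; rewrite -(hsnK hD) => ch.
    by rewrite EFinD; apply: lte_leD; [by []|exact: Si|exact: ch].
  case=> [[Ow [q _ [m _ h]]]|[Ow U0]]; last by rewrite /= (Phi_limit_out Ow).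
  have q0 : 0 < q.+1%:R^-1 / 2 :> R by rewrite divr_gt0 // invr_gt0.
  have [m' hm] := Phi_limitP Ow q0; apply: (h (maxn m m')); rewrite /= ?leq_maxl //.
  rewrite (eseminormBC (eseminorm_hs dot e)).
  apply: (le_lt_trans (hm _ (leq_maxr _ _))).
  by rewrite lte_fin ltr_pdivrMr // ltr_pMr ?ltr1n // invr_gt0.
apply: measurableU.
  apply: measurableI => //; apply: bigcup_measurable => q _.
  apply: bigcup_measurable => m _; apply: bigcap_measurable => [|i _]; first by exists m => /=.
  apply: discrete_preimage; exact: discrete_psum.
apply: measurableI; first exact: measurableC.
have [h|h] := pselect (U 0).
  by rewrite (_ : [set _ | _] = setT) //; apply/seteqP; split.
by rewrite (_ : [set _ | _] = set0) //; apply/seteqP; split.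
Qed.

Let mL : weakly_measurable dot Phi_limit.
Proof. exact: (weakly_measurable_borel e_basis hs_Phi_limit borel_Phi_limit). Qed.

Lemma Phi_limit_is_Phi : is_Phi P xi dot e n A Phi_limit.
Proof.
have app (eps : R) : 0 < eps -> exists F0 : {fset mindex J},
    forall F : {fset mindex J}, (F0 `<=` F)%fset ->
      (\int[P]_w (hsnorm (Phi_limit w - rsum F A w)%R ^+ 2) <= eps%:E)%E.
  move=> eps0; pose dl := Num.sqrt eps / 2.
  have s0 : 0 < Num.sqrt eps by rewrite sqrtr_gt0.
  have d0 : 0 < dl by rewrite divr_gt0.
  have [F0 hF0] := restr_close fA d0; exists F0 => F /hF0 hF.
  pose f i w := (hsnorm (X i w - rsum F A w)%R ^+ 2)%E.
  have mF : weakly_measurable dot (rsum F A) by exact: (measurable_psum dot n xi_signs).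
  have hFA w : hs (rsum F A w) by apply: hs_psum; exact: fA.1.
  have mf i : measurable_fun setT (f i).
    by apply: measurable_sqr_hsnorm => //; exact: (weakly_measurableB (mX i) mF).
  have mg : measurable_fun setT (fun w => hsnorm (Phi_limit w - rsum F A w)%R ^+ 2)%E.
    by apply: measurable_sqr_hsnorm => //; exact: (weakly_measurableB mL mF).
  apply: (fatou_lsc mf _ mg); rewrite /f.
  - by move=> i w; exact: expe2_ge0.
  - by move=> w; exact: expe2_ge0.
  - move: ae_Om; apply: filterS => w Ow.
    have hD i : hs (X i w - rsum F A w) := hsB (hX i w) (hFA w).
    apply: lsc_sqr => [i||]; try exact: (eseminorm_ge0 (eseminorm_hs dot e)).
    have hG : hs (Phi_limit w - rsum F A w) := hsB (hs_Phi_limit w) (hFA w).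
    rewrite -(hsnK hG); under [X in lsc X _]eq_fun => i do rewrite -(hsnK (hD i)).
    apply: lsc_cvg; apply/cvgrPdist_le => t t0.
    have [m hm] := Phi_limitP Ow t0; exists m => // i /= mi.
    have hXL : hs (X i w - Phi_limit w) := hsB (hX i w) (hs_Phi_limit w).
    have hLX : hs (Phi_limit w - X i w) := hsB (hs_Phi_limit w) (hX i w).
    have c := hm i mi; have c' := c.
    rewrite -(hsnK hXL) lee_fin in c.
    rewrite (eseminormBC (eseminorm_hs dot e)) -(hsnK hLX) lee_fin in c'.
    have t1 : hsn (Phi_limit w - rsum F A w) <= hsn (Phi_limit w - X i w) + hsn (X i w - rsum F A w).
      by have h := hsnD hLX (hD i); rewrite addrA subrK in h; exact: h.
    have t2 : hsn (X i w - rsum F A w) <= hsn (X i w - Phi_limit w) + hsn (Phi_limit w - rsum F A w).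
      by have h := hsnD hXL hG; rewrite addrA subrK in h; exact: h.
    by apply/ler_normlP; split; rewrite ?opprB; move: c c' t1 t2; lra.
  have [m hm] : exists m, (1 / 2 / 4 ^+ m.+1 : R) <= dl.
    exists (Num.truncn (1 / dl)); rewrite ler_pdivrMr ?exprn_gt0 //.
    have : 1 / dl < 4 ^+ (Num.truncn (1 / dl)).+1.
      apply: (lt_trans (truncnS_gt _)); rewrite -natrX ltr_nat; exact: ltn_expl.
    by rewrite ltr_pdivrMr //; lra.
  exists m => // i /= mi.
  have sF : supported F (restr F A) by exact: restr_supported fA.1.
  have [t ut tE] := psum_diff (trunc_supported (k i) fA.1) sF.
  have FE w : rsum F A w = rsum (undup F) (restr F A) w.
    rewrite undup_id ?fset_uniq // /psum big_seq [RHS]big_seq.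
    by apply: eq_bigr => alpha aF; rewrite /restr aF.
  under eq_integral => w _ do rewrite FE /X tE.
  apply: (le_trans (integral_psum_pnorm _ ut)).
  have -> : eps%:E = ((2 * dl)%:E ^+ 2)%E.
    by rewrite -EFin_expe /dl mulrC divfK // sqr_sqrtr // ltW.
  apply: le_expe2; first exact: pnorm_ge0.
  apply: (le_trans (pnorm_split dot e _ A _ ler01)).
  rewrite [X in (X + _)%E](pnormBC dot e _ _ ler01).
  have -> : ((2 * dl)%:E = dl%:E + dl%:E)%E by rewrite -EFinD; congr EFin; ring.
  apply: leeD; last exact: hF.
  apply: (le_trans (kP i)); rewrite lee_fin; apply: le_trans hm.
  by rewrite ler_pM2l // lef_pV2 ?posrE ?exprn_gt0 // ler_eXn2l ?ltnS // ltr1n.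
have LL : L2sum dot e P n xi A Phi_limit.
  by split; [exact: hs_Phi_limit|exact: mL|exact: app].
split; [exact: hs_Phi_limit|exact: borel_Phi_limit| |].
  apply: (le_lt_trans (L2sum_bound e_basis xi_signs n0 fA.1 LL)).
  have [a a0 ->] := pspace_fin ltr01 (frakA2_pspace fA ltr01).
  by rewrite -EFin_expe -EFinM ltry.
move=> eps /app[F0 hF0]; exists F0 => F /hF0 h.
by rewrite (integral_Phi_partial e_basis n xi_signs F A mL).
Qed.

End construction.

Lemma Phi_exists A : frakA2 A -> exists X, is_Phi P xi dot e n A X.
Proof.
move=> fA.
have sel i : exists k, (pnorm 1 (A - trunc k A)%R <= (1 / 2 / 4 ^+ i.+1)%:E)%E.
  have c0 : 0 < 1 / 2 / 4 ^+ i.+1 :> R by rewrite !divr_gt0 // exprn_gt0.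
  have [k _ /(_ k (leqnn k)) hk] := pcvg_restr mbox_exhausting ltr01 (frakA2_pspace fA ltr01) c0.
  by exists k; rewrite (pnormBC dot e _ _ ler01).
exists (Phi_limit A (fun i => sval (cid (sel i)))).
exact: (Phi_limit_is_Phi fA (fun i => svalP (cid (sel i)))).
Qed.

End existence.

(** * Necessity of the admissibility condition *)

Section generating_function.
Context {R : realType}.
Implicit Types (x y u q : R).

Definition contraction_coef m n s : R :=
  (s`! * 'C(m, s) * 'C(n, s))%:R * Num.sqrt ((m + n - 2 * s)`!%:R / (m`!%:R * n`!%:R)).

Definition exp_sum u L : R := \sum_(0 <= l < L) u ^+ l / l`!%:R.

(** Between [expR (u ^+ 2 / 2)] and [expR ((1 + eps) * u ^+ 2 / 2)] up to a
    constant: it replaces the exponential when the weights are the square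
    roots of factorials. *)
Definition gauss_sum u L : R := \sum_(0 <= l < L) u ^+ l / Num.sqrt l`!%:R.

Lemma exp_sum_cvg u : exp_sum u L @[L --> \oo] --> expR u.
Proof. exact: is_cvg_series_exp_coeff. Qed.

Lemma exp_sum_le u L : 0 <= u -> exp_sum u L <= expR u.
Proof.
move=> u0; apply: (nondecreasing_cvgn_le _ (is_cvg_series_exp_coeff u)).
apply/nondecreasing_seqP => k; rewrite /series /= big_nat_recr //= lerDl.
exact: exp_coeff_ge0.
Qed.

Lemma exp_sum_ge0 u L : 0 <= u -> 0 <= exp_sum u L.
Proof. by move=> u0; apply: sumr_ge0 => l _; rewrite divr_ge0 ?exprn_ge0. Qed.

Lemma gauss_sum_ge0 u L : 0 <= u -> 0 <= gauss_sum u L.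
Proof. by move=> u0; apply: sumr_ge0 => l _; rewrite divr_ge0 ?exprn_ge0 ?sqrtr_ge0. Qed.

(** The square of a sum of nonnegative terms dominates the sum of squares. *)
Lemma gauss_sum_lower u L : 0 <= u -> exp_sum (u ^+ 2) L <= gauss_sum u L ^+ 2.
Proof.
move=> u0; elim: L => [|L ih]; first by rewrite /exp_sum /gauss_sum !big_geq // expr0n.
rewrite /exp_sum /gauss_sum !big_nat_recr //= -/(exp_sum _ L) -/(gauss_sum _ L) sqrrD.
have t0 : 0 <= u ^+ L / Num.sqrt L`!%:R by rewrite divr_ge0 ?exprn_ge0 ?sqrtr_ge0.
have -> : (u ^+ 2) ^+ L / L`!%:R = (u ^+ L / Num.sqrt L`!%:R) ^+ 2.
  by rewrite expr_div_n sqr_sqrtr // -!exprM mulnC.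
by rewrite lerD2r (le_trans ih) // lerDl mulrn_wge0 // mulr_ge0 // gauss_sum_ge0.
Qed.

Lemma geometric_sum_le q L : 0 < q -> q < 1 -> \sum_(0 <= l < L) (q ^+ l) ^+ 2 <= (1 - q ^+ 2)^-1.
Proof.
move=> q0 q1; have p0 : 0 < 1 - q ^+ 2 by rewrite subr_gt0 expr_lt1 // ltW.
rewrite -[leRHS]mul1r ler_pdivlMr //.
have -> : (\sum_(0 <= l < L) (q ^+ l) ^+ 2) * (1 - q ^+ 2) = 1 - (q ^+ 2) ^+ L.
  elim: L => [|L ih]; first by rewrite big_geq // mul0r expr0 subrr.
  have qL : (q ^+ L) ^+ 2 = (q ^+ 2) ^+ L by rewrite -!exprM mulnC.
  by rewrite big_nat_recr //= mulrDl ih qL [(q ^+ 2) ^+ L.+1]exprS; ring.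
by rewrite gerBl exprn_ge0 // exprn_ge0 // ltW.
Qed.

(** Cauchy-Schwarz against a geometric series; the price is the factor
    [1 / q] in the argument. *)
Lemma gauss_sum_upper q u L : 0 < q -> q < 1 -> 0 <= u ->
  gauss_sum u L ^+ 2 <= (1 - q ^+ 2)^-1 * expR ((u / q) ^+ 2).
Proof.
move=> q0 q1 u0.
have -> : gauss_sum u L = \sum_(0 <= l < L) q ^+ l * ((u / q) ^+ l / Num.sqrt l`!%:R).
  have uq : q * (u / q) = u by rewrite mulrC divfK // gt_eqF.
  by apply: eq_bigr => l _; rewrite mulrA -exprMn uq.
apply: (le_trans (sum_cauchy_schwarz _ _ _)); apply: ler_pM.
- by apply: sumr_ge0 => l _; rewrite sqr_ge0.
- by apply: sumr_ge0 => l _; rewrite sqr_ge0.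
- exact: geometric_sum_le.
have -> : \sum_(t <- index_iota 0 L) ((u / q) ^+ t / Num.sqrt t`!%:R) ^+ 2 = exp_sum ((u / q) ^+ 2) L.
  by apply: eq_bigr => l _; rewrite [LHS]expr_div_n sqr_sqrtr // -!exprM mulnC.
by apply: exp_sum_le; rewrite sqr_ge0.
Qed.

Variables (sigma rho eta C : R).
Hypotheses (sigma0 : 0 < sigma) (rho0 : 0 < rho) (eta0 : 0 < eta).
Hypothesis bound : forall m n, \sum_(0 <= s < (minn m n).+1)
  sigma ^+ (m + n - 2 * s) * contraction_coef m n s <= C * (rho ^+ m * eta ^+ n).

Lemma contraction_coef_ge0 m n s : 0 <= contraction_coef m n s.
Proof. by rewrite mulr_ge0 // sqrtr_ge0. Qed.

(** With [m = a + s] and [n = b + s] the weighted coefficient is a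
    multinomial term of [expR (x * y)] times one of the sum in
    [sigma * (x + y)]. *)
Lemma contraction_term x y a b s : 
  (x * y) ^+ s / s`!%:R * (sigma ^+ (a + b) * ('C(a + b, b)%:R * (x ^+ a * y ^+ b)) / Num.sqrt (a + b)`!%:R) =
  x ^+ (a + s) / Num.sqrt (a + s)`!%:R * (y ^+ (b + s) / Num.sqrt (b + s)`!%:R) *
   (sigma ^+ (a + b) * contraction_coef (a + s) (b + s) s).
Proof.
rewrite /contraction_coef; have -> : (a + s + (b + s) - 2 * s = a + b)%N by lia.
have f0 k : 0 < k`!%:R :> R by rewrite ltr0n fact_gt0.
have sf k : 0 < Num.sqrt k`!%:R :> R by rewrite sqrtr_gt0.
have sK k : Num.sqrt k`!%:R * Num.sqrt k`!%:R = k`!%:R :> R by rewrite -expr2 sqr_sqrtr // ltW.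
rewrite sqrtrM ?(ltW (f0 _)) // sqrtrV ?mulr_ge0 ?(ltW (f0 _)) // sqrtrM ?(ltW (f0 _)) //.
have := sK (a + s)%N; have := sK (b + s)%N; have := sK (a + b)%N.
have := sf (a + s)%N; have := sf (b + s)%N; have := sf (a + b)%N.
move: (Num.sqrt (a + s)`!%:R) (Num.sqrt (b + s)`!%:R) (Num.sqrt (a + b)`!%:R) => p q r r0 q0 p0.
have h1 : (a + s)`!%:R = 'C(a + s, s)%:R * s`!%:R * a`!%:R :> R.
  by rewrite -!natrM -(@bin_fact (a + s) s) ?leq_addl // addnK; congr _%:R; ring.
have h2 : (b + s)`!%:R = 'C(b + s, s)%:R * s`!%:R * b`!%:R :> R.
  by rewrite -!natrM -(@bin_fact (b + s) s) ?leq_addl // addnK; congr _%:R; ring.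
have h3 : (a + b)`!%:R = 'C(a + b, b)%:R * b`!%:R * a`!%:R :> R.
  by rewrite -!natrM -(@bin_fact (a + b) b) ?leq_addl // addnK; congr _%:R; ring.
rewrite h1 h2 h3 !natrM !exprD exprMn.
have c1 : 0 < 'C(a + s, s)%:R :> R by rewrite ltr0n bin_gt0 leq_addl.
have c2 : 0 < 'C(b + s, s)%:R :> R by rewrite ltr0n bin_gt0 leq_addl.
move: ('C(a + s, s)%:R) ('C(b + s, s)%:R) ('C(a + b, b)%:R) c1 c2 (f0 s) (f0 a) (f0 b) => c1 c2 c3.
move: (s`!%:R) (a`!%:R) (b`!%:R) (x ^+ a) (x ^+ s) (y ^+ b) (y ^+ s) (sigma ^+ a) (sigma ^+ b).
move=> fs fa fb xa xs yb ys sa sb c10 c20 fs0 fa0 fb0 rE qE pE.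
have e1 : c3 / r = r / (fa * fb).
  have r00 : r != 0 by rewrite gt_eqF.
  have ab0 : fb * fa != 0 by rewrite mulf_neq0 // gt_eqF.
  have -> : c3 = r * r / (fb * fa) by rewrite rE -mulrA mulfK.
  by field; rewrite r00 !gt_eqF.
have e2 : fs * c1 * c2 / (p * p * (q * q)) = (fs * fa * fb)^-1.
  by rewrite pE qE; field; rewrite !gt_eqF.
transitivity (xa * xs * (yb * ys) * (sa * sb) / fs * (c3 / r)); first by ring.
rewrite e1.
transitivity (xa * xs * (yb * ys) * (sa * sb) * r * (fs * c1 * c2 / (p * p * (q * q)))).
  by rewrite e2 !invfM; ring.
by rewrite !invfM; ring.
Qed.

(** The hypothesis is multiplied by [x ^ m * y ^ n / sqrt (m`! * n`!)] and
    summed; the indices [(m, n, s)] with [m, n < 2 L] include all those coming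
    from [s, l < L] through [m = l - a + s] and [n = a + s]. *)
Lemma generating_bound x y L : 0 <= x -> 0 <= y ->
  exp_sum (x * y) L * gauss_sum (sigma * (x + y)) L <=
  C * (gauss_sum (rho * x) (2 * L) * gauss_sum (eta * y) (2 * L)).
Proof.
move=> x0 y0.
pose xm m : R := x ^+ m / Num.sqrt m`!%:R; pose yn n : R := y ^+ n / Num.sqrt n`!%:R.
have xm0 m : 0 <= xm m by rewrite divr_ge0 ?exprn_ge0 ?sqrtr_ge0.
have yn0 n : 0 <= yn n by rewrite divr_ge0 ?exprn_ge0 ?sqrtr_ge0.
pose g (t : nat * nat * nat) : R := xm t.1.1 * yn t.1.2 *
  (sigma ^+ (t.1.1 + t.1.2 - 2 * t.2) * contraction_coef t.1.1 t.1.2 t.2).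
pose f (t : nat * nat * nat) : R := (x * y) ^+ t.1.1 / t.1.1`!%:R *
  (sigma ^+ t.1.2 * ('C(t.1.2, t.2)%:R * (x ^+ (t.1.2 - t.2) * y ^+ t.2)) / Num.sqrt t.1.2`!%:R).
pose L' := [seq (p, s) | p <- [seq (m, n) | m <- index_iota 0 (2 * L), n <- index_iota 0 (2 * L)],
  s <- index_iota 0 (minn p.1 p.2).+1].
pose L1 := [seq (p, a) | p <- [seq (s, l) | s <- index_iota 0 L, l <- index_iota 0 L],
  a <- index_iota 0 p.2.+1].
pose phi (t : nat * nat * nat) := (t.1.2 - t.2 + t.1.1, t.2 + t.1.1, t.1.1)%N.
have -> : exp_sum (x * y) L * gauss_sum (sigma * (x + y)) L = \sum_(t <- L1) f t.
  rewrite /L1 !big_allpairs_dep /exp_sum /gauss_sum mulr_suml; apply: eq_bigr => s _.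
  rewrite mulr_sumr; apply: eq_bigr => l _.
  rewrite [(sigma * _) ^+ _]exprMn exprDn [in RHS]big_mkord mulr_sumr mulr_suml mulr_sumr.
  by apply: eq_bigr => a _; rewrite /f /= mulr_natl.
apply: (@le_trans _ _ (\sum_(t <- L') g t)).
  have uniq_dep (s1 s2 : seq nat) (b : nat * nat -> seq nat) : uniq s1 -> uniq s2 ->
      (forall p, uniq (b p)) -> uniq [seq (p, a) | p <- [seq (s, l) | s <- s1, l <- s2], a <- b p].
    move=> u1 u2 ub; apply: allpairs_uniq_dep => [|p _|]; [|exact: ub|].
      by apply: allpairs_uniq => // -[? ?] [? ?].
    by move=> [? ?] [? ?] _ _ /= [<- <-].
  apply: (@sum_inj_le R _ _ L1 L' phi).
  - by apply: uniq_dep => [||p]; exact: iota_uniq.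
  - by apply: uniq_dep => [||p]; exact: iota_uniq.
  - move=> t /allpairsPdep[p [a [/allpairsP[[s l] /= [sL lL ->]] /= aL ->]]] _.
    move: sL lL aL; rewrite !mem_index_iota /= ltnS => sL lL al; split.
      apply/allpairsPdep; exists (l - a + s, a + s)%N, s; split => //=.
        by apply/allpairsP; exists (l - a + s, a + s)%N; rewrite /= !mem_index_iota; split => //; lia.
      by rewrite mem_index_iota /= ltnS leq_min !leq_addl.
    rewrite /f /g /phi /= /xm /yn; have := contraction_term x y (l - a) a s; rewrite subnK // => ->.
    by have -> : (l - a + s + (a + s) - 2 * s = l)%N by lia.
  - move=> t t' /allpairsPdep[p [a [/allpairsP[[s l] /= [_ _ ->]] /= aL ->]]].
    move=> /allpairsPdep[p' [a' [/allpairsP[[s' l'] /= [_ _ ->]] /= aL' ->]]] _ _.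
    move: aL aL'; rewrite !mem_index_iota /phi /= !ltnS => al al' [h1 h2 h3].
    have aa : a = a' by lia.
    have ll : l = l' by lia.
    by rewrite h3 aa ll.
  move=> t _; rewrite /g !mulr_ge0 ?contraction_coef_ge0 ?exprn_ge0 //; exact: ltW.
rewrite /L' !big_allpairs_dep /gauss_sum [X in _ <= C * X]big_distrlr mulr_sumr.
apply: ler_sum => m _; rewrite mulr_sumr; apply: ler_sum => n _.
have -> : \sum_(s <- index_iota 0 (minn (m, n).1 (m, n).2).+1) g (m, n, s) = xm m * yn n *
    \sum_(0 <= s < (minn m n).+1) sigma ^+ (m + n - 2 * s) * contraction_coef m n s by rewrite mulr_sumr.
apply: (@le_trans _ _ (xm m * yn n * (C * (rho ^+ m * eta ^+ n)))).
  by apply: ler_wpM2l; [rewrite mulr_ge0|exact: bound].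
rewrite le_eqVlt; apply/orP; left; apply/eqP; rewrite /xm /yn [(rho * x) ^+ m]exprMn [(eta * y) ^+ n]exprMn.
move: (x ^+ m) (y ^+ n) (rho ^+ m) (eta ^+ n) (Num.sqrt _)^-1 (Num.sqrt _)^-1 => p q p' q' s t.
by rewrite /=; ring.
Qed.

Lemma bound_ge1 : 1 <= C.
Proof.
have c1 : contraction_coef 0 0 0 = 1.
  rewrite /contraction_coef bin0 (_ : (0 + 0 - 2 * 0)%N = 0%N) // fact0.
  by rewrite !(mulr1, mul1r, invr1, muln1, sqrtr1).
by have := bound 0 0; rewrite minnn big_nat1 c1 !expr0 !mulr1.
Qed.

(** Replacing [(x, y)] by [(t * x, t * y)] multiplies both exponents by
    [t ^ 2], so that the constants do not matter as [t] grows. *)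
Lemma gaussian_bound q x y : 0 < q -> q < 1 -> 0 < x -> 0 < y ->
  2 * (x * y) + (sigma * (x + y)) ^+ 2 <= ((rho * x) / q) ^+ 2 + ((eta * y) / q) ^+ 2.
Proof.
move=> q0 q1 x0 y0; have C1 := bound_ge1; have C0 : 0 <= C by exact: le_trans C1.
pose D := (1 - q ^+ 2)^-1.
have p0 : 0 < 1 - q ^+ 2 by rewrite subr_gt0 expr_lt1 // ltW.
have D0 : 0 <= D by rewrite invr_ge0 ltW.
have key a b : 0 < a -> 0 < b -> expR (2 * (a * b) + (sigma * (a + b)) ^+ 2) <=
    C ^+ 2 * D ^+ 2 * expR (((rho * a) / q) ^+ 2 + ((eta * b) / q) ^+ 2).
  move=> a0 b0; rewrite !expRD expRM_natl.
  have ab0 : 0 <= a * b by rewrite mulr_ge0 // ltW.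
  have s0 : 0 <= sigma * (a + b) by rewrite mulr_ge0 ?addr_ge0 // ltW.
  have ra : 0 <= rho * a by rewrite mulr_ge0 // ltW.
  have eb : 0 <= eta * b by rewrite mulr_ge0 // ltW.
  have cv : exp_sum (a * b) L ^+ 2 * exp_sum ((sigma * (a + b)) ^+ 2) L @[L --> \oo] -->
      expR (a * b) ^+ 2 * expR ((sigma * (a + b)) ^+ 2).
    have c1 := @exp_sum_cvg (a * b); have c2 := @exp_sum_cvg ((sigma * (a + b)) ^+ 2).
    rewrite expr2; under eq_fun do rewrite expr2.
    by apply: cvgM => //; apply: cvgM.
  apply: (cvgr_to_le cv); apply: nearW => L.
  apply: (@le_trans _ _ ((exp_sum (a * b) L * gauss_sum (sigma * (a + b)) L) ^+ 2)).
    by rewrite [leRHS]exprMn; apply: ler_wpM2l; [exact: sqr_ge0|exact: gauss_sum_lower].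
  apply: (@le_trans _ _ ((C * (gauss_sum (rho * a) (2 * L) * gauss_sum (eta * b) (2 * L))) ^+ 2)).
    rewrite ler_pXn2r ?nnegrE ?mulr_ge0 ?exp_sum_ge0 ?gauss_sum_ge0 //.
    by apply: generating_bound; exact: ltW.
  rewrite [leLHS]exprMn [(gauss_sum _ _ * _) ^+ 2]exprMn -mulrA; apply: ler_wpM2l; first exact: sqr_ge0.
  have -> : D ^+ 2 * (expR ((rho * a / q) ^+ 2) * expR ((eta * b / q) ^+ 2)) =
      (D * expR ((rho * a / q) ^+ 2)) * (D * expR ((eta * b / q) ^+ 2)) by ring.
  by apply: ler_pM; rewrite ?sqr_ge0 ?gauss_sum_upper.
rewrite leNgt; apply/negP => gap.
set l := (X in _ < X) in gap; set r := (X in X < _) in gap.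
have G0 : 0 < l - r by rewrite subr_gt0.
pose c := C ^+ 2 * D ^+ 2; have c0 : 0 <= c by rewrite mulr_ge0 ?exprn_ge0.
pose t := Num.sqrt ((c + 1) / (l - r)).
have t0 : 0 < t by rewrite sqrtr_gt0 divr_gt0 // ltr_wpDl.
have t2 : t ^+ 2 * (l - r) = c + 1.
  have u0 : 0 <= (c + 1) / (l - r) by apply: divr_ge0; [exact: addr_ge0|exact: ltW].
  by rewrite sqr_sqrtr // divfK // gt_eqF.
have := key (t * x) (t * y) (mulr_gt0 t0 x0) (mulr_gt0 t0 y0).
have -> : 2 * (t * x * (t * y)) + (sigma * (t * x + t * y)) ^+ 2 = t ^+ 2 * (l - r) + t ^+ 2 * r.
  by rewrite /l; ring.
have -> : (rho * (t * x) / q) ^+ 2 + (eta * (t * y) / q) ^+ 2 = t ^+ 2 * r by rewrite /r; ring.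
rewrite expRD ler_pM2r ?expR_gt0 // t2 -/c.
have := expR_ge1Dx (c + 1); lra.
Qed.

Lemma quadratic_bound x y : 0 < x -> 0 < y ->
  2 * (x * y) + (sigma * (x + y)) ^+ 2 <= (rho * x) ^+ 2 + (eta * y) ^+ 2.
Proof.
move=> x0 y0; rewrite leNgt; apply/negP; set l := (X in _ < X); set r := (X in X < _) => rl.
have r0 : 0 <= r by rewrite addr_ge0 // sqr_ge0.
have l0 : 0 < l by exact: le_lt_trans rl.
pose k := (r / l + 1) / 2.
have rl1 : r / l < 1 by rewrite ltr_pdivrMr // mul1r.
have rl0 : 0 <= r / l by rewrite divr_ge0 // ltW.
have k0 : 0 < k by rewrite /k; lra.
have k1 : k < 1 by rewrite /k; lra.
have rk : r / l < k by rewrite /k; lra.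
have q0 : 0 < Num.sqrt k by rewrite sqrtr_gt0.
have qK : Num.sqrt k ^+ 2 = k by rewrite sqr_sqrtr // ltW.
have q1 : Num.sqrt k < 1 by rewrite -sqrtr1 ltr_sqrt.
have := gaussian_bound q0 q1 x0 y0; rewrite -/l ![_ / Num.sqrt k]mulrC !exprMn.
rewrite exprVn qK -mulrDr -!exprMn -/r ler_pdivlMl // leNgt.
by move: rk; rewrite ltr_pdivrMr // => ->.
Qed.

(** With [a = rho ^ 2 - sigma ^ 2], [b = eta ^ 2 - sigma ^ 2] and
    [k = 1 + sigma ^ 2] the quadratic inequality reads
    [2 k x y <= a x ^ 2 + b y ^ 2] for positive [x] and [y]; it forces
    [a > 0] and [k ^ 2 <= a b], which is admissibility. *)
Lemma bound_admissible : admissible sigma rho eta.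
Proof.
pose a := rho ^+ 2 - sigma ^+ 2; pose b := eta ^+ 2 - sigma ^+ 2; pose k := 1 + sigma ^+ 2.
have k0 : 0 < k by rewrite /k ltr_pwDl // sqr_ge0.
have h x y : 0 < x -> 0 < y -> 2 * k * (x * y) <= a * x ^+ 2 + b * y ^+ 2.
  by move=> x0 y0; have := quadratic_bound x0 y0; rewrite /a /b /k; nra.
have a0 : 0 < a.
  rewrite ltNge; apply/negP => a0; pose y := k / (`|b| + 1).
  have b1 : 0 < `|b| + 1 by rewrite ltr_wpDl.
  have y0 : 0 < y by rewrite divr_gt0.
  have yk : y * (`|b| + 1) = k by rewrite divfK // gt_eqF.
  have := h 1 y ltr01 y0; rewrite expr1n mulr1 mul1r leNgt => /negP; apply.
  have bb : b <= `|b| by exact: ler_norm.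
  have : b * y ^+ 2 <= k * y.
    have -> : b * y ^+ 2 = (b * y) * y by ring.
    rewrite ler_pM2r // -yk [y * _]mulrC ler_pM2r // (le_trans bb) // lerDl ler01 //.
  have ky : 0 < k * y by rewrite mulr_gt0.
  have -> : 2 * k * y = k * y + k * y by ring.
  by lra.
have ab : k ^+ 2 <= a * b.
  have := h k a k0 a0.
  have -> : a * k ^+ 2 + b * a ^+ 2 = a * (k ^+ 2 + a * b) by ring.
  have -> : 2 * k * (k * a) = a * (2 * k ^+ 2) by ring.
  by rewrite ler_pM2l //; lra.
have b0 : 0 < b.
  by rewrite -(pmulr_rgt0 _ a0) (lt_le_trans _ ab) // exprn_gt0.
rewrite /admissible; have -> : 1 + rho ^+ 2 = a + k by rewrite /a /k; ring.
have -> : 1 + eta ^+ 2 = b + k by rewrite /b /k; ring.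
have ak : 0 < a + k by rewrite addr_gt0. have bk : 0 < b + k by rewrite addr_gt0.
rewrite -/k -[leRHS]mul1r ler_pdivlMr // -(ler_pM2r ak) -(ler_pM2r bk).
have -> : ((a + k)^-1 + (b + k)^-1) * k * (a + k) * (b + k) = k * (b + k) + k * (a + k).
  by field; rewrite !gt_eqF.
by rewrite mul1r; move: ab; nra.
Qed.

End generating_function.

Section sharpness.
Context {R : realType} {E : lmodType R[i]} (dot : {dot E for Num.conj})
  {K : countType} (e : K -> E) {J : countType}.
Local Open Scope complex_scope.
Hypothesis e_basis : orthonormal_basis dot (cnorm dot) e.
Local Notation pnorm := (@Defs.pnorm R E dot K e J).
Local Notation hsnorm := (Defs.hsnorm dot e).
Variables (k0 : K) (j0 : J).

Definition rank_one : E -> E := finop dot e [:: k0] (fun=> e k0).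

Lemma rank_one_basis k : rank_one (e k) = if k == k0 then e k0 else 0.
Proof. by rewrite /rank_one (finop_basis e_basis) // inE. Qed.

Lemma hs_rank_one : hilbert_schmidt dot e rank_one.
Proof. exact: (hs_finop e_basis). Qed.

Lemma hsnorm_rank_one : hsnorm rank_one = 1%E.
Proof.
have h := sqr_hsnorm_finop e_basis (fun=> e k0) (isT : uniq [:: k0]).
rewrite -[LHS](gee0_abs (eseminorm_ge0 (eseminorm_hs dot e) _)) -sqrte_sqr h.
by rewrite big_seq1 (cnorm_basis e_basis) expr1n /= sqrtr1.
Qed.

Lemma rank_one_idem : rank_one \o rank_one = rank_one.
Proof.
have hh := hs_comp e_basis hs_rank_one hs_rank_one.
apply: (bounded_eq e_basis hh.1 hs_rank_one.1) => k /=.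
rewrite !rank_one_basis; case: ifP => _; first by rewrite rank_one_basis eqxx.
by rewrite (lin0 hs_rank_one.1.1).
Qed.

(** The multi-indices of a single coordinate. *)
Definition axis m : mindex J := mk [:: j0] (fun=> m).

Lemma axisE m j : axis m j = if j == j0 then m else 0%N.
Proof. by rewrite mkE inE. Qed.

Lemma axis_sub m : {subset finsupp (axis m) <= [:: j0]}.
Proof. by move=> j; rewrite mem_finsupp axisE inE; case: ifP. Qed.

Lemma axis_le s m : (s <= m)%N -> mle (axis s) (axis m).
Proof. by move=> sm j; rewrite !axisE; case: ifP. Qed.

Lemma mdegree_axis m : mdegree (axis m) = m.
Proof. by rewrite (mdegree_sup (s := [:: j0]) _ (@axis_sub m)) // big_seq1 axisE eqxx. Qed.

Lemma mfact_axis m : mfact (axis m) = m`!.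
Proof. by rewrite (mfact_sup (s := [:: j0]) _ (@axis_sub m)) // big_seq1 axisE eqxx. Qed.

Lemma mbin_axis m s : (s <= m)%N -> mbin (axis m) (axis s) = 'C(m, s).
Proof.
move=> sm; rewrite (mbin_sup (s := [:: j0]) _ (@axis_sub m) (axis_le sm)) //.
by rewrite big_seq1 !axisE eqxx.
Qed.

Lemma mcontract_axis m n s : mcontract (axis m) (axis n) (axis s) = axis (m + n - 2 * s).
Proof. by apply: mindexP => j; rewrite mcontractE !axisE; case: ifP. Qed.

Lemma coef_c_axis m n s : (s <= m)%N -> (s <= n)%N ->
  coef_c R (axis m) (axis n) (axis s) = contraction_coef m n s.
Proof.
by move=> sm sn; rewrite /coef_c mcontract_axis !mfact_axis !mbin_axis.
Qed.

Lemma supported_single (alpha : mindex J) : supported dot e [:: alpha] (single alpha rank_one).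
Proof.
split; first exact: (hs_single alpha hs_rank_one).
by move=> beta; rewrite inE /single => /negPf ->.
Qed.

Lemma finite_single (alpha : mindex J) : finite_array dot e (single alpha rank_one).
Proof.
split; first exact: (hs_single alpha hs_rank_one).
  apply: (sub_finite_set _ (finite_set1 alpha)) => beta /=.
  by rewrite /single; case: eqP.
move=> beta; apply: (sub_finite_set _ (finite_set1 (k0, k0))) => -[k l] /=.
rewrite /single; case: ifP => _; last by rewrite dot0l.
rewrite rank_one_basis; case: eqP => [->|_]; last by rewrite dot0l.
by rewrite (dot_basis e_basis); case: eqP => [->|].
Qed.

(** The product has one nonzero coefficient on each of its levels, so its
    norm is at least the weighted sum of these coefficients. *)
Lemma star_axis_lower N sigma m n : (0 < N)%N -> 0 < sigma ->
  ((\sum_(0 <= s < (minn m n).+1) sigma ^+ (m + n - 2 * s) *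
     (contraction_coef m n s * vartheta R N (axis m) (axis n) (axis s)))%:E <=
   pnorm sigma (fin_starN N (single (axis m) rank_one) (single (axis n) rank_one)))%E.
Proof.
move=> N0 s0; set X := fin_starN _ _ _.
pose h r := coef_c R (axis m) (axis n) r * vartheta R N (axis m) (axis n) r.
have h0 r : 0 <= h r.
  by rewrite mulr_ge0 ?coef_c_ge0 //; have /andP[] := vartheta_range R N0 (axis m) (axis n) r.
pose cs gamma := \sum_(r <- below2 (axis m) (axis n) | mcontract (axis m) (axis n) r == gamma) h r.
have XE gamma : X gamma = (cs gamma)%:C *: rank_one.
  rewrite /X /fin_starN (prodE _ _ (s := [:: axis m]) (s' := [:: axis n]) _ _
    (supported_single _) (supported_single _)) // !big_seq1 rmorph_sum scaler_suml.
  by apply: eq_bigr => r _; rewrite /single !eqxx rank_one_idem.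
have hX gamma : hsnorm (X gamma) = (cs gamma)%:E.
  rewrite XE (eseminormZ (eseminorm_hs dot e)) hsnorm_rank_one mule1 -/(modc _) modc_real.
  by rewrite ger0_norm // sumr_ge0.
pose L := (m + n).+1.
apply: (@le_trans _ _ (\sum_(0 <= l < L) (sigma ^+ l)%:E * level_norm dot e l X)%E); last first.
  rewrite pnormE; apply: nneseries_lim_ge => l _ _.
  by rewrite mule_ge0 ?level_ge0 // lee_fin exprn_ge0 // ltW.
apply: (@le_trans _ _ (\sum_(0 <= l < L) sigma ^+ l * cs (axis l))%:E); last first.
  rewrite -sumEFin; apply: lee_sum => l _; rewrite EFinM; apply: lee_wpmul2l.
    by rewrite lee_fin exprn_ge0 // ltW.
  by have := hsnorm_le_level dot e X (axis l); rewrite mdegree_axis hX.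
rewrite lee_fin.
have -> : \sum_(0 <= l < L) sigma ^+ l * cs (axis l) =
    \sum_(r <- below2 (axis m) (axis n))
      \sum_(0 <= l < L | mcontract (axis m) (axis n) r == axis l) sigma ^+ l * h r.
  under eq_bigr do rewrite mulr_sumr.
  by rewrite (exchange_big_dep predT).
have mem_axis s : s \in index_iota 0 (minn m n).+1 -> (s <= m)%N /\ (s <= n)%N.
  by rewrite mem_index_iota /= ltnS leq_min => /andP[].
apply: (@sum_inj_le R _ _ (index_iota 0 (minn m n).+1) (below2 (axis m) (axis n)) axis).
- exact: iota_uniq.
- exact: below2_uniq.
- move=> s /mem_axis[sm sn] _; split.
    by rewrite mem_below2; apply/andP; split; apply/mlebP; exact: axis_le.
  rewrite big_mkcond (bigD1_seq (m + n - 2 * s)%N) ?iota_uniq //=; last first.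
    by rewrite mem_index_iota /= ltnS leq_subr.
  rewrite mcontract_axis eqxx /h coef_c_axis // lerDl; apply: sumr_ge0 => l _.
  case: ifP => // _; apply: mulr_ge0; first by rewrite exprn_ge0 // ltW.
  by have := h0 (axis s); rewrite /h coef_c_axis.
- move=> s t _ _ _ _ /(congr1 (fun a : mindex J => a j0)).
  by rewrite !axisE eqxx.
move=> r _; apply: sumr_ge0 => l _; apply: mulr_ge0 => //.
by rewrite exprn_ge0 // ltW.
Qed.

(** [vartheta] tends to 1 as [N] grows, for fixed [m] and [n]. *)
Lemma uniform_bound sigma rho eta C : 0 < sigma -> 0 < rho -> 0 < eta ->
  uniform_constant (J := J) dot e sigma rho eta C ->
  forall m n, \sum_(0 <= s < (minn m n).+1)
    sigma ^+ (m + n - 2 * s) * contraction_coef m n s <= C * (rho ^+ m * eta ^+ n).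
Proof.
move=> s0 r0 e0 hC m n; set S := (X in X <= _); set D := (X in _ <= X).
pose B : R := 'C(m + n, 2)%:R.
have t0 s : 0 <= sigma ^+ (m + n - 2 * s) * contraction_coef m n s.
  by rewrite mulr_ge0 ?contraction_coef_ge0 // exprn_ge0 // ltW.
have S0 : 0 <= S by exact: sumr_ge0.
have bN N : (0 < N)%N -> S * (1 - B / N%:R) <= D.
  move=> N0; rewrite -lee_fin.
  have := hC N N0 _ _ (finite_single (axis m)) (finite_single (axis n)).
  rewrite (pnorm_single dot e _ _ (ltW r0)) (pnorm_single dot e _ _ (ltW e0)).
  rewrite !mdegree_axis hsnorm_rank_one !mule1 -!EFinM -/D; apply: le_trans.
  apply: le_trans (star_axis_lower m n N0 s0); rewrite lee_fin mulr_suml.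
  rewrite big_seq [leRHS]big_seq; apply: ler_sum => s.
  rewrite mem_index_iota /= ltnS leq_min => /andP[sm sn].
  rewrite [leRHS]mulrA; apply: ler_wpM2l; first exact: t0.
  have := vartheta_lower R N0 (axis_le sm) (axis_le sn); rewrite !mdegree_axis -/B.
  by move: (vartheta _ _ _ _ _) (B / _) => v b; lra.
apply/ler_addgt0Pr => eps eps0.
pose N := (Num.truncn (S * B / eps)).+1.
have N0 : 0 < N%:R :> R by [].
have hN : S * B / eps < N%:R by exact: truncnS_gt.
have hS : S <= D + S * B / N%:R.
  by have := bN N isT; rewrite mulrBr mulr1 mulrA lerBlDr.
apply: (le_trans hS); rewrite lerD2l ler_pdivrMr // [eps * _]mulrC.
by move: hN; rewrite ltr_pdivrMr // => /ltW.
Qed.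

End sharpness.

(** Over an empty basis the only approximation is zero. *)
Lemma real_basis_inhabited (R : realType) (H : lmodType R) (dot : {dot H for idfun})
  (J : Type) (b : J -> H) (h : H) :
  (forall (x : H) (eps : R), 0 < eps -> exists (s : seq J) (c : J -> R),
     rnorm dot (x - \sum_(i <- s) c i *: b i) < eps) -> h != 0 -> inhabited J.
Proof.
move=> dense h0; have hn : 0 < rnorm dot h.
  by rewrite /rnorm sqrtr_gt0; exact: (neq0_dnorm_gt0 h h0).
have [[|j s] [c]] := dense h _ hn; last by [].
by rewrite big_nil subr0 ltxx.
Qed.

Lemma complex_basis_inhabited (R : realType) (E : lmodType R[i]) (dot : {dot E for Num.conj})
  (K : Type) (e : K -> E) (x : E) :
  (forall (x : E) (eps : R), 0 < eps -> exists (s : seq K) (c : K -> R[i]),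
     cnorm dot (x - \sum_(i <- s) c i *: e i) < eps) -> x != 0 -> inhabited K.
Proof.
move=> dense x0; have xn : 0 < cnorm dot x by rewrite lt_def cnorm_eq0 x0 cnorm_ge0.
have [[|k s] [c]] := dense x _ xn; last by [].
by rewrite big_nil subr0 ltxx.
Qed.


Theorem theorem5p6 (R : realType)
  (* the real Hilbert space H and its orthonormal basis *)
  (H : lmodType R) (dotH : {dot H for idfun})
  (J : countType) (b : J -> H)
  (H_complete : complete_norm (rnorm dotH))
  (b_basis : orthonormal_basis dotH (rnorm dotH) b)
  (* the complex Hilbert space E and its fixed orthonormal basis *)
  (E : lmodType R[i]) (dotE : {dot E for Num.conj})
  (K : countType) (e : K -> E)
  (E_complete : complete_norm (cnorm dotE))
  (e_basis : orthonormal_basis dotE (cnorm dotE) e)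
  (* the random signs *)
  (d : measure_display) (Omega : measurableType d) (P : probability Omega R)
  (xi : J * nat -> Omega -> R) (xi_signs : independent_signs P xi) :
  (exists (starN : nat -> array E J -> array E J -> array E J)
          (star : array E J -> array E J -> array E J),
    [/\ (* continuous extensions, bounds, and rate of convergence *)
        forall sigma rho eta : R, 1 <= sigma -> 0 < rho -> 0 < eta ->
          admissible sigma rho eta ->
          [/\ forall N : nat, (0 < N)%N ->
                unique_continuous_extension dotE e
                  (fin_starN N) sigma rho eta (starN N) /\
                forall A B, pspace dotE e rho A -> pspace dotE e eta B ->
                  (pnorm dotE e sigma (starN N A B)
                     <= pnorm dotE e rho A * pnorm dotE e eta B)%E,
              unique_continuous_extension dotE e
                (@fin_star R E J) sigma rho eta star /\
              forall A B, pspace dotE e rho A -> pspace dotE e eta B ->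
                (pnorm dotE e sigma (star A B)
                   <= pnorm dotE e rho A * pnorm dotE e eta B)%E &
              forall (N : nat) (Rp Sp : R), (0 < N)%N -> rho < Rp -> eta < Sp ->
                let q := Num.max (rho / Rp) (eta / Sp) in
                q < 1 /\
                forall A B, pspace dotE e Rp A -> pspace dotE e Sp B ->
                  (pnorm dotE e sigma (starN N A B - star A B)%R
                     <= (q ^+ 2 / (N%:R * (1 - q) ^+ 3))%:E *
                        (pnorm dotE e Rp A * pnorm dotE e Sp B))%E],
        (* the products on the whole of frakA2 *)
        (forall N : nat, (0 < N)%N ->
           (forall A B, frakA2 dotE e A -> frakA2 dotE e B ->
              frakA2 dotE e (starN N A B)) /\
           jointly_continuous (frakA2 dotE e) (frakA2_seminorm dotE e)
             (starN N)) /\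
        (forall A B, frakA2 dotE e A -> frakA2 dotE e B ->
           frakA2 dotE e (star A B)) /\
        jointly_continuous (frakA2 dotE e) (frakA2_seminorm dotE e) star,
        (* the Frechet algebras *)
        forall N : nat, (0 < N)%N ->
          frechet_star_algebra (frakA2N dotE e N) (frakA2_seminorm dotE e)
            (starN N) (array_adjoint dotE) &
        (* Phi_N is well defined and multiplicative *)
        forall N : nat, (0 < N)%N ->
          (forall A, frakA2 dotE e A -> exists X, is_Phi P xi dotE e N A X) /\
          (forall A B X Y Z, frakA2 dotE e A -> frakA2 dotE e B ->
             is_Phi P xi dotE e N A X -> is_Phi P xi dotE e N B Y ->
             is_Phi P xi dotE e N (starN N A B) Z ->
             {ae P, forall w, Z w = X w \o Y w})])
  /\
  (* sharpness *)
  ((exists h : H, h != 0) -> (exists x : E, x != 0) ->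
   forall sigma rho eta : R, 1 <= sigma -> 0 < rho -> 0 < eta ->
     ((exists C : R, uniform_constant (J := J) dotE e sigma rho eta C) ->
      admissible sigma rho eta) /\
     (admissible sigma rho eta ->
      uniform_constant (J := J) dotE e sigma rho eta 1 /\
      forall C : R, uniform_constant (J := J) dotE e sigma rho eta C ->
        1 <= C)).
Proof.
split.
  exists (fun N => ext_prod dotE (vartheta R N)), (ext_prod dotE (@one_weight R J)); split.
  - move=> sigma rho eta s1 r0 e0 adm; have s0 : 0 < sigma by exact: lt_le_trans s1.
    split.
    + move=> N N0; exact: (star_extension E_complete e_basis s1 r0 e0
        (vartheta_bounded e_basis N0 s0 r0 e0 adm)).
    + exact: (star_extension E_complete e_basis s1 r0 e0 (one_bounded e_basis s0 r0 e0 adm)).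
    + move=> N Rp Sp N0 rR eS; exact: (star_rate E_complete e_basis s1 r0 e0 adm N0 rR eS).
  - have b1 := one_double (J := J) e_basis.
    split; [move=> N N0; have bw := vartheta_double (J := J) e_basis N0; split|split].
    + by move=> A B fA fB; exact: (frakA2_ext_prod E_complete e_basis bw fA fB).
    + exact: (jointly_continuous_sub E_complete e_basis bw (fun A h => h)).
    + by move=> A B fA fB; exact: (frakA2_ext_prod E_complete e_basis b1 fA fB).
    + exact: (jointly_continuous_sub E_complete e_basis b1 (fun A h => h)).
  - move=> N N0; exact: (frakA2N_frechet_star_algebra E_complete e_basis xi_signs N0).
  - move=> N N0; split.
      by move=> A fA; exact: (Phi_exists E_complete e_basis xi_signs N0 fA).
    move=> A B X Y Z fA fB hX hY hZ.
    exact: (L2sum_mul E_complete e_basis xi_signs N0 fA fB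
      (is_Phi_L2sum e_basis xi_signs hX) (is_Phi_L2sum e_basis xi_signs hY)
      (is_Phi_L2sum e_basis xi_signs hZ)).
move=> [h h0] [x x0] sigma rho eta s1 r0 e0; have s0 : 0 < sigma by exact: lt_le_trans s1.
have [j0] := real_basis_inhabited b_basis.2 h0.
have [k0] := complex_basis_inhabited e_basis.2 x0.
split.
  move=> [C /(uniform_bound e_basis k0 j0 s0 r0 e0) bound].
  exact: (bound_admissible s0 r0 e0 bound).
move=> adm; split.
  move=> N N0 A B /finite_supported[s sA] /finite_supported[s' sB].
  exact: (vartheta_bounded e_basis N0 s0 r0 e0 adm sA sB).
by move=> C /(uniform_bound e_basis k0 j0 s0 r0 e0) bound; exact: (bound_ge1 bound).
Qed.
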